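(* Let $X$ and $Y$ be real random variables with marginal distribution functions $F_1,F_2$, and let $(X_1,Y_1),(X_2,Y_2),\dots$ be i.i.d. copies of $(X,Y)$. Suppose the kernels $h_{F_1}$ and $h_{F_2}$ exist and are square integrable with spectral decompositions (convergent in mean square) $$h_{F_1}(x_1,x_2)=\sum_{k=0}^\infty\lambda_kg_{1k}(x_1)g_{1k}(x_2),\qquad h_{F_2}(y_1,y_2)=\sum_{k=0}^\infty\mu_kg_{2k}(y_1)g_{2k}(y_2).$$ Suppose $X$ and $Y$ are independent and let $Z_{ij}$ ($i,j\ge0$) be i.i.d. standard normal variables. Then, as the sample size $n\to\infty$, $$n\tilde\kappa(X,Y)\to_D\sum_{i,j=0}^\infty\lambda_i\mu_j(Z_{ij}^2-1).$$ If additionally $h_{F_1}$ and $h_{F_2}$ are trace class, then $$n\hat\kappa(X,Y)\to_D\sum_{i,j=0}^\infty\lambda_i\mu_jZ_{ij}^2.$$ Here $\to_D$ denotes convergence in distribution.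
   Context: For a real random variable $Z$ its distribution function is taken in the convention $F(z)=P(Z<z)+\tfrac12P(Z=z)$. With $Z,Z_1,Z_2$ i.i.d. with distribution function $F$, define $$h_F(z_1,z_2)=-\tfrac12E\big(|z_1-z_2|-|z_1-Z_2|-|Z_1-z_2|+|Z_1-Z_2|\big).$$ $h_F$ exists if this expectation is finite for some $(z_1,z_2)$ (then for all); it is square integrable if $Eh_F(Z_1,Z_2)^2<\infty$, and trace class if $Eh_F(Z,Z)<\infty$. A number $\lambda$ is an eigenvalue of $h_F$ with eigenfunction $g$ if $Eg(Z)^2=1$ and $\lambda g(z)=Eh_F(z,Z)g(Z)$. In the spectral decompositions, $\{g_{1k}\}$ (resp. $\{g_{2k}\}$) is a complete orthonormal system of $L_2(F_1)$ (resp. $L_2(F_2)$) consisting of eigenfunctions, with corresponding eigenvalues $\lambda_k\ge0$ (resp. $\mu_k\ge0$), the index $0$ being the constant function with $\lambda_0=\mu_0=0$. (If $L_2(F_i)$ is finite-dimensional the sums are finite.) The estimators, based on the sample $(X_1,Y_1),\dots,(X_n,Y_n)$, $n\ge2$, are as follows. Let $$A_{1k}=\frac1n\sum_{i=1}^n|X_k-X_i|,\quad A_{2k}=\frac1n\sum_{i=1}^n|Y_k-Y_i|,\quad B_1=\frac1{n^2}\sum_{i,j=1}^n|X_i-X_j|,\quad B_2=\frac1{n^2}\sum_{i,j=1}^n|Y_i-Y_j|.$$ For $k,l=1,\dots,n$ put $$h_{\hat F_1}(X_k,X_l)=-\tfrac12(|X_k-X_l|-A_{1k}-A_{1l}+B_1),\quad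 h_{\hat F_2}(Y_k,Y_l)=-\tfrac12(|Y_k-Y_l|-A_{2k}-A_{2l}+B_2),$$ $$\tilde h_{\hat F_1}(X_k,X_l)=-\tfrac12\Big(|X_k-X_l|-\tfrac n{n-1}A_{1k}-\tfrac n{n-1}A_{1l}+\tfrac n{n-1}B_1\Big),$$ $$\tilde h_{\hat F_2}(Y_k,Y_l)=-\tfrac12\Big(|Y_k-Y_l|-\tfrac n{n-1}A_{2k}-\tfrac n{n-1}A_{2l}+\tfrac n{n-1}B_2\Big).$$ Then $$\hat\kappa(X,Y)=\frac1{n^2}\sum_{i,j=1}^nh_{\hat F_1}(X_i,X_j)h_{\hat F_2}(Y_i,Y_j),\qquad \tilde\kappa(X,Y)=\frac2{n(n-1)}\sum_{1\le i<j\le n}\tilde h_{\hat F_1}(X_i,X_j)\tilde h_{\hat F_2}(Y_i,Y_j).$$ *)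

(* Defs.v *)
From mathcomp Require Export all_boot all_order all_algebra.
From mathcomp Require Export all_classical all_reals all_analysis.
Export Order.TTheory GRing.Theory Num.Theory.
Export numFieldNormedType.Exports.

Set Implicit Arguments.
Unset Strict Implicit.
Unset Printing Implicit Defensive.

Local Open Scope classical_set_scope.
Local Open Scope ring_scope.

Section Independence.
Context {d d' : measure_display} {T : measurableType d} {T' : measurableType d'}.
Context {R : realType} (P : probability T R).

Definition independent_family (I : eqType) (X : I -> T -> T') : Prop :=
  forall (J : seq I) (A : I -> set T'), uniq J -> (forall i, measurable (A i)) ->
    P (\bigcap_(i in [set` J]) (X i @^-1` A i)) =
    (\prod_(i <- J) P (X i @^-1` A i))%E.

Definition independent_pair (X Y : T -> T') : Prop :=
  forall A B : set T', measurable A -> measurable B ->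
    P (X @^-1` A `&` Y @^-1` B) = (P (X @^-1` A) * P (Y @^-1` B))%E.

End Independence.

Definition same_law {d1 d2 d' : measure_display} {T1 : measurableType d1}
    {T2 : measurableType d2} {T' : measurableType d'} {R : realType}
    (P1 : probability T1 R) (P2 : probability T2 R)
    (X1 : T1 -> T') (X2 : T2 -> T') : Prop :=
  forall A : set T', measurable A -> P1 (X1 @^-1` A) = P2 (X2 @^-1` A).

(* Convergence of distribution functions at the continuity points of the
   limit; the limit may live on another probability space. *)
Definition cvg_in_distribution {d d' : measure_display} {T : measurableType d}
    {T' : measurableType d'} {R : realType} (P : probability T R)
    (Q : probability T' R) (U : nat -> T -> R) (L : T' -> R) : Prop :=
  forall x : R,
    {for x, continuous (fun y : R => Q (L @^-1` `]-oo, y]))} ->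
    P (U n @^-1` `]-oo, x]) @[n --> \oo] --> Q (L @^-1` `]-oo, x]).

(* A distribution function F is represented by the law mu it determines, so
   that L_2(F) is L_2(mu) and (Z1, Z2) has law mu \x mu. *)
Section Kernel.
Context {R : realType} (mu : probability (measurableTypeR R) R).

Definition kernel_integrand (z1 z2 : R) (w : R * R) : R :=
  `|z1 - z2| - `|z1 - w.2| - `|w.1 - z2| + `|w.1 - w.2|.

Definition kernel_exists : Prop :=
  exists z1 z2 : R, (mu \x mu)%E.-integrable [set: measurableTypeR R * measurableTypeR R]
    (fun w => (kernel_integrand z1 z2 w)%:E).

Definition kernel (z1 z2 : R) : R :=
  - 2^-1 * fine (\int[mu \x mu]_w (kernel_integrand z1 z2 w)%:E)%E.

Definition kernel_square_integrable : Prop :=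
  (\int[mu \x mu]_w ((kernel w.1 w.2) ^+ 2)%:E < +oo)%E.

Definition kernel_trace_class : Prop :=
  (\int[mu]_z (kernel z z)%:E < +oo)%E.

(* Eigenfunctions are elements of L_2(mu): the eigenvalue equation is
   understood mu-almost everywhere. *)
Definition is_eigen (lambda : R) (g : R -> R) : Prop :=
  [/\ g \in Lfun mu 2%:E,
      (\int[mu]_z ((g z) ^+ 2)%:E = 1)%E &
      {ae mu, forall z : R,
        ((lambda * g z)%:E = \int[mu]_w (kernel z w * g w)%:E)%E}].

Definition complete_orthonormal (K : set nat) (g : nat -> R -> R) : Prop :=
  [/\ forall k, k \in K -> g k \in Lfun mu 2%:E,
      forall k l, k \in K -> l \in K ->
        (\int[mu]_z (g k z * g l z)%:E = ((k == l)%:R)%:E)%E &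
      forall f : R -> R, f \in Lfun mu 2%:E ->
        (forall k, k \in K -> (\int[mu]_z (f z * g k z)%:E = 0)%E) ->
        {ae mu, forall z : R, f z = 0}].

(* The index set K is an initial segment of nat: nat itself, or {0,...,N-1}
   when L_2(mu) has finite dimension N. The values of lambda and g outside K
   are irrelevant. *)
Definition spectral_decomposition (K : set nat) (lambda : nat -> R)
    (g : nat -> R -> R) : Prop :=
  [/\ 0%N \in K /\ (forall k, k.+1 \in K -> k \in K),
      lambda 0%N = 0 /\ (exists c : R, {ae mu, forall z : R, g 0%N z = c}),
      complete_orthonormal K g,
      forall k, k \in K -> 0 <= lambda k /\ is_eigen (lambda k) (g k) &
      (\int[mu \x mu]_w
         ((kernel w.1 w.2
           - \sum_(k < n | (k : nat) \in K) lambda k * g k w.1 * g k w.2)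
          ^+ 2)%:E)%E @[n --> \oo] --> 0%E].

End Kernel.

(* A sample x_1, ..., x_n is the list of the first n values x 0, ..., x n.-1
   of a sequence. *)
Section Estimators.
Context {R : realType}.
Implicit Types (x y : nat -> R) (n k l : nat).

Definition mean_dist x n k : R := n%:R^-1 * \sum_(i < n) `|x k - x i|.

Definition grand_mean_dist x n : R :=
  (n%:R ^+ 2)^-1 * \sum_(i < n) \sum_(j < n) `|x i - x j|.

Definition h_hat x n k l : R :=
  - 2^-1 * (`|x k - x l| - mean_dist x n k - mean_dist x n l
            + grand_mean_dist x n).

Definition h_tilde x n k l : R :=
  let c := n%:R / (n%:R - 1) in
  - 2^-1 * (`|x k - x l| - c * mean_dist x n k - c * mean_dist x n l
            + c * grand_mean_dist x n).

Definition kappa_hat x y n : R :=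
  (n%:R ^+ 2)^-1 * \sum_(i < n) \sum_(j < n) h_hat x n i j * h_hat y n i j.

Definition kappa_tilde x y n : R :=
  2 / (n%:R * (n%:R - 1)) *
  \sum_(i < n) \sum_(j < n | (i < j)%N) h_tilde x n i j * h_tilde y n i j.

End Estimators.

(* L is the sum over K1 x K2 of the double series of random variables W i j,
   the rectangular partial sums converging to L in mean square. *)
Definition mean_square_sum {d : measure_display} {T : measurableType d}
    {R : realType} (Q : probability T R) (K1 K2 : set nat)
    (W : nat -> nat -> T -> R) (L : T -> R) : Prop :=
  (\int[Q]_w ((L w - \sum_(i < p.1 | (i : nat) \in K1)
                      \sum_(j < p.2 | (j : nat) \in K2) W i j w) ^+ 2)%:E)%E
    @[p --> filter_prod \oo \oo] --> 0%E.

(* Main.v *)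
(** A kernel h_F = - |z1 - z2| / 2 + a(z1) + a(z2) + c is degenerate, because its
    eigenvalue 0 belongs to the constant function. Up to terms tending to 0 in
    probability, both statistics equal the U-statistic
    U_n = n^-1 sum_{i <> j} h_1(X_i, X_j) h_2(Y_i, Y_j), the second one increased by
    n^-1 sum_i h_1(X_i, X_i) h_2(Y_i, Y_i), whose limit is the product of the two
    traces. The only error terms without a second moment involve n^-2 sum_i X_i^2;
    this tends to 0 in probability since square integrability of h_F forces
    t P(|X| > t) -> 0.

    Truncating both spectral series turns U_n into a diagonal quadratic form in
    S_kl = n^-1/2 sum_i g_1k(X_i) g_2l(Y_i), minus its mean in the limit. Writing
    exp(-t s^2) as E cos(sqrt(2t) s Z) with Z standard normal reduces the Laplace
    transform of the quadratic form to a central limit theorem for cosines, and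
    Bernstein polynomials in exp(-x) pass from Laplace transforms to the piecewise
    linear functions that determine convergence in distribution.

    The trace of h_F is the sum of its eigenvalues: on a cell of length e the kernel
    differs from its diagonal by at most e, so the trace is a limit of sums of
    averages of h_F over squares, which can be computed on the spectral series. *)

Require Import Defs.
From mathcomp Require Import ring lra measurable_realfun borel_hierarchy.
Set Implicit Arguments.
Unset Strict Implicit.
Unset Printing Implicit Defensive.
Local Open Scope classical_set_scope.
Local Open Scope ring_scope.

(** * Integrable real functions *)

(** The sample becomes one independent family indexed by [(b, i)], with [b] = [false] for X_i and
    [true] for Y_i. Facts about one kernel are proved once, for a side [b]. The sides are
    independent, so second moments of products factor; the rows [i] are independent too, as the
    limit theorems require. No moment of X or Y is assumed. Hence a(z) is built from |z - w| - |w|,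
    which is bounded in w, and errors are measured by E min(1, |error|). Tails are controlled by
    h(x, y) - h(z, x) - h(z, y) + h(z, z), which equals min(|x - z|, |y - z|) for x, y on the same
    side of z: if X_1 and X_2 both exceed z + t it is at least t, so (t P(X > z + t))^2 is at most a
    finite integral restricted to a shrinking event. Double centring removes a(X_i) exactly from the
    biased statistic. The factor n/(n-1) spoils this cancellation in the other one, and the
    remainder produces the terms without second moment. Spectral truncation costs little uniformly
    in n, because E U_n^2 is at most twice the product of the squared Hilbert-Schmidt norms; n may
    thus tend to infinity before the truncation level does. *)

Section real_integrals.
Context d (T : measurableType d) (R : realType) (P : {measure set T -> \bar R}).
Implicit Types f g : T -> R.

Definition L1 f := P.-integrable setT (EFin \o f).
(** Measurability is a separate clause because integrability of the square does not imply it. *)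
Definition L2 f := measurable_fun setT f /\ L1 (fun x => f x ^+ 2).
(** A total function: an infinite integral counts as 0, so [E_ge0] needs no integrability. *)
Definition E f : R := (\int[P]_x f x)%R.

Lemma L1_meas f : L1 f -> measurable_fun setT f.
Proof. by move=> /integrableP[/measurable_EFinP]. Qed.

Lemma L1_le f g : measurable_fun setT f -> (forall x, `|f x| <= g x) -> L1 g -> L1 f.
Proof.
move=> mf fg Lg; apply: (le_integrable measurableT _ _ Lg).
  exact/measurable_EFinP.
by move=> x _ /=; rewrite lee_fin (le_trans (fg x))// ler_norm.
Qed.

Lemma L1D f g : L1 f -> L1 g -> L1 (fun x => f x + g x).
Proof. by move=> Lf Lg; have := integrableD measurableT Lf Lg. Qed.

Lemma L1Z k f : L1 f -> L1 (fun x => k * f x).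
Proof. by move=> Lf; have := integrableZl measurableT k Lf. Qed.

Lemma L1N f : L1 f -> L1 (fun x => - f x).
Proof. by move=> Lf; have := integrableN Lf. Qed.

Lemma L1B f g : L1 f -> L1 g -> L1 (fun x => f x - g x).
Proof. by move=> Lf Lg; apply: L1D => //; exact: L1N. Qed.

Lemma L1_norm f : L1 f -> L1 (fun x => `|f x|).
Proof. by move=> Lf; have := integrable_norm Lf. Qed.

Lemma L1_0 : L1 (fun=> 0).
Proof. exact: integrable0. Qed.

Lemma L1_sum (I : Type) (s : seq I) (p : pred I) (F : I -> T -> R) :
  (forall i, p i -> L1 (F i)) -> L1 (fun x => \sum_(i <- s | p i) F i x).
Proof.
move=> LF; elim: s => [|i s IH].
  by under eq_fun do rewrite big_nil; exact: L1_0.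
under eq_fun do rewrite big_cons; case: (boolP (p i)) => // pi.
by apply: L1D => //; exact: LF.
Qed.

Lemma eq_L1 f g : f =1 g -> L1 f -> L1 g.
Proof. by move=> /funext ->. Qed.

Lemma EE f : L1 f -> (\int[P]_x (f x)%:E)%E = (E f)%:E.
Proof. by move=> Lf; rewrite /E /Rintegral fineK// integrable_fin_num. Qed.

Lemma ED f g : L1 f -> L1 g -> E (fun x => f x + g x) = E f + E g.
Proof. by move=> Lf Lg; rewrite /E RintegralD. Qed.

Lemma EB f g : L1 f -> L1 g -> E (fun x => f x - g x) = E f - E g.
Proof. by move=> Lf Lg; rewrite /E RintegralB. Qed.

Lemma EZ k f : L1 f -> E (fun x => k * f x) = k * E f.
Proof. by move=> Lf; rewrite /E RintegralZl. Qed.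

Lemma E0 : E (fun=> 0) = 0.
Proof. by rewrite /E /Rintegral integral0. Qed.

Lemma E_sum (I : Type) (s : seq I) (p : pred I) (F : I -> T -> R) :
  (forall i, p i -> L1 (F i)) ->
  E (fun x => \sum_(i <- s | p i) F i x) = \sum_(i <- s | p i) E (F i).
Proof.
move=> LF; elim: s => [|i s IH].
  by under eq_fun do rewrite big_nil; rewrite big_nil E0.
under eq_fun do rewrite big_cons; rewrite big_cons; case: ifPn => // pi.
by rewrite ED ?IH//; [exact: LF|exact: L1_sum].
Qed.

Lemma E_le f g : L1 f -> L1 g -> (forall x, f x <= g x) -> E f <= E g.
Proof. by move=> Lf Lg fg; apply: le_Rintegral. Qed.

Lemma E_ge0 f : (forall x, 0 <= f x) -> 0 <= E f.
Proof. by move=> f0; apply: Rintegral_ge0. Qed.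

Lemma E_norm f : L1 f -> `|E f| <= E (fun x => `|f x|).
Proof. by move=> Lf; apply: le_normr_Rintegral. Qed.

Lemma eq_E f g : f =1 g -> E f = E g.
Proof. by move=> /funext ->. Qed.

Lemma eq_E_ae f g : measurable_fun setT f -> measurable_fun setT g ->
  {ae P, forall x, f x = g x} -> E f = E g.
Proof.
move=> mf mg fg; rewrite /E /Rintegral; congr fine; apply: ae_eq_integral => //.
- exact/measurable_EFinP.
- exact/measurable_EFinP.
- by apply: filterS fg => x -> _.
Qed.

Lemma L1_ge0 f : measurable_fun setT f -> (forall x, 0 <= f x) ->
  (\int[P]_x (f x)%:E < +oo)%E -> L1 f.
Proof.
move=> mf f0 fy; apply/integrableP; split; first exact/measurable_EFinP.
by under eq_integral => x _ do rewrite /= ger0_norm//.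
Qed.

Lemma L2_meas f : L2 f -> measurable_fun setT f.
Proof. by case. Qed.

Lemma L2_sqr f : L2 f -> L1 (fun x => f x ^+ 2).
Proof. by case. Qed.

Lemma L2_mul f g : L2 f -> L2 g -> L1 (fun x => f x * g x).
Proof.
move=> [mf Lf] [mg Lg]; apply: (@L1_le _ (fun x => f x ^+ 2 + g x ^+ 2)).
- exact: measurable_funM.
- by move=> x; rewrite ler_norml; apply/andP; split; nra.
- exact: L1D.
Qed.

Lemma L2D f g : L2 f -> L2 g -> L2 (fun x => f x + g x).
Proof.
move=> Lf Lg; split; first by apply: measurable_funD; exact: L2_meas.
apply: (@eq_L1 (fun x => f x ^+ 2 + g x ^+ 2 + 2 * (f x * g x))).
  by move=> x; ring.
by apply: L1D; [apply: L1D; exact: L2_sqr|apply/L1Z/L2_mul].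
Qed.

Lemma L2Z k f : L2 f -> L2 (fun x => k * f x).
Proof.
move=> [mf Lf]; split; first exact: measurable_funM.
by apply: (@eq_L1 (fun x => k ^+ 2 * f x ^+ 2)) => [x|]; [ring|exact: L1Z].
Qed.

Lemma L2N f : L2 f -> L2 (fun x => - f x).
Proof. by move=> /(L2Z (-1)); congr L2; apply/funext => x; rewrite mulN1r. Qed.

Lemma L2B f g : L2 f -> L2 g -> L2 (fun x => f x - g x).
Proof. by move=> Lf Lg; apply: L2D => //; exact: L2N. Qed.

Lemma L2_0 : L2 (fun=> 0).
Proof. by split => //; under eq_fun do rewrite expr0n; exact: L1_0. Qed.

Lemma L2_sum (I : Type) (s : seq I) (p : pred I) (F : I -> T -> R) :
  (forall i, p i -> L2 (F i)) -> L2 (fun x => \sum_(i <- s | p i) F i x).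
Proof.
move=> LF; elim: s => [|i s IH].
  by under eq_fun do rewrite big_nil; exact: L2_0.
under eq_fun do rewrite big_cons; case: (boolP (p i)) => // pi.
by apply: L2D => //; exact: LF.
Qed.

Lemma eq_L2 f g : f =1 g -> L2 f -> L2 g.
Proof. by move=> /funext ->. Qed.

Lemma E_sqrD f g : L2 f -> L2 g ->
  E (fun x => (f x + g x) ^+ 2) <= 2 * E (fun x => f x ^+ 2) + 2 * E (fun x => g x ^+ 2).
Proof.
move=> Lf Lg; rewrite -!EZ ?L2_sqr// -ED; [|by apply/L1Z/L2_sqr..].
apply: E_le => [||x]; first exact/L2_sqr/L2D.
  by apply: L1D; apply/L1Z/L2_sqr.
by have := sqr_ge0 (f x - g x); nra.
Qed.

Lemma Lfun_L2 f : f \in Lfun P 2%:E -> L2 f.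
Proof.
move=> Lf; split; last exact: Lfun2_integrable_sqr.
by move: Lf; rewrite inE => /andP[]; rewrite inE.
Qed.

End real_integrals.

Section finite_measure_integrals.
Context d (T : measurableType d) (R : realType) (P : probability T R).
Implicit Types f g : T -> R.

Lemma L1_cst k : L1 P (fun=> k).
Proof. exact: finite_measure_integrable_cst. Qed.

Lemma E_cst k : E P (fun=> k) = k.
Proof. rewrite /E Rintegral_cst//; have := probability_setT P; rewrite /= => ->; by rewrite mulr1. Qed.

Lemma L1_bounded f k : measurable_fun setT f -> (forall x, `|f x| <= k) -> L1 P f.
Proof. by move=> mf fk; apply: (L1_le _ fk) => //; exact: L1_cst. Qed.

Lemma L2_cst k : L2 P (fun=> k).
Proof. by split => //; exact: L1_cst. Qed.

Lemma L2_L1 f : L2 P f -> L1 P f.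
Proof.
move=> Lf; have := L2_mul Lf (L2_cst 1).
by apply: eq_L1 => x; rewrite mulr1.
Qed.

Lemma L2_bounded f k : measurable_fun setT f -> (forall x, `|f x| <= k) -> L2 P f.
Proof.
move=> mf fk; split => //; apply: (@L1_bounded _ (k ^+ 2)).
  exact: measurable_funX.
by move=> x; rewrite normrX lerXn2r// ?nnegrE//; exact: le_trans (fk x).
Qed.

(** The difference of the two sides is the variance. *)
Lemma E_sqr_le f : L2 P f -> E P f ^+ 2 <= E P (fun x => f x ^+ 2).
Proof.
move=> Lf; set m := E P f; rewrite -subr_ge0.
have -> : E P (fun x => f x ^+ 2) - m ^+ 2 = E P (fun x => (f x - m) ^+ 2).
  rewrite (@eq_E _ _ _ _ (fun x => (f x - m) ^+ 2) (fun x => f x ^+ 2 + (- (2 * m) * f x + m ^+ 2))); last by move=> x; ring.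
  have := L2_L1 Lf; have := L2_sqr Lf => L2f L1f.
  rewrite ED//; last by apply: L1D; [exact: L1Z|exact: L1_cst].
  rewrite ED; [|exact: L1Z|exact: L1_cst].
  by rewrite EZ// E_cst -/m; ring.
by apply: E_ge0 => x; exact: sqr_ge0.
Qed.

End finite_measure_integrals.

(** * Independence and decoupling *)

Lemma measurable_sum_seq d (T : measurableType d) (R : realType) (I : eqType) (s : seq I)
  (p : pred I) (h : I -> T -> R) : (forall i, i \in s -> p i -> measurable_fun setT (h i)) ->
  measurable_fun setT (fun w => \sum_(i <- s | p i) h i w).
Proof.
elim: s => [_|i s IH mh]; first by under eq_fun do rewrite big_nil; exact: measurable_cst.
have ms : measurable_fun setT (fun w => \sum_(i <- s | p i) h i w).
  by apply: IH => j js; apply: mh; rewrite in_cons js orbT.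
under eq_fun do rewrite big_cons; case: (boolP (p i)) => // pi.
by apply: measurable_funD => //; apply: mh => //; exact: mem_head.
Qed.

Section independence.
Context d d' (T : measurableType d) (S : measurableType d') (R : realType)
  (P : probability T R) (I : choiceType) (X : I -> T -> S).
Hypothesis mX : forall i, measurable_fun setT (X i).
Hypothesis indX : independent_family P X.

(** A pi-system generating the sigma-algebra of the variables [X i] with [i] in [J];
    [independent_family] is a product formula for exactly such sets. *)
Definition cylinders (J : set I) : set (set T) :=
  [set E | exists (s : seq I) (A : I -> set S), [/\ uniq s, forall i, i \in s -> J i,
     forall i, measurable (A i) & E = \bigcap_(i in [set` s]) (X i @^-1` A i)]].

(** The space [T] with a smaller sigma-algebra, so that the general measurability lemmas apply
    unchanged to functions of the [X i] with [i] in [J]. *)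
Definition sub_type (J : set I) := g_sigma_algebraType (cylinders J).

Definition J_measurable d1 (S1 : measurableType d1) J (V : T -> S1) : Prop :=
  @measurable_fun _ _ (sub_type J) S1 setT V.

Lemma cylinders_measurable J : cylinders J `<=` measurable.
Proof.
move=> _ [s [A [_ _ mA ->]]]; apply: fin_bigcap_measurable => // i _.
by rewrite -[X in measurable X]setTI; exact: mX.
Qed.

Lemma sub_measurable J E : measurable (E : set (sub_type J)) -> measurable (E : set T).
Proof.
move=> mE; have := smallest_sub (@sigma_algebra_measurable _ T) (@cylinders_measurable J).
exact.
Qed.

Lemma sub_measurable_fun d1 (S1 : measurableType d1) J (V : T -> S1) :
  J_measurable J V -> measurable_fun setT V.
Proof. by move=> mV _ B mB; apply: (@sub_measurable J); exact: mV. Qed.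

Lemma cylindersT J : cylinders J setT.
Proof.
exists [::], (fun=> setT); split => //.
by apply/seteqP; split => // x _ i.
Qed.

Lemma cylinders_setI J : setI_closed (cylinders J).
Proof.
move=> _ _ [s [A [us sJ mA ->]]] [s' [A' [us' sJ' mA' ->]]].
(* An index that occurs in only one of the lists takes the whole space from the other. *)
exists (undup (s ++ s')), (fun i => (if i \in s then A i else setT) `&` (if i \in s' then A' i else setT)).
split.
- exact: undup_uniq.
- by move=> i; rewrite mem_undup mem_cat => /orP[/sJ|/sJ'].
- by move=> i; apply: measurableI; case: ifP.
apply/seteqP; split => [x [Ax A'x] i /= _|x Ax].
  split; case: ifP => // si; [exact: Ax|exact: A'x].
split=> i /= si; have := Ax i; rewrite /= mem_undup mem_cat si ?orbT => /(_ isT)[]; by [].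
Qed.

Lemma sub_mono d1 (S1 : measurableType d1) J J' (V : T -> S1) : J `<=` J' ->
  J_measurable J V -> J_measurable J' V.
Proof.
move=> JJ' mV _ B mB; have := mV measurableT B mB; apply: smallest_sub.
  exact: smallest_sigma_algebra.
move=> _ [s [A [us sJ mA ->]]]; apply: sub_sigma_algebra.
by exists s, A; split => // i /sJ; exact: JJ'.
Qed.

Lemma sub_var J i : J i -> J_measurable J (X i).
Proof.
move=> Ji _ B mB; rewrite setTI; apply: sub_sigma_algebra.
exists [:: i], (fun=> B); split => //.
  by move=> j; rewrite inE => /eqP ->.
apply/seteqP; split => [x Bx j /=|x]; first by rewrite inE => /eqP ->.
by apply; rewrite /= inE.
Qed.

Lemma cylinders_indep J J' E F : J `&` J' = set0 -> cylinders J E -> cylinders J' F ->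
  P (E `&` F) = (P E * P F)%E.
Proof.
move=> JJ' [s [A [us sJ mA ->]]] [s' [A' [us' sJ' mA' ->]]].
have ss' i : i \in s -> i \in s' -> False.
  by move=> /sJ Ji /sJ' J'i; have : (J `&` J') i by []; rewrite JJ'.
pose B i := if i \in s then A i else A' i.
have mB i : measurable (B i) by rewrite /B; case: ifP.
rewrite indX// indX//.
have -> : \bigcap_(i in [set` s]) (X i @^-1` A i) `&` \bigcap_(i in [set` s']) (X i @^-1` A' i) =
    \bigcap_(i in [set` s ++ s']) (X i @^-1` B i).
  apply/seteqP; split => [x [Ax A'x] i /=|x Bx].
    rewrite mem_cat /B => si; case: ifPn => [/Ax//|/negbTE sif].
    by apply: A'x; move: si; rewrite sif.
  split=> i /= si; have := Bx i; rewrite /= mem_cat si ?orbT /B => /(_ isT); first by rewrite si.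
  by case: ifPn => // /ss' /(_ si).
rewrite indX//.
  rewrite big_cat/=; congr (_ * _)%E; apply: eq_big_seq => i si; rewrite /B ?si//.
  by case: ifPn => // /ss' /(_ si).
rewrite cat_uniq us us' andbT /=; apply/hasPn => i si'; apply/negP => si; exact: ss' si'.
Qed.

(** As functions of [E], both sides are finite measures; they agree on the pi-system [G] and
    therefore on the sigma-algebra it generates. *)
Let unique (G : set (set T)) (F : set T) : measurable F -> G `<=` measurable ->
  setI_closed G -> G setT -> (forall E, G E -> P (E `&` F) = (P E * P F)%E) ->
  forall E, <<s G >> E -> P (E `&` F) = (P E * P F)%E.
Proof.
move=> mF Gm GI GT GF E GE.
have f0 : 0 <= fine (P F) by exact: fine_ge0.
have PF : P F = (fine (P F))%:E by rewrite fineK//; exact: fin_num_measure.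
rewrite PF muleC.
have H := @g_sigma_algebra_measure_unique _ _ _ G Gm (fun=> setT) (fun=> GT) _
  (mrestr P mF) (mscale (NngNum f0) P) GI _ _ E GE.
have -> : P (E `&` F) = mrestr P mF E by [].
rewrite H//.
- exact: bigcup_const.
- move=> A /GF GA; apply: (etrans GA).
  by rewrite muleC {1}PF.
- move=> _; apply: (@le_lt_trans _ _ (P (setT `&` F))) => //.
  by rewrite setTI -ge0_fin_numE//; exact: fin_num_measure.
Qed.

(** The uniqueness argument is used twice: [E] varies with [F] fixed, then [F] varies with [E] fixed
    in the pi-system. *)
Lemma sub_indep J J' E F : J `&` J' = set0 ->
  measurable (E : set (sub_type J)) -> measurable (F : set (sub_type J')) ->
  P (E `&` F) = (P E * P F)%E.
Proof.
move=> JJ' mE mF.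
have mFT := sub_measurable mF.
apply: (@unique (cylinders J)) => //.
- exact: cylinders_measurable.
- exact: cylinders_setI.
- exact: cylindersT.
move=> {mE}E cE; rewrite setIC muleC.
have mE : measurable E by exact: cylinders_measurable cE.
apply: (@unique (cylinders J')) => //.
- exact: cylinders_measurable.
- exact: cylinders_setI.
- exact: cylindersT.
by move=> G cG; rewrite setIC muleC; exact: cylinders_indep JJ' cE cG.
Qed.

Section decoupling.
Context d1 d2 (S1 : measurableType d1) (S2 : measurableType d2) (J J' : set I)
  (V : T -> S1) (W : T -> S2).
Hypothesis JJ' : J `&` J' = set0.
Hypothesis mV : J_measurable J V.
Hypothesis mW : J_measurable J' W.
Variable F : S1 * S2 -> R.
Hypothesis mF : measurable_fun setT F.

Let mVT := sub_measurable_fun mV.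
Let mWT := sub_measurable_fun mW.

Let VW (w : T) := (V w, W w).
Let mVW : measurable_fun setT VW.
Proof. exact: measurable_fun_pair. Qed.

Let VxW (w : T * T) := (V w.1, W w.2).
Let mVxW : measurable_fun setT VxW.
Proof. by apply: measurable_fun_pair; exact: measurableT_comp. Qed.

(** On rectangles both laws are the product of the marginal laws, because [J] and [J'] are
    disjoint. *)
Let lawVW A : measurable A -> P (VW @^-1` A) = (P \x P)%E (VxW @^-1` A).
Proof.
move=> mA.
have := @product_measure_unique _ _ _ _ _ (distribution P (mfun_Sub (mem_set mVT)))
  (distribution P (mfun_Sub (mem_set mWT))).
pose n1 : {measure set _ -> \bar R} := pushforward P VW.
pose n2 : {measure set _ -> \bar R} := pushforward (P \x P)%E VxW.
move=> H; have H1 : (n1 mVW) A = (n2 mVxW) A.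
  rewrite -(H (n1 mVW))//; last first.
    move=> B C mB mC; rewrite /n1 /= /distribution /pushforward /=.
    by apply: sub_indep JJ' _ _; rewrite -[X in measurable X]setTI; [exact: mV|exact: mW].
  apply: (H (n2 mVxW)) => // B C mB mC; rewrite /n2 /= /distribution /pushforward /=.
  have -> : VxW @^-1` (B `*` C) = (V @^-1` B) `*` (W @^-1` C) by [].
  by rewrite product_measure1E// -[X in measurable X]setTI; [exact: mVT|exact: mWT].
exact: H1.
Qed.

Lemma decoupling_ge0 : (forall x, 0 <= F x) ->
  (\int[P]_w (F (V w, W w))%:E = \int[P]_w1 \int[P]_w2 (F (V w1, W w2))%:E)%E.
Proof.
move=> F0.
have mF' : measurable_fun setT (EFin \o F) by exact/measurable_EFinP.
rewrite -[RHS](@fubini_tonelli1 _ _ _ _ _ P P (fun w => (F (V w.1, W w.2))%:E)); last 2 first.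
- by apply/measurable_EFinP; exact: measurableT_comp mF mVxW.
- by move=> w; rewrite lee_fin.
rewrite -[LHS](ge0_integral_pushforward mVW P measurableT (f := EFin \o F))//; last first.
  by move=> x _; rewrite lee_fin.
rewrite -[RHS](ge0_integral_pushforward mVxW (P \x P)%E measurableT (f := EFin \o F))//; last first.
  by move=> x _; rewrite lee_fin.
by apply: eq_measure_integral => A mA _; exact: lawVW.
Qed.

Lemma decoupling : L1 P (fun w => F (V w, W w)) ->
  (P \x P)%E.-integrable setT (fun w => (F (V w.1, W w.2))%:E) /\
  (\int[P]_w (F (V w, W w))%:E = \int[P]_w1 \int[P]_w2 (F (V w1, W w2))%:E)%E.
Proof.
move=> LF.
have mF' : measurable_fun setT (EFin \o F) by exact/measurable_EFinP.
have i2 : (P \x P)%E.-integrable setT (fun w => (F (V w.1, W w.2))%:E).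
  have : (pushforward P VW).-integrable setT (EFin \o F) by exact: integrable_pushforward.
  move=> /integrableP[_ H]; apply/integrableP; split.
    by apply/measurable_EFinP; exact: measurableT_comp mF mVxW.
  rewrite -[ltLHS](ge0_integral_pushforward mVxW (P \x P)%E measurableT (f := fun x => `|(F x)%:E|%E))//; last first.
    exact: measurableT_comp.
  rewrite (eq_measure_integral (pushforward P VW)); first exact: H.
  by move=> A mA _; exact: esym (lawVW mA).
split=> //.
rewrite (@integral12_prod_meas1 _ _ _ _ _ P P (fun w => (F (V w.1, W w.2))%:E) i2).
rewrite -[LHS](integral_pushforward mVW (mu := P) (D := setT) (f := EFin \o F))//.
rewrite -[RHS](integral_pushforward mVxW (mu := (P \x P)%E) (D := setT) (f := EFin \o F))//.
by apply: eq_measure_integral => A mA _; exact: lawVW.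
Qed.

(** Integrability of every section makes the inner [E] agree with the extended integral of
    [decoupling] at every point, not merely almost everywhere. *)
Lemma decouplingE : L1 P (fun w => F (V w, W w)) ->
  (forall w1, L1 P (fun w2 => F (V w1, W w2))) ->
  L1 P (fun w1 => E P (fun w2 => F (V w1, W w2))) /\
  E P (fun w => F (V w, W w)) = E P (fun w1 => E P (fun w2 => F (V w1, W w2))).
Proof.
move=> LF LF2; have [i2 eq2] := decoupling LF.
have inE1 w1 : (\int[P]_w2 (F (V w1, W w2))%:E)%E = (E P (fun w2 => F (V w1, W w2)))%:E.
  by rewrite EE.
split.
  have := integrable_fubini_F i2; rewrite /fubini_F/=.
  by under eq_fun do rewrite inE1.
rewrite /E /Rintegral; congr fine; rewrite eq2.
by apply: eq_integral => w1 _; rewrite inE1.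
Qed.

End decoupling.

Lemma indep_mul J J' (V W : T -> R) : J `&` J' = set0 ->
  J_measurable J V -> J_measurable J' W ->
  L1 P V -> L1 P W -> L1 P (fun w => V w * W w) /\ E P (fun w => V w * W w) = E P V * E P W.
Proof.
move=> JJ' mV mW LV LW.
have mmul : measurable_fun setT (fun x : R * R => x.1 * x.2) by exact: measurable_funM.
have mVT := sub_measurable_fun mV; have mWT := sub_measurable_fun mW.
have LVW : L1 P (fun w => V w * W w).
  apply/integrableP; split; first by apply/measurable_EFinP; exact: measurable_funM.
  have mF : measurable_fun setT (fun x : R * R => `|x.1 * x.2|) by exact: measurableT_comp.
  (* Tonelli for |V W| supplies the integrability of the product that [decouplingE] presupposes. *)
  rewrite [ltLHS](decoupling_ge0 JJ' mV mW mF) => [|x]; last exact: normr_ge0.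
  under eq_integral => w1 _.
    rewrite /=; under eq_integral do rewrite normrM EFinM.
    rewrite ge0_integralZl//=; last exact/measurable_EFinP/measurableT_comp.
    rewrite [X in (_ * X)%E](EE (L1_norm LW)) muleC; over.
  rewrite ge0_integralZl//=; last 2 first.
  - exact/measurable_EFinP/measurableT_comp.
  - by rewrite lee_fin E_ge0.
  by rewrite (EE (L1_norm LV)) ltry.
split=> //.
have [_ ->] := @decouplingE _ _ _ _ J J' V W JJ' mV mW _ mmul LVW (fun w1 => L1Z _ LW).
by rewrite -[RHS]mulrC -EZ//; apply: eq_E => w1 /=; rewrite EZ// mulrC.
Qed.

End independence.

(** * Bernstein operators and trigonometric bounds *)

Section bernstein.
Variable R : realType.
Implicit Types (f g : nat -> R) (x : R).

(* The Bernstein operator of degree n, in de Casteljau form. *)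
Fixpoint bern n f x : R :=
  if n is n'.+1 then (1 - x) * bern n' f x + x * bern n' (fun k => f k.+1) x else f 0%N.

Lemma bern_le n f g x : 0 <= x <= 1 -> (forall k, f k <= g k) -> bern n f x <= bern n g x.
Proof.
move=> x01; elim: n f g => //= n IH f g fg; apply: lerD; apply: ler_wpM2l.
- by lra.
- exact: IH.
- by lra.
- by apply: IH.
Qed.

Lemma bernDZ n a f g x : bern n (fun k => a * f k + g k) x = a * bern n f x + bern n g x.
Proof. by elim: n f g => //= n IH f g; rewrite (IH f g) (IH (f \o S) (g \o S))/=; ring. Qed.

Lemma bern_cst n c x : bern n (fun=> c) x = c.
Proof. by elim: n => //= n ->; ring. Qed.

(** The second moment about [c] of a binomial variable: variance plus squared bias. *)
Lemma bern_sqr n c x : bern n (fun k => (k%:R - c) ^+ 2) x = n%:R * x * (1 - x) + (n%:R * x - c) ^+ 2.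
Proof.
elim: n c => [c|n IH c]; first by rewrite /=; ring.
rewrite /= IH (_ : (fun k => (k.+1%:R - c) ^+ 2) = (fun k => (k%:R - (c - 1)) ^+ 2)).
  by rewrite IH -natr1; ring.
by apply/funext => k; rewrite -natr1; ring.
Qed.

(** Chebyshev's argument, with |u| <= d/2 + u^2/(2d) in place of a split into near and far nodes, so
    that a single use of [bern_sqr] suffices. *)
Lemma bern_approx (p : R -> R) (K e : R) : 0 <= K -> 0 < e ->
  (forall x y, `|p x - p y| <= K * `|x - y|) ->
  exists n f, forall x, 0 <= x <= 1 -> `|bern n f x - p x| <= e.
Proof.
move=> K0 e0 pK.
(* The final bound consists of two parts of size K d / 2, and K d <= e; adding 1 avoids a division
   by 0. *)
pose d := e / (K + 1).
have d0 : 0 < d by rewrite divr_gt0//; lra.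
have Kd : K * (d + d) <= 2 * e.
  have -> : K * (d + d) = 2 * (K * d) by ring.
  rewrite ler_pM2l// /d mulrA ler_pdivrMr; last lra.
  by nra.
(* For this degree the node k/(n+1) has variance at most 1/(n+1) <= d^2. *)
have [n nd] : exists n, d ^-2 <= n.+1%:R.
  by exists (Num.truncn (d ^-2)); exact/ltW/truncnS_gt.
have n0 : (0 : R) < n.+1%:R by rewrite ltr0n.
exists n.+1, (fun k => p (k%:R / n.+1%:R)) => x x01.
have B0 k : `|p (k%:R / n.+1%:R) - p x| <= K * (d / 2) + K / (2 * d * n.+1%:R ^+ 2) * (k%:R - n.+1%:R * x) ^+ 2.
  apply: (le_trans (pK _ _)).
  have -> : K * (d / 2) + K / (2 * d * n.+1%:R ^+ 2) * (k%:R - n.+1%:R * x) ^+ 2 =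
    K * (d / 2 + (2 * d)^-1 * (k%:R / n.+1%:R - x) ^+ 2).
    by field; rewrite addrC natr1 !gt_eqF.
  apply: ler_wpM2l => //.
  rewrite -(real_normK (num_real (_ - x))); set u := `|_|.
  rewrite -(ler_pM2l (_ : 0 < 2 * d)); last by lra.
  have -> : 2 * d * (d / 2 + (2 * d)^-1 * u ^+ 2) = d ^+ 2 + u ^+ 2 by field; rewrite gt_eqF.
  by have := sqr_ge0 (d - u); nra.
pose q k := K / (2 * d * n.+1%:R ^+ 2) * (k%:R - n.+1%:R * x) ^+ 2 + K * (d / 2).
have qE : bern n.+1 q x <= e.
  rewrite /q bernDZ bern_cst bern_sqr subrr expr0n addr0.
  have -> : K / (2 * d * n.+1%:R ^+ 2) * (n.+1%:R * x * (1 - x)) + K * (d / 2) =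
     K * ((d^-1 / n.+1%:R) * (x * (1 - x)) + d) / 2.
    by field; rewrite addrC natr1 !gt_eqF.
  have : d^-1 / n.+1%:R * (x * (1 - x)) <= d.
    apply: (@le_trans _ _ (d^-1 / n.+1%:R)).
      by rewrite ler_piMr ?divr_ge0 ?invr_ge0 ?ltW//; nra.
    rewrite ler_pdivrMr//; apply: le_trans (ler_wpM2l (ltW d0) nd).
    by have -> : d * d ^- 2 = d^-1 by field; rewrite gt_eqF.
  rewrite ler_pdivrMr// => h.
  apply: (@le_trans _ _ (K * (d + d))); last by rewrite [e * 2]mulrC.
  by apply: ler_wpM2l; rewrite ?lerD2r.
rewrite ler_norml; apply/andP; split.
  rewrite -subr_ge0 opprK -(bern_cst n.+1 (p x) x) -[X in 0 <= X](_ : bern n.+1 (fun k => 1 * p (k%:R / n.+1%:R) + (e - p x)) x = _); last first.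
    by rewrite bernDZ bern_cst bern_cst; ring.
  apply: le_trans (_ : bern n.+1 (fun k => -1 * q k + e) x <= _).
    by rewrite bernDZ bern_cst; lra.
  apply: bern_le => // k; have := B0 k; rewrite ler_norml => /andP[+ _].
  by rewrite /q; move: (K / _ * _) (K * (d / 2)) => u v; lra.
rewrite -(bern_cst n.+1 (p x) x) lerBlDr; apply: le_trans (_ : bern n.+1 (fun k => 1 * q k + p x) x <= _).
  apply: bern_le => // k; have := B0 k; rewrite ler_norml => /andP[_].
  by rewrite /q; move: (K / _ * _) (K * (d / 2)) => u v; lra.
by rewrite bernDZ !bern_cst; lra.
Qed.

End bernstein.

(** * Taylor bounds for sine and cosine *)

Section trig_bounds.
Variable R : realType.
Implicit Types x : R.

(** The mean value theorem. Starting from cos <= 1, each bound below integrates the preceding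
    one. *)
Lemma le_of_derive (f g f' g' : R -> R) :
  (forall x, is_derive x 1 f (f' x)) -> (forall x, is_derive x 1 g (g' x)) ->
  (forall x, 0 <= x -> f' x <= g' x) -> f 0 <= g 0 -> forall x, 0 <= x -> f x <= g x.
Proof.
move=> df dg f'g' fg0 x; rewrite le_eqVlt => /predU1P[<-//|x0].
have dh (y : R) : is_derive y 1 (g - f) (g' y - f' y) by exact: is_deriveB.
have [|c] := @MVT _ (g - f) (fun y => g' y - f' y) 0 x x0.
  apply: derivable_within_continuous => y _; exact: (@ex_derive _ _ _ _ _ _ _ (dh y)).
rewrite in_itv/= => /andP[c0 _].
have -> : (g - f) x - (g - f) 0 = (g x - f x) - (g 0 - f 0) by [].
rewrite subr0 => H.
have : 0 <= (g' c - f' c) * x by rewrite mulr_ge0 ?subr_ge0 ?f'g'// ltW.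
by rewrite -H; lra.
Qed.

Lemma sin_le x : 0 <= x -> sin x <= x.
Proof.
apply: (@le_of_derive sin id cos (fun=> 1)) => //; last by rewrite sin0.
Qed.

Lemma norm_sin_le x : `|sin x| <= `|x|.
Proof.
wlog x0 : x / 0 <= x.
  move=> H; have [/H//|/ltW] := leP 0 x; rewrite -oppr_ge0 => /H.
  by rewrite sinN !normrN.
rewrite (ger0_norm x0) ler_norml sin_le// andbT.
apply: (@le_of_derive (fun x => - x) sin (fun=> -1) cos) => //; last by rewrite sin0 oppr0.
by move=> y _; exact: cos_geN1.
Qed.

Lemma cos_ge x : 1 - x ^+ 2 / 2 <= cos x.
Proof.
wlog x0 : x / 0 <= x.
  by move=> H; have [/H//|/ltW] := leP 0 x; rewrite -oppr_ge0 => /H; rewrite cosN sqrrN.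
apply: (@le_of_derive (fun x => 1 - x ^+ 2 / 2) cos (fun x => - x) (fun x => - sin x)) => //.
- by move=> y; apply: is_derive_eq; rewrite /GRing.scale/=; field.
- by move=> y /sin_le; rewrite lerN2.
- by rewrite cos0 expr0n /= mul0r subr0.
Qed.

Lemma sin_ge x : 0 <= x -> x - x ^+ 3 / 6 <= sin x.
Proof.
apply: (@le_of_derive (fun x => x - x ^+ 3 / 6) sin (fun x => 1 - x ^+ 2 / 2) cos) => //.
- by move=> y; apply: is_derive_eq; rewrite /GRing.scale/=; field.
- by move=> y _; exact: cos_ge.
- by rewrite sin0 expr0n /= mul0r subr0.
Qed.

Lemma cos_le x : cos x <= 1 - x ^+ 2 / 2 + x ^+ 4 / 24.
Proof.
wlog x0 : x / 0 <= x.
  move=> H; have [/H//|/ltW] := leP 0 x; rewrite -oppr_ge0 => /H; rewrite cosN sqrrN.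
  by rewrite (_ : (- x) ^+ 4 = x ^+ 4)//; ring.
apply: (@le_of_derive cos (fun x => 1 - x ^+ 2 / 2 + x ^+ 4 / 24) (fun x => - sin x) (fun x => - x + x ^+ 3 / 6)) => //.
- by move=> y; apply: is_derive_eq; rewrite /GRing.scale/=; field.
- by move=> y /sin_ge; lra.
- by rewrite cos0 !expr0n /= !mul0r subr0 addr0.
Qed.

Lemma cos_taylor x : `|cos x - 1 + x ^+ 2 / 2| <= x ^+ 4 / 24.
Proof. by have := cos_le x; have := cos_ge x; rewrite ler_norml => ? ?; apply/andP; split; nra. Qed.

(** Weaker than [cos_taylor] near 0, but quadratic: this one serves as a dominating function when
    only second moments exist, the other one gives the pointwise limit. The two sine bounds share
    the work in the same way. *)
Lemma cos_taylor2 x : `|cos x - 1 + x ^+ 2 / 2| <= x ^+ 2 / 2.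
Proof. by have := cos_le1 x; have := cos_ge x; rewrite ler_norml => ? ?; apply/andP; split; nra. Qed.

Lemma sin_taylor x : `|sin x - x| <= `|x| ^+ 3 / 6.
Proof.
wlog x0 : x / 0 <= x.
  by move=> H; have [/H//|/ltW] := leP 0 x; rewrite -oppr_ge0 => /H; rewrite sinN -opprB opprK normrN addrC normrN distrC -normrN opprB.
by have := sin_le x0; have := sin_ge x0; rewrite ler_norml ger0_norm// => ? ?; apply/andP; split; lra.
Qed.

Lemma sin_taylor2 x : `|sin x - x| <= x ^+ 2.
Proof.
wlog x0 : x / 0 <= x.
  by move=> H; have [/H//|/ltW] := leP 0 x; rewrite -oppr_ge0 => /H; rewrite sinN sqrrN -opprD normrN.
have := sin_le x0; have := sin_ge x0; have := sin_geN1 x; rewrite ler_norml => ? ? ?.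
apply/andP; split; last by nra.
(* Up to 6 the cubic bound is at most x^2; beyond 6, x - sin x <= x + 1 <= x^2. *)
have [x6|x6] := leP x 6; last by nra.
have : x ^+ 3 / 6 <= x ^+ 2 by rewrite exprS; nra.
by lra.
Qed.

End trig_bounds.

Section limits.
Context d (T : measurableType d) (R : realType) (P : probability T R).

Lemma E_dominated (f : nat -> T -> R) (g h : T -> R) : (forall n, measurable_fun setT (f n)) ->
  (forall x, f n x @[n --> \oo] --> g x) -> L1 P h -> (forall n x, `|f n x| <= h x) ->
  E P (f n) @[n --> \oo] --> E P g.
Proof.
move=> mf fg Lh fh.
have mg : measurable_fun setT g by exact: measurable_fun_cvg mf _.
have [] := @dominated_convergence _ _ _ P setT measurableT (fun n => EFin \o f n) (EFin \o g) (EFin \o h).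
- by move=> n; exact/measurable_EFinP.
- exact/measurable_EFinP.
- by apply: aeW => x _ /=; apply: cvg_EFin; [exact: nearW|exact: fg].
- exact: Lh.
- by apply: aeW => x n _ /=; rewrite lee_fin.
by move=> Lg _ H; rewrite /E /Rintegral; apply: fine_cvg; rewrite fineK ?integrable_fin_num.
Qed.

End limits.

(** * Laplace transforms and a central limit theorem for cosines *)

Lemma cvg_divn (R : realType) (C : R) : C / n%:R @[n --> \oo] --> (0 : R).
Proof.
rewrite -(cvg_shiftS (fun n => C / n%:R)).
have /= H := cvgM (cvg_cst C) (@cvg_harmonic R).
by rewrite mulr0 in H; exact: H.
Qed.

Lemma cvg0_le (R : realType) (u v : nat -> R) : (forall n, `|u n| <= v n) ->
  v n @[n --> \oo] --> 0 -> u n @[n --> \oo] --> 0.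
Proof.
move=> uv v0; apply: norm_cvg0; apply: (@squeeze_cvgr _ _ _ _ (cst 0) v) => //.
  by apply: nearW => n; rewrite normr_ge0 uv.
exact: cvg_cst.
Qed.

Section laplace.
Context d (T : measurableType d) d' (T' : measurableType d') (R : realType)
  (P : probability T R) (Q : probability T' R).

Lemma ln_lipschitz (a x y : R) : 0 < a -> a <= x -> a <= y -> `|ln x - ln y| <= a^-1 * `|x - y|.
Proof.
move=> a0; wlog yx : x y / y <= x.
  move=> H ax ay; have [yx|/ltW xy] := leP y x; first exact: H.
  by rewrite distrC [in leRHS]distrC; exact: H.
move=> ax ay; have y0 := lt_le_trans a0 ay; have x0 := lt_le_trans a0 ax.
rewrite ger0_norm ?subr_ge0 ?ler_ln// ger0_norm ?subr_ge0//.
rewrite -ln_div// -[x / y](subrK 1) [_ - 1 + 1]addrC.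
have -> : x / y - 1 = y^-1 * (x - y) by field; rewrite gt_eqF.
have h : 0 <= y^-1 * (x - y) by rewrite mulr_ge0 ?invr_ge0 ?subr_ge0// ltW.
apply: (le_trans (le_ln1Dx _)); first by lra.
by apply: ler_wpM2r; rewrite ?subr_ge0// lef_pV2.
Qed.

Variables (U : nat -> T -> R) (V : T' -> R).
Hypotheses (mU : forall n, measurable_fun setT (U n)) (mV : measurable_fun setT V).
Hypotheses (U0 : forall n w, 0 <= U n w) (V0 : forall w, 0 <= V w).
Hypothesis UV : forall j : nat, E P (fun w => expR (- (j%:R * U n w))) @[n --> \oo] -->
  E Q (fun w => expR (- (j%:R * V w))).

(** The prefactor exp(-jU) carries the induction: a de Casteljau step multiplies by 1 - exp(-U) or
    exp(-U), which only raises [j]. For [j] = 0 this is convergence for all Bernstein polynomials in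
    exp(-U). *)
Let bernUV m f (j : nat) :
  [/\ forall n, L1 P (fun w => expR (- (j%:R * U n w)) * bern m f (expR (- U n w))),
   L1 Q (fun w => expR (- (j%:R * V w)) * bern m f (expR (- V w))) &
   E P (fun w => expR (- (j%:R * U n w)) * bern m f (expR (- U n w))) @[n --> \oo] -->
   E Q (fun w => expR (- (j%:R * V w)) * bern m f (expR (- V w)))].
Proof.
elim: m f j => [f j|m IH f j].
  have LP n : L1 P (fun w => expR (- (j%:R * U n w))).
    apply: (@L1_bounded _ _ _ _ _ 1) => [|w].
      by apply: measurableT_comp => //; apply: measurableT_comp => //; exact: measurable_funM.
    by rewrite ger0_norm ?expR_ge0// -expR0 ler_expR oppr_le0 mulr_ge0.
  have LQ : L1 Q (fun w => expR (- (j%:R * V w))).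
    apply: (@L1_bounded _ _ _ _ _ 1) => [|w].
      by apply: measurableT_comp => //; apply: measurableT_comp => //; exact: measurable_funM.
    by rewrite ger0_norm ?expR_ge0// -expR0 ler_expR oppr_le0 mulr_ge0.
  split => [n||] /=.
  - by have := L1Z (f 0%N) (LP n); apply: eq_L1 => w; rewrite mulrC.
  - by have := L1Z (f 0%N) LQ; apply: eq_L1 => w; rewrite mulrC.
  - have -> : (fun n => E P (fun w => expR (- (j%:R * U n w)) * f 0%N)) =
       (fun n => f 0%N * E P (fun w => expR (- (j%:R * U n w)))).
      by apply/funext => n; rewrite -EZ//; apply: eq_E => w; rewrite mulrC.
    rewrite (_ : E Q _ = f 0%N * E Q (fun w => expR (- (j%:R * V w)))).
      by apply: cvgM; [exact: cvg_cst|exact: UV].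
    by rewrite -EZ//; apply: eq_E => w; rewrite mulrC.
have [LP1 LQ1 C1] := IH f j.
have [LP2 LQ2 C2] := IH f j.+1.
have [LP3 LQ3 C3] := IH (f \o S) j.+1.
have expE (x : R) : expR (- (j%:R * x)) * bern m.+1 f (expR (- x)) =
   expR (- (j%:R * x)) * bern m f (expR (- x)) - expR (- (j.+1%:R * x)) * bern m f (expR (- x))
   + expR (- (j.+1%:R * x)) * bern m (f \o S) (expR (- x)).
  have -> : expR (- (j.+1%:R * x)) = expR (- (j%:R * x)) * expR (- x).
    by rewrite -natr1 mulrDl mul1r opprD expRD.
  by rewrite /=; ring.
split => [n||].
- apply: (eq_L1 (fun w => esym (expE (U n w)))).
  by apply: L1D => //; exact: L1B.
- apply: (eq_L1 (fun w => esym (expE (V w)))).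
  by apply: L1D => //; exact: L1B.
- rewrite (eq_E _ (fun w => expE (V w))) ED ?EB//; last exact: L1B.
  have -> : (fun n => E P (fun w => expR (- (j%:R * U n w)) * bern m.+1 f (expR (- U n w)))) =
     (fun n => E P (fun w => expR (- (j%:R * U n w)) * bern m f (expR (- U n w))) -
        E P (fun w => expR (- (j.+1%:R * U n w)) * bern m f (expR (- U n w))) +
        E P (fun w => expR (- (j.+1%:R * U n w)) * bern m (f \o S) (expR (- U n w)))).
    by apply/funext => n; rewrite (eq_E _ (fun w => expE (U n w))) ED ?EB//; exact: L1B.
  exact: (cvgD (cvgB C1 C2) C3).
Qed.

(* e^{-U} lives in [0,1], where F(-ln y) is a uniform limit of polynomials. *)
Lemma laplace_cvg (F : R -> R) (K b : R) : 0 <= K -> 0 <= b ->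
  (forall x y, `|F x - F y| <= K * `|x - y|) -> (forall x, b <= x -> F x = 0) ->
  E P (fun w => F (U n w)) @[n --> \oo] --> E Q (fun w => F (V w)).
Proof.
move=> K0 b0 FK Fb.
pose a := expR (- b).
have a0 : 0 < a by exact: expR_gt0.
have a1 : a <= 1 by rewrite -expR0 ler_expR oppr_le0.
(* As [F] vanishes beyond [b], values of y below exp(-b) do not matter; clipping them keeps ln away
   from its singularity and makes [p] Lipschitz with constant K/a. *)
pose c (y : R) := Num.max a y.
have ca y : a <= c y by rewrite /c le_max lexx.
have cL x y : `|c x - c y| <= `|x - y|.
  rewrite /c.
  case: (leP a x) => ?; case: (leP a y) => ?; rewrite ler_norml; have := ler_norm (x - y);
    have := ler_norm (y - x); rewrite (distrC y x) => ? ?; apply/andP; split; lra.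
pose p y := F (- ln (c y)).
have pL x y : `|p x - p y| <= K * a^-1 * `|x - y|.
  apply: (le_trans (FK _ _)); rewrite -mulrA; apply: ler_wpM2l => //.
  rewrite -opprD normrN; apply: (le_trans (ln_lipschitz a0 (ca x) (ca y))).
  by apply: ler_wpM2l => //; rewrite invr_ge0 ltW.
have pF u : 0 <= u -> p (expR (- u)) = F u.
  move=> u0; rewrite /p /c.
  have [bu|ub] := leP b u.
    by rewrite max_l ?ler_expR ?lerN2// expRK opprK !Fb.
  by rewrite max_r ?ler_expR ?lerN2 1?ltW// expRK opprK.
have mF : measurable_fun setT F.
  apply: continuous_measurable_fun => x; apply/cvgrPdist_le => /= e e0.
  near=> y; apply: (le_trans (FK _ _)).
  apply: (@le_trans _ _ ((K + 1) * `|x - y|)); first by apply: ler_wpM2r => //; lra.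
  rewrite -ler_pdivlMl; last lra.
  near: y; exists ((K + 1)^-1 * e) => /=; last by move=> z; exact: ltW.
  by rewrite mulr_gt0 ?invr_gt0//; lra.
have LB d1 (T1 : measurableType d1) (P1 : probability T1 R) (W : T1 -> R) :
    measurable_fun setT W -> (forall w, 0 <= W w) -> L1 P1 (fun w => F (W w)).
  move=> mW W0; apply: (@L1_bounded _ _ _ _ _ (K * b)); first exact: measurableT_comp.
  move=> w; have [bW|Wb] := leP b (W w); first by rewrite Fb// normr0 mulr_ge0.
  have := FK (W w) b; rewrite [F b]Fb// subr0 => /le_trans; apply.
  by apply: ler_wpM2l => //; rewrite ler_norml; have := W0 w; lra.
apply/cvgrPdist_le => /= e e0.
have [m [f mfp]] : exists m f, forall x, 0 <= x <= 1 -> `|bern m f x - p x| <= e / 3.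
  apply: bern_approx pL; last by lra.
  exact: divr_ge0 K0 (ltW a0).
have [LP LQ C] := bernUV m f 0.
have e3 : 0 < e / 3 by lra.
have approx d1 (T1 : measurableType d1) (P1 : probability T1 R) (W : T1 -> R) :
    measurable_fun setT W -> (forall w, 0 <= W w) ->
    L1 P1 (fun w => expR (- (0%:R * W w)) * bern m f (expR (- W w))) ->
    `|E P1 (fun w => expR (- (0%:R * W w)) * bern m f (expR (- W w))) - E P1 (fun w => F (W w))| <= e / 3.
  move=> mW W0 LBW; have LF := LB _ _ P1 W mW W0.
  rewrite -EB//; apply: (le_trans (E_norm _)); first exact: L1B.
  rewrite -[leRHS](E_cst P1); apply: E_le; first exact/L1_norm/L1B.
    exact: L1_cst.
  move=> w; rewrite mul0r oppr0 expR0 mul1r -pF//; apply: mfp.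
  by rewrite expR_ge0/= expR_le1 oppr_le0; exact: W0.
near=> n.
have := approx _ _ P (U n) (mU n) (U0 n) (LP n).
have := approx _ _ Q V mV V0 LQ.
have : `|E Q (fun w => expR (- (0%:R * V w)) * bern m f (expR (- V w))) -
   E P (fun w => expR (- (0%:R * U n w)) * bern m f (expR (- U n w)))| <= e / 3.
  by near: n; apply: cvgr_dist_le C _ e3.
rewrite !ler_norml => /andP[? ?] /andP[? ?] /andP[? ?]; apply/andP; split; lra.
Unshelve. all: by end_near. Qed.

End laplace.

(** * A central limit theorem tested on cosines *)

Section cos_clt.
Context d d' (T : measurableType d) (S : measurableType d') (R : realType)
  (P : probability T R) (I : choiceType) (X : I -> T -> S).
Hypothesis mX : forall i, measurable_fun setT (X i).
Hypothesis indX : independent_family P X.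
Variables (J : nat -> set I) (eta : nat -> T -> R).
Hypothesis dJ : forall i n, (i < n)%N -> J n `&` J i = set0.
Hypothesis meta : forall i, J_measurable X (J i) (eta i).

Let JJ n := \bigcup_(i in `I_n) J i.

Let msum n : J_measurable X (JJ n) (fun w => \sum_(i < n) eta i w).
Proof.
rewrite /J_measurable; apply: measurable_sum => i; apply: (sub_mono _ (@meta i)).
by move=> x Jx; exists i => /=.
Qed.

Let dJJ n : J n `&` JJ n = set0.
Proof.
apply/seteqP; split => // x [Jn [i /= i_n Ji]].
by have : (J n `&` J i) x by []; rewrite dJ.
Qed.

Let meta' i : measurable_fun setT (eta i).
Proof. exact: (@sub_measurable_fun _ _ _ _ _ X (@mX) _ _ (J i) (eta i) (@meta i)). Qed.

Let L1_cos (f : T -> R) : measurable_fun setT f -> L1 P (fun w => cos (f w)).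
Proof.
move=> mf; apply: (@L1_bounded _ _ _ _ _ 1) => [|w]; last exact: cos_max.
by apply: measurableT_comp mf; apply: continuous_measurable_fun; exact: continuous_cos.
Qed.

Let L1_sin (f : T -> R) : measurable_fun setT f -> L1 P (fun w => sin (f w)).
Proof.
move=> mf; apply: (@L1_bounded _ _ _ _ _ 1) => [|w]; last exact: sin_max.
by apply: measurableT_comp mf; apply: continuous_measurable_fun; exact: continuous_sin.
Qed.

Let L1_expand (f : T -> R) x : measurable_fun setT f ->
  E P (fun w => cos (x + f w)) = cos x * E P (fun w => cos (f w)) - sin x * E P (fun w => sin (f w)).
Proof.
move=> mf; under eq_E do rewrite cosD.
rewrite EB; [|exact/L1Z/L1_cos|exact/L1Z/L1_sin].
by rewrite !EZ//; [exact: L1_sin|exact: L1_cos].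
Qed.

(** The summands are integrated out one at a time. Averaging over one of them turns cos(x + t eta)
    into cos x E cos(t eta) - sin x E sin(t eta), which is within [delta] of rho cos x. The free
    phase [x] makes the induction possible without complex exponentials. *)
Lemma cos_telescope (t rho delta : R) : 0 <= rho <= 1 ->
  (forall i, `|E P (fun w => cos (t * eta i w)) - rho| + `|E P (fun w => sin (t * eta i w))| <= delta) ->
  forall n x, `|E P (fun w => cos (x + t * \sum_(i < n) eta i w)) - rho ^+ n * cos x| <= n%:R * delta.
Proof.
move=> rho01 Hd; elim=> [x|n IH x].
  by under eq_E do rewrite big_ord0 mulr0 addr0; rewrite E_cst mul1r subrr normr0 mul0r.
have mcos : measurable_fun setT (fun uv : R * R => cos (x + t * uv.1 + t * uv.2)).
  apply: measurableT_comp; first by apply: continuous_measurable_fun; exact: continuous_cos.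
  apply: measurable_funD; first apply: measurable_funD => //; exact: measurable_funM.
have mS : measurable_fun setT (fun w => \sum_(i < n) eta i w).
  by apply: measurable_sum => i.
have mt i : measurable_fun setT (fun w => t * eta i w) by exact: measurable_funM.
have [] := @decouplingE _ _ _ _ _ P _ X (@mX) (@indX) _ _ _ _ (J n) (JJ n) (eta n) (fun w => \sum_(i < n) eta i w)
  (dJJ n) (@meta n) (@msum n) _ mcos.
- apply: L1_cos; apply: measurable_funD; last exact: measurable_funM.
  by apply: measurable_funD => //; exact: mt.
- move=> w1; rewrite /=; apply: L1_cos; apply: measurable_funD => //; exact: measurable_funM.
move=> /= LE EE1.
have -> : (fun w => cos (x + t * \sum_(i < n.+1) eta i w)) =
   (fun w => cos (x + t * eta n w + t * \sum_(i < n) eta i w)).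
  by apply/funext => w; rewrite big_ord_recr/= mulrDr; congr cos; ring.
rewrite {}EE1.
set psi := fun w1 => _ in LE *.
have Lc : L1 P (fun w => cos (x + t * eta n w)) by apply: L1_cos; exact: measurable_funD.
(* The first difference is the induction hypothesis at the random phase [x + t * eta n w]; the
   second replaces the last summand. *)
have -> : E P psi - rho ^+ n.+1 * cos x = (E P psi - rho ^+ n * E P (fun w => cos (x + t * eta n w)))
  + rho ^+ n * (E P (fun w => cos (x + t * eta n w)) - rho * cos x) by rewrite exprSr; ring.
rewrite -natr1 mulrDl mul1r; apply: (le_trans (ler_normD _ _)); apply: lerD.
  rewrite -EZ// -EB//; last exact: L1Z.
  apply: (le_trans (E_norm _)); first by apply: L1B => //; exact: L1Z.
  rewrite -[leRHS](E_cst P); apply: E_le; first by apply/L1_norm/L1B => //; exact: L1Z.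
    exact: L1_cst.
  by move=> w; exact: IH.
rewrite normrM (@le_trans _ _ (1 * `|E P (fun w => cos (x + t * eta n w)) - rho * cos x|))//.
  apply: ler_wpM2r => //; rewrite normrX ger0_norm; last by lra.
  by apply: exprn_ile1; lra.
rewrite mul1r L1_expand//.
have -> : forall A B : R, cos x * A - sin x * B - rho * cos x = cos x * (A - rho) - sin x * B.
  by move=> A B; ring.
apply: le_trans (Hd n); apply: (le_trans (ler_normB _ _)).
rewrite !normrM; apply: lerD; rewrite -[leRHS]mul1r; apply: ler_wpM2r => //.
  exact: cos_max.
exact: sin_max.
Qed.

Variable v : R.
Hypothesis Leta : forall i, L2 P (eta i).
Hypothesis eta_mean : E P (eta 0%N) = 0.
Hypothesis eta_var : E P (fun w => eta 0%N w ^+ 2) = v.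
Hypothesis eta_cos : forall i (t : R), E P (fun w => cos (t * eta i w)) = E P (fun w => cos (t * eta 0%N w)).
Hypothesis eta_sin : forall i (t : R), E P (fun w => sin (t * eta i w)) = E P (fun w => sin (t * eta 0%N w)).

Let tn n : R := (Num.sqrt n%:R)^-1.

Let tnE n : (0 < n)%N -> tn n ^+ 2 = n%:R^-1.
Proof. by move=> n0; rewrite exprVn sqr_sqrtr. Qed.

(** Dominated convergence with second moments only: [cos_taylor] gives the pointwise limit and
    [cos_taylor2] the dominating function eta^2. *)
Let cos_rate : n%:R * (E P (fun w => cos (tn n * eta 0%N w)) - 1) + v / 2 @[n --> \oo] --> 0.
Proof.
pose f n w := n%:R * (cos (tn n * eta 0%N w) - 1 + (tn n * eta 0%N w) ^+ 2 / 2).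
have mtn n : measurable_fun setT (fun w => tn n * eta 0%N w) by exact: measurable_funM.
have f0 : E P (f n) @[n --> \oo] --> E P (fun=> 0).
  apply: (@E_dominated _ _ _ _ _ _ (fun w => eta 0%N w ^+ 2)); last first.
  - move=> [|n] w; first by rewrite /f mul0r normr0 sqr_ge0.
    rewrite /f normrM ger0_norm//; apply: (le_trans (ler_wpM2l _ (cos_taylor2 _))) => //.
    rewrite exprMn tnE//; have -> : n.+1%:R * (n.+1%:R^-1 * eta 0%N w ^+ 2 / 2) = eta 0%N w ^+ 2 / 2.
      by field; rewrite addrC natr1.
    by have := sqr_ge0 (eta 0%N w); lra.
  - exact: L2_sqr.
  - move=> w; apply: (@cvg0_le _ _ (fun n => eta 0%N w ^+ 4 / 24 / n%:R)); last exact: cvg_divn.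
    move=> [|n]; first by rewrite /f mul0r normr0 invr0 mulr0.
    rewrite /f normrM ger0_norm//; apply: (le_trans (ler_wpM2l _ (cos_taylor _))) => //.
    rewrite exprMn (_ : tn n.+1 ^+ 4 = (tn n.+1 ^+ 2) ^+ 2); last by ring.
    by rewrite tnE// le_eqVlt; apply/orP; left; apply/eqP; field; rewrite addrC natr1.
  - move=> n; apply: measurable_funM => //; apply: measurable_funD.
      by apply: measurable_funB => //; apply: measurableT_comp (mtn n); apply: continuous_measurable_fun; exact: continuous_cos.
    by apply: measurable_funM => //; exact: measurable_funX.
rewrite E_cst in f0; apply: cvg_trans f0; apply: near_eq_cvg.
exists 1%N => // -[//|n] _; rewrite /f EZ; last first.
  apply: L1D; first by apply: L1B; [exact: L1_cos|exact: L1_cst].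
  under eq_fun do rewrite exprMn mulrAC; apply: L1Z; exact: L2_sqr.
have Lt2 : L1 P (fun w => (tn n.+1 * eta 0%N w) ^+ 2 / 2).
  under eq_fun do rewrite exprMn mulrAC; apply: L1Z; exact: L2_sqr.
rewrite ED//; last by apply: L1B; [exact: L1_cos|exact: L1_cst].
rewrite EB; [|exact: L1_cos|exact: L1_cst].
rewrite E_cst (_ : E P (fun w => (tn n.+1 * eta 0%N w) ^+ 2 / 2) = n.+1%:R^-1 / 2 * v).
  by field; rewrite addrC natr1.
under eq_E do rewrite exprMn mulrAC tnE//.
by rewrite EZ ?eta_var//; exact: L2_sqr.
Qed.

(** The mean is 0, so the linear term of the sine can be subtracted without changing the
    expectation. *)
Let sin_rate : n%:R * E P (fun w => sin (tn n * eta 0%N w)) @[n --> \oo] --> 0.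
Proof.
pose f n w := n%:R * (sin (tn n * eta 0%N w) - tn n * eta 0%N w).
have mtn n : measurable_fun setT (fun w => tn n * eta 0%N w) by exact: measurable_funM.
have f0 : E P (f n) @[n --> \oo] --> E P (fun=> 0).
  apply: (@E_dominated _ _ _ _ _ _ (fun w => eta 0%N w ^+ 2)); last first.
  - move=> [|n] w; first by rewrite /f mul0r normr0 sqr_ge0.
    rewrite /f normrM ger0_norm//; apply: (le_trans (ler_wpM2l _ (sin_taylor2 _))) => //.
    by rewrite exprMn tnE// mulrA divff// mul1r.
  - exact: L2_sqr.
  - move=> w; apply: (@cvg0_le _ _ (fun n => `|eta 0%N w| ^+ 3 / 6 * tn n)); last first.
      rewrite -(mulr0 (`|eta 0%N w| ^+ 3 / 6)); apply: cvgMr.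
      have := @cvg_divn R 1; under eq_fun do rewrite mul1r.
      move=> H; have : Num.sqrt (n%:R^-1) @[n --> \oo] --> Num.sqrt (0 : R).
        by apply: continuous_cvg => //; exact: sqrt_continuous.
      rewrite sqrtr0; apply: cvg_trans; apply: near_eq_cvg; apply: nearW => n.
      by rewrite /tn sqrtrV.
    move=> [|n]; first by rewrite /f mul0r normr0 mulr_ge0 ?divr_ge0// invr_ge0.
    rewrite /f normrM ger0_norm//; apply: (le_trans (ler_wpM2l _ (sin_taylor _))) => //.
    have tn0 : 0 <= tn n.+1 by rewrite invr_ge0.
    rewrite normrM [`|tn _|]ger0_norm// exprMn exprS tnE// le_eqVlt; apply/orP; left; apply/eqP.
    by field; rewrite addrC natr1.
  - move=> n; apply: measurable_funM => //; apply: measurable_funB => //.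
    by apply: measurableT_comp (mtn n); apply: continuous_measurable_fun; exact: continuous_sin.
rewrite E_cst in f0; apply: cvg_trans f0; apply: near_eq_cvg; apply: nearW => n.
have L1e : L1 P (fun w => tn n * eta 0%N w) by apply/L1Z/L2_L1.
rewrite /f EZ; last by apply: L1B => //; exact: L1_sin.
by rewrite EB//; [rewrite EZ ?eta_mean ?mulr0 ?subr0//; exact: L2_L1|exact: L1_sin].
Qed.

Let exp_rate : n%:R * (1 - expR (- (v / 2 / n%:R))) - v / 2 @[n --> \oo] --> 0.
Proof.
have v0 : 0 <= v by rewrite -eta_var; apply: E_ge0 => w; exact: sqr_ge0.
rewrite -(cvg_shiftS (fun n => n%:R * (1 - expR (- (v / 2 / n%:R))) - v / 2)).
  apply: (@cvg0_le _ _ (fun n => (v / 2) ^+ 2 / n.+1%:R)).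
    move=> n; set u := v / 2 / n.+1%:R.
    have u0 : 0 <= u by rewrite !divr_ge0.
    have -> : v / 2 = n.+1%:R * u by rewrite /u; field; rewrite addrC natr1.
    rewrite -mulrBr normrM ger0_norm// exprMn.
    have -> : n.+1%:R ^+ 2 * u ^+ 2 / n.+1%:R = n.+1%:R * u ^+ 2 by field; rewrite addrC natr1.
    apply: ler_wpM2l => //.
    have h1 := expR_ge1Dx (- u); have h2 := expR_ge1Dx u.
    have h3 : expR (- u) * (1 + u) <= 1.
      by apply: (le_trans (ler_wpM2l (expR_ge0 _) h2)); rewrite -expRD addNr expR0.
    have h4 : expR (- u) <= 1 - u + u ^+ 2.
      rewrite -(ler_pM2r (_ : 0 < 1 + u)); last lra.
      by apply: (le_trans h3); have := exprn_ge0 3 u0; nra.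
    by rewrite ler_norml; apply/andP; split; nra.
  by rewrite (cvg_shiftS (fun n => (v / 2) ^+ 2 / n%:R)); exact: cvg_divn.
Qed.

(** In [cos_telescope] take rho = exp(-v/(2n)), whose n-th power is the limit; n times the error of
    one step is controlled by the three rates above. *)
Lemma cos_clt : E P (fun w => cos ((Num.sqrt n%:R)^-1 * \sum_(i < n) eta i w)) @[n --> \oo] --> expR (- (v / 2)).
Proof.
have v0 : 0 <= v by rewrite -eta_var; apply: E_ge0 => w; exact: sqr_ge0.
pose delta n := `|E P (fun w => cos (tn n * eta 0%N w)) - expR (- (v / 2 / n%:R))| + `|E P (fun w => sin (tn n * eta 0%N w))|.
have d0 : n%:R * delta n @[n --> \oo] --> 0.
  have H : `|n%:R * (E P (fun w => cos (tn n * eta 0%N w)) - 1) + v / 2| +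
     `|n%:R * (1 - expR (- (v / 2 / n%:R))) - v / 2| + `|n%:R * E P (fun w => sin (tn n * eta 0%N w))|
     @[n --> \oo] --> 0 + 0 + 0.
    have N0 (u : nat -> R) : u n @[n --> \oo] --> 0 -> `|u n| @[n --> \oo] --> 0.
      by move=> /cvg_norm; rewrite normr0.
    exact: (cvgD (cvgD (N0 _ cos_rate) (N0 _ exp_rate)) (N0 _ sin_rate)).
  rewrite !addr0 in H; apply: cvg0_le H => n.
  rewrite ger0_norm; last by rewrite mulr_ge0// addr_ge0.
  rewrite mulrDr; apply: lerD; last by rewrite normrM ger0_norm.
  rewrite -[X in X * _](ger0_norm (ler0n _ n)) -normrM.
  apply: le_trans (ler_normD _ _); rewrite le_eqVlt; apply/orP; left; apply/eqP; congr `|_|; ring.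
apply/cvgrPdist_le => /= e e0; near=> n.
have n0 : (0 < n)%N by near: n; exists 1%N.
have := @cos_telescope (tn n) (expR (- (v / 2 / n%:R))) (delta n) _ _ n 0.
rewrite cos0 mulr1 -expRM_natr mulNr mulfVK ?pnatr_eq0 -?lt0n//.
have -> : (fun w => cos (0 + tn n * \sum_(i < n) eta i w)) = (fun w => cos ((Num.sqrt n%:R)^-1 * \sum_(i < n) eta i w)).
  by apply/funext => w; rewrite add0r.
rewrite distrC => H; apply: (le_trans (H _ _)).
- by rewrite expR_ge0 -expR0 ler_expR oppr_le0 !divr_ge0.
- by move=> i; rewrite eta_cos eta_sin.
- have : `|0 - n%:R * delta n| <= e by near: n; apply: cvgr_dist_le d0 _ e0.
  by rewrite sub0r normrN; apply: le_trans; exact: ler_norm.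
Unshelve. all: by end_near. Qed.

End cos_clt.

(** * Gaussian integrals *)

Section gaussian.
Variable R : realType.
Let N : probability (measurableTypeR R) R := @normal_prob R 0 1.
Let leb : {measure set (measurableTypeR R) -> \bar R} := @lebesgue_measure R.
Let phi : R -> R := normal_pdf 0 1.

Let phi0 x : 0 <= phi x. Proof. exact: normal_pdf_ge0. Qed.

Let phiE x : phi x = normal_peak 1 * expR (- (x ^+ 2 / 2)).
Proof.
rewrite /phi normal_pdfE ?oner_neq0// /normal_fun subr0 expr1n; congr (_ * expR _).
by rewrite mulNr.
Qed.

Let mphi : measurable_fun setT phi. Proof. exact: measurable_normal_pdf. Qed.

(** Change of variables introduces the Radon-Nikodym derivative of the normal law, which is
    identified almost everywhere with the density by comparing integrals over sets. *)
Lemma ge0_integral_normal (f : R -> R) : measurable_fun setT f -> (forall x, 0 <= f x) ->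
  (\int[N]_x (f x)%:E = \int[leb]_x (f x * phi x)%:E)%E.
Proof.
move=> mf f0.
have dom : N `<< (@lebesgue_measure R) by exact: normal_prob_dominates.
rewrite -(@Radon_Nikodym_SigmaFinite.change_of_variables _ _ R N (@lebesgue_measure R) dom (EFin \o f))//=; last exact/measurable_EFinP.
apply: ae_eq_integral => //.
- apply: emeasurable_funM; first exact/measurable_EFinP.
  exact: measurable_int (Radon_Nikodym_SigmaFinite.f_integrable dom).
- by apply/measurable_EFinP; exact: measurable_funM.
under [X in ae_eq _ _ _ X]eq_fun do rewrite EFinM.
apply: ae_eqe_mul2l.
apply: integral_ae_eq => //.
- exact: Radon_Nikodym_SigmaFinite.f_integrable.
- exact/measurable_EFinP.
- by move=> A _ mA; rewrite -Radon_Nikodym_SigmaFinite.f_integral.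
Qed.

Lemma integral_normal (f : R -> R) : L1 N f ->
  leb.-integrable setT (fun x => (f x * phi x)%:E) /\ (E N f = \int[leb]_x (f x * phi x))%R.
Proof.
move=> Lf; have mf := L1_meas Lf.
have L : leb.-integrable setT (fun x => (f x * phi x)%:E).
  apply/integrableP; split; first by apply/measurable_EFinP; exact: measurable_funM.
  under eq_integral do rewrite abse_EFin normrM (ger0_norm (phi0 _)).
  rewrite -ge0_integral_normal//; last exact: measurableT_comp.
  by rewrite (EE (L1_norm Lf)) ltry.
split=> //; rewrite /E /Rintegral.
rewrite [in RHS]integralE [in LHS]integralE.
have -> : (fun x => (f x * phi x)%:E)^\+%E = (fun x => (Num.max (f x) 0 * phi x)%:E).
  by apply/funext => x; rewrite funeposE -EFin_max maxr_pMl// mul0r.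
have -> : (fun x => (f x * phi x)%:E)^\-%E = (fun x => (Num.max (- f x) 0 * phi x)%:E).
  by apply/funext => x; rewrite funenegE -EFinN -EFin_max maxr_pMl// mul0r mulNr.
rewrite -!ge0_integral_normal//.
- by congr (fine (_ - _)); apply: eq_integral => x _; rewrite ?funeposE ?funenegE -?EFinN EFin_max.
- by apply: measurable_maxr => //; exact: measurableT_comp.
- by move=> x; rewrite le_max lexx orbT.
- exact: measurable_maxr.
- by move=> x; rewrite le_max lexx orbT.
Qed.

Let L1_exp : L1 N (fun x => expR (x ^+ 2 / 4)).
Proof.
apply: L1_ge0 => [|x|]; last 2 first.
- exact: expR_ge0.
- rewrite ge0_integral_normal; last 2 first.
  + by apply: measurableT_comp => //; exact: measurable_funM.
  + by move=> x; exact: expR_ge0.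
  have s0 : Num.sqrt 2 != 0 :> R by rewrite gt_eqF// sqrtr_gt0.
  (* Since x^2/4 - x^2/2 = -x^2/4, the integrand is a multiple of the normal density of variance
     2. *)
  have -> : (fun x => (expR (x ^+ 2 / 4) * phi x)%:E) =
    (fun x => ((normal_peak 1 / normal_peak (Num.sqrt 2)) * normal_pdf 0 (Num.sqrt 2) x)%:E).
    apply/funext => x; rewrite phiE normal_pdfE// /normal_fun subr0 sqr_sqrtr//; congr EFin.
    rewrite mulrA divfK; last by rewrite gt_eqF// normal_peak_gt0.
    rewrite mulrCA -expRD; congr (_ * expR _).
    by rewrite -mulr_natr; field.
  under eq_integral do rewrite EFinM.
  rewrite ge0_integralZl//=.
  + by rewrite integral_normal_pdf mule1 ltry.
  + by apply/measurable_EFinP; exact: measurable_normal_pdf.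
  + by move=> x _; rewrite lee_fin normal_pdf_ge0.
  + by rewrite lee_fin divr_ge0// normal_peak_ge0.
- by apply: measurableT_comp => //; exact: measurable_funM.
Qed.

Lemma L1_normal4 : L1 N (fun x => x ^+ 4).
Proof.
(* The factor 32 comes from exp(y) >= y^2/2 at y = x^2/4. *)
apply: (@L1_le _ _ _ _ _ (fun x : measurableTypeR R => 32 * expR (x ^+ 2 / 4))).
- exact: measurable_funX.
- move=> x; have := @expR_ge1Dxn _ (x ^+ 2 / 4) 1; rewrite ger0_norm ?exprn_even_ge0//.
  have -> : (x ^+ 2 / 4) ^+ 2 / 2`!%:R = x ^+ 4 / 32 by rewrite (_ : 2`!%:R = 2)//; field.
  by move=> /(_ ltac:(by have := sqr_ge0 x; lra)); lra.
- exact: L1Z.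
Qed.

Lemma L2_normal_sqr : L2 N (fun x => x ^+ 2).
Proof.
split; first exact: measurable_funX.
by apply: eq_L1 L1_normal4 => x; rewrite -exprM.
Qed.

Lemma L2_normal_id : L2 N id.
Proof. by split => //; exact: L2_L1 L2_normal_sqr. Qed.

Let phi_cvg0 : phi n%:R @[n --> \oo] --> 0.
Proof.
rewrite -(cvg_shiftS (fun n => phi n%:R)).
apply: (@cvg0_le _ _ (fun n => normal_peak 1 / n.+1%:R)); last first.
  by rewrite (cvg_shiftS (fun n => normal_peak 1 / n%:R)); exact: cvg_divn.
move=> n; rewrite ger0_norm// phiE; apply: ler_wpM2l; first exact: normal_peak_ge0.
rewrite expRN lef_pV2 ?posrE ?expR_gt0//.
apply: le_trans (expR_ge1Dx _); have := sqr_ge0 (n.+1%:R - 1 : R); nra.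
Qed.

Let is_derive_phi (x : R) : is_derive x 1 phi (- x * phi x).
Proof.
have -> : phi = (fun x => normal_peak 1 * expR (- (x ^+ 2 / 2))) by apply/funext => y; exact: phiE.
by apply: is_derive_eq; rewrite /GRing.scale/=; field.
Qed.

(** Stein's identity E f'(Z) = E Z f(Z) for f(x) = sin(a + b x). The integrand times the density is
    the derivative of phi f; on [-n, n] only boundary terms remain, at most 2 phi(n), and dominated
    convergence removes the restriction. *)
Lemma normal_stein (a b : R) : E N (fun x => b * cos (a + b * x) - x * sin (a + b * x)) = 0.
Proof.
pose h x := b * cos (a + b * x) - x * sin (a + b * x).
pose F x := phi x * sin (a + b * x).
have ch : continuous h.
  move=> x; apply: cvgB; apply: cvgM => //; try exact: cvg_cst.
    by apply: continuous_comp; [apply: cvgD; [exact: cvg_cst|exact: mulrl_continuous]|exact: continuous_cos].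
  by apply: continuous_comp; [apply: cvgD; [exact: cvg_cst|exact: mulrl_continuous]|exact: continuous_sin].
have cphi : continuous phi by apply: continuous_normal_pdf; exact: oner_neq0.
have dF (x : R) : is_derive x 1 F (h x * phi x).
  have := is_derive_phi x => ?.
  by apply: is_derive_eq; rewrite /GRing.scale/= /h; ring.
have mh : measurable_fun setT h by exact: continuous_measurable_fun.
have Lh : L1 N h.
  apply: (@L1_le _ _ _ _ _ (fun x : measurableTypeR R => `|b| + `|x|)) => //.
    move=> x; apply: (le_trans (ler_normB _ _)); rewrite !normrM; apply: lerD.
      by rewrite -[leRHS]mulr1; apply: ler_wpM2l => //; exact: cos_max.
    by rewrite -[leRHS]mulr1; apply: ler_wpM2l => //; exact: sin_max.
  by apply: L1D; [exact: L1_cst|apply/L1_norm/L2_L1/L2_normal_id].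
pose hn n x := h x * \1_(`[(- n%:R), n%:R]%classic : set R) x.
have mhn n : measurable_fun setT (hn n).
  by apply: measurable_funM => //; apply: measurable_indic; exact: measurable_itv.
have hn_h n x : `|hn n x| <= `|h x|.
  rewrite /hn normrM -[leRHS]mulr1; apply: ler_wpM2l => //.
  by rewrite indicE; case: (_ \in _); rewrite ?normr1 ?normr0.
have Ehn n : E N (hn n.+1) = phi n.+1%:R * (sin (a + b * n.+1%:R) - sin (a - b * n.+1%:R)).
  have Lhn : L1 N (hn n.+1).
    by apply: (@L1_le _ _ _ _ _ (fun x : measurableTypeR R => `|h x|)); [exact: mhn|exact: hn_h|exact: L1_norm].
  have [_ ->] := integral_normal Lhn.
  have -> : (fun x => hn n.+1 x * phi x) = (fun x => (h x * phi x)) \_ (`[(- n.+1%:R), n.+1%:R]%classic : set R).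
    by apply/funext => x; rewrite /hn /patch indicE; case: ifPn => xi; rewrite ?mulr1// mulr0 mul0r.
  rewrite -Rintegral_mkcond /Rintegral (@continuous_FTC2 _ _ F).
  - rewrite /= /F mulrN.
    have -> : phi (- n.+1%:R) = phi n.+1%:R by rewrite !phiE sqrrN.
    by rewrite -mulrBr.
  - by rewrite -subr_gt0 opprK addr_gt0.
  - apply: continuous_subspaceT => x; apply: cvgM; [exact: ch|exact: cphi].
  - have cF (x : R) : {for x, continuous F}.
      by apply/differentiable_continuous/derivable1_diffP; exact: ex_derive.
    split.
    + by move=> x _; exact: ex_derive.
    + by apply: cvg_at_right_filter; exact: cF.
    + by apply: cvg_at_left_filter; exact: cF.
  - by move=> x _; rewrite derive1E; exact: derive_val.
have H1 : E N (hn n) @[n --> \oo] --> E N h.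
  apply: (@E_dominated _ _ _ _ _ _ (fun x : measurableTypeR R => `|h x|)) => //; last exact: L1_norm.
  move=> x; apply: cvg_trans (_ : h x @[n --> \oo] --> h x); last exact: cvg_cst.
  apply: near_eq_cvg; exists (Num.truncn `|x|).+1 => // n /= xn.
  rewrite /hn indicE mem_set ?mulr1//= in_itv/= -ler_norml.
  by apply: ltW; apply: lt_le_trans (truncnS_gt _) _; rewrite ler_nat.
have H2 : E N (hn n) @[n --> \oo] --> 0.
  rewrite -(cvg_shiftS (fun n => E N (hn n))).
  apply: (@cvg0_le _ _ (fun n => 2 * phi n.+1%:R)).
    move=> n; rewrite Ehn normrM ger0_norm// mulrC; apply: ler_wpM2r => //.
    apply: (le_trans (ler_normB _ _)).
    by have := sin_max (a + b * n.+1%:R); have := sin_max (a - b * n.+1%:R); lra.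
  have := phi_cvg0; rewrite -(cvg_shiftS (fun n => phi n%:R)) => H.
  by rewrite -(mulr0 2); apply: cvgM H; exact: cvg_cst.
by rewrite -(cvg_lim _ H1)// -(cvg_lim _ H2).
Qed.

Let L1_cosb (a b : R) : L1 N (fun x => cos (a + b * x)).
Proof.
apply: (@L1_bounded _ _ _ _ _ 1) => [|w]; last exact: cos_max.
apply: (@measurableT_comp _ _ _ _ _ _ cos); last by apply: measurable_funD => //; exact: measurable_funM.
by apply: continuous_measurable_fun; exact: continuous_cos.
Qed.

Let L1_xsin (a b : R) : L1 N (fun x => x * sin (a + b * x)).
Proof.
apply: (@L1_le _ _ _ _ _ (fun x : measurableTypeR R => `|x|)) => [||]; last exact/L1_norm/L2_L1/L2_normal_id.
  apply: measurable_funM => //; apply: (@measurableT_comp _ _ _ _ _ _ sin); last by apply: measurable_funD => //; exact: measurable_funM.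
  by apply: continuous_measurable_fun; exact: continuous_sin.
by move=> x; rewrite normrM -[leRHS]mulr1; apply: ler_wpM2l => //; exact: sin_max.
Qed.

(** As a function of [b] the left side [C] satisfies C' = -b C, by differentiation under the
    integral and Stein's identity; hence C(b) exp(b^2/2) is constant, equal to cos a. *)
Lemma normal_cos (a b : R) : E N (fun x => cos (a + b * x)) = cos a * expR (- (b ^+ 2 / 2)).
Proof.
pose C b := E N (fun x => cos (a + b * x)).
have dcos (x y : R) : is_derive x 1 (fun b : R => cos (a + b * y) : R) (- (y * sin (a + x * y))).
  by apply: is_derive_eq; rewrite /GRing.scale/=; ring.
have dC (c : R) : is_derive c 1 C (- (c * C c)).
  have Ic : `](c - 1), (c + 1)[%classic c by rewrite /= in_itv/=; apply/andP; split; lra.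
  have i1 x : `](c - 1), (c + 1)[%classic x -> N.-integrable setT (EFin \o (fun y => cos (a + x * y))).
    by move=> _; exact: L1_cosb.
  have d1 (x y : R) : `](c - 1), (c + 1)[%classic x -> setT y -> derivable (fun b : R => cos (a + b * y) : R) x 1.
    by move=> _ _; exact: ex_derive.
  have p1 (x y : R) : partial1of2 (fun b y => cos (a + b * y)) x y = - (y * sin (a + x * y)).
    by rewrite /partial1of2 derive1E; exact: derive_val.
  have iG : N.-integrable setT (EFin \o (fun y : R => `|y|)) by exact/L1_norm/L2_L1/L2_normal_id.
  have G1 (x y : R) : `](c - 1), (c + 1)[%classic x -> setT y -> `|partial1of2 (fun b y => cos (a + b * y)) x y| <= `|y|.
    by move=> _ _; rewrite p1 normrN normrM -[leRHS]mulr1; apply: ler_wpM2l => //; exact: sin_max.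
  have dd := derivable_under_integral measurableT Ic i1 d1 (fun y => normr_ge0 y) iG G1.
  have de := differentiation_under_integral measurableT Ic i1 d1 (fun y => normr_ge0 y) iG G1.
  apply: DeriveDef; first exact: dd.
  rewrite -derive1E; apply: (etrans de).
  have -> : (fun y : R => partial1of2 (fun b y => cos (a + b * y)) c y) = (fun y => - (y * sin (a + c * y))).
    by apply/funext => y; rewrite p1.
  have := normal_stein a c; rewrite EB//; last exact/L1Z/L1_cosb.
  rewrite EZ// -/(C c) => H.
  have -> : (\int[N]_x - (x * sin (a + c * x)))%R = E N (fun x => (-1) * (x * sin (a + c * x))).
    by apply: eq_E => x; rewrite mulN1r.
  by rewrite EZ//; lra.
pose D (b : R) := C b * expR (b ^+ 2 / 2).
have dD (c : R) : is_derive c 1 D 0.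
  have := dC c => ?.
  by apply: is_derive_eq; rewrite /GRing.scale/=; field.
have := is_derive_0_is_cst b 0 dD; rewrite /D expr0n /= mul0r expR0 mulr1.
have -> : C 0 = cos a.
  by rewrite /C; under eq_E do rewrite mul0r addr0; rewrite E_cst.
move=> H; apply: (mulIf (lt0r_neq0 (expR_gt0 (b ^+ 2 / 2)))).
by rewrite -[RHS]mulrA -expRD addNr expR0 mulr1; exact: H.
Qed.

(** Stein's identity with [a] = 0 gives E Z sin(b Z) / b = E cos(b Z) = exp(-b^2/2); both ends are
    evaluated as b tends to 0. *)
Lemma normal_sqr : E N (fun x => x ^+ 2) = 1.
Proof.
pose b n : R := n.+1%:R^-1.
have b0 n : 0 < b n by rewrite invr_gt0.
have bc : b n @[n --> \oo] --> 0 by exact: cvg_harmonic.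
have H1 : E N (fun x => (b n)^-1 * (x * sin (b n * x))) @[n --> \oo] --> E N (fun x => x ^+ 2).
  apply: (@E_dominated _ _ _ _ _ _ (fun x : measurableTypeR R => x ^+ 2)).
  - by move=> n; apply: measurable_funM => //; by have := L1_meas (L1_xsin 0 (b n)); under eq_fun do rewrite add0r.
  - move=> x; apply/subr_cvg0.
    apply: (@cvg0_le _ _ (fun n => `|x| ^+ 3 * b n)).
      move=> n; have -> : (b n)^-1 * (x * sin (b n * x)) - x ^+ 2 = (b n)^-1 * x * (sin (b n * x) - b n * x).
        by field; rewrite gt_eqF.
      rewrite normrM; apply: (le_trans (ler_wpM2l _ (sin_taylor2 _))) => //.
      have b1 : 0 <= (b n)^-1 by rewrite invr_ge0 ltW.
      rewrite normrM (ger0_norm b1) -(real_normK (num_real (b n * x))) normrM (ger0_norm (ltW (b0 n))).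
      by rewrite le_eqVlt; apply/orP; left; apply/eqP; field; rewrite gt_eqF.
    by rewrite -(mulr0 (`|x| ^+ 3)); apply: cvgM => //; exact: cvg_cst.
  - exact: L2_L1 L2_normal_sqr.
  - move=> n x; have b1 : 0 <= (b n)^-1 by rewrite invr_ge0 ltW.
    rewrite normrM (ger0_norm b1) normrM.
    apply: (le_trans (ler_wpM2l b1 (ler_wpM2l (normr_ge0 _) (norm_sin_le _)))).
    rewrite normrM (ger0_norm (ltW (b0 n))) -(real_normK (num_real x)) le_eqVlt.
    by apply/orP; left; apply/eqP; field; rewrite gt_eqF.
have H2 : E N (fun x => (b n)^-1 * (x * sin (b n * x))) @[n --> \oo] --> (1 : R).
  have -> : (fun n => E N (fun x => (b n)^-1 * (x * sin (b n * x)))) = (fun n => expR (- (b n ^+ 2 / 2))).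
    apply/funext => n; have := normal_stein 0 (b n); rewrite EB//; last exact/L1Z/L1_cosb.
    have LL := L1_xsin 0 (b n).
    rewrite EZ// normal_cos cos0 mul1r => /eqP; rewrite subr_eq0 => /eqP.
    rewrite (_ : (fun x => x * sin (0 + b n * x)) = (fun x : R => x * sin (b n * x))) in LL *; last by apply/funext => x; rewrite add0r.
    by move=> H; rewrite EZ// -H mulKf// gt_eqF.
  have bz : - (b n ^+ 2 / 2) @[n --> \oo] --> (0 : R).
    rewrite -oppr0 -(mul0r (2^-1 : R)) -(mulr0 (0 : R)).
    by apply: cvgN; apply: cvgM; [exact: cvgM|exact: cvg_cst].
  have e0 : expR (0 : R) = 1 := @expR0 R.
  by rewrite -[in X in _ --> X]e0; apply: continuous_cvg => //; exact: continuous_expR.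
by rewrite -(cvg_lim _ H1)// -(cvg_lim _ H2).
Qed.

End gaussian.

(** * Quadratic forms of asymptotically Gaussian vectors *)

Section laws.
Context d (T : measurableType d) d' (S : measurableType d') (R : realType)
  (P : probability T R) (mu : {measure set S -> \bar R}) (X : T -> S).
Hypothesis mX : measurable_fun setT X.
Hypothesis lawX : forall A, measurable A -> P (X @^-1` A) = mu A.

Lemma law_integral (f : S -> R) : measurable_fun setT f -> (forall x, 0 <= f x) ->
  (\int[P]_w (f (X w))%:E = \int[mu]_x (f x)%:E)%E.
Proof.
move=> mf f0.
rewrite -[LHS](ge0_integral_pushforward mX P measurableT (f := EFin \o f))//.
- by apply: eq_measure_integral => A mA _; exact: lawX.
- exact/measurable_EFinP.
- by move=> x _; rewrite lee_fin.
Qed.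

Lemma law_L1 (f : S -> R) : measurable_fun setT f -> L1 mu f -> L1 P (fun w => f (X w)).
Proof.
move=> mf Lf; apply/integrableP; split.
  by apply/measurable_EFinP; exact: measurableT_comp.
rewrite [ltLHS](@law_integral (fun x => `|f x|)) => [||x]; last exact: normr_ge0.
  by rewrite (EE (L1_norm Lf)) ltry.
exact: measurableT_comp.
Qed.

Lemma L1_law (f : S -> R) : measurable_fun setT f -> L1 P (fun w => f (X w)) -> L1 mu f.
Proof.
move=> mf Lf; apply/integrableP; split; first exact/measurable_EFinP.
rewrite -[ltLHS](@law_integral (fun x => `|f x|)) => [||x]; last exact: normr_ge0.
  by rewrite (EE (L1_norm Lf)) ltry.
exact: measurableT_comp.
Qed.

Lemma law_L2 (f : S -> R) : L2 mu f -> L2 P (fun w => f (X w)).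
Proof.
move=> [mf Lf]; split; first exact: measurableT_comp.
by apply: (@law_L1 (fun x => f x ^+ 2)) => //; exact: measurable_funX.
Qed.

Lemma law_E (f : S -> R) : measurable_fun setT f -> L1 mu f ->
  E P (fun w => f (X w)) = E mu f.
Proof.
move=> mf Lf; rewrite /E /Rintegral; congr fine.
rewrite -[LHS](integral_pushforward mX (mu := P) (D := setT) (f := EFin \o f))//.
- by apply: eq_measure_integral => A mA _; exact: lawX.
- exact/measurable_EFinP.
- exact: law_L1.
Qed.

End laws.

Section fubini_bounded.
Context d (T : measurableType d) d' (T' : measurableType d') (R : realType)
  (P : probability T R) (Q : probability T' R) (F : T * T' -> R).
Hypothesis mF : measurable_fun setT F.
Hypothesis F1 : forall x, `|F x| <= 1.

Let mF1 w : measurable_fun setT (fun w' => F (w, w')).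
Proof. exact: measurableT_comp mF (pair1_measurable w). Qed.

Let mF2 w' : measurable_fun setT (fun w => F (w, w')).
Proof. exact: measurableT_comp mF (pair2_measurable w'). Qed.

Let iF : (P \x Q)%E.-integrable setT (EFin \o F).
Proof.
apply/integrable12ltyP; first exact/measurable_EFinP.
apply: (@le_lt_trans _ _ (\int[P]_x 1)%E); last first.
  by rewrite integral_cst//= mul1e; have := probability_setT P => /= ->; rewrite ltry.
have m2 : measurable_fun setT (abse \o (EFin \o F)).
  by apply: measurableT_comp => //; exact/measurable_EFinP.
apply: ge0_le_integral => //.
- by move=> x _; exact: integral_ge0.
- exact: (@measurable_fun_fubini_tonelli_F _ _ _ _ _ Q (abse \o (EFin \o F)) m2 (fun=> abse_ge0 _)).
- move=> x _; rewrite -[leRHS](@probability_setT _ _ _ Q) -[leRHS]mul1e -integral_cst//.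
  apply: ge0_le_integral => //.
  + by apply/measurable_EFinP; apply: measurableT_comp.
  + by move=> y _; rewrite lee_fin.
Qed.

Lemma fubini_bounded : E P (fun w => E Q (fun w' => F (w, w'))) = E Q (fun w' => E P (fun w => F (w, w'))) /\
  measurable_fun setT (fun w' => E P (fun w => F (w, w'))).
Proof.
have L1w w : L1 Q (fun w' => F (w, w')) by apply: (@L1_bounded _ _ _ _ _ 1).
have L1w' w' : L1 P (fun w => F (w, w')) by apply: (@L1_bounded _ _ _ _ _ 1).
split.
  have := Fubini iF.
  under eq_integral do rewrite /= (EE (L1w _)).
  under [in RHS]eq_integral do rewrite /= (EE (L1w' _)).
  by rewrite /E /Rintegral => ->.
have := measurable_fubini_G iF; rewrite /fubini_G.
under eq_fun do rewrite /= (EE (L1w' _)).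
by move/measurable_EFinP.
Qed.

End fubini_bounded.

(** * Gaussian randomization of quadratic forms *)

Section gaussian_randomization.
Context d' (T' : measurableType d') (R : realType) (Q : probability T' R)
  (I : choiceType) (Z : I -> T' -> R).
Hypothesis mZ : forall e, measurable_fun setT (Z e).
Hypothesis indZ : independent_family Q Z.
Hypothesis lawZ : forall e A, measurable A -> Q (Z e @^-1` A) = normal_prob 0 1 A.

(** The phase [x] receives the term [b e * Z e] that stays fixed while the induction hypothesis
    integrates the other variables. *)
Lemma normal_cos_sum (s : seq I) (b : I -> R) x : uniq s ->
  E Q (fun w => cos (x + \sum_(e <- s) b e * Z e w)) =
  cos x * expR (- ((\sum_(e <- s) b e ^+ 2) / 2)).
Proof.
have mcos : measurable_fun setT (@cos R) by apply: continuous_measurable_fun; exact: continuous_cos.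
elim: s x => [x _|e s IH x /andP[es us]].
  by under eq_E do rewrite big_nil addr0; rewrite big_nil mul0r oppr0 expR0 mulr1 E_cst.
pose V w := \sum_(e <- s) b e * Z e w.
have JJ' : [set e] `&` [set` s] = set0.
  by apply/seteqP; split => // y [/= ->]; rewrite (negbTE es).
have mV : J_measurable Z [set` s] V.
  apply: measurable_sum_seq => y ys _; apply: measurable_funM => //.
  exact: (@sub_var _ _ _ _ _ Z).
have me : J_measurable Z [set e] (Z e) by exact: (@sub_var _ _ _ _ _ Z).
have mVT : measurable_fun setT V by exact: (@sub_measurable_fun _ _ _ _ _ Z (@mZ) _ _ [set` s] V mV).
have mF : measurable_fun setT (fun uv : R * R => cos (x + b e * uv.1 + uv.2)).
  apply: measurableT_comp => //; apply: measurable_funD => //; apply: measurable_funD => //.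
  exact: measurable_funM.
have cosL (f : T' -> R) : measurable_fun setT f -> L1 Q (fun w => cos (f w)).
  move=> mf; apply: (@L1_bounded _ _ _ _ _ 1) => [|w]; last exact: cos_max.
  exact: measurableT_comp.
have [] := @decouplingE _ _ _ _ _ Q _ Z (@mZ) (@indZ) _ _ _ _ [set e] [set` s] (Z e) V JJ' me mV _ mF.
- rewrite /=; apply: cosL; apply: measurable_funD => //; apply: measurable_funD => //.
  exact: measurable_funM.
- by move=> w1; rewrite /=; apply: cosL; exact: measurable_funD.
move=> /= _ H.
under eq_E do rewrite big_cons addrA.
rewrite -/V; apply: (etrans H).
under eq_E do rewrite IH// mulrC.
rewrite EZ; last first.
  by apply: cosL; apply: measurable_funD => //; exact: measurable_funM.
have cosN : measurable_fun setT (fun z : measurableTypeR R => cos (x + b e * z)).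
  by apply: (@measurableT_comp _ _ _ _ _ _ cos) => //; apply: measurable_funD => //; exact: measurable_funM.
have LN : L1 (@normal_prob R 0 1) (fun z : measurableTypeR R => cos (x + b e * z)).
  by apply: (@L1_bounded _ _ _ _ _ 1) => // w; exact: cos_max.
rewrite (@law_E _ _ _ (measurableTypeR R) R Q (normal_prob 0 1) (Z e) (@mZ e) (@lawZ e) _ cosN LN).
rewrite normal_cos big_cons mulrC -mulrA -expRD; congr (_ * expR _).
by field.
Qed.

Context d (T : measurableType d) (P : probability T R).
Variables (s : seq I) (c : I -> R) (S : nat -> I -> T -> R).
Hypothesis us : uniq s.
Hypothesis c0 : forall e, 0 <= c e.
Hypothesis mS : forall n e, measurable_fun setT (S n e).
(** Only directions supported where [c] is nonzero are required: elsewhere [S n e] may be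
    identically 0, in which case the unit variance on the right would be wrong. *)
Hypothesis S_clt : forall u : I -> R, (forall e, c e = 0 -> u e = 0) ->
  E P (fun w => cos (\sum_(e <- s) u e * S n e w)) @[n --> \oo] -->
  expR (- ((\sum_(e <- s) u e ^+ 2) / 2)).

(* Averaging cos over an independent Gaussian vector linearizes the quadratic
   form: exp(-t s^2) = E cos(sqrt(2t) s Z). *)
Lemma quadratic_laplace (t : R) : 0 <= t ->
  E P (fun w => expR (- (t * \sum_(e <- s) c e * S n e w ^+ 2))) @[n --> \oo] -->
  E Q (fun w => expR (- (t * \sum_(e <- s) c e * Z e w ^+ 2))).
Proof.
move=> t0.
have mcos : measurable_fun setT (@cos R) by apply: continuous_measurable_fun; exact: continuous_cos.
(* Chosen so that (a s)^2/2 = t c s^2. *)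
pose a e := Num.sqrt (2 * t * c e).
have a2 e : a e ^+ 2 = 2 * t * c e by rewrite sqr_sqrtr// !mulr_ge0.
pose F n (x : T * T') := cos (\sum_(e <- s) a e * S n e x.1 * Z e x.2).
have mF n : measurable_fun setT (F n).
  apply: measurableT_comp => //; apply: measurable_sum => e; apply: measurable_funM; last exact: measurableT_comp.
  by apply: measurable_funM => //; exact: measurableT_comp.
have F1 n x : `|F n x| <= 1 by exact: cos_max.
have sumE (f : I -> R) : (\sum_(e <- s) (a e * f e) ^+ 2) / 2 = t * \sum_(e <- s) c e * f e ^+ 2.
  rewrite mulr_suml mulr_sumr; apply: eq_bigr => e _.
  by rewrite exprMn a2; field.
have -> : (fun n => E P (fun w => expR (- (t * \sum_(e <- s) c e * S n e w ^+ 2)))) =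
    (fun n => E Q (fun w' => E P (fun w => F n (w, w')))).
  apply/funext => n; have [<- _] := fubini_bounded P Q (mF n) (F1 n).
  apply: eq_E => w; rewrite -(sumE (fun e => S n e w)) /F/=.
  by have := @normal_cos_sum s (fun e => a e * S n e w) 0 us; rewrite cos0 mul1r => <-; apply: eq_E => w'; rewrite add0r.
(* For a frozen value of the Gaussian vector, [a e * Z e w'] is a deterministic direction to which
   [S_clt] applies; the bound 1 then allows integration over [w']. *)
apply: (@E_dominated _ _ _ _ _ _ (fun=> 1)).
- by move=> n; have [] := fubini_bounded P Q (mF n) (F1 n).
- move=> w'; rewrite -(sumE (fun e => Z e w')).
  apply: cvg_trans (@S_clt (fun e => a e * Z e w') _); last first.
    by move=> e ce; rewrite /a ce mulr0 sqrtr0 mul0r.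
  apply: near_eq_cvg; apply: nearW => n; apply: eq_E => w; rewrite /F/=; congr cos.
  by apply: eq_bigr => e _; rewrite mulrAC.
- exact: L1_cst.
- move=> n w'; have L : L1 P (fun w => F n (w, w')).
    apply: (@L1_bounded _ _ _ _ _ 1) => //.
    exact: measurableT_comp (mF n) (pair2_measurable w').
  apply: (le_trans (E_norm L)); rewrite -[leRHS](E_cst P); apply: E_le => //; first exact: L1_norm.
  exact: L1_cst.
Qed.

Lemma quadratic_cvg (F : R -> R) (K b : R) : 0 <= K -> 0 <= b ->
  (forall x y, `|F x - F y| <= K * `|x - y|) -> (forall x, b <= x -> F x = 0) ->
  E P (fun w => F (\sum_(e <- s) c e * S n e w ^+ 2)) @[n --> \oo] -->
  E Q (fun w => F (\sum_(e <- s) c e * Z e w ^+ 2)).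
Proof.
move=> K0 b0 FK Fb; apply: laplace_cvg FK Fb => //.
- by move=> n; apply: measurable_sum => e; apply: measurable_funM => //; exact: measurable_funX.
- by apply: measurable_sum => e; apply: measurable_funM => //; exact: measurable_funX.
- by move=> n w; apply: sumr_ge0 => e _; rewrite mulr_ge0 ?sqr_ge0.
- by move=> w; apply: sumr_ge0 => e _; rewrite mulr_ge0 ?sqr_ge0.
- by move=> j; exact: quadratic_laplace.
Qed.

End gaussian_randomization.

(** * Degenerate kernels *)

Lemma ae_law d (T : measurableType d) d' (S : measurableType d') (R : realType)
    (P : probability T R) (mu : {measure set S -> \bar R}) (X : T -> S) (G : S -> Prop) :
  measurable_fun setT X -> (forall A, measurable A -> P (X @^-1` A) = mu A) ->
  {ae mu, forall x, G x} -> {ae P, forall w, G (X w)}.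
Proof.
move=> mX lawX [N [mN N0 GN]]; exists (X @^-1` N); split.
- by rewrite -[X in measurable X]setTI; exact: mX.
- by rewrite lawX.
- by move=> w /= nG; apply: GN.
Qed.

Section sample.
Context d (T : measurableType d) (R : realType) (P : probability T R)
  (W : bool * nat -> T -> R) (mu : bool -> probability (measurableTypeR R) R).
Hypothesis mW : forall a, measurable_fun setT (W a).
Hypothesis indW : independent_family P W.
Hypothesis lawW : forall a (A : set (measurableTypeR R)), measurable A -> P (W a @^-1` A) = mu a.1 A.

Let mW2 a a' : measurable_fun setT (fun w => (W a w, W a' w)).
Proof. exact: measurable_fun_pair. Qed.

Lemma law2 a a' (A : set (measurableTypeR R * measurableTypeR R)) : a != a' -> measurable A ->
  P ((fun w => (W a w, W a' w)) @^-1` A) = (mu a.1 \x mu a'.1)%E A.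
Proof.
move=> aa' mA.
pose WW : T -> (measurableTypeR R * measurableTypeR R)%type := fun w => (W a w, W a' w).
have mp : measurable_fun setT WW by exact: mW2.
pose n1 : {measure set _ -> \bar R} := pushforward P WW.
have := @product_measure_unique _ _ _ _ R (mu a.1) (mu a'.1).
move=> /(_ (n1 mp)) H; apply/esym; apply: (H _ A mA) => B C mB mC.
rewrite /n1 /= /pushforward.
have JJ' : [set a] `&` [set a'] = set0.
  by apply/seteqP; split => // y [/= ->] /eqP; rewrite (negbTE aa').
rewrite -(@lawW a B mB) -(@lawW a' C mC).
apply: (@sub_indep _ _ _ _ R P _ W (@mW) (@indW) [set a] [set a'] _ _ JJ').
- by rewrite -[X in measurable X]setTI; apply: (@sub_var _ _ _ _ _ W [set a] a).
- by rewrite -[X in measurable X]setTI; apply: (@sub_var _ _ _ _ _ W [set a'] a').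
Qed.

(** The law of two distinct entries depends only on their sides. Equal sides serve the Gram
    matrices, opposite sides the rows (X_i, Y_i). *)
Lemma E_pair a a' c c' (F : R * R -> R) : measurable_fun setT F ->
  a != a' -> c != c' -> a.1 = c.1 -> a'.1 = c'.1 -> L1 P (fun w => F (W c w, W c' w)) ->
  L1 P (fun w => F (W a w, W a' w)) /\ E P (fun w => F (W a w, W a' w)) = E P (fun w => F (W c w, W c' w)).
Proof.
move=> mF aa' cc' ac ac' LF.
have m1 : measurable_fun setT ((fun w => (W a w, W a' w)) : T -> measurableTypeR R * measurableTypeR R) by exact: mW2.
have m2 : measurable_fun setT ((fun w => (W c w, W c' w)) : T -> measurableTypeR R * measurableTypeR R) by exact: mW2.
have mF' : measurable_fun setT (F : measurableTypeR R * measurableTypeR R -> R) by exact: mF.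
have lc := fun A mA => @law2 c c' A cc' mA.
have la : forall A, measurable A -> P ((fun w => (W a w, W a' w)) @^-1` A) = (mu c.1 \x mu c'.1)%E A.
  by move=> A mA; rewrite -ac -ac'; exact: law2.
have Lm := L1_law m2 lc mF' LF.
by rewrite (law_E m1 la mF' Lm) (law_E m2 lc mF' Lm); split => //; exact: (law_L1 m1 la mF' Lm).
Qed.

Lemma W_L1 a (f : R -> R) : measurable_fun setT f -> L1 (mu a.1) f -> L1 P (fun w => f (W a w)).
Proof. by move=> mf Lf; exact: (@law_L1 _ T _ (measurableTypeR R) R P (mu a.1) (W a) (mW a) (@lawW a) f mf Lf). Qed.

Lemma W_L2 a (f : R -> R) : L2 (mu a.1) f -> L2 P (fun w => f (W a w)).
Proof. by move=> Lf; exact: (@law_L2 _ T _ (measurableTypeR R) R P (mu a.1) (W a) (mW a) (@lawW a) f Lf). Qed.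

Lemma W_E a (f : R -> R) : measurable_fun setT f -> L1 (mu a.1) f ->
  E P (fun w => f (W a w)) = E (mu a.1) f.
Proof. by move=> mf Lf; exact: (@law_E _ T _ (measurableTypeR R) R P (mu a.1) (W a) (mW a) (@lawW a) f mf Lf). Qed.

Lemma W_ae a (G : R -> Prop) : {ae mu a.1, forall z : R, G z} -> {ae P, forall w, G (W a w)}.
Proof. exact: (@ae_law _ T _ (measurableTypeR R) R P (mu a.1) (W a) G (mW a) (@lawW a)). Qed.

Definition side b : set (bool * nat) := [set a | a.1 = b].

Lemma side_disjoint : side false `&` side true = set0.
Proof. by apply/seteqP; split => // -[b i] []; rewrite /side /= => ->. Qed.

(** The centring clause holds only almost everywhere because it is derived from an eigenvalue
    equation that does. *)
Definition degenerate b (k : R -> R -> R) : Prop :=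
  [/\ measurable_fun setT (fun x : R * R => k x.1 x.2), forall x y, k x y = k y x,
   L2 P (fun w => k (W (b, 0%N) w) (W (b, 1%N) w)) &
   {ae mu b, forall z : R, L1 (mu b) (k z) /\ E (mu b) (k z) = 0}].

Definition gram b (k : R -> R -> R) (i j : nat) (w : T) := k (W (b, i) w) (W (b, j) w).

(** The squared Hilbert-Schmidt norm of the kernel, computed from two sample points. *)
Definition knorm b (k : R -> R -> R) := E P (fun w => gram b k 0 1 w ^+ 2).

Section degenerate.
Variables (b : bool) (k : R -> R -> R).
Hypothesis kP : degenerate b k.

Lemma gram_measurable i j (J : set (bool * nat)) : J (b, i) -> J (b, j) -> J_measurable W J (gram b k i j).
Proof.
case: kP => mk _ _ _ Ji Jj.
have mp : J_measurable W J (fun w => (W (b, i) w, W (b, j) w)).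
  by apply: measurable_fun_pair; exact: (@sub_var _ _ _ _ _ W J).
exact: (measurableT_comp mk mp).
Qed.

Lemma gram_measT i j : measurable_fun setT (gram b k i j).
Proof.
exact: (@sub_measurable_fun _ _ _ _ _ W (@mW) _ _ setT _ (@gram_measurable i j setT I I)).
Qed.

Lemma gram_sqr i j : i != j ->
  L1 P (fun w => gram b k i j w ^+ 2) /\ E P (fun w => gram b k i j w ^+ 2) = knorm b k.
Proof.
move=> ij; case: kP => mk _ [_ Lk] _.
apply: (@E_pair (b, i) (b, j) (b, 0%N) (b, 1%N) (fun x => k x.1 x.2 ^+ 2)) => //.
- exact: measurable_funX.
- by rewrite xpair_eqE eqxx.
- by rewrite xpair_eqE eqxx.
Qed.

Lemma gram_L2 i j : i != j -> L2 P (gram b k i j).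
Proof. by move=> ij; split; [exact: gram_measT|exact: (gram_sqr ij).1]. Qed.

Lemma gramC i j : gram b k i j = gram b k j i.
Proof. by case: kP => _ ks _ _; apply/funext => w; rewrite /gram ks. Qed.

(** The entry [(b, j)] is independent of everything indexed by [J]; integrating it out first gives
    0. *)
Lemma degenerate_orth (J : set (bool * nat)) (V : T -> R) i j : J (b, i) -> ~ J (b, j) ->
  J_measurable W J V -> L1 P (fun w => V w * gram b k i j w) -> E P (fun w => V w * gram b k i j w) = 0.
Proof.
case: kP => mk _ _ kae Ji Jj mV LVk.
have JJ' : J `&` [set (b, j)] = set0 by apply/seteqP; split => // y [/= Jy yb]; apply: Jj; rewrite -yb.
have mVW : J_measurable W J (fun w => (V w, W (b, i) w)).
  by apply: measurable_fun_pair => //; exact: (@sub_var _ _ _ _ _ W J).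
have mF : measurable_fun setT (fun x : (R * R) * R => x.1.1 * k x.1.2 x.2).
  apply: measurable_funM; first exact: measurableT_comp.
  have mp : measurable_fun setT (fun x : (R * R) * R => (x.1.2, x.2)).
    by apply: measurable_fun_pair => //; exact: measurableT_comp.
  exact: (measurableT_comp mk mp).
have [i2 eq2] := @decoupling _ _ _ _ R P _ W (@mW) (@indW) _ _ _ _ J [set (b, j)]
  (fun w => (V w, W (b, i) w)) (W (b, j)) JJ' mVW (@sub_var _ _ _ _ _ W [set (b, j)] (b, j) erefl) _ mF LVk.
rewrite /E /Rintegral [X in fine X]eq2 /=.
rewrite (_ : (\int[P]_w1 _)%E = (\int[P]_w1 0)%E); first by rewrite integral0.
apply: ae_eq_integral => //.
  exact: (measurable_fubini_F i2).
have kae' : {ae P, forall w, L1 (mu b) (k (W (b, i) w)) /\ E (mu b) (k (W (b, i) w)) = 0}.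
  exact: (@W_ae (b, i) (fun z => L1 (mu b) (k z) /\ E (mu b) (k z) = 0)).
apply: filterS kae' => w1 [Lk Ek] _.
have mk1 : measurable_fun setT (k (W (b, i) w1)).
  exact: (measurableT_comp mk (pair1_measurable (W (b, i) w1))).
under eq_integral do rewrite EFinM.
rewrite integralZl//; last exact: (@W_L1 (b, j) _ mk1 Lk).
rewrite (EE (@W_L1 (b, j) _ mk1 Lk)).
by rewrite (@W_E (b, j) _ mk1 Lk) Ek mule0.
Qed.

Lemma gram_mul_L1 i j p q : i != j -> p != q -> L1 P (fun w => gram b k i j w * gram b k p q w).
Proof. by move=> ij pq; apply: L2_mul; exact: gram_L2. Qed.

(** An index that occurs only once is integrated out by [degenerate_orth], so the covariance
    vanishes unless the two unordered pairs coincide. *)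
Lemma gram_cov i j p q : i != j -> p != q ->
  E P (fun w => gram b k i j w * gram b k p q w) =
  knorm b k * ((i == p) && (j == q) || (i == q) && (j == p))%:R.
Proof.
move=> ij pq.
have orth : forall i j p q, i != j -> p != q -> q != i -> q != j ->
    E P (fun w => gram b k i j w * gram b k p q w) = 0.
  move=> {ij pq}i {}j {}p {}q ij pq qi qj.
  apply: (@degenerate_orth [set a | a != (b, q)]) => /=.
  - by rewrite xpair_eqE eqxx.
  - by move/negP; rewrite eqxx.
  - by apply: gram_measurable; rewrite /= xpair_eqE eqxx eq_sym.
  - exact: gram_mul_L1.
have [qij|] := boolP ((q == i) || (q == j)); last first.
  rewrite negb_or => /andP[qi qj]; rewrite orth//.
  by rewrite (eq_sym j q) (negbTE qj) (eq_sym i q) (negbTE qi) andbF mulr0.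
have [pij|] := boolP ((p == i) || (p == j)); last first.
  rewrite negb_or => /andP[pi pj]; rewrite (gramC p q) (orth i j q p)//; last by rewrite eq_sym.
  by rewrite (eq_sym i p) (negbTE pi) (eq_sym j p) (negbTE pj) andbF mulr0.
have sq := (gram_sqr ij).2.
case/orP: pij => /eqP ?; case/orP: qij => /eqP ?; subst p q.
- by rewrite eqxx in pq.
- by rewrite !eqxx mulr1.
- by rewrite !eqxx orbT mulr1 (gramC j i).
- by rewrite eqxx in pq.
Qed.

End degenerate.

Lemma knorm_ge0 b k : 0 <= knorm b k.
Proof. by apply: E_ge0 => w; exact: sqr_ge0. Qed.

Definition off (A : nat -> nat -> T -> R) n i w := \sum_(j < n | (j : nat) != i) A i j w.

Lemma sum_pick n (x : nat) : (x < n)%N -> \sum_(q < n) (x == q)%:R = 1 :> R.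
Proof.
move=> xn; rewrite (bigD1 (Ordinal xn))//= eqxx big1 ?addr0// => q.
by rewrite -val_eqE eq_sym => /negbTE ->.
Qed.

(** * Moments of off-diagonal row sums on one side *)

Section moments.
Variables (b : bool) (k : R -> R -> R).
Hypothesis kP : degenerate b k.
Let A := gram b k.
Let N := knorm b k.

Let LA i j : j != i -> L2 P (A i j).
Proof. by rewrite eq_sym; exact: gram_L2. Qed.

Lemma off_L2 n i : L2 P (off A n i).
Proof. by apply: L2_sum => j; exact: LA. Qed.

Lemma off_measurable n i : J_measurable W (side b) (off A n i).
Proof. by rewrite /J_measurable /off; apply: measurable_sum_seq => j _ _; exact: gram_measurable. Qed.

(** For i = p the n - 1 terms with j = q survive; for distinct rows only j = p, q = i does. The
    lower bound lets such covariances from the two sides be multiplied. *)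
Lemma off_cov n (i p : nat) : (i < n)%N -> (p < n)%N ->
  0 <= E P (fun w => off A n i w * off A n p w) <= N * ((i == p)%:R * n%:R + 1).
Proof.
move=> i_n p_n.
have -> : E P (fun w => off A n i w * off A n p w) =
   \sum_(j < n | (j : nat) != i) \sum_(q < n | (q : nat) != p)
     N * ((i == p) && ((j : nat) == q) || (i == q) && ((j : nat) == p))%:R.
  under eq_E do rewrite /off mulr_suml.
  rewrite E_sum => [|j ji]; last first.
    by apply: L2_mul; [exact: LA|exact: off_L2].
  apply: eq_bigr => j ji; under eq_E do rewrite mulr_sumr.
  rewrite E_sum => [|q qp]; last by apply: L2_mul; exact: LA.
  by apply: eq_bigr => q qp; rewrite /A gram_cov// eq_sym.
have N0 : 0 <= N by exact: knorm_ge0.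
apply/andP; split; first by do 2!apply: sumr_ge0 => ? _; exact: mulr_ge0.
under eq_bigr do rewrite -mulr_sumr.
rewrite -mulr_sumr; apply: ler_wpM2l => //.
apply: (@le_trans _ _ (\sum_(j < n) \sum_(q < n) ((i == p)%:R * (j == q)%:R + (i == q)%:R * ((j : nat) == p)%:R))).
  rewrite [leRHS](bigID (fun j : 'I_n => (j : nat) != i)) /= ler_wpDr//.
    by do 2!apply: sumr_ge0 => ? _; rewrite addr_ge0// mulr_ge0.
  apply: ler_sum => j ji.
  rewrite [leRHS](bigID (fun j : 'I_n => (j : nat) != p)) /= ler_wpDr//.
    by apply: sumr_ge0 => ? _; rewrite addr_ge0// mulr_ge0.
  apply: ler_sum => q qp; rewrite -!natrM -natrD ler_nat -val_eqE /=.
  by case: (i == p); case: (_ == _ :> nat); case: (_ == _ :> nat); case: (_ == _ :> nat).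
under eq_bigr do rewrite big_split /= -mulr_sumr.
rewrite big_split /=; apply: lerD.
  rewrite -mulr_sumr; apply: ler_wpM2l => //.
  under eq_bigr => j _.
    rewrite (bigD1 j)//= eqxx big1; last by move=> q; rewrite eq_sym => /negbTE ->.
    rewrite addr0; over.
  by rewrite sumr_const card_ord.
under eq_bigr do rewrite -mulr_suml sum_pick// mul1r eq_sym.
by rewrite sum_pick.
Qed.

Lemma off_sum_sqr n : E P (fun w => \sum_(i < n) off A n i w ^+ 2) <= N * (n%:R * (n%:R + 1)).
Proof.
rewrite E_sum => [|i _]; last by apply: L2_sqr; exact: off_L2.
apply: (@le_trans _ _ (\sum_(i < n) N * (n%:R + 1))).
  apply: ler_sum => i _; have /andP[_] := off_cov (ltn_ord i) (ltn_ord i).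
  by rewrite eqxx mul1r.
by rewrite sumr_const card_ord -mulr_natl; have N0 : 0 <= N := knorm_ge0 b k; nra.
Qed.

Lemma off_tot_sqr n : E P (fun w => (\sum_(i < n) off A n i w) ^+ 2) <= N * (2 * n%:R ^+ 2).
Proof.
under eq_E do rewrite expr2 mulr_suml.
rewrite E_sum => [|i _]; last first.
  by apply: L2_mul; [exact: off_L2|apply: L2_sum => p _; exact: off_L2].
have N0 : 0 <= N by exact: knorm_ge0.
apply: (@le_trans _ _ (\sum_(i < n) \sum_(p < n) N * ((i == p)%:R * n%:R + 1))).
  apply: ler_sum => i _; under eq_E do rewrite mulr_sumr.
  rewrite E_sum => [|p _]; last by apply: L2_mul; exact: off_L2.
  apply: ler_sum => p _; have /andP[_] := off_cov (ltn_ord i) (ltn_ord p).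
  by rewrite val_eqE.
under eq_bigr do rewrite -mulr_sumr; rewrite -mulr_sumr; apply: ler_wpM2l => //.
under eq_bigr => i _.
  rewrite big_split /= (bigD1 i)//= eqxx big1; last by move=> q; rewrite eq_sym => /negbTE ->; rewrite mul0r.
  rewrite mul1r addr0 sumr_const card_ord; over.
by rewrite sumr_const card_ord -mulr_natl le_eqVlt; apply/orP; left; apply/eqP; ring.
Qed.

End moments.

(** * Moments of products over the two sides *)

Section two_sided.
Variables (k1 k2 : R -> R -> R).
Hypotheses (k1P : degenerate false k1) (k2P : degenerate true k2).
Let A := gram false k1.
Let B := gram true k2.
Let N1 := knorm false k1.
Let N2 := knorm true k2.

Lemma sides_mul (U V : T -> R) : J_measurable W (side false) U -> J_measurable W (side true) V ->
  L1 P U -> L1 P V -> L1 P (fun w => U w * V w) /\ E P (fun w => U w * V w) = E P U * E P V.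
Proof. by move=> mU mV LU LV; exact: (@indep_mul _ _ _ _ R P _ W (@mW) (@indW) _ _ U V side_disjoint mU mV LU LV). Qed.

Lemma sides_L2 (U V : T -> R) : J_measurable W (side false) U -> J_measurable W (side true) V ->
  L2 P U -> L2 P V -> L2 P (fun w => U w * V w).
Proof.
move=> mU mV LU LV; split.
  by apply: measurable_funM; [exact: L2_meas LU|exact: L2_meas LV].
have [] := @sides_mul (fun w => U w ^+ 2) (fun w => V w ^+ 2).
- exact: measurable_funX.
- exact: measurable_funX.
- exact: L2_sqr.
- exact: L2_sqr.
by move=> H _; apply: eq_L1 H => w; rewrite exprMn.
Qed.

Let mA i j : J_measurable W (side false) (A i j).
Proof. exact: gram_measurable. Qed.
Let mB i j : J_measurable W (side true) (B i j).
Proof. exact: gram_measurable. Qed.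

Lemma gram_prod_L2 i j : i != j -> L2 P (fun w => A i j w * B i j w).
Proof. by move=> ij; apply: sides_L2 => //; exact: gram_L2. Qed.

Lemma off_prod_L2 n i : L2 P (fun w => off A n i w * off B n i w).
Proof. by apply: sides_L2; [exact: off_measurable|exact: off_measurable|exact: off_L2|exact: off_L2]. Qed.

(** Expectations factor over the sides, so an ordered pair of indices correlates only with itself
    and with its reversal; this is the factor 2. *)
Lemma ustat_sqr n :
  E P (fun w => (\sum_(i < n) \sum_(j < n | (j : nat) != i) A i j w * B i j w) ^+ 2) <= N1 * N2 * (2 * n%:R ^+ 2).
Proof.
have NN0 : 0 <= N1 * N2 by apply: mulr_ge0; exact: knorm_ge0.
have LAB i j : j != i -> L2 P (fun w => A i j w * B i j w) by rewrite eq_sym; exact: gram_prod_L2.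
have LI n' (i : nat) : L2 P (fun w => \sum_(j < n' | (j : nat) != i) A i j w * B i j w).
  by apply: L2_sum => j; exact: LAB.
under eq_E do rewrite expr2 mulr_suml.
rewrite E_sum => [|i _]; last by apply: L2_mul => //; apply: L2_sum.
apply: (@le_trans _ _ (\sum_(i < n) \sum_(j < n) (N1 * N2 * 2))); last first.
  by rewrite !sumr_const !card_ord -mulrnA -[_ *+ (n * n)]mulr_natl natrM le_eqVlt; apply/orP; left; apply/eqP; ring.
apply: ler_sum => i _.
under eq_E do rewrite mulr_suml.
rewrite E_sum => [|j ji]; last by apply: L2_mul; [exact: LAB|apply: L2_sum].
rewrite [leRHS](bigID (fun j : 'I_n => (j : nat) != i)) /= ler_wpDr//.
  by apply: sumr_ge0 => ? _; exact: mulr_ge0.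
apply: ler_sum => j ji; under eq_E do rewrite mulr_sumr.
rewrite E_sum => [|p _]; last by apply: L2_mul; [exact: LAB|exact: LI].
apply: (@le_trans _ _ (\sum_(p < n) \sum_(q < n) N1 * N2 * ((i == p)%:R * (j == q)%:R + (i == q)%:R * (j == p)%:R))).
  apply: ler_sum => p _; under eq_E do rewrite mulr_sumr.
  rewrite E_sum => [|q qp]; last by apply: L2_mul; exact: LAB.
  rewrite [leRHS](bigID (fun q : 'I_n => (q : nat) != p)) /= ler_wpDr//.
    by apply: sumr_ge0 => ? _; rewrite mulr_ge0// addr_ge0// mulr_ge0.
  apply: ler_sum => q qp.
  have ij' : (i : nat) != j by rewrite eq_sym. have pq' : (p : nat) != q by rewrite eq_sym.
  have -> : E P (fun w => A i j w * B i j w * (A p q w * B p q w)) =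
    N1 * N2 * ((i == p) && (j == q) || (i == q) && (j == p))%:R.
    rewrite (@eq_E _ _ _ _ _ (fun w => (A i j w * A p q w) * (B i j w * B p q w))); last by move=> w; ring.
    have [_ ->] := @sides_mul (fun w => A i j w * A p q w) (fun w => B i j w * B p q w)
      (measurable_funM (mA i j) (mA p q)) (measurable_funM (mB i j) (mB p q))
      (gram_mul_L1 k1P ij' pq') (gram_mul_L1 k2P ij' pq').
    rewrite /A /B !gram_cov// !val_eqE mulrACA -natrM mulnb andbb//.
  apply: ler_wpM2l => //; rewrite -!natrM -natrD ler_nat.
  by case: (i == p); case: (j == q); case: (i == q); case: (j == p).
under eq_bigr do rewrite -mulr_sumr; rewrite -mulr_sumr; apply: ler_wpM2l => //.
under eq_bigr do rewrite big_split /= -mulr_sumr -mulr_suml.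
have sum1 (x : 'I_n) : \sum_(y < n) (x == y)%:R = 1 :> R.
  by rewrite (bigD1 x)//= eqxx big1 ?addr0// => y; rewrite eq_sym => /negbTE ->.
under eq_bigr do rewrite !sum1 mulr1 mul1r.
by rewrite big_split /= !sum1.
Qed.

(** Row sums have size n^(1/2) and their products size n; the n products are nearly uncorrelated,
    whence n^3. Division by n^4 still makes this vanish. *)
Lemma off_prod_sqr n :
  E P (fun w => (\sum_(i < n) off A n i w * off B n i w) ^+ 2) <= N1 * N2 * (2 * n%:R ^+ 3 + 2 * n%:R ^+ 2).
Proof.
have NN0 : 0 <= N1 * N2 by apply: mulr_ge0; exact: knorm_ge0.
under eq_E do rewrite expr2 mulr_suml.
rewrite E_sum => [|i _]; last by apply: L2_mul; [exact: off_prod_L2|apply: L2_sum => p _; exact: off_prod_L2].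
apply: (@le_trans _ _ (\sum_(i < n) \sum_(p < n) N1 * N2 * ((i == p)%:R * (2 * n%:R ^+ 2) + 2))).
  apply: ler_sum => i _; under eq_E do rewrite mulr_sumr.
  rewrite E_sum => [|p _]; last by apply: L2_mul; exact: off_prod_L2.
  apply: ler_sum => p _.
  rewrite (@eq_E _ _ _ _ _ (fun w => (off A n i w * off A n p w) * (off B n i w * off B n p w))); last by move=> w; ring.
  have m1 i := off_measurable k1P n i; have m2 i := off_measurable k2P n i.
  have L1' i := off_L2 k1P n i; have L2' i := off_L2 k2P n i.
  have [_ ->] := @sides_mul (fun w => off A n i w * off A n p w) (fun w => off B n i w * off B n p w)
      (measurable_funM (m1 i) (m1 p)) (measurable_funM (m2 i) (m2 p))
      (L2_mul (L1' i) (L1' p)) (L2_mul (L2' i) (L2' p)).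
  have /andP[a0 a1] := off_cov k1P (ltn_ord i) (ltn_ord p).
  have /andP[b0 b1] := off_cov k2P (ltn_ord i) (ltn_ord p).
  apply: (le_trans (ler_pM a0 b0 a1 b1)); rewrite mulrACA; apply: ler_wpM2l => //.
  rewrite val_eqE; case: (i == p); rewrite ?mul1r ?mul0r; last by lra.
  by have := sqr_ge0 (n%:R - 1 : R); nra.
under eq_bigr do rewrite -mulr_sumr; rewrite -mulr_sumr; apply: ler_wpM2l => //.
under eq_bigr => i _.
  rewrite big_split /= (bigD1 i)//= eqxx big1; last by move=> q; rewrite eq_sym => /negbTE ->; rewrite mul0r.
  rewrite mul1r addr0 sumr_const card_ord -mulr_natr; over.
by rewrite /= sumr_const card_ord -[_ *+ n]mulr_natr le_eqVlt; apply/orP; left; apply/eqP; ring.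
Qed.

End two_sided.

End sample.

(** * The kernel and its spectral truncations *)

Lemma lipschitz_measurable (R : realType) (F : R -> R) (K : R) :
  (forall x y, `|F x - F y| <= K * `|x - y|) -> measurable_fun setT F.
Proof.
move=> FK; have K0 : 0 <= K.
  by have := FK 1 0; rewrite subr0 normr1 mulr1; apply: le_trans.
apply: continuous_measurable_fun => x; apply/cvgrPdist_le => /= e e0.
near=> y; apply: (le_trans (FK _ _)).
apply: (@le_trans _ _ ((K + 1) * `|x - y|)); first by apply: ler_wpM2r => //; lra.
rewrite -ler_pdivlMl; last lra.
near: y; exists ((K + 1)^-1 * e) => /=; last by move=> z; exact: ltW.
by rewrite mulr_gt0 ?invr_gt0//; lra.
Unshelve. all: by end_near. Qed.

Lemma ae_exists d (T : measurableType d) (R : realType) (P : probability T R) (G : T -> Prop) :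
  {ae P, forall x, G x} -> exists x, G x.
Proof.
move=> [N [mN N0 GN]]; apply: contrapT => nG.
have : P setT = 0.
  apply/eqP; rewrite -measure_le0 -N0; apply: le_measure; rewrite ?inE//.
  by move=> x _; apply: GN => /= Gx; apply: nG; exists x.
by have := probability_setT P => /= -> [] /eqP; rewrite oner_eq0.
Qed.

Lemma ae_mono d (T : measurableType d) (R : realType) (P : probability T R) (G H : T -> Prop) :
  (forall x, G x -> H x) -> {ae P, forall x, G x} -> {ae P, forall x, H x}.
Proof.
move=> GH [N [mN N0 GN]]; exists N; split=> // x nH; apply: GN => Gx.
by apply: nH; exact: GH.
Qed.

Lemma ae_mono2 d (T : measurableType d) (R : realType) (P : probability T R) (G H I : T -> Prop) :
  (forall x, G x -> H x -> I x) -> {ae P, forall x, G x} -> {ae P, forall x, H x} ->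
  {ae P, forall x, I x}.
Proof.
move=> GHI [N [mN N0 GN]] [N' [mN' N0' HN']]; exists (N `|` N'); split=> //.
- exact: measurableU.
- exact: null_set_setU.
- move=> x nI; apply: contrapT => /not_orP[nN nN']; apply: nI; apply: GHI.
    by apply: contrapT => nG; exact/nN/GN.
  by apply: contrapT => nG; exact/nN'/HN'.
Qed.

Lemma L1_ae d (T : measurableType d) (R : realType) (P : probability T R) (f h : T -> R) :
  measurable_fun setT f -> L1 P h -> {ae P, forall x, f x = h x} -> L1 P f.
Proof.
move=> mf Lh fh; have mh := L1_meas Lh; apply/integrableP; split; first exact/measurable_EFinP.
have -> : (\int[P]_x `|(EFin \o f) x| = \int[P]_x (`|h x|)%:E)%E; last by rewrite (EE (L1_norm Lh)) ltry.
apply: ae_eq_integral => //.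
- by apply/measurable_EFinP; exact: measurableT_comp.
- by apply/measurable_EFinP; exact: measurableT_comp.
- by apply: ae_mono _ fh => x /= -> _.
Qed.

Lemma cvg_bigsum (R : realType) (I : Type) (s : seq I) (u : I -> nat -> R) (l : I -> R) :
  (forall i, u i n @[n --> \oo] --> l i) -> \sum_(i <- s) u i n @[n --> \oo] --> \sum_(i <- s) l i.
Proof.
move=> ul; elim: s => [|i s IH].
  by rewrite big_nil; under eq_cvg do rewrite big_nil; exact: cvg_cst.
by rewrite big_cons; under eq_cvg do rewrite big_cons; exact: cvgD.
Qed.

Section sample.
Context d (T : measurableType d) (R : realType) (P : probability T R)
  (W : bool * nat -> T -> R) (mu : bool -> probability (measurableTypeR R) R).
Hypothesis mW : forall a, measurable_fun setT (W a).
Hypothesis indW : independent_family P W.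
Hypothesis lawW : forall a (A : set (measurableTypeR R)), measurable A -> P (W a @^-1` A) = mu a.1 A.
Variable b : bool.
Let X := W (b, 0%N).
Let Y := W (b, 1%N).
Let m := mu b.

Let XY : T -> (measurableTypeR R * measurableTypeR R)%type := fun w => (X w, Y w).
Let mXY : measurable_fun setT XY.
Proof. exact: measurable_fun_pair (mW _) (mW _). Qed.

Let lawXY A : measurable A -> P (XY @^-1` A) = (m \x m)%E A.
Proof.
move=> mA; apply: (@law2 _ _ _ _ _ mu (@mW) (@indW) (@lawW) (b, 0%N) (b, 1%N) A _ mA).
by rewrite xpair_eqE eqxx.
Qed.

(** The single distances |X| need not be integrable. The function D(x, z) = |x - z| - |z| is bounded
    in z, so a(x) = E D(x, Z)/2 always exists, and existence of the kernel amounts to integrability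
    of M = |X| + |Y| - |X - Y|, which gives c = E M/2. Nonnegativity on the diagonal is the triangle
    inequality. *)
Lemma kernel_formula : kernel_exists m -> exists (a : R -> R) (c : R),
  [/\ forall x y, `|a x - a y| <= 2^-1 * `|x - y|,
   forall x y, kernel m x y = - 2^-1 * `|x - y| + a x + a y + c &
   forall x, 0 <= kernel m x x].
Proof.
move=> [z1 [z2 iz]].
have mF x y : measurable_fun setT (kernel_integrand x y : measurableTypeR R * measurableTypeR R -> R).
  rewrite /kernel_integrand; apply: measurable_funD; last first.
    by apply: measurableT_comp => //; apply: measurable_funB.
  apply: measurable_funB; last by apply: measurableT_comp => //; apply: measurable_funB.
  by apply: measurable_funB => //; apply: measurableT_comp => //; apply: measurable_funB.
pose D (x z : R) : R := `|x - z| - `|z|.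
have mD x : measurable_fun setT (D x).
  apply: (@lipschitz_measurable _ _ 2) => y z; rewrite /D.
  have := ler_dist_dist (x - y) (x - z); have := ler_dist_dist y z.
  rewrite (_ : x - y - (x - z) = z - y); last by ring.
  by rewrite (distrC z y) => h1 h2; move: (ler_normB (`|x - y| - `|x - z|) (`|y| - `|z|)); rewrite (_ : `|x - y| - `|x - z| - (`|y| - `|z|) = `|x - y| - `|y| - (`|x - z| - `|z|)); lra.
have DLip x y z : `|D x z - D y z| <= `|x - y|.
  rewrite /D (_ : `|x - z| - `|z| - (`|y - z| - `|z|) = `|x - z| - `|y - z|); last by ring.
  by apply: (le_trans (ler_dist_dist _ _)); rewrite (_ : x - z - (y - z) = x - y)//; ring.
have D0 x z : `|D x z| <= `|x|.
  by have := DLip x 0 z; rewrite /D sub0r normrN subrr !subr0.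
have LDm x : L1 m (D x : measurableTypeR R -> R) by apply: (@L1_bounded _ _ _ _ _ `|x|); [exact: mD|exact: D0].
have LD i x : L1 P (fun w => D x (W (b, i) w)) by exact: (W_L1 (@mW) (@lawW) (a := (b, i)) (mD x) (LDm x)).
have ED' i x : E P (fun w => D x (W (b, i) w)) = E m (D x) by exact: (W_E (@mW) (@lawW) (a := (b, i)) (mD x) (LDm x)).
pose M w := `|X w| + `|Y w| - `|X w - Y w|.
have FE x y w : kernel_integrand x y (XY w) = `|x - y| - D x (Y w) - D y (X w) - M w.
  by rewrite /kernel_integrand /D /M /XY /= (distrC (X w) y); ring.
have LM : L1 P M.
  have Lz : L1 P (fun w => kernel_integrand z1 z2 (XY w)) by exact: (law_L1 mXY lawXY (mF z1 z2) iz).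
  apply: (@eq_L1 _ _ _ _ (fun w => `|z1 - z2| - D z1 (Y w) - D z2 (X w) - kernel_integrand z1 z2 (XY w))).
    by move=> w; rewrite FE; ring.
  apply: L1B => //; apply: L1B; last exact: LD.
  by apply: L1B; [exact: L1_cst|exact: LD].
have LF x y : L1 P (fun w => kernel_integrand x y (XY w)).
  apply: (@eq_L1 _ _ _ _ (fun w => `|x - y| - D x (Y w) - D y (X w) - M w)); first by move=> w; rewrite FE.
  apply: L1B => //; apply: L1B; last exact: LD.
  by apply: L1B; [exact: L1_cst|exact: LD].
have kE x y : kernel m x y = - 2^-1 * E P (fun w => kernel_integrand x y (XY w)).
  by rewrite (law_E mXY lawXY (mF x y) (L1_law mXY lawXY (mF x y) (LF x y))).
exists (fun x => 2^-1 * E m (D x)), (2^-1 * E P M); split.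
- move=> x y; rewrite -mulrBr normrM ger0_norm//; apply: ler_wpM2l => //.
  rewrite -EB//; apply: (le_trans (E_norm _)); first exact: L1B.
  rewrite -[leRHS](E_cst m); apply: E_le; [exact/L1_norm/L1B|exact: L1_cst|exact: DLip].
- move=> x y; rewrite kE (eq_E _ (FE x y)) EB//; last first.
    by apply: L1B; [apply: L1B; [exact: L1_cst|exact: LD]|exact: LD].
  rewrite EB; [|by apply: L1B; [exact: L1_cst|exact: LD]|exact: LD].
  rewrite EB; [|exact: L1_cst|exact: LD].
  by rewrite E_cst !ED'; field.
- move=> x; rewrite kE mulNr -mulrN mulr_ge0// oppr_ge0 -oppr_ge0.
  rewrite -[- _]mulN1r -EZ//; apply: E_ge0 => w.
  rewrite /kernel_integrand /XY /= subrr normr0.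
  have := ler_distD x (X w) (Y w); lra.
Qed.

Section spectral.
Variables (K : set nat) (lambda : nat -> R) (g : nat -> R -> R).
Hypothesis k_ex : kernel_exists m.
Hypothesis k_L2 : kernel_square_integrable m.
Hypothesis k_spec : spectral_decomposition m K lambda g.
Let k := kernel m.

Lemma kernel_measurable : measurable_fun setT (fun x : R * R => k x.1 x.2).
Proof.
have [a [c [aL kE _]]] := kernel_formula k_ex.
have ma := lipschitz_measurable aL.
under eq_fun do rewrite /k kE.
apply: measurable_funD => //; apply: measurable_funD; last exact: measurableT_comp.
apply: measurable_funD; last exact: measurableT_comp.
apply: measurable_funM => //; apply: measurableT_comp => //.
exact: measurable_funB.
Qed.

Lemma kernelC x y : k x y = k y x.
Proof. by have [a [c [_ kE _]]] := kernel_formula k_ex; rewrite /k !kE distrC; ring. Qed.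

(** One half of the constant comes from |x - z|, the other from [a]. *)
Lemma kernel_lipschitz x y z : `|k x z - k y z| <= `|x - y|.
Proof.
have [a [c [aL kE _]]] := kernel_formula k_ex; rewrite /k !kE.
have -> : - 2^-1 * `|x - z| + a x + a z + c - (- 2^-1 * `|y - z| + a y + a z + c) =
   (a x - a y) - 2^-1 * (`|x - z| - `|y - z|) by ring.
apply: (le_trans (ler_normB _ _)); rewrite normrM ger0_norm//.
have := ler_dist_dist (x - z) (y - z); rewrite (_ : x - z - (y - z) = x - y); last by ring.
by have := aL x y; lra.
Qed.

Let mk2 : measurable_fun setT ((fun x => k x.1 x.2) : measurableTypeR R * measurableTypeR R -> R).
Proof. exact: kernel_measurable. Qed.

Let L1k2 : L1 (m \x m)%E (fun x : measurableTypeR R * measurableTypeR R => k x.1 x.2 ^+ 2).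
Proof. by apply: L1_ge0 => [|x|]; [exact: measurable_funX|exact: sqr_ge0|exact: k_L2]. Qed.

Lemma kernel_section_L2 : {ae m, forall z : R, L2 m (k z)}.
Proof.
apply: ae_mono _ (ae_integrable1 L1k2) => z iz; split => //.
exact: (measurableT_comp kernel_measurable (pair1_measurable z)).
Qed.

(** The normalization of the constant eigenfunction gives c^2 = 1. *)
Lemma eigfun0_cst : exists c : R,
  [/\ c != 0, measurable_fun setT (g 0%N) & {ae m, forall z, g 0%N z = c}].
Proof.
have [[K0 _] [_ [c gc]] _ eig _] := k_spec; have [_ [g0L g1 _]] := eig 0%N K0.
have mg : measurable_fun setT (g 0%N) by have [] := Lfun_L2 g0L.
exists c; split => //.
have c2 : c ^+ 2 = 1.
  rewrite -(E_cst m (c ^+ 2)); transitivity (E m (fun z => g 0%N z ^+ 2)); last by rewrite /E /Rintegral g1.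
  by apply: eq_E_ae; [exact: measurable_cst|exact: measurable_funX|apply: ae_mono _ gc => z ->].
by apply: contra_eq_neq c2 => ->; rewrite expr0n /= eq_sym oner_eq0.
Qed.

(** For the constant eigenfunction, with eigenvalue 0, the eigenvalue equation reads c E k(z, Z) =
    0. *)
Lemma spectral_mean_kernel : {ae m, forall z : R, L1 m (k z) /\ E m (k z) = 0}.
Proof.
have [[K0 _] [l0 _] _ eig _] := k_spec; have [_ [_ _ eq0]] := eig 0%N K0.
have [c [c0 mg gc]] := eigfun0_cst.
apply: ae_mono2 _ kernel_section_L2 eq0 => z Lz; rewrite l0 mul0r => Ez.
have L1z := L2_L1 Lz; split=> //.
have : E m (fun w => k z w * g 0%N w) = E m (fun w => c * k z w).
  apply: eq_E_ae.
  - by apply: measurable_funM => //; exact: L1_meas L1z.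
  - by apply: measurable_funM => //; exact: L1_meas L1z.
  - by apply: ae_mono _ gc => w ->; rewrite mulrC.
rewrite EZ// {1}/E /Rintegral -Ez /= => /esym/eqP.
by rewrite mulf_eq0 (negbTE c0) /= => /eqP.
Qed.

Lemma kernel_gram_L2 : L2 P (fun w => k (X w) (Y w)).
Proof.
split; last exact: (law_L1 mXY lawXY (measurable_funX 2 mk2) L1k2).
exact: (measurableT_comp mk2 mXY).
Qed.

Lemma kernel_degenerate : degenerate P W mu b k.
Proof.
split.
- exact: kernel_measurable.
- exact: kernelC.
- exact: kernel_gram_L2.
- exact: spectral_mean_kernel.
Qed.

(* The constant function is dropped and invalid indices get the zero function, so
   that every eigfun i is centred. *)
Definition valid_index i := (i \in K) && (i != 0%N).
Definition eigval i := if i \in K then lambda i else 0.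
Definition eigfun i : R -> R := if valid_index i then g i else fun=> 0.

Lemma eigval_ge0 i : 0 <= eigval i.
Proof. by rewrite /eigval; case: ifPn => // iK; have [_ _ _ /(_ i iK)[]] := k_spec. Qed.

Lemma eigval_invalid i : ~~ valid_index i -> eigval i = 0.
Proof.
rewrite negb_and negbK /eigval => /orP[/negbTE -> //|/eqP ->].
by have [_ [-> _] _ _ _] := k_spec; rewrite if_same.
Qed.

Lemma eigfun_L2 i : L2 m (eigfun i).
Proof.
rewrite /eigfun /valid_index; case: ifPn => [/andP[iK _]|_]; last exact: L2_0.
by have [_ _ [gL _ _] _ _] := k_spec; apply: Lfun_L2; exact: gL.
Qed.

Lemma eigfun_measurable i : measurable_fun setT (eigfun i).
Proof. by have [] := eigfun_L2 i. Qed.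

Lemma eigfun_orthonormal i j : E m (fun z => eigfun i z * eigfun j z) = ((i == j) && valid_index i)%:R.
Proof.
have [vi|vi] := boolP (valid_index i); last first.
  by rewrite andbF /eigfun (negbTE vi); under eq_E do rewrite mul0r; rewrite E0.
have [vj|vj] := boolP (valid_index j); last first.
  have -> : (i == j) = false by apply/negP => /eqP ij; move: vj; rewrite -ij vi.
  by rewrite /eigfun (negbTE vj); under eq_E do rewrite mulr0; rewrite E0.
have [_ _ [_ go _] _ _] := k_spec.
have := go i j; rewrite andbT /eigfun vi vj; case/andP: vi => iK _; case/andP: vj => jK _.
by move=> /(_ iK jK) H; rewrite /E /Rintegral H.
Qed.

(** Orthogonality to the constant eigenfunction. *)
Lemma eigfun_mean i : E m (eigfun i) = 0.
Proof.
have [vi|vi] := boolP (valid_index i); last by rewrite /eigfun (negbTE vi) E0.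
have [[K0 _] _ [_ go _] _ _] := k_spec; have [c [c0 mg gc]] := eigfun0_cst.
have L1i := L2_L1 (eigfun_L2 i); have mi := eigfun_measurable i.
case/andP: (vi) => iK i0.
have H : E m (fun z => g i z * g 0%N z) = E m (fun z => c * eigfun i z).
  apply: eq_E_ae.
  - by apply: measurable_funM => //; move: mi; rewrite /eigfun vi.
  - exact: measurable_funM.
  - by apply: ae_mono _ gc => z ->; rewrite /eigfun vi mulrC.
move: H; rewrite EZ// {1}/E /Rintegral go// (negbTE i0) /= => /esym/eqP.
by rewrite mulf_eq0 (negbTE c0) /= => /eqP.
Qed.

Definition trunc n x y : R := \sum_(i < n) eigval i * eigfun i x * eigfun i y.

Lemma trunc_measurable n : measurable_fun setT (fun x : R * R => trunc n x.1 x.2).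
Proof.
apply: measurable_sum => i; apply: measurable_funM; last exact: (measurableT_comp (eigfun_measurable i)).
by apply: measurable_funM => //; exact: (measurableT_comp (eigfun_measurable i)).
Qed.

Lemma eigfun_pair_L2 i j : L2 P (fun w => eigfun i (X w) * eigfun j (Y w)).
Proof.
have Li := W_L2 (@mW) (@lawW) (a := (b, 0%N)) (eigfun_L2 i).
have Lj := W_L2 (@mW) (@lawW) (a := (b, 1%N)) (eigfun_L2 j).
split; first by apply: measurable_funM; [case: Li|case: Lj].
have JJ' : [set (b, 0%N)] `&` [set (b, 1%N)] = set0 by apply/seteqP; split => // y [/= ->].
have mi : J_measurable W [set (b, 0%N)] (fun w => eigfun i (X w) ^+ 2).
  apply: measurable_funX; apply: (measurableT_comp (eigfun_measurable i)).
  exact: (@sub_var _ _ _ _ _ W [set (b, 0%N)]).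
have mj : J_measurable W [set (b, 1%N)] (fun w => eigfun j (Y w) ^+ 2).
  apply: measurable_funX; apply: (measurableT_comp (eigfun_measurable j)).
  exact: (@sub_var _ _ _ _ _ W [set (b, 1%N)]).
have [H _] := @indep_mul _ _ _ _ _ P _ W (@mW) (@indW) _ _ _ _ JJ' mi mj (L2_sqr Li) (L2_sqr Lj).
by apply: eq_L1 H => w; rewrite exprMn.
Qed.

Lemma trunc_degenerate n : degenerate P W mu b (trunc n).
Proof.
split.
- exact: trunc_measurable.
- by move=> x y; apply: eq_bigr => i _; rewrite mulrAC.
- apply: L2_sum => i _; have := L2Z (eigval i) (eigfun_pair_L2 i i).
  by apply: eq_L2 => w; rewrite mulrA.
- apply: aeW => z; split.
    apply: L1_sum => i _; apply: L1Z; exact/L2_L1/eigfun_L2.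
  rewrite E_sum => [|i _]; last by apply: L1Z; exact/L2_L1/eigfun_L2.
  apply: big1 => i _; rewrite EZ ?eigfun_mean ?mulr0//; exact/L2_L1/eigfun_L2.
Qed.

Lemma degenerateB k1 k2 : degenerate P W mu b k1 -> degenerate P W mu b k2 ->
  degenerate P W mu b (fun x y => k1 x y - k2 x y).
Proof.
move=> [m1 s1 L1' a1] [m2 s2 L2' a2]; split.
- exact: measurable_funB.
- by move=> x y; rewrite s1 s2.
- exact: L2B.
- apply: ae_mono2 _ a1 a2 => z [Lz1 Ez1] [Lz2 Ez2]; split; first exact: L1B.
  by rewrite EB// Ez1 Ez2 subrr.
Qed.

Lemma truncE n x y :
  \sum_(i < n | (i : nat) \in K) lambda i * g i x * g i y = trunc n x y.
Proof.
rewrite /trunc big_mkcond; apply: eq_bigr => i _; rewrite /eigval /eigfun /valid_index.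
case: ifPn => iK; last by rewrite !mul0r.
case: eqVneq => //= ->; have [_ [-> _] _ _ _] := k_spec.
by rewrite !mul0r.
Qed.

Lemma trunc_cvg : knorm P W b (fun x y => k x y - trunc n x y) @[n --> \oo] --> 0.
Proof.
have [_ _ _ _ H] := k_spec.
apply: fine_cvg; apply: cvg_trans H; apply: near_eq_cvg; apply: nearW => n.
have := kernel_degenerate; have := trunc_degenerate n => td kd.
have [mkt _ [_ Lkt] _] := degenerateB kd td.
have mkt2 : measurable_fun setT ((fun x => (k x.1 x.2 - trunc n x.1 x.2) ^+ 2) : measurableTypeR R * measurableTypeR R -> R).
  exact: (measurable_funX 2 mkt).
have H0 := law_integral mXY lawXY mkt2.
rewrite [RHS]H0 /=; last by move=> x; exact: sqr_ge0.
by apply: eq_integral => w _; rewrite truncE.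
Qed.

End spectral.

End sample.

(** * Truncated second moments *)

Lemma squeeze0 (R : realType) (u v : nat -> R) : (forall n, 0 <= u n) -> (forall n, u n <= v n) ->
  v n @[n --> \oo] --> 0 -> u n @[n --> \oo] --> 0.
Proof. by move=> u0 uv; apply: cvg0_le => n; rewrite ger0_norm. Qed.

Lemma cvg0_sqr (R : realType) (u : nat -> R) : u n ^+ 2 @[n --> \oo] --> 0 -> u n @[n --> \oo] --> 0.
Proof.
move=> /cvgrPdist_lt H; apply/cvgrPdist_lt => e e0.
have := H (e ^+ 2) (exprn_gt0 2 e0); apply: filterS => n.
rewrite !sub0r !normrN normrX; rewrite ltr_pXn2r// ?nnegrE//; exact: ltW.
Qed.

(** A discrete layer-cake formula, with 2k + 1 = (k + 1)^2 - k^2. *)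
Lemma min_sqr_le (R : realType) (t : R) n : 0 <= t ->
  Num.min n%:R t ^+ 2 <= \sum_(k < n) (2 * k%:R + 1) * (k%:R < t)%R%:R.
Proof.
move=> t0; elim: n => [|n IH].
  by rewrite big_ord0 (min_idPl t0) expr0n.
rewrite big_ord_recr /=; apply: le_trans (lerD IH (lexx _)).
have n1 : n%:R + 1 = n.+1%:R :> R by rewrite natr1.
have n0 : 0 <= n%:R :> R by [].
have [nt|tn] := ltP n%:R t; rewrite ?mulr1 ?mulr0 ?addr0.
  have : 0 <= Num.min n.+1%:R t <= n%:R + 1.
    by rewrite le_min t0 ler0n n1 ge_min lexx.
  by move: (Num.min _ _) => u /andP[u0 un]; nra.
by rewrite (min_idPr _)// -n1; lra.
Qed.

Lemma two_tails (R : realType) (x z t : R) : 0 <= t ->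
  (t < `|x - z|)%R%:R = (z + t < x)%R%:R + (x < z - t)%R%:R :> R.
Proof.
move=> t0; have [h1|h1] := ltP (z + t) x; have [h2|h2] := ltP x (z - t);
  by have [h3|h3] := ler0P (x - z); case: ltP => h4 /=; lra.
Qed.

Lemma min1_sum (R : realType) (I : Type) (s : seq I) (F : I -> R) : (forall i, 0 <= F i) ->
  Num.min 1 (\sum_(i <- s) F i) <= \sum_(i <- s) Num.min 1 (F i).
Proof.
move=> F0; elim: s => [|i s IH]; first by rewrite !big_nil minElt ltr10.
have S0 : 0 <= \sum_(j <- s) Num.min 1 (F j) by apply: sumr_ge0 => j _; rewrite le_min F0 ler01.
have S1 : 0 <= \sum_(j <- s) F j by apply: sumr_ge0.
have := F0 i.
rewrite !big_cons; move: IH S0 S1; move: (\sum_(j <- s) F j) (\sum_(j <- s) Num.min 1 (F j)) (F i) => u v a.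
by rewrite !minElt; do ![case: ifP => ?]; lra.
Qed.

Section sample.
Context d (T : measurableType d) (R : realType) (P : probability T R)
  (W : bool * nat -> T -> R) (mu : bool -> probability (measurableTypeR R) R).
Hypothesis mW : forall a, measurable_fun setT (W a).
Hypothesis indW : independent_family P W.
Hypothesis lawW : forall a (A : set (measurableTypeR R)), measurable A -> P (W a @^-1` A) = mu a.1 A.
Variable b : bool.
Let X := W (b, 0%N).
Let Y := W (b, 1%N).
Let m := mu b.
Hypothesis k_ex : kernel_exists m.
Hypothesis k_L2 : kernel_square_integrable m.
Let k := kernel m.

Let k_gram : L2 P (fun w => k (X w) (Y w)).
Proof. exact: (kernel_gram_L2 (@mW) (@indW) (@lawW) k_ex k_L2). Qed.

Let JJ' : [set (b, 0%N)] `&` [set (b, 1%N)] = set0.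
Proof. by apply/seteqP; split => // y [/= ->]. Qed.

Let jm0 (f : R -> R) : measurable_fun setT f -> J_measurable W [set (b, 0%N)] (fun w => f (X w)).
Proof. by move=> mf; apply: (measurableT_comp mf); exact: (@sub_var _ _ _ _ _ W [set (b, 0%N)]). Qed.

Let jm1 (f : R -> R) : measurable_fun setT f -> J_measurable W [set (b, 1%N)] (fun w => f (Y w)).
Proof. by move=> mf; apply: (measurableT_comp mf); exact: (@sub_var _ _ _ _ _ W [set (b, 1%N)]). Qed.

(** The Gromov product of [x] and [y] at [z0]: the smaller of the distances to [z0] for points on
    the same side, 0 for points on opposite sides. *)
Let dev z0 (x y : R) := 2^-1 * (`|x - z0| + `|y - z0| - `|x - y|).

(** The terms in [a] cancel in k(x, y) - k(z0, x) - k(z0, y) + k(z0, z0), which leaves exactly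
    [dev]. *)
Let dev_L2 z0 : L2 m (k z0) -> L2 P (fun w => dev z0 (X w) (Y w)).
Proof.
move=> L0; have LX := W_L2 (@mW) (@lawW) (a := (b, 0%N)) L0.
have LY := W_L2 (@mW) (@lawW) (a := (b, 1%N)) L0.
apply: (@eq_L2 _ _ _ _ (fun w => k (X w) (Y w) - k z0 (X w) - k z0 (Y w) + k z0 z0)).
  move=> w; have [a [c [_ kE _]]] := kernel_formula (@mW) (@indW) (@lawW) k_ex.
  rewrite /k !kE subrr normr0 /dev (distrC z0 (X w)) (distrC z0 (Y w)); ring.
by apply: L2D; [apply: L2B => //; exact: L2B|exact: L2_cst].
Qed.

(** Independence makes the probability that both points lie in [A] the square of that of one, and
    there [dev] is at least [t]. *)
Let tail_set z0 (t : R) (A : set R) : L2 m (k z0) -> 0 <= t -> measurable (A : set (measurableTypeR R)) ->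
  (forall x y, A x -> A y -> t <= dev z0 x y) ->
  (t * E m \1_A) ^+ 2 <= E P (fun w => dev z0 (X w) (Y w) ^+ 2 * (\1_A (X w) * \1_A (Y w))).
Proof.
move=> L0 t0 mA tA.
have mI : measurable_fun setT (\1_A : R -> R) by exact: measurable_indic.
have LI : L1 m (\1_A : measurableTypeR R -> R).
  by apply: (@L1_bounded _ _ _ _ _ 1) => [|x]; [exact: measurable_indic|rewrite indicE; case: (_ \in _); rewrite ?normr1 ?normr0].
have LX := W_L1 (@mW) (@lawW) (a := (b, 0%N)) mI LI.
have LY := W_L1 (@mW) (@lawW) (a := (b, 1%N)) mI LI.
have [LXY EXY] := @indep_mul _ _ _ _ _ P _ W (@mW) (@indW) _ _ _ _ JJ' (jm0 mI) (jm1 mI) LX LY.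
rewrite exprMn [E m _ ^+ 2]expr2.
have EX : E m \1_A = E P (fun w => \1_A (X w)) by rewrite (W_E (@mW) (@lawW) (a := (b, 0%N)) mI LI).
have EY : E m \1_A = E P (fun w => \1_A (Y w)) by rewrite (W_E (@mW) (@lawW) (a := (b, 1%N)) mI LI).
rewrite {1}EX EY -EXY -EZ//; apply: E_le; first exact: L1Z.
  have [md Ld] := dev_L2 L0.
  apply: (L1_le _ _ Ld).
    apply: measurable_funM; first exact: measurable_funX.
    exact: L1_meas LXY.
  move=> w; rewrite !indicE; case: (_ \in _); case: (_ \in _); rewrite !(mulr0, mul0r, mulr1) ?normr0 ?ger0_norm ?sqr_ge0 ?lexx //.
move=> w; rewrite !indicE; case: (boolP (X w \in A)) => [/set_mem Xw|_]; last by rewrite !(mul0r, mulr0).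
case: (boolP (Y w \in A)) => [/set_mem Yw|_]; last by rewrite !(mul0r, mulr0).
by rewrite !mulr1 ler_pXn2r ?nnegrE ?tA// (le_trans t0)// tA.
Qed.

(** At each outcome [dev] is eventually below n, so the integrand of [tail_set] is eventually 0;
    dev^2 dominates it. *)
Let tail_cvg z0 (A : nat -> set R) : L2 m (k z0) -> (forall n, measurable (A n : set (measurableTypeR R))) ->
  (forall n x y, A n x -> A n y -> n%:R <= dev z0 x y) ->
  n%:R * E m \1_(A n) @[n --> \oo] --> 0.
Proof.
move=> L0 mA nA; apply: cvg0_sqr.
have [md Ld] := dev_L2 L0.
have H : E P (fun w => dev z0 (X w) (Y w) ^+ 2 * (\1_(A n) (X w) * \1_(A n) (Y w))) @[n --> \oo] --> E P (fun=> 0).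
  apply: (E_dominated _ _ Ld).
  - move=> n; apply: measurable_funM; first exact: measurable_funX.
    have mAn := mA n; have mI : measurable_fun setT (\1_(A n) : R -> R) by exact: measurable_indic.
    by apply: measurable_funM; [exact: (measurableT_comp mI (mW (b, 0%N)))|exact: (measurableT_comp mI (mW (b, 1%N)))].
  - move=> w; apply: cvg_near_cst; near=> n.
    rewrite !indicE; case: (boolP (X w \in A n)) => [/set_mem Xw|_]; last by rewrite !(mul0r, mulr0).
    case: (boolP (Y w \in A n)) => [/set_mem Yw|_]; last by rewrite !(mul0r, mulr0).
    exfalso; have := nA n _ _ Xw Yw; apply/negP; rewrite -ltNge.
    by near: n; exact: nbhs_infty_gtr.
  - by move=> n w; rewrite !indicE; case: (_ \in _); case: (_ \in _);
      rewrite !(mulr0, mul0r, mulr1) ?normr0 ?ger0_norm ?sqr_ge0 ?lexx.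
rewrite E0 in H.
apply: (@squeeze0 _ _ _ _ _ H) => n; first exact: sqr_ge0.
by apply: tail_set => //; exact: nA.
Unshelve. all: by end_near. Qed.

(** The expectation is at most n E min(1, (X - z0)^2/n^2) = n^-1 E min(n, |X - z0|)^2, which by
    [min_sqr_le] is bounded by the Cesaro mean of (2k + 1) P(|X - z0| > k), a null sequence. *)
Lemma truncated_sqr_cvg z0 : L2 m (k z0) ->
  E P (fun w => Num.min 1 (n%:R ^- 2 * \sum_(i < n) (W (b, i : nat) w - z0) ^+ 2)) @[n --> \oo] --> 0.
Proof.
move=> L0.
(* The tails are kept apart because [dev] vanishes for points on opposite sides of [z0]. *)
pose Ap n : set R := `]z0 + n%:R, +oo[%classic.
pose Am n : set R := `]-oo, z0 - n%:R[%classic.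
have mAp n : measurable (Ap n : set (measurableTypeR R)) by exact: measurable_itv.
have mAm n : measurable (Am n : set (measurableTypeR R)) by exact: measurable_itv.
have n0 (n : nat) : 0 <= n%:R :> R by [].
have tp := tail_cvg L0 mAp; have {}tp : n%:R * E m \1_(Ap n) @[n --> \oo] --> 0.
  apply: tp => n x y; rewrite /Ap /= !in_itv /= !andbT => xz yz; rewrite /dev.
  have nn := n0 n; rewrite (ger0_norm (x := x - z0)); last lra.
  by rewrite (ger0_norm (x := y - z0)); last lra; case: (ler0P (x - y)); lra.
have tm := tail_cvg L0 mAm; have {}tm : n%:R * E m \1_(Am n) @[n --> \oo] --> 0.
  apply: tm => n x y; rewrite /Am /= !in_itv /= => xz yz; rewrite /dev.
  have nn := n0 n; rewrite (ler0_norm (x := x - z0)); last lra.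
  by rewrite (ler0_norm (x := y - z0)); last lra; case: (ler0P (x - y)); lra.
pose q n := E m \1_(Ap n) + E m \1_(Am n).
have q0 n : 0 <= q n by rewrite addr_ge0// E_ge0.
pose v n := (2 * n%:R + 1) * q n.
have v0 n : 0 <= v n by rewrite mulr_ge0// addr_ge0// mulr_ge0.
have v_cvg : v n @[n --> \oo] --> 0.
  rewrite -(cvg_shiftS v); have H : 3 * (n%:R * E m \1_(Ap n) + n%:R * E m \1_(Am n)) @[n --> \oo] --> (3 * (0 + 0) : R).
    by apply: cvgM; [exact: cvg_cst|exact: cvgD].
  rewrite addr0 mulr0 in H.
  rewrite -(cvg_shiftS (fun n => 3 * (n%:R * E m \1_(Ap n) + n%:R * E m \1_(Am n)))) in H.
  apply: (@squeeze0 _ _ _ _ _ H) => n; first exact: v0.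
  by rewrite /v -mulrDr mulrA ler_wpM2r// -natr1; have := n0 n; lra.
have := cesaro v_cvg; rewrite /arithmetic_mean => ces.
rewrite -(cvg_shiftS (fun n => E P (fun w => Num.min 1 (n%:R ^- 2 * \sum_(i < n) (W (b, i : nat) w - z0) ^+ 2)))).
apply: (@squeeze0 _ _ _ _ _ ces) => n.
  by apply: E_ge0 => w; rewrite le_min ler01 mulr_ge0// sumr_ge0// => i _; exact: sqr_ge0.
set N : R := n.+1%:R; have N0 : 0 < N by rewrite ltr0n.
pose f x : R := Num.min 1 (N ^- 2 * (x - z0) ^+ 2).
have mf : measurable_fun setT f.
  by apply: measurable_minr => //; apply: measurable_funM => //; apply: measurable_funX; exact: measurable_funB.
have f01 x : 0 <= f x <= 1.
  by rewrite /f le_min ler01 ge_min lexx mulr_ge0 ?sqr_ge0// invr_ge0 exprn_ge0// ltW.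
have Lf : L1 m f.
  by apply: (@L1_bounded _ _ _ _ _ 1) => // x; have /andP[? ?] := f01 x; rewrite ger0_norm.
have LfW i := W_L1 (@mW) (@lawW) (a := (b, i)) mf Lf.
have EfW i : E P (fun w => f (W (b, i) w)) = E m f by rewrite (W_E (@mW) (@lawW) (a := (b, i)) mf Lf).
apply: (@le_trans _ _ (E P (fun w => \sum_(i < n.+1) f (W (b, i : nat) w)))).
  apply: E_le.
  - apply: (@L1_bounded _ _ _ _ _ 1).
      apply: measurable_minr => //; apply: measurable_funM => //; apply: measurable_sum => i.
      by apply: measurable_funX; exact: measurable_funB.
    move=> w; rewrite ger0_norm ?ge_min ?lexx// le_min ler01 mulr_ge0//; last first.
      by apply: sumr_ge0 => i _; exact: sqr_ge0.
    by rewrite invr_ge0 exprn_ge0// ltW.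
  - by apply: L1_sum => i _; exact: LfW.
  - move=> w; rewrite mulr_sumr; apply: min1_sum => i.
    by rewrite mulr_ge0 ?sqr_ge0// invr_ge0 exprn_ge0// ltW.
rewrite E_sum; last by move=> i _; exact: LfW.
under eq_bigr do rewrite EfW.
rewrite sumr_const card_ord -[E m f *+ _]mulr_natr -/N.
have mI (B : set R) : measurable (B : set (measurableTypeR R)) -> L1 m (\1_B : measurableTypeR R -> R).
  move=> mB; by apply: (@L1_bounded _ _ _ _ _ 1) => [|x]; [exact: measurable_indic|rewrite indicE; case: (_ \in _); rewrite ?normr1 ?normr0].
have LG : L1 m (fun x : measurableTypeR R => \sum_(j < n.+1) (2 * j%:R + 1) * (\1_(Ap j) x + \1_(Am j) x)).
  by apply: L1_sum => j _; apply: L1Z; apply: L1D; exact: mI.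
have EG : E m (fun x : measurableTypeR R => \sum_(j < n.+1) (2 * j%:R + 1) * (\1_(Ap j) x + \1_(Am j) x)) = series v n.+1.
  rewrite E_sum => [|j _]; last by apply: L1Z; apply: L1D; exact: mI.
  rewrite seriesEord; apply: eq_bigr => j _; rewrite EZ; last by apply: L1D; exact: mI.
  by rewrite ED//; exact: mI.
suff : E m f <= N ^- 2 * series v n.+1.
  move=> H; have := ler_wpM2r (ltW N0) H; rewrite mulrAC.
  by have -> : N ^- 2 * N = N^-1 by field; lra.
rewrite -EG -EZ//; apply: E_le => //; first exact: L1Z.
move=> x; have := @min_sqr_le _ `|x - z0| n.+1 (normr_ge0 _); rewrite -/N.
set s := \sum_(_ < _) _; set s' := \sum_(_ < _) _ => H.
have ss' : s = s'.
  apply: eq_bigr => j _; congr (_ * _); rewrite !indicE /Ap /Am.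
  by rewrite !mem_setE /= !in_itv /= andbT two_tails.
rewrite -ss' mulrC ler_pdivlMr; last by rewrite exprn_gt0.
apply: le_trans H; rewrite /f.
have [h|h] := leP 1 (N ^- 2 * (x - z0) ^+ 2).
  rewrite mul1r; rewrite (min_idPl _)//.
  move: h; rewrite mulrC ler_pdivlMr ?exprn_gt0// mul1r -(real_normK (num_real (x - z0))).
  by rewrite ler_pXn2r ?nnegrE// ltW.
rewrite mulrAC mulVf ?mul1r ?expf_neq0 ?gt_eqF//.
rewrite (min_idPr _) ?real_normK ?num_real//.
move: h; rewrite mulrC ltr_pdivrMr ?exprn_gt0// mul1r -(real_normK (num_real (x - z0))).
by rewrite ltr_pXn2r ?nnegrE//; exact: ltW.
Qed.

End sample.

(** * The trace formula *)

(** Here [i] plays the part of the indicator of a null set: truncations of [f] times [i] integrate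
    to 0, and dominated convergence passes to [f]. *)
Lemma E_null_mul d (T : measurableType d) (R : realType) (P : probability T R) (f i : T -> R) :
  measurable_fun setT i -> (forall x, 0 <= i x <= 1) -> L1 P f -> E P i = 0 ->
  E P (fun x => f x * i x) = 0.
Proof.
move=> mi i01 Lf Ei; have mf := L1_meas Lf.
have mabs : measurable_fun setT (fun x => `|f x|) by exact: measurableT_comp.
have Li : L1 P i.
  by apply: (@L1_bounded _ _ _ _ _ 1) => // x; have /andP[i0 i1] := i01 x; rewrite ger0_norm.
have H : E P (fun x => Num.min n%:R `|f x| * i x) @[n --> \oo] --> E P (fun x => `|f x| * i x).
  apply: (E_dominated _ _ (L1_norm Lf)).
  - by move=> n; apply: measurable_funM => //; exact: measurable_minr.
  - move=> x; apply: cvg_near_cst; near=> n; congr (_ * _); apply/min_idPr.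
    by near: n; exact: nbhs_infty_ger.
  - move=> n x; have /andP[i0 i1] := i01 x.
    have m0 : 0 <= Num.min n%:R `|f x| by rewrite le_min ler0n normr_ge0.
    have m1 : Num.min n%:R `|f x| <= `|f x| by rewrite ge_min lexx orbT.
    by rewrite ger0_norm ?mulr_ge0//; nra.
have Lfi : L1 P (fun x => f x * i x).
  apply: (L1_le _ _ (L1_norm Lf)); first exact: measurable_funM.
  by move=> x; have /andP[i0 i1] := i01 x; rewrite normrM (ger0_norm i0) ler_piMr.
apply/eqP; rewrite -normr_le0; apply: (le_trans (E_norm Lfi)).
have <- : E P (fun x => `|f x| * i x) = E P (fun x => `|f x * i x|).
  by apply: eq_E => x; have /andP[i0 _] := i01 x; rewrite normrM (ger0_norm i0).
have H0 : E P (fun x => Num.min n%:R `|f x| * i x) @[n --> \oo] --> (0 : R).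
  apply: (@squeeze0 _ _ (fun=> 0)); [| |exact: cvg_cst] => n.
    by apply: E_ge0 => x; have /andP[i0 _] := i01 x; rewrite mulr_ge0// le_min ler0n normr_ge0.
  rewrite -(mulr0 n%:R) -Ei -EZ//; apply: E_le; last 1 first.
  - by move=> x; have /andP[i0 _] := i01 x; rewrite ler_wpM2r// ge_min lexx.
  - apply: (L1_le _ _ (L1_norm Lf)); first by apply: measurable_funM => //; exact: measurable_minr.
    move=> x; have /andP[i0 i1] := i01 x.
    have m0 : 0 <= Num.min n%:R `|f x| by rewrite le_min ler0n normr_ge0.
    have m1 : Num.min n%:R `|f x| <= `|f x| by rewrite ge_min lexx orbT.
    by rewrite ger0_norm ?mulr_ge0//; nra.
  - exact: L1Z.
by rewrite (cvg_unique _ H H0).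
Unshelve. all: by end_near. Qed.

Lemma cvg_le_cst (R : realType) (u : nat -> R) (l z : R) :
  u n @[n --> \oo] --> l -> (forall n, u n <= z) -> l <= z.
Proof.
move=> ul uz; rewrite -(cvg_lim _ ul)//; apply: limr_le; first exact: cvgP ul.
by apply: nearW => n; exact: uz.
Qed.

(** A partial sum of [l] is the limit of partial sums of [s n], which are at most S n; conversely S
    n is at most the sum of [l] by termwise comparison. No domination by a summable sequence is
    assumed in advance. *)
Lemma dominated_series (R : realType) (s : nat -> nat -> R) (l S : nat -> R) (t : R) :
  (forall n j, 0 <= s n j <= l j) -> (forall j, s n j @[n --> \oo] --> l j) ->
  (forall n, \sum_(j < J) s n j @[J --> \oo] --> S n) -> S n @[n --> \oo] --> t ->
  \sum_(j < J) l j @[J --> \oo] --> t.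
Proof.
move=> sl sc sS St.
have l0 j : 0 <= l j by have /andP[] := sl 0%N j; exact: le_trans.
have sums_le n J : \sum_(j < J) s n j <= S n.
  have inc : nondecreasing_seq (fun J => \sum_(j < J) s n j).
    apply/nondecreasing_seqP => J'; rewrite big_ord_recr /= lerDl.
    by have /andP[] := sl n J'.
  have := @nondecreasing_cvgn_le _ _ inc (cvgP _ (sS n)) J.
  by rewrite (cvg_lim _ (sS n)).
have A_le J : \sum_(j < J) l j <= t.
  have H : \sum_(j < J) s n j @[n --> \oo] --> \sum_(j < J) l j.
    by exact: cvg_bigsum.
  by apply: (ler_cvg_to H St); apply: nearW => n; exact: sums_le.
have inc : nondecreasing_seq (fun J => \sum_(j < J) l j).
  by apply/nondecreasing_seqP => J'; rewrite big_ord_recr /= lerDl.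
have bd : has_ubound (range (fun J => \sum_(j < J) l j)).
  by exists t => _ [J _ <-]; exact: A_le.
have AL := nondecreasing_cvgn inc bd; set L := sup _ in AL.
suff -> : t = L by [].
apply/eqP; rewrite eq_le; apply/andP; split.
  apply: (cvg_le_cst St) => n.
  apply: (ler_cvg_to (sS n) AL); apply: nearW => J; apply: ler_sum => j _.
  by have /andP[] := sl n j.
exact: (cvg_le_cst AL).
Qed.

(** * A grid of cells on the line *)

Section bins.
Variable R : realType.

(** Grid points of mesh 1/(n+1) starting at -(n+1); with 2(n+1)^2 cells the grid reaches n+1, so it
    becomes finer and longer at once. *)
Definition node (n r : nat) : R := - n.+1%:R + r%:R / n.+1%:R.
(** The indicator of a half-open cell, written as a difference so that sums over cells telescope. *)
Definition bin n r (x : R) : R := (x < node n r.+1)%R%:R - (x < node n r)%R%:R.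

Lemma node_step n r : node n r.+1 = node n r + n.+1%:R^-1.
Proof. by rewrite /node -[r.+1%:R]natr1 mulrDl mul1r addrA. Qed.

Lemma inv_gt0 n : 0 < n.+1%:R^-1 :> R. Proof. by rewrite invr_gt0. Qed.

Lemma bin_cases n r x : bin n r x = 0 \/ bin n r x = 1 /\ node n r <= x < node n r.+1.
Proof.
rewrite /bin node_step; have := inv_gt0 n; move: n.+1%:R^-1 (node n r) => e t e0.
by have [h1|h1] := ltP x (t + e); have [h2|h2] := ltP x t; rewrite /=; [left|right|exfalso|left]; lra.
Qed.

Lemma bin01 n r x : 0 <= bin n r x <= 1.
Proof. by case: (bin_cases n r x) => [->|[-> _]]; lra. Qed.

Lemma bin_norm n r x : `|bin n r x| <= 1.
Proof. by have /andP[? ?] := bin01 n r x; rewrite ger0_norm. Qed.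

Lemma bin_near n r x y : bin n r x = 0 \/ bin n r y = 0 \/ `|x - y| <= n.+1%:R^-1.
Proof.
case: (bin_cases n r x) => [->|[_ +]]; first by left.
case: (bin_cases n r y) => [->|[_ +]]; first by right; left.
rewrite node_step => h1 h2; right; right.
by move: (n.+1%:R^-1) (node n r) h1 h2 => e t h1 h2; case: (ler0P (x - y)); lra.
Qed.

Lemma bin_measurable n r : measurable_fun setT (bin n r).
Proof.
have m t : measurable_fun setT (fun x : R => (x < t)%R%:R : R).
  have -> : (fun x : R => (x < t)%R%:R : R) = \1_(`]-oo, t[%classic : set R).
    by apply: funext => x; rewrite indicE mem_setE in_itv.
  by have mt : measurable (`]-oo, t[%classic : set (measurableTypeR R)) by []; exact: measurable_indic.
exact: measurable_funB.
Qed.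

Lemma bin_sum n x : \sum_(r < 2 * n.+1 ^ 2) bin n r x = (x < n.+1%:R)%R%:R - (x < - n.+1%:R)%R%:R.
Proof.
have H := @telescope_sumr R 0 (2 * n.+1 ^ 2) (fun r => (x < node n r)%R%:R) (leq0n _).
rewrite big_mkord in H; rewrite H {H} /node mul0r addr0.
have -> : - n.+1%:R + (2 * n.+1 ^ 2)%:R / n.+1%:R = n.+1%:R :> R.
  by rewrite natrM natrX; have : n.+1%:R != 0 :> R by []; move: (n.+1%:R : R) => N N0; field.
by [].
Qed.

End bins.

Section sample.
Context d (T : measurableType d) (R : realType) (P : probability T R)
  (W : bool * nat -> T -> R) (mu : bool -> probability (measurableTypeR R) R).
Hypothesis mW : forall a, measurable_fun setT (W a).
Hypothesis indW : independent_family P W.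
Hypothesis lawW : forall a (A : set (measurableTypeR R)), measurable A -> P (W a @^-1` A) = mu a.1 A.
Variable b : bool.
Let X := W (b, 0%N).
Let Y := W (b, 1%N).
Let m := mu b.

Let JJ' : [set (b, 0%N)] `&` [set (b, 1%N)] = set0.
Proof. by apply/seteqP; split => // y [/= ->]. Qed.

Let jm0 (f : R -> R) : measurable_fun setT f -> J_measurable W [set (b, 0%N)] (fun w => f (X w)).
Proof. by move=> mf; apply: (measurableT_comp mf); exact: (@sub_var _ _ _ _ _ W [set (b, 0%N)]). Qed.

Let jm1 (f : R -> R) : measurable_fun setT f -> J_measurable W [set (b, 1%N)] (fun w => f (Y w)).
Proof. by move=> mf; apply: (measurableT_comp mf); exact: (@sub_var _ _ _ _ _ W [set (b, 1%N)]). Qed.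

Lemma pair_mul (f g : R -> R) : measurable_fun setT f -> measurable_fun setT g -> L1 m f -> L1 m g ->
  L1 P (fun w => f (X w) * g (Y w)) /\ E P (fun w => f (X w) * g (Y w)) = E m f * E m g.
Proof.
move=> mf mg Lf Lg.
have LX := W_L1 (@mW) (@lawW) (a := (b, 0%N)) mf Lf.
have LY := W_L1 (@mW) (@lawW) (a := (b, 1%N)) mg Lg.
have [H ->] := @indep_mul _ _ _ _ _ P _ W (@mW) (@indW) _ _ _ _ JJ' (jm0 mf) (jm1 mg) LX LY.
by split => //; rewrite (W_E (@mW) (@lawW) (a := (b, 0%N)) mf Lf) (W_E (@mW) (@lawW) (a := (b, 1%N)) mg Lg).
Qed.

Let q n r := E m (bin n r).
Let N n : R := n.+1%:R.

Let Lbin n r : L1 m (bin n r).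
Proof. by apply: (@L1_bounded _ _ _ _ _ 1); [exact: bin_measurable|exact: bin_norm]. Qed.

Let Lmbin f n r : measurable_fun setT (f : R -> R) -> L1 m f -> L1 m (fun x => f x * bin n r x).
Proof.
move=> mf Lf; apply: (L1_le _ _ (L1_norm Lf)); first by apply: measurable_funM => //; exact: bin_measurable.
by move=> x; rewrite normrM ler_piMr// bin_norm.
Qed.

Let mXY (F : R -> R -> R) : measurable_fun setT (fun x : R * R => F x.1 x.2) ->
  measurable_fun setT (fun w => F (X w) (Y w)).
Proof.
move=> mF; have mp : measurable_fun setT (fun w => (X w, Y w)) by exact: measurable_fun_pair (mW _) (mW _).
exact: (measurableT_comp mF mp).
Qed.

Let binXY n r w := bin n r (X w) * bin n r (Y w).

Let binXY_measurable n r : measurable_fun setT (binXY n r).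
Proof.
by apply: measurable_funM; [exact: (measurableT_comp (@bin_measurable R n r) (mW (b, 0%N)))
  |exact: (measurableT_comp (@bin_measurable R n r) (mW (b, 1%N)))].
Qed.

Let binXY01 n r w : 0 <= binXY n r w <= 1.
Proof. by rewrite /binXY; case: (bin_cases n r (X w)) => [->|[-> _]]; case: (bin_cases n r (Y w)) => [->|[-> _]]; lra. Qed.

Let L1_bin F n r : L1 P (fun w => F (X w) (Y w)) -> L1 P (fun w => F (X w) (Y w) * binXY n r w).
Proof.
move=> LF; apply: (L1_le _ _ (L1_norm LF)); first by apply: measurable_funM => //; exact: L1_meas LF.
by move=> w; have /andP[u0 u1] := binXY01 n r w; rewrite normrM ler_piMr// ger0_norm.
Qed.

(** The sum over cells C of P(C) times the average of [F] over C x C, an approximate trace that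
    makes sense although the diagonal may be a null set. Cells of probability 0 contribute 0. *)
Let binned n (F : R -> R -> R) := \sum_(r < 2 * n.+1 ^ 2) (q n r)^-1 * E P (fun w => F (X w) (Y w) * binXY n r w).

Let q_ge0 n r : 0 <= q n r.
Proof. by apply: E_ge0 => x; have /andP[] := bin01 n r x. Qed.

Let binE (f : R -> R) n r : measurable_fun setT f -> L1 m f -> (q n r)^-1 * (E m (fun x => f x * bin n r x) * q n r) = E m (fun x => f x * bin n r x).
Proof.
move=> mf Lf; have [q0|q0] := eqVneq (q n r) 0; last by rewrite mulrA mulrAC mulVf ?mul1r.
rewrite (@E_null_mul _ _ _ m f (bin n r)) ?mul0r ?mulr0//.
  exact: bin_measurable.
exact: bin01.
Qed.

Let fXbin (f : R -> R) n r : measurable_fun setT f -> L1 m f ->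
  L1 P (fun w => f (X w) * binXY n r w) /\ E P (fun w => f (X w) * binXY n r w) = E m (fun x => f x * bin n r x) * q n r.
Proof.
move=> mf Lf; have [] := pair_mul (measurable_funM mf (@bin_measurable R n r)) (@bin_measurable R n r) (Lmbin n r mf Lf) (Lbin n r).
by move=> H <-; split; [apply: eq_L1 H => w|apply: eq_E => w]; rewrite /binXY mulrA.
Qed.

Let fYbin (f : R -> R) n r : measurable_fun setT f -> L1 m f ->
  L1 P (fun w => f (Y w) * binXY n r w) /\ E P (fun w => f (Y w) * binXY n r w) = E m (fun x => f x * bin n r x) * q n r.
Proof.
move=> mf Lf; have [] := pair_mul (@bin_measurable R n r) (measurable_funM mf (@bin_measurable R n r)) (Lbin n r) (Lmbin n r mf Lf).
by rewrite [E m _ * _]mulrC => H <-; split; [apply: eq_L1 H => w|apply: eq_E => w]; rewrite /binXY /=; ring.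
Qed.

(** With [f] the intended diagonal of [F], the error is the average of f(x) + f(y) - 2 F(x, y) over
    the squares; nonnegativity of this defect gives inequalities, its smallness gives limits. *)
Let binned_identity n (F : R -> R -> R) (f : R -> R) : measurable_fun setT f -> L1 m f ->
  L1 P (fun w => F (X w) (Y w)) ->
  \sum_(r < 2 * n.+1 ^ 2) E m (fun x => f x * bin n r x) - binned n F =
  2^-1 * binned n (fun x y => f x + f y - 2 * F x y).
Proof.
move=> mf Lf LF; rewrite /binned -sumrB mulr_sumr; apply: eq_bigr => r _.
have [L1f E1] := fXbin n r mf Lf; have [L2f E2] := fYbin n r mf Lf; have L3 := L1_bin n r LF.
have -> : E P (fun w => (f (X w) + f (Y w) - 2 * F (X w) (Y w)) * binXY n r w) =
    E m (fun x => f x * bin n r x) * q n r + E m (fun x => f x * bin n r x) * q n r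
    - 2 * E P (fun w => F (X w) (Y w) * binXY n r w).
  rewrite -{1}E1 -E2 -ED// -EZ// -EB; [|exact: L1D|exact: L1Z].
  by apply: eq_E => w; ring.
have := binE n r mf Lf; move: (E P _) (E m _) (q n r) => u v p; move: p^-1 => z Bv.
by rewrite -{1}Bv; field.
Qed.

Let binned_ge0 n F : (forall x y, 0 <= F x y) -> 0 <= binned n F.
Proof.
move=> F0; apply: sumr_ge0 => r _; rewrite mulr_ge0 ?invr_ge0 ?q_ge0//.
by apply: E_ge0 => w; rewrite mulr_ge0//; have /andP[] := binXY01 n r w.
Qed.

Let binned_tail (f : R -> R) : measurable_fun setT f -> L1 m f ->
  \sum_(r < 2 * n.+1 ^ 2) E m (fun x => f x * bin n r x) @[n --> \oo] --> E m f.
Proof.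
move=> mf Lf.
have eqn n : \sum_(r < 2 * n.+1 ^ 2) E m (fun x => f x * bin n r x) =
    E m (fun x => f x * \sum_(r < 2 * n.+1 ^ 2) bin n r x).
  rewrite -E_sum => [|r _]; last exact: Lmbin.
  by apply: eq_E => x; rewrite mulr_sumr.
under eq_cvg do rewrite eqn.
apply: (E_dominated _ _ (L1_norm Lf)).
- by move=> n; apply: measurable_funM => //; apply: measurable_sum => r; exact: bin_measurable.
- move=> x; apply: cvg_near_cst; near=> n; rewrite bin_sum.
  have xn : `|x| < n.+1%:R.
    by apply: (@lt_le_trans _ _ n%:R); [near: n; exact: nbhs_infty_gtr|rewrite ler_nat].
  move: xn; rewrite ltr_norml => /andP[h1 h2]; rewrite h2 /= ltNge (ltW h1) /=.
  by rewrite subr0 mulr1.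
- move=> n x; rewrite bin_sum normrM ler_piMr//.
  have := ler0n R n.+1; case: ltP => h1; case: ltP => h2 => _ /=.
  + by rewrite subrr normr0.
  + by rewrite subr0 normr1.
  + by exfalso; have := ltr0Sn R n; lra.
  + by rewrite subrr normr0.
Unshelve. all: by end_near. Qed.

Let binned_tail_le (f : R -> R) n : measurable_fun setT f -> L1 m f -> (forall x, 0 <= f x) ->
  \sum_(r < 2 * n.+1 ^ 2) E m (fun x => f x * bin n r x) <= E m f.
Proof.
move=> mf Lf f0; rewrite -E_sum => [|r _]; last exact: Lmbin.
apply: E_le => //; first by apply: L1_sum => r _; exact: Lmbin.
move=> x; rewrite -mulr_sumr bin_sum ler_piMr//.
by case: ltP => _; case: ltP => _ /=; lra.
Qed.

(** Two points of a cell are at distance at most 1/(n+1), so the whole error is at most E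
    g/(n+1). *)
Let binned_defect_cvg (F : R -> R -> R) (f g : R -> R) : measurable_fun setT f -> L1 m f ->
  measurable_fun setT g -> L1 m g -> L1 P (fun w => F (X w) (Y w)) ->
  (forall x y, 0 <= f x + f y - 2 * F x y <= `|x - y| * (g x + g y)) -> (forall x, 0 <= g x) ->
  2^-1 * binned n (fun x y => f x + f y - 2 * F x y) @[n --> \oo] --> 0.
Proof.
move=> mf Lf mg Lg LF FD g0.
pose D x y := f x + f y - 2 * F x y; rewrite -/D.
have LD : L1 P (fun w => D (X w) (Y w)).
  apply: L1B; last exact: L1Z.
  apply: L1D; [exact: (W_L1 (@mW) (@lawW) (a := (b, 0%N)))|exact: (W_L1 (@mW) (@lawW) (a := (b, 1%N)))].
apply: (@squeeze0 _ _ (fun n => E m g * n.+1%:R^-1)) => [n|n|].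
- by rewrite mulr_ge0//; apply: binned_ge0 => x y; have /andP[] := FD x y.
- apply: (@le_trans _ _ (2^-1 * \sum_(r < 2 * n.+1 ^ 2) (2 * n.+1%:R^-1) * E m (fun x => g x * bin n r x))); last first.
    rewrite -mulr_sumr mulrA mulrA mulVf// mul1r mulrC ler_wpM2r//.
    exact: binned_tail_le.
  apply: ler_wpM2l => //; apply: ler_sum => r _.
  have [L1g E1] := fXbin n r mg Lg; have [L2g E2] := fYbin n r mg Lg.
  apply: (@le_trans _ _ ((q n r)^-1 * (n.+1%:R^-1 * (2 * (E m (fun x => g x * bin n r x) * q n r))))); last first.
    by rewrite mulrCA [in leLHS](mulrCA _ 2) binE// mulrCA mulrA.
  apply: ler_wpM2l; first by rewrite invr_ge0.
  have -> : 2 * (E m (fun x => g x * bin n r x) * q n r) = E P (fun w => g (X w) * binXY n r w + g (Y w) * binXY n r w).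
    by rewrite ED// E1 E2; ring.
  rewrite -EZ; last exact: L1D.
  apply: E_le; [exact: L1_bin|by apply: L1Z; exact: L1D|].
  move=> w; rewrite -mulrDl mulrA.
  have /andP[u0 u1] := binXY01 n r w.
  have /andP[_ h] := FD (X w) (Y w).
  case: (bin_near n r (X w) (Y w)) => [h0|[h0|h1]].
  + by rewrite /binXY h0 mul0r !mulr0.
  + by rewrite /binXY h0 !mulr0.
  + apply: ler_wpM2r => //; apply: (le_trans h); apply: ler_wpM2r => //.
    exact: addr_ge0.
- have := @cvg_divn R (E m g); rewrite -(cvg_shiftS (fun n => E m g / n%:R)); exact.
Qed.

Let binned_cvg (F : R -> R -> R) (f g : R -> R) : measurable_fun setT f -> L1 m f ->
  measurable_fun setT g -> L1 m g -> L1 P (fun w => F (X w) (Y w)) ->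
  (forall x y, 0 <= f x + f y - 2 * F x y <= `|x - y| * (g x + g y)) -> (forall x, 0 <= g x) ->
  binned n F @[n --> \oo] --> E m f.
Proof.
move=> mf Lf mg Lg LF FD g0.
pose D x y := f x + f y - 2 * F x y.
have eqn n : binned n F = \sum_(r < 2 * n.+1 ^ 2) E m (fun x => f x * bin n r x) - 2^-1 * binned n D.
  by rewrite -binned_identity//; ring.
have H : \sum_(r < 2 * n.+1 ^ 2) E m (fun x => f x * bin n r x) - 2^-1 * binned n D @[n --> \oo] --> (E m f - 0 : R).
  apply: cvgB; first exact: binned_tail.
  exact: (binned_defect_cvg mf Lf mg Lg LF FD g0).
rewrite subr0 in H; apply: cvg_trans H; apply: near_eq_cvg; apply: nearW => n.
by rewrite eqn.
Qed.

Section spectral.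
Variables (K : set nat) (lambda : nat -> R) (g : nat -> R -> R).
Hypothesis k_ex : kernel_exists m.
Hypothesis k_L2 : kernel_square_integrable m.
Hypothesis k_spec : spectral_decomposition m K lambda g.
Hypothesis k_tr : kernel_trace_class m.
Let k := kernel m.
Let gam := eigfun K g.
Let lam := eigval K lambda.

Let kform := kernel_formula (@mW) (@indW) (@lawW) k_ex.
Let mk : measurable_fun setT (fun x : R * R => k x.1 x.2) := kernel_measurable (@mW) (@indW) (@lawW) k_ex.
Let lam0 j : 0 <= lam j := eigval_ge0 k_spec j.
Let gamL2 j : L2 m (gam j) := eigfun_L2 k_spec j.
Let mgam j : measurable_fun setT (gam j) := eigfun_measurable k_spec j.

Lemma kernel_diag_L1 : L1 m (fun z => k z z).
Proof.
have [a [c [_ _ k0]]] := kform.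
apply: L1_ge0 => //.
have md : measurable_fun setT (fun z : R => (z, z)) by exact: measurable_fun_pair.
exact: (measurableT_comp mk md).
Qed.

Let section_L2 x : L2 m (k x).
Proof.
have [z0 L0] := ae_exists (kernel_section_L2 (@mW) (@indW) (@lawW) k_ex k_L2).
apply: (@eq_L2 _ (measurableTypeR R) _ _ (fun z => k z0 z + (k x z - k z0 z))); first by move=> z; ring.
have mx y : measurable_fun setT (k y) by exact: (measurableT_comp mk (pair1_measurable y)).
apply: L2D => //; apply: (@L2_bounded _ _ _ _ _ `|x - z0|); first exact: (measurable_funB (mx x) (mx z0)).
by move=> z; exact: (kernel_lipschitz (@mW) (@indW) (@lawW) k_ex).
Qed.

(** A version of lambda_j g_j defined at every point. Unlike the eigenfunction itself it is
    1-Lipschitz, by [kernel_lipschitz], which the comparison with the diagonal requires. *)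
Let e j x := E m (fun z => k x z * gam j z).

Let gam_sqr j : E m (fun z => gam j z ^+ 2) <= 1.
Proof.
have -> : E m (fun z => gam j z ^+ 2) = E m (fun z => gam j z * gam j z) by apply: eq_E => z; rewrite expr2.
by rewrite (eigfun_orthonormal k_spec) eqxx /=; case: (valid_index _ _).
Qed.

Let gam_norm j : E m (fun z => `|gam j z|) <= 1.
Proof.
have L : L2 m (fun z => `|gam j z|).
  split; first exact: (measurableT_comp (@normr_measurable R setT) (mgam j)).
  by apply: eq_L1 (L2_sqr (gamL2 j)) => z; rewrite real_normK ?num_real.
have := E_sqr_le L; have -> : E m (fun z => `|gam j z| ^+ 2) = E m (fun z => gam j z ^+ 2).
  by apply: eq_E => z; rewrite real_normK ?num_real.
have e0 : 0 <= E m (fun z => `|gam j z|) by exact: E_ge0.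
by move: (gam_sqr j) => h1 h2; rewrite -(@ler_pXn2r _ 2) ?nnegrE ?ler01// expr1n (le_trans h2).
Qed.

Let e_lip j x y : `|e j x - e j y| <= `|x - y|.
Proof.
have Lx x' : L1 m (fun z => k x' z * gam j z) by exact: (L2_mul (section_L2 x') (gamL2 j)).
rewrite /e -EB//; apply: (le_trans (E_norm (L1B (Lx x) (Lx y)))).
apply: (@le_trans _ _ (`|x - y| * E m (fun z => `|gam j z|))); last by rewrite ler_piMr// gam_norm.
have Lg : L1 m (fun z => `|gam j z|) by exact/L1_norm/L2_L1.
rewrite -EZ//; apply: E_le; [exact/L1_norm/L1B|exact: L1Z|].
move=> z; rewrite -mulrBl normrM ler_wpM2r//.
exact: (kernel_lipschitz (@mW) (@indW) (@lawW) k_ex).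
Qed.

Let me j : measurable_fun setT (e j).
Proof. by apply: (@lipschitz_measurable _ _ 1) => x y; rewrite mul1r; exact: e_lip. Qed.

Let e_ae j : {ae m, forall x, e j x = lam j * gam j x}.
Proof.
have [vj|vj] := boolP (valid_index K j); last first.
  apply: aeW => x; rewrite /lam (eigval_invalid k_spec vj) mul0r /e.
  by rewrite /gam /eigfun (negbTE vj); under eq_E do rewrite mulr0; rewrite E0.
have /andP[jK _] := vj; have [_ _ _ /(_ j jK)[_ [_ _]] H _] := k_spec.
apply: ae_mono _ H => x; rewrite /lam /eigval jK /e /gam /eigfun vj /E /Rintegral => <-.
by [].
Qed.

(** The rank-one term lambda_j g_j(x) g_j(y), up to null sets. For eigenvalue 0 the inverse is 0,
    which agrees with [e j] = 0 almost everywhere. *)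
Let F j x y := (lam j)^-1 * (e j x * e j y).
Let f j x := (lam j)^-1 * e j x ^+ 2.

Let f_ae j : {ae m, forall x, f j x = lam j * gam j x ^+ 2}.
Proof.
apply: ae_mono _ (e_ae j) => x; rewrite /f => ->.
have [->|l0] := eqVneq (lam j) 0; first by rewrite invr0 !mul0r.
by field.
Qed.

Let mf j : measurable_fun setT (f j).
Proof. by apply: measurable_funM => //; exact: (measurable_funX 2 (me j)). Qed.

Let mg2 j : measurable_fun setT (fun x => lam j * gam j x ^+ 2).
Proof. by apply: measurable_funM => //; exact: (measurable_funX 2 (mgam j)). Qed.

Let eL2 j : L2 m (e j).
Proof.
split; first exact: me.
apply: (@L1_ae _ (measurableTypeR R) _ _ _ (fun x => (lam j * gam j x) ^+ 2)).
- exact: (measurable_funX 2 (me j)).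
- exact: L2_sqr (L2Z _ (gamL2 j)).
- by apply: ae_mono _ (e_ae j) => x ->.
Qed.

Let fL1 j : L1 m (f j).
Proof. exact: L1Z (L2_sqr (eL2 j)). Qed.

Let Ef j : E m (f j) = lam j.
Proof.
transitivity (E m (fun x => lam j * (gam j x * gam j x))).
  apply: eq_E_ae; first exact: mf.
    by apply: measurable_funM => //; exact: (measurable_funM (mgam j) (mgam j)).
  by apply: ae_mono _ (f_ae j) => x ->; rewrite expr2.
rewrite EZ; last exact: (L2_mul (gamL2 j) (gamL2 j)).
rewrite (eigfun_orthonormal k_spec) eqxx /=.
case: (boolP (valid_index K j)) => vj; first by rewrite mulr1.
by rewrite /lam (eigval_invalid k_spec vj) mul0r.
Qed.

Let FL1 j : L1 P (fun w => F j (X w) (Y w)).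
Proof. by apply: L1Z; have [] := pair_mul (me j) (me j) (L2_L1 (eL2 j)) (L2_L1 (eL2 j)). Qed.

Let s n j := binned n (F j).

Let s_cvg j : s n j @[n --> \oo] --> lam j.
Proof.
rewrite -(Ef j).
have mabs : measurable_fun setT (fun x => (lam j)^-1 * `|e j x|).
  by apply: measurable_funM => //; exact: (measurableT_comp (@normr_measurable R setT) (me j)).
have Labs : L1 m (fun x => (lam j)^-1 * `|e j x|) by exact: L1Z (L1_norm (L2_L1 (eL2 j))).
have li : 0 <= (lam j)^-1 by rewrite invr_ge0.
apply: (binned_cvg (mf j) (fL1 j) mabs Labs (FL1 j)) => [x y|x]; last by rewrite mulr_ge0.
rewrite /f /F (_ : _ - _ = (lam j)^-1 * (e j x - e j y) ^+ 2); last first.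
  by move: (lam j)^-1 (e j x) (e j y) => p u v; ring.
rewrite mulr_ge0 ?sqr_ge0//= -mulrDr [leRHS]mulrCA; apply: ler_wpM2l => //.
rewrite -(real_normK (num_real _)) expr2 ler_pM//; exact: ler_normB.
Qed.

(** On each square the expectation factors into a square, hence is nonnegative; the upper bound is
    nonnegativity of the defect (e x - e y)^2 / lambda_j. *)
Let s_le n j : 0 <= s n j <= lam j.
Proof.
apply/andP; split.
  apply: sumr_ge0 => r _; rewrite mulr_ge0 ?invr_ge0 ?q_ge0//.
  have me1 : measurable_fun setT (fun x => e j x * bin n r x).
    by apply: measurable_funM => //; exact: bin_measurable.
  have [L1e E1] := pair_mul me1 me1 (Lmbin n r (me j) (L2_L1 (eL2 j))) (Lmbin n r (me j) (L2_L1 (eL2 j))).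
  rewrite (eq_E _ (g := fun w => (lam j)^-1 * (e j (X w) * bin n r (X w) * (e j (Y w) * bin n r (Y w))))); last first.
    by move=> w; rewrite /F /binXY; move: (lam j)^-1 (e j _) (e j _) (bin _ _ _) (bin _ _ _) => p u v y z; ring.
  by rewrite EZ// E1 mulr_ge0 ?invr_ge0// -expr2 sqr_ge0.
have li : 0 <= (lam j)^-1 by rewrite invr_ge0.
have H := binned_identity n (mf j) (fL1 j) (FL1 j).
have : 0 <= binned n (fun x y => f j x + f j y - 2 * F j x y).
  apply: binned_ge0 => x y.
  rewrite /f /F (_ : _ - _ = (lam j)^-1 * (e j x - e j y) ^+ 2); last first.
  by move: (lam j)^-1 (e j x) (e j y) => p u v; ring.
  by rewrite mulr_ge0 ?sqr_ge0.
have f0 x : 0 <= f j x by rewrite mulr_ge0 ?sqr_ge0.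
have Ht := binned_tail_le n (mf j) (fL1 j) f0; rewrite Ef in Ht.
rewrite /s => H0; move: H Ht H0; move: (\sum_(_ < _) _) (binned n (F j)) (binned n _) (lam j) => a c u l; lra.
Qed.

Let s_trunc n J : \sum_(j < J) s n j = binned n (trunc K lambda g J).
Proof.
rewrite /s /binned exchange_big /=; apply: eq_bigr => r _; rewrite -mulr_sumr; congr (_ * _).
have gL j : L1 P (fun w => gam j (X w) * gam j (Y w)).
  by have [] := pair_mul (mgam j) (mgam j) (L2_L1 (gamL2 j)) (L2_L1 (gamL2 j)).
rewrite (eq_E _ (g := fun w => \sum_(j < J) lam j * (gam j (X w) * gam j (Y w) * binXY n r w))); last first.
  by move=> w; rewrite /trunc mulr_suml; apply: eq_bigr => j _; rewrite -/(lam j) -/(gam j); move: (lam j) (gam j _) (gam j _) (binXY _ _ _) => p u v z; ring.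
rewrite E_sum => [|j _]; last by apply: L1Z; exact: (L1_bin (F := fun x y => gam j x * gam j y)).
apply: eq_bigr => j _; apply: eq_E_ae.
- exact: L1_meas (L1_bin n r (FL1 j)).
- by apply: L1_meas (L1Z _ (L1_bin (F := fun x y => gam j x * gam j y) n r (gL j))).
- apply: ae_mono2 _ (W_ae (@mW) (@lawW) (a := (b, 0%N)) (e_ae j)) (W_ae (@mW) (@lawW) (a := (b, 1%N)) (e_ae j)) => w.
  rewrite -/(X w) -/(Y w) /F => -> ->; have [->|l0] := eqVneq (lam j) 0; first by rewrite invr0 !mul0r.
  by field.
Qed.

(** For fixed n only finitely many bounded weights occur, so mean square convergence of the spectral
    series suffices. *)
Let s_series n : \sum_(j < J) s n j @[J --> \oo] --> binned n k.
Proof.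
under eq_cvg do rewrite s_trunc.
apply: cvg_bigsum => r; apply: cvgM; first exact: cvg_cst.
have kL2 := kernel_gram_L2 (@mW) (@indW) (@lawW) k_ex k_L2.
have tL2 J : L2 P (fun w => trunc K lambda g J (X w) (Y w)).
  by have [] := trunc_degenerate (@mW) (@indW) (@lawW) k_spec J.
have dL J : L2 P (fun w => k (X w) (Y w) - trunc K lambda g J (X w) (Y w)) by exact: L2B.
have Lk := L1_bin n r (L2_L1 kL2).
have Lt J := L1_bin n r (L2_L1 (tL2 J)).
apply/subr_cvg0; apply: cvg0_sqr.
apply: (@squeeze0 _ _ _ _ _ (trunc_cvg (@mW) (@indW) (@lawW) k_ex k_L2 k_spec)) => J; first exact: sqr_ge0.
rewrite -EB// -sqrrN -[- E P _]mulN1r -EZ; last exact: L1B.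
have mD : measurable_fun setT (fun w => (k (X w) (Y w) - trunc K lambda g J (X w) (Y w)) * binXY n r w).
  by apply: measurable_funM => //; exact: L2_meas (dL J).
have D2 : L2 P (fun w => (k (X w) (Y w) - trunc K lambda g J (X w) (Y w)) * binXY n r w).
  split => //; apply: (L1_le _ _ (L2_sqr (dL J))); first exact: measurable_funX.
  move=> w; have /andP[u0 u1] := binXY01 n r w; rewrite exprMn normrM ger0_norm ?sqr_ge0// ler_piMr ?sqr_ge0//.
  by rewrite ger0_norm ?sqr_ge0// expr_le1.
rewrite (eq_E _ (g := fun w => (k (X w) (Y w) - trunc K lambda g J (X w) (Y w)) * binXY n r w)); last by move=> w; ring.
apply: (le_trans (E_sqr_le D2)); apply: E_le; [exact: L2_sqr|exact: L2_sqr (dL J)|].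
move=> w; have /andP[u0 u1] := binXY01 n r w; rewrite exprMn ler_piMr ?sqr_ge0//.
by rewrite expr_le1.
Qed.

Lemma trace_formula : \sum_(j < n) eigval K lambda j @[n --> \oo] --> E m (fun z => kernel m z z).
Proof.
apply: (dominated_series s_le s_cvg s_series).
have [a [c [_ kE _]]] := kform.
have mdiag : measurable_fun setT (fun z : R => k z z) by exact: L1_meas kernel_diag_L1.
have kL2 := kernel_gram_L2 (@mW) (@indW) (@lawW) k_ex k_L2.
(* For the kernel the defect k(x, x) + k(y, y) - 2 k(x, y) is exactly |x - y|, hence the constant
   1/2. *)
apply: (binned_cvg (g := fun=> 2^-1) mdiag kernel_diag_L1 _ _ (L2_L1 kL2)) => //.
- exact: L1_cst.
- move=> x y; have -> : k x x + k y y - 2 * k x y = `|x - y|.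
    by rewrite /k !kE !subrr normr0; field.
  have -> : 2^-1 + 2^-1 = 1 :> R by field.
  by rewrite normr_ge0 mulr1 /=.
Qed.

End spectral.
End sample.

(** * The estimators in terms of the kernels *)

Section sums.
Variables (R : realType) (n : nat).
Implicit Types (F : nat -> nat -> R) (u v r s : nat -> R).

Lemma sum_neq u (i : 'I_n) : \sum_(j < n | (j : nat) != i) u j = \sum_(j < n) u j - u i.
Proof. by rewrite [in RHS](bigD1 i)//= addrAC subrr add0r. Qed.

Lemma sum_cst (t : R) : \sum_(i < n) t = n%:R * t.
Proof. by rewrite sumr_const card_ord mulr_natl. Qed.

Lemma exchange_neq F : \sum_(i < n) \sum_(j < n | (j : nat) != i) F i j =
  \sum_(j < n) \sum_(i < n | (i : nat) != j) F i j.
Proof. by rewrite (exchange_big_dep xpredT)//=; apply: eq_bigr => j _; apply: eq_bigl => i; rewrite eq_sym. Qed.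

Lemma sum_lt F : (forall i j, F i j = F j i) ->
  2 * \sum_(i < n) \sum_(j < n | (i < j)%N) F i j = \sum_(i < n) \sum_(j < n | (j : nat) != i) F i j.
Proof.
move=> FC.
have -> : \sum_(i < n) \sum_(j < n | (j : nat) != i) F i j =
  \sum_(i < n) \sum_(j < n | (i < j)%N) F i j + \sum_(i < n) \sum_(j < n | (j < i)%N) F i j.
  rewrite -big_split /=; apply: eq_bigr => i _.
  rewrite (bigID (fun j : 'I_n => (i < j)%N)) /=; congr (_ + _); apply: eq_bigl => j; by case: ltngtP.
have -> : \sum_(i < n) \sum_(j < n | (j < i)%N) F i j = \sum_(i < n) \sum_(j < n | (i < j)%N) F i j; last by ring.
by rewrite (exchange_big_dep xpredT)//=; apply: eq_bigr => j _; apply: eq_bigr => i _; exact: FC.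
Qed.

(** [r] and [s] are row corrections. As they sum to 0, only their products with the row sums of [B]
    and [A] and with each other survive, besides the constants. *)
Lemma bilinear_neq (A B : nat -> nat -> R) r s (al be : R) :
  (forall i j, A i j = A j i) -> (forall i j, B i j = B j i) ->
  \sum_(i < n) r i = 0 -> \sum_(i < n) s i = 0 ->
  let oA i := \sum_(j < n | (j : nat) != i) A i j in
  let oB i := \sum_(j < n | (j : nat) != i) B i j in
  \sum_(i < n) \sum_(j < n | (j : nat) != i) (A i j - r i - r j - al) * (B i j - s i - s j - be) =
  \sum_(i < n) \sum_(j < n | (j : nat) != i) A i j * B i j
  - 2 * \sum_(i < n) oA i * s i - 2 * \sum_(i < n) oB i * r i
  - be * \sum_(i < n) oA i - al * \sum_(i < n) oB i
  + (2 * n%:R - 4) * \sum_(i < n) r i * s i + n%:R * (n%:R - 1) * (al * be).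
Proof.
move=> AC BC r0 s0 oA oB.
have inner (i : 'I_n) : \sum_(j < n | (j : nat) != i) (A i j - r i - r j - al) * (B i j - s i - s j - be) =
   \sum_(j < n | (j : nat) != i) A i j * B i j - \sum_(j < n | (j : nat) != i) A j i * s j
   - \sum_(j < n | (j : nat) != i) B j i * r j
   + (\sum_(j < n) r j * s j - r i * s i)
   - (s i + be) * oA i - (r i + al) * oB i - (s i + be) * r i - (r i + al) * s i
   + (n%:R - 1) * ((r i + al) * (s i + be)).
  have -> : (n%:R - 1) * ((r i + al) * (s i + be)) = \sum_(j < n | (j : nat) != i) (r i + al) * (s i + be).
    by rewrite (sum_neq (fun=> (r i + al) * (s i + be))) sum_cst; ring.
  have -> : (s i + be) * r i = - \sum_(j < n | (j : nat) != i) (s i + be) * r j.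
    by rewrite -mulr_sumr sum_neq r0; ring.
  have -> : (r i + al) * s i = - \sum_(j < n | (j : nat) != i) (r i + al) * s j.
    by rewrite -mulr_sumr sum_neq s0; ring.
  rewrite -(sum_neq (fun j => r j * s j)) /oA /oB !opprK !mulr_sumr -!sumrN -!big_split /=.
  by apply: eq_bigr => j _; rewrite (AC j i) (BC j i); ring.
rewrite (eq_bigr _ (fun i _ => inner i)) !(big_split, sumrN) /=.
have -> : \sum_(i < n) \sum_(j < n | (j : nat) != i) A j i * s j = \sum_(i < n) oA i * s i.
  by rewrite (exchange_neq (fun i j => A j i * s j)); apply: eq_bigr => j _; rewrite -mulr_suml.
have -> : \sum_(i < n) \sum_(j < n | (j : nat) != i) B j i * r j = \sum_(i < n) oB i * r i.
  by rewrite (exchange_neq (fun i j => B j i * r j)); apply: eq_bigr => j _; rewrite -mulr_suml.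
have -> : \sum_(i < n) (s i + be) * oA i = \sum_(i < n) oA i * s i + be * \sum_(i < n) oA i.
  by rewrite mulr_sumr -big_split; apply: eq_bigr => i _ /=; ring.
have -> : \sum_(i < n) (r i + al) * oB i = \sum_(i < n) oB i * r i + al * \sum_(i < n) oB i.
  by rewrite mulr_sumr -big_split; apply: eq_bigr => i _ /=; ring.
have -> : \sum_(i < n) (s i + be) * r i = \sum_(i < n) r i * s i.
  transitivity (\sum_(i < n) r i * s i + be * \sum_(i < n) r i); last by rewrite r0; ring.
  by rewrite mulr_sumr -big_split; apply: eq_bigr => i _ /=; ring.
have -> : \sum_(i < n) (r i + al) * s i = \sum_(i < n) r i * s i.
  transitivity (\sum_(i < n) r i * s i + al * \sum_(i < n) s i); last by rewrite s0; ring.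
  by rewrite mulr_sumr -big_split; apply: eq_bigr => i _ /=; ring.
have -> : \sum_(i < n) (n%:R - 1) * ((r i + al) * (s i + be)) =
    (n%:R - 1) * (\sum_(i < n) r i * s i + n%:R * (al * be)).
  rewrite -mulr_sumr; congr (_ * _).
  transitivity (\sum_(i < n) (r i * s i + be * r i + al * s i + al * be)); first by apply: eq_bigr => i _; ring.
  rewrite !big_split /= -!mulr_sumr r0 s0 sum_cst; ring.
rewrite sum_cst.
move: (\sum_(i < n) r i * s i) (\sum_(i < n) oA i * s i) (\sum_(i < n) oB i * r i) => x y z; ring.
Qed.

(** The mean minimizes the sum of squared deviations. *)
Lemma centered_sqr u t : 
  \sum_(i < n) (u i - n%:R^-1 * \sum_(j < n) u j) ^+ 2 <= \sum_(i < n) (u i - t) ^+ 2.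
Proof.
have [->|n0] := eqVneq n 0%N; first by rewrite !big_ord0.
have nR : n%:R != 0 :> R by rewrite pnatr_eq0.
set mu := _ * _; rewrite -subr_ge0 -sumrB.
have -> : \sum_(i < n) ((u i - t) ^+ 2 - (u i - mu) ^+ 2) = n%:R * (mu - t) ^+ 2.
  transitivity (\sum_(i < n) (2 * (mu - t) * u i + (t ^+ 2 - mu ^+ 2))); first by apply: eq_bigr => i _; ring.
  rewrite big_split /= -mulr_sumr sum_cst.
  have -> : \sum_(i < n) u i = n%:R * mu by rewrite /mu mulrA divff ?mul1r.
  by ring.
by rewrite mulr_ge0 ?sqr_ge0.
Qed.

End sums.

(** [P] stands for n - 1 and [N] for n; the constants come from 1/P <= 2/N and are not sharp. The
    squares [c2] and [d2] of the centred terms carry the weight P^-2 and are absorbed into [x2] and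
    [y2]. *)
Lemma tilde_arith (R : realType) (P N s0 q0 o G1 G2 C a2 b2 c2 d2 x2 y2 : R) :
  1 <= P -> N = P + 1 -> 2 * `|G1| <= a2 + d2 -> 2 * `|G2| <= b2 + c2 -> 2 * `|C| <= c2 + d2 ->
  0 <= a2 -> 0 <= b2 -> 0 <= c2 -> 0 <= d2 -> c2 <= 4^-1 * x2 -> d2 <= 4^-1 * y2 ->
  `|P^-1 * (s0 - 2 / P * (2 * (q0 - N^-1 * o) + G1 + G2)
     + (2 * P - 2) / P ^+ 2 * (q0 - N^-1 * o + G1 + G2 + C) - (N * P)^-1 * o) - N^-1 * s0| <=
  2 * (N ^+ 2)^-1 * `|s0| + 16 * (N ^+ 2)^-1 * `|q0| + 20 * (N ^+ 3)^-1 * `|o| + 8 * (N ^+ 3)^-1 * (a2 + b2)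
  + 2 * ((N ^+ 2)^-1 * x2) + 2 * ((N ^+ 2)^-1 * y2).
Proof.
move=> P1 NE g1 g2 gc a0 b0 c0 d0 cx dy.
have P0 : 0 < P by lra.
have N0 : 0 < N by rewrite NE; lra.
have [u uE] : exists u, u = P^-1 by eexists.
have [v vE] : exists v, v = N^-1 by eexists.
have u0 : 0 < u by rewrite uE invr_gt0.
have v0 : 0 < v by rewrite vE invr_gt0.
have Pu : P * u = 1 by rewrite uE divff// gt_eqF.
have Nv : N * v = 1 by rewrite vE divff// gt_eqF.
have uv : u <= 2 * v.
  have -> : u = u * (N * v) by rewrite Nv mulr1.
  have -> : u * (N * v) = (P * u) * v + u * v by rewrite NE; ring.
  rewrite Pu; have : u <= 1 by rewrite uE invf_le1.
  by nra.
have -> : P^-1 * (s0 - 2 / P * (2 * (q0 - N^-1 * o) + G1 + G2) + (2 * P - 2) / P ^+ 2 * (q0 - N^-1 * o + G1 + G2 + C) - (N * P)^-1 * o) - N^-1 * s0 =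
   (u * v) * s0 - (2 * u ^+ 2 + 2 * u ^+ 3) * q0 + (v * (u ^+ 2 + 2 * u ^+ 3)) * o
   - (2 * u ^+ 3) * (G1 + G2) + (2 * u ^+ 2 - 2 * u ^+ 3) * C.
  by rewrite uE vE NE; field; lra.
have -> : (N ^+ 2)^-1 = v ^+ 2 by rewrite vE exprVn.
have -> : (N ^+ 3)^-1 = v ^+ 3 by rewrite vE exprVn.
have u1 : u <= 1 by rewrite uE invf_le1.
have u2 : u ^+ 2 <= 4 * v ^+ 2 by nra.
have u20 : 0 < u ^+ 2 by rewrite exprn_gt0.
have u30 : 0 < u ^+ 3 by rewrite exprn_gt0.
have u32 : u ^+ 3 <= u ^+ 2 by rewrite exprS; nra.
have u3 : u ^+ 3 <= 8 * v ^+ 3.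
  by rewrite !exprS expr0 !mulr1; move: u2; rewrite !expr2 => u2; nra.
have t1 : `|(u * v) * s0| <= 2 * v ^+ 2 * `|s0|.
  have uv0 : 0 <= u * v by rewrite mulr_ge0// ltW.
  by rewrite normrM (ger0_norm uv0); apply: ler_wpM2r => //; nra.
have t2 : `|(2 * u ^+ 2 + 2 * u ^+ 3) * q0| <= 16 * v ^+ 2 * `|q0|.
  by rewrite normrM ger0_norm; [rewrite ler_wpM2r//; lra|lra].
have t3 : `|(v * (u ^+ 2 + 2 * u ^+ 3)) * o| <= 20 * v ^+ 3 * `|o|.
  have w : v * (u ^+ 2 + 2 * u ^+ 3) <= 20 * v ^+ 3 by rewrite [v ^+ 3]exprS; nra.
  by rewrite normrM ger0_norm; [rewrite ler_wpM2r|rewrite mulr_ge0; lra].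
have t4 : `|(2 * u ^+ 3) * (G1 + G2)| <= 8 * v ^+ 3 * (a2 + b2) + u ^+ 2 * (c2 + d2).
  rewrite normrM ger0_norm; last lra.
  have := ler_normD G1 G2; nra.
have t5 : `|(2 * u ^+ 2 - 2 * u ^+ 3) * C| <= u ^+ 2 * (c2 + d2).
  rewrite normrM ger0_norm; last lra.
  have := normr_ge0 C; nra.
have t6 : 2 * (u ^+ 2 * (c2 + d2)) <= 2 * (v ^+ 2 * x2) + 2 * (v ^+ 2 * y2).
  have v20 : 0 < v ^+ 2 by rewrite exprn_gt0.
  nra.
have h1 := ler_normD ((u * v) * s0 - (2 * u ^+ 2 + 2 * u ^+ 3) * q0 + (v * (u ^+ 2 + 2 * u ^+ 3)) * o - (2 * u ^+ 3) * (G1 + G2)) ((2 * u ^+ 2 - 2 * u ^+ 3) * C).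
have h2 := ler_normB ((u * v) * s0 - (2 * u ^+ 2 + 2 * u ^+ 3) * q0 + (v * (u ^+ 2 + 2 * u ^+ 3)) * o) ((2 * u ^+ 3) * (G1 + G2)).
have h3 := ler_normD ((u * v) * s0 - (2 * u ^+ 2 + 2 * u ^+ 3) * q0) ((v * (u ^+ 2 + 2 * u ^+ 3)) * o).
have h4 := ler_normB ((u * v) * s0) ((2 * u ^+ 2 + 2 * u ^+ 3) * q0).
lra.
Qed.

(** * Both estimators as perturbed double sums of the kernels *)

Section estimators.
Variables (R : realType) (p : nat).
Hypothesis p0 : (0 < p)%N.
Let n := p.+1.

Section one.
Variables (x a : nat -> R) (c : R).
Let A i j : R := - 2^-1 * `|x i - x j| + a i + a j + c.
Definition offs (A : nat -> nat -> R) n (i : nat) := \sum_(j < n | (j : nat) != i) A i j.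
Definition center (a : nat -> R) n i := a i - n%:R^-1 * \sum_(j < n) a j.
(** The row correction made by the unbiased estimator. Averaging over j <> i does not annihilate a_i
    + a_j exactly; the centred [a] divided by n - 1 is what remains. *)
Definition resid (A : nat -> nat -> R) (a : nat -> R) n i :=
  (n%:R - 1)^-1 * (offs A n i - n%:R^-1 * \sum_(j < n) offs A n j + center a n i).

Lemma center_sum : \sum_(i < n) center a n i = 0.
Proof.
rewrite big_split /= sumrN sum_cst.
by rewrite mulrA divff ?mul1r ?subrr// pnatr_eq0.
Qed.

Lemma resid_sum B : \sum_(i < n) resid B a n i = 0.
Proof.
rewrite -mulr_sumr big_split /= center_sum addr0 big_split /= sumrN sum_cst.
by rewrite mulrA divff ?mul1r ?subrr ?mulr0// pnatr_eq0.
Qed.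

Lemma h_tildeE (i j : 'I_n) : (j : nat) != i ->
  h_tilde x n i j = A i j - resid A a n i - resid A a n j
    - (n%:R * (n%:R - 1))^-1 * \sum_(l < n) offs A n l.
Proof.
move=> ji.
have nR : n%:R != 0 :> R by rewrite pnatr_eq0.
have pR : n%:R - 1 != 0 :> R by rewrite /n -natr1 addrK pnatr_eq0 -lt0n.
pose S := \sum_(l < n) a l.
pose D (k : nat) := \sum_(l < n) `|x k - x l|.
pose DD := \sum_(k < n) D k.
have oE (k : 'I_n) : offs A n k = - 2^-1 * D k + (n%:R - 2) * a k + S + (n%:R - 1) * c.
  rewrite /offs (sum_neq (A k)) /A !big_split /= -mulr_sumr -/(D k) -/S !sum_cst.
  by rewrite subrr normr0; ring.
have OE : \sum_(k < n) offs A n k = - 2^-1 * DD + (2 * n%:R - 2) * S + n%:R * (n%:R - 1) * c.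
  rewrite (eq_bigr _ (fun k _ => oE k)) !big_split /= -!mulr_sumr -/S -/DD !sum_cst.
  by ring.
rewrite /h_tilde /mean_dist /grand_mean_dist -/(D i) -/(D j) -/DD /resid /center -/S OE !oE /A.
by move: (D i) (D j) (DD) (S) (a i) (a j) (n%:R) nR pR => d1 d2 d3 s a1 a2 N N0 N1; field; rewrite N0 N1.
Qed.

(** Double centring over all indices annihilates additive terms, so |x_k - x_l| may be replaced by
    the kernel with no remainder in [a] or [c]. *)
Lemma h_hatE (i j : 'I_n) :
  h_hat x n i j = A i j - n%:R^-1 * \sum_(l < n) A i l - n%:R^-1 * \sum_(l < n) A j l
    + (n%:R ^+ 2)^-1 * \sum_(k < n) \sum_(l < n) A k l.
Proof.
have nR : n%:R != 0 :> R by rewrite pnatr_eq0.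
pose S := \sum_(l < n) a l.
pose D (k : nat) := \sum_(l < n) `|x k - x l|.
pose DD := \sum_(k < n) D k.
have oE (k : 'I_n) : \sum_(l < n) A k l = - 2^-1 * D k + n%:R * a k + S + n%:R * c.
  rewrite /A !big_split /= -mulr_sumr -/(D k) -/S !sum_cst.
  by ring.
have OE : \sum_(k < n) \sum_(l < n) A k l = - 2^-1 * DD + 2 * n%:R * S + n%:R ^+ 2 * c.
  rewrite (eq_bigr _ (fun k _ => oE k)) !big_split /= -!mulr_sumr -/S -/DD !sum_cst.
  by ring.
rewrite /h_hat /mean_dist /grand_mean_dist -/(D i) -/(D j) -/DD OE !oE /A.
by move: (D i) (D j) (DD) (S) (a i) (a j) (n%:R) nR => d1 d2 d3 s a1 a2 N N0; field.
Qed.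

End one.

Lemma h_tildeC (x : nat -> R) m i j : h_tilde x m i j = h_tilde x m j i.
Proof. by rewrite /h_tilde distrC; congr (_ * (_ + _)); exact: addrAC. Qed.

Section two.
Variables (x y a b : nat -> R) (c c' : R).
Let A i j : R := - 2^-1 * `|x i - x j| + a i + a j + c.
Let B i j : R := - 2^-1 * `|y i - y j| + b i + b j + c'.
Let oA i := offs A n i.
Let oB i := offs B n i.

Let AC i j : A i j = A j i.
Proof. by rewrite /A distrC; ring. Qed.

Let BC i j : B i j = B j i.
Proof. by rewrite /B distrC; ring. Qed.

Lemma kappa_tildeE :
  let Q := \sum_(i < n) oA i * oB i - n%:R^-1 * ((\sum_(i < n) oA i) * \sum_(i < n) oB i) in
  let G1 := \sum_(i < n) oA i * center b n i in
  let G2 := \sum_(i < n) oB i * center a n i in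
  let C := \sum_(i < n) center a n i * center b n i in
  n%:R * kappa_tilde x y n = p%:R^-1 * (\sum_(i < n) \sum_(j < n | (j : nat) != i) A i j * B i j
    - 2 / p%:R * (2 * Q + G1 + G2) + (2 * p%:R - 2) / p%:R ^+ 2 * (Q + G1 + G2 + C)
    - (n%:R * p%:R)^-1 * ((\sum_(i < n) oA i) * \sum_(i < n) oB i)).
Proof.
move=> Q G1 G2 C.
have nR : n%:R != 0 :> R by rewrite pnatr_eq0.
have pE : n%:R - 1 = p%:R :> R by rewrite /n -natr1 addrK.
have pR : p%:R != 0 :> R by rewrite pnatr_eq0 -lt0n.
pose al := (n%:R * p%:R)^-1 * \sum_(i < n) oA i.
pose be := (n%:R * p%:R)^-1 * \sum_(i < n) oB i.
pose r i := resid A a n i; pose s i := resid B b n i.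
have bil := bilinear_neq al be AC BC (resid_sum a A) (resid_sum b B).
have hE : \sum_(i < n) \sum_(j < n | (j : nat) != i) h_tilde x n i j * h_tilde y n i j =
    \sum_(i < n) \sum_(j < n | (j : nat) != i) (A i j - r i - r j - al) * (B i j - s i - s j - be).
  apply: eq_bigr => i _; apply: eq_bigr => j ji.
  by rewrite (h_tildeE x a c ji) (h_tildeE y b c' ji) pE.
have symE : forall i j, h_tilde x n i j * h_tilde y n i j = h_tilde x n j i * h_tilde y n j i.
  by move=> i j; rewrite (h_tildeC x) (h_tildeC y).
have S2 := sum_lt n symE.
have sumb : \sum_(i < n) center b n i = 0 by exact: center_sum.
have suma : \sum_(i < n) center a n i = 0 by exact: center_sum.
have [mA mAE] : exists m : R, m = n%:R^-1 * \sum_(i < n) oA i by eexists.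
have [mB mBE] : exists m : R, m = n%:R^-1 * \sum_(i < n) oB i by eexists.
have rE i : r i = p%:R^-1 * (oA i - mA + center a n i) by rewrite /r /resid pE mAE.
have sE i : s i = p%:R^-1 * (oB i - mB + center b n i) by rewrite /s /resid pE mBE.
have rs1 : \sum_(i < n) oA i * s i = p%:R^-1 * (Q + G1).
  transitivity (p%:R^-1 * (\sum_(i < n) oA i * oB i - mB * \sum_(i < n) oA i + G1)); last by rewrite mBE /Q; ring.
  rewrite !mulr_sumr -sumrN -!big_split /= mulr_sumr; apply: eq_bigr => i _.
  by rewrite sE; ring.
have rs2 : \sum_(i < n) oB i * r i = p%:R^-1 * (Q + G2).
  transitivity (p%:R^-1 * (\sum_(i < n) oA i * oB i - mA * \sum_(i < n) oB i + G2)); last by rewrite mAE /Q; ring.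
  rewrite !mulr_sumr -sumrN -!big_split /= mulr_sumr; apply: eq_bigr => i _.
  by rewrite rE; ring.
have rs3 : \sum_(i < n) r i * s i = p%:R^-1 ^+ 2 * (Q + G1 + G2 + C).
  have su : \sum_(i < n) r i * s i = p%:R^-1 * (\sum_(i < n) oA i * s i - mA * \sum_(i < n) s i
      + \sum_(i < n) center a n i * s i).
    rewrite !mulr_sumr -sumrN -!big_split /= mulr_sumr; apply: eq_bigr => i _.
    by rewrite rE; ring.
  have su2 : \sum_(i < n) center a n i * s i = p%:R^-1 * (G2 + C).
    transitivity (p%:R^-1 * (G2 - mB * \sum_(i < n) center a n i + C)); last by rewrite suma; ring.
    rewrite !mulr_sumr -sumrN -!big_split /= mulr_sumr; apply: eq_bigr => i _.
    by rewrite sE; ring.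
  by rewrite su rs1 su2 (resid_sum b B); ring.
rewrite /kappa_tilde pE.
have -> : n%:R * (2 / (n%:R * p%:R) * (\sum_(i < n) \sum_(j < n | (i < j)%N) h_tilde x n i j * h_tilde y n i j)) =
   p%:R^-1 * (2 * (\sum_(i < n) \sum_(j < n | (i < j)%N) h_tilde x n i j * h_tilde y n i j)).
  by field; rewrite nR pR.
rewrite S2 hE bil pE -/(oA _) -/(oB _) rs1 rs2 rs3 /al /be.
have nE : n%:R = p%:R + 1 :> R by rewrite natr1.
move: nR; rewrite nE.
move: (\sum_(i < n) \sum_(j < n | (j : nat) != i) A i j * B i j) (\sum_(i < n) oA i) (\sum_(i < n) oB i) (Q) (G1) (G2) (C) (p%:R) pR => s1 s2 s3 q g1 g2 cc P P0 P1.
by field; rewrite P0 P1.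
Qed.

Lemma kappa_hatE : n%:R * kappa_hat x y n = n%:R^-1 * (\sum_(i < n) \sum_(j < n) A i j * B i j
    - 2 / n%:R * \sum_(i < n) (\sum_(j < n) A i j) * (\sum_(j < n) B i j)
    + (n%:R ^+ 2)^-1 * ((\sum_(i < n) \sum_(j < n) A i j) * \sum_(i < n) \sum_(j < n) B i j)).
Proof.
have nR : n%:R != 0 :> R by rewrite pnatr_eq0.
have [rA rAE] : exists r : nat -> R, forall i, r i = \sum_(j < n) A i j by eexists.
have [rB rBE] : exists r : nat -> R, forall i, r i = \sum_(j < n) B i j by eexists.
have [SA SAE] : exists t : R, t = \sum_(i < n) rA i by eexists.
have [SB SBE] : exists t : R, t = \sum_(i < n) rB i by eexists.
have colA (j : 'I_n) : \sum_(i < n) A i j = rA j by rewrite rAE; apply: eq_bigr => i _; exact: AC.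
have colB (j : 'I_n) : \sum_(i < n) B i j = rB j by rewrite rBE; apply: eq_bigr => i _; exact: BC.
have -> : \sum_(i < n) \sum_(j < n) A i j = SA by rewrite SAE; apply: eq_bigr => i _; rewrite rAE.
have -> : \sum_(i < n) \sum_(j < n) B i j = SB by rewrite SBE; apply: eq_bigr => i _; rewrite rBE.
have -> : \sum_(i < n) (\sum_(j < n) A i j) * (\sum_(j < n) B i j) = \sum_(i < n) rA i * rB i.
  by apply: eq_bigr => i _; rewrite rAE rBE.
have inner (i : 'I_n) : \sum_(j < n) h_hat x n i j * h_hat y n i j =
    \sum_(j < n) A i j * B i j
    - n%:R^-1 * \sum_(j < n) A j i * rB j - n%:R^-1 * \sum_(j < n) B j i * rA j + n%:R^-1 ^+ 2 * \sum_(j < n) rA j * rB j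
    - n%:R^-1 * (rA i * rB i) - n%:R^-1 * (rA i * rB i) + n%:R * (n%:R^-1 ^+ 2 * (rA i * rB i))
    + n%:R^-1 ^+ 2 * (rA i * SB) + n%:R^-1 ^+ 2 * (rB i * SA)
    + (n%:R ^+ 2)^-1 * (rA i * SB) + (n%:R ^+ 2)^-1 * (rB i * SA)
    - (n%:R * n%:R^-1 * (n%:R ^+ 2)^-1) * (rA i * SB) - (n%:R * n%:R^-1 * (n%:R ^+ 2)^-1) * (rB i * SA)
    - (n%:R ^+ 2)^-1 * n%:R^-1 * (SA * SB) - (n%:R ^+ 2)^-1 * n%:R^-1 * (SA * SB)
    + n%:R * ((n%:R ^+ 2)^-1 ^+ 2 * (SA * SB)).
  transitivity (\sum_(j < n) (A i j - n%:R^-1 * rA i - n%:R^-1 * rA j + (n%:R ^+ 2)^-1 * SA) *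
       (B i j - n%:R^-1 * rB i - n%:R^-1 * rB j + (n%:R ^+ 2)^-1 * SB)).
    have SA2 : \sum_(i < n) \sum_(j < n) A i j = SA by rewrite SAE; apply: eq_bigr => l _; rewrite rAE.
    have SB2 : \sum_(i < n) \sum_(j < n) B i j = SB by rewrite SBE; apply: eq_bigr => l _; rewrite rBE.
    by apply: eq_bigr => j _; rewrite (h_hatE x a c i j) (h_hatE y b c' i j) SA2 SB2 !rAE !rBE.
  have [u uE] : exists u : R, u = n%:R^-1 by eexists.
  have [v vE] : exists v : R, v = (n%:R ^+ 2)^-1 by eexists.
  rewrite -uE -vE.
  transitivity (\sum_(j < n) A i j * B i j - u * \sum_(j < n) A j i * rB j - u * \sum_(j < n) B j i * rA j
     + u ^+ 2 * \sum_(j < n) rA j * rB j + (v * SB - u * rB i) * \sum_(j < n) A i j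
     + (v * SA - u * rA i) * \sum_(j < n) B i j
     - u * (v * SB - u * rB i) * \sum_(j < n) rA j - u * (v * SA - u * rA i) * \sum_(j < n) rB j
     + \sum_(j < n) (v * SA - u * rA i) * (v * SB - u * rB i)).
    rewrite !mulr_sumr -!sumrN -!big_split /=; apply: eq_bigr => j _.
    by rewrite (AC j i) (BC j i); ring.
  by rewrite -rAE -rBE -SAE -SBE sum_cst; ring.
rewrite /kappa_hat (eq_bigr _ (fun i _ => inner i)) !(big_split, sumrN) /= -!mulr_sumr.
have cross (F : nat -> nat -> R) (r : nat -> R) (f : nat -> R) :
    (forall j : 'I_n, \sum_(i < n) F j i = f j) ->
    \sum_(i < n) \sum_(j < n) F j i * r j = \sum_(j < n) f j * r j.
  move=> Ff; rewrite exchange_big /=; apply: eq_bigr => j _.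
  by rewrite -mulr_suml Ff.
rewrite (cross A rB rA) => [|j]; last by rewrite rAE.
rewrite (cross B rA rB) => [|j]; last by rewrite rBE.
rewrite -!mulr_suml -SAE -SBE !sum_cst.
have -> : \sum_(j < n) rB j * rA j = \sum_(j < n) rA j * rB j by apply: eq_bigr => j _; rewrite mulrC.
clear -nR; move: (\sum_(i < n) \sum_(j < n) A i j * B i j) (\sum_(j < n) rA j * rB j) (n%:R) nR => s1 s2 N N0.
by field.
Qed.

(** Full row sums consist of the diagonal entry and the off-diagonal sum. The diagonal enters with
    first moments only, and no bare sample value occurs. *)
Lemma kappa_hat_error :
  `|n%:R * kappa_hat x y n - n%:R^-1 * (\sum_(i < n) \sum_(j < n | (j : nat) != i) A i j * B i j)
     - n%:R^-1 * \sum_(i < n) A i i * B i i| <=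
  2 * (n%:R ^+ 2)^-1 * (`|\sum_(i < n) oA i * oB i| + \sum_(i < n) `|A i i| * `|oB i|
     + \sum_(i < n) `|oA i| * `|B i i| + \sum_(i < n) `|A i i| * `|B i i|)
  + (n%:R ^+ 3)^-1 * ((\sum_(i < n) `|A i i| + `|\sum_(i < n) oA i|) *
      (\sum_(i < n) `|B i i| + `|\sum_(i < n) oB i|)).
Proof.
have nR : n%:R != 0 :> R by rewrite pnatr_eq0.
have n0 : 0 < n%:R :> R by rewrite ltr0n.
have rowA (i : 'I_n) : \sum_(j < n) A i j = A i i + oA i by rewrite /oA /offs (sum_neq (A i)); ring.
have rowB (i : 'I_n) : \sum_(j < n) B i j = B i i + oB i by rewrite /oB /offs (sum_neq (B i)); ring.
have rowAB (i : 'I_n) : \sum_(j < n) A i j * B i j = \sum_(j < n | (j : nat) != i) A i j * B i j + A i i * B i i.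
  by rewrite (sum_neq (fun j => A i j * B i j)); ring.
rewrite kappa_hatE (eq_bigr _ (fun i _ => rowAB i)) big_split /=.
rewrite (eq_bigr _ (fun i _ => rowA i)) (eq_bigr _ (fun i _ => rowB i)).
have -> : \sum_(i < n) (\sum_(j < n) A i j) * (\sum_(j < n) B i j) =
   \sum_(i < n) oA i * oB i + \sum_(i < n) A i i * oB i + \sum_(i < n) oA i * B i i + \sum_(i < n) A i i * B i i.
  by rewrite -!big_split /=; apply: eq_bigr => i _; rewrite rowA rowB; ring.
have -> : \sum_(i < n) (A i i + oA i) = \sum_(i < n) A i i + \sum_(i < n) oA i by rewrite big_split.
have -> : \sum_(i < n) (B i i + oB i) = \sum_(i < n) B i i + \sum_(i < n) oB i by rewrite big_split.
have nt (f : nat -> R) : `|\sum_(i < n) f i| <= \sum_(i < n) `|f i| by exact: ler_norm_sum.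
have nM (f g : nat -> R) : `|\sum_(i < n) f i * g i| <= \sum_(i < n) `|f i| * `|g i|.
  by apply: (le_trans (nt (fun i => f i * g i))); apply: ler_sum => i _; rewrite normrM.
have h1 := nM (fun i => A i i) oB; have h2 := nM oA (fun i => B i i); have h3 := nM (fun i => A i i) (fun i => B i i).
have h4 := nt (fun i => A i i); have h5 := nt (fun i => B i i).
set s0 := \sum_(i < n) \sum_(j < n | _) _; set q0 := \sum_(i < n) oA i * oB i.
set q1 := \sum_(i < n) A i i * oB i in h1 *; set q2 := \sum_(i < n) oA i * B i i in h2 *; set q3 := \sum_(i < n) A i i * B i i in h3 *.
set ta := \sum_(i < n) A i i in h4 *; set tb := \sum_(i < n) B i i in h5 *.
set oa := \sum_(i < n) oA i; set ob := \sum_(i < n) oB i.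
have -> : n%:R^-1 * (s0 + q3 - 2 / n%:R * (q0 + q1 + q2 + q3) + (n%:R ^+ 2)^-1 * ((ta + oa) * (tb + ob))) - n%:R^-1 * s0 - n%:R^-1 * q3
   = - (2 * (n%:R ^+ 2)^-1 * (q0 + q1 + q2 + q3)) + (n%:R ^+ 3)^-1 * ((ta + oa) * (tb + ob)).
  by clear -nR; move: s0 q0 q1 q2 q3 ta tb oa ob => ? ? ? ? ? ? ? ? ?; move: (n%:R) nR => N N0; field.
apply: (le_trans (ler_normD _ _)); rewrite normrN; apply: lerD.
  rewrite normrM (ger0_norm (x := 2 * _)); last by rewrite mulr_ge0// invr_ge0 exprn_ge0// ltW.
  apply: ler_wpM2l; first by rewrite mulr_ge0// invr_ge0 exprn_ge0// ltW.
  apply: (le_trans (ler_normD _ _)); apply: lerD => //.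
  apply: (le_trans (ler_normD _ _)); apply: lerD => //.
  by apply: (le_trans (ler_normD _ _)); apply: lerD.
rewrite normrM (ger0_norm (x := (n%:R ^+ 3)^-1)); last by rewrite invr_ge0 exprn_ge0// ltW.
apply: ler_wpM2l; first by rewrite invr_ge0 exprn_ge0// ltW.
rewrite normrM; apply: ler_pM => //.
  by apply: (le_trans (ler_normD _ _)); apply: lerD.
by apply: (le_trans (ler_normD _ _)); apply: lerD.
Qed.

(** Products with the centred [a] or [b] are bounded by sums of squares. As [a] is 1/2-Lipschitz,
    centring about the mean costs at most 1/4 of the sum of (x_i - z0)^2; this is the one place
    where the sample itself enters. *)
Lemma kappa_tilde_error (a0 b0 z0 w0 : R) :
  (forall i, `|a i - a0| <= 2^-1 * `|x i - z0|) -> (forall i, `|b i - b0| <= 2^-1 * `|y i - w0|) ->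
  `|n%:R * kappa_tilde x y n - n%:R^-1 * (\sum_(i < n) \sum_(j < n | (j : nat) != i) A i j * B i j)| <=
  2 * (n%:R ^+ 2)^-1 * `|\sum_(i < n) \sum_(j < n | (j : nat) != i) A i j * B i j|
  + 16 * (n%:R ^+ 2)^-1 * `|\sum_(i < n) oA i * oB i|
  + 20 * (n%:R ^+ 3)^-1 * (`|\sum_(i < n) oA i| * `|\sum_(i < n) oB i|)
  + 8 * (n%:R ^+ 3)^-1 * (\sum_(i < n) oA i ^+ 2 + \sum_(i < n) oB i ^+ 2)
  + 2 * ((n%:R ^+ 2)^-1 * (\sum_(i < n) (x i - z0) ^+ 2))
  + 2 * ((n%:R ^+ 2)^-1 * (\sum_(i < n) (y i - w0) ^+ 2)).
Proof.
move=> aL bL.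
have nE : n%:R = p%:R + 1 :> R by rewrite natr1.
have P1 : 1 <= p%:R :> R by rewrite ler1n.
have AM (f g : nat -> R) : 2 * `|\sum_(i < n) f i * g i| <= \sum_(i < n) f i ^+ 2 + \sum_(i < n) g i ^+ 2.
  apply: (@le_trans _ _ (2 * \sum_(i < n) `|f i * g i|)); first by rewrite ler_wpM2l// ler_norm_sum.
  rewrite mulr_sumr -big_split /=; apply: ler_sum => i _.
  rewrite -(real_normK (num_real (f i))) -(real_normK (num_real (g i))) normrM.
  by have := sqr_ge0 (`|f i| - `|g i|); nra.
have ctr (u : nat -> R) (t : R) (v : nat -> R) (s : R) : (forall i, `|u i - t| <= 2^-1 * `|v i - s|) ->
    \sum_(i < n) center u n i ^+ 2 <= 4^-1 * \sum_(i < n) (v i - s) ^+ 2.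
  move=> H; apply: (le_trans (centered_sqr n u t)).
  rewrite mulr_sumr; apply: ler_sum => i _.
  rewrite -(real_normK (num_real (u i - t))) -(real_normK (num_real (v i - s))).
  have := H i; have := normr_ge0 (u i - t); nra.
have ca := ctr _ _ _ _ aL; have cb := ctr _ _ _ _ bL.
have g1 := AM oA (center b n); have g2 := AM oB (center a n); have gc := AM (center a n) (center b n).
rewrite kappa_tildeE /=.
set s0 := \sum_(i < n) \sum_(j < n | _) _; set q0 := \sum_(i < n) oA i * oB i.
set oa := \sum_(i < n) oA i; set ob := \sum_(i < n) oB i.
set G1 := \sum_(i < n) oA i * center b n i in g1 *; set G2 := \sum_(i < n) oB i * center a n i in g2 *.
set C := \sum_(i < n) center a n i * center b n i in gc *.
set a2 := \sum_(i < n) oA i ^+ 2 in g1 *; set b2 := \sum_(i < n) oB i ^+ 2 in g2 *.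
set c2 := \sum_(i < n) center a n i ^+ 2 in ca g2 gc *; set d2 := \sum_(i < n) center b n i ^+ 2 in cb g1 gc *.
set x2 := \sum_(i < n) (x i - z0) ^+ 2 in ca *; set y2 := \sum_(i < n) (y i - w0) ^+ 2 in cb *.
have a20 : 0 <= a2 by apply: sumr_ge0 => i _; exact: sqr_ge0.
have b20 : 0 <= b2 by apply: sumr_ge0 => i _; exact: sqr_ge0.
have c20 : 0 <= c2 by apply: sumr_ge0 => i _; exact: sqr_ge0.
have d20 : 0 <= d2 by apply: sumr_ge0 => i _; exact: sqr_ge0.
have H := @tilde_arith R p%:R n%:R s0 q0 (oa * ob) G1 G2 C a2 b2 c2 d2 x2 y2 P1 nE g1 g2 gc a20 b20 c20 d20 ca cb.
rewrite normrM in H; exact: H.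
Qed.

End two.
End estimators.

(** * Convergence in probability and the law of large numbers *)

Lemma double_limit0 (R : realType) (u : nat -> R) (a : nat -> R) (c : nat -> nat -> R) :
  (forall n, 0 <= u n) -> (forall m n, u n <= a m + c m n) ->
  a m @[m --> \oo] --> 0 -> (forall m, c m n @[n --> \oo] --> 0) -> u n @[n --> \oo] --> 0.
Proof.
move=> u0 uac /cvgrPdist_lt a0 c0; apply/cvgrPdist_lt => e e0.
have e20 : 0 < e / 2 by rewrite divr_gt0.
have [m _ /(_ m (leqnn m)) am] := a0 _ e20.
have /cvgrPdist_lt /(_ _ e20) := c0 m; apply: filterS => n.
rewrite !sub0r !normrN in am * => cn.
rewrite ger0_norm//; apply: (le_lt_trans (uac m n)).
by have := ler_norm (a m); have := ler_norm (c m n); lra.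
Qed.

Section rho.
Context d (T : measurableType d) (R : realType) (P : probability T R).
Implicit Types U V : T -> R.

(* Metrizes convergence in probability. *)
Definition rho U := E P (fun w => Num.min 1 `|U w|).

Lemma min1_L1 U : measurable_fun setT U -> L1 P (fun w => Num.min 1 `|U w|).
Proof.
move=> mU; apply: (@L1_bounded _ _ _ _ _ 1).
  by apply: measurable_minr => //; exact: measurableT_comp.
by move=> w; rewrite ger0_norm ?ge_min ?lexx// le_min ler01 normr_ge0.
Qed.

Lemma rho_ge0 U : 0 <= rho U.
Proof. by apply: E_ge0 => w; rewrite le_min ler01 normr_ge0. Qed.

Lemma rho_le U V : measurable_fun setT U -> measurable_fun setT V ->
  (forall w, `|U w| <= `|V w|) -> rho U <= rho V.
Proof.
move=> mU mV UV; apply: E_le; [exact: min1_L1|exact: min1_L1|] => w.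
by rewrite le_min !ge_min lexx /= UV orbT.
Qed.

Lemma min1D (a b : R) : 0 <= a -> 0 <= b -> Num.min 1 (a + b) <= Num.min 1 a + Num.min 1 b.
Proof. by move=> a0 b0; rewrite !minElt; do ![case: ifP => ?]; lra. Qed.

Lemma rhoD U V : measurable_fun setT U -> measurable_fun setT V ->
  rho (fun w => U w + V w) <= rho U + rho V.
Proof.
move=> mU mV; rewrite -ED; [|exact: min1_L1|exact: min1_L1].
apply: E_le; [by apply: min1_L1; exact: measurable_funD|by apply: L1D; exact: min1_L1|] => w.
apply: le_trans (min1D (normr_ge0 _) (normr_ge0 _)).
by rewrite le_min !ge_min lexx /= ler_normD orbT.
Qed.

Lemma rho_le_E U : L1 P U -> rho U <= E P (fun w => `|U w|).
Proof.
move=> LU; apply: E_le; [exact: min1_L1 (L1_meas LU)|exact: L1_norm|] => w.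
by rewrite ge_min lexx orbT.
Qed.

Lemma E_norm_sqr_le U : L2 P U -> E P (fun w => `|U w|) ^+ 2 <= E P (fun w => U w ^+ 2).
Proof.
move=> [mU LU]; have L : L2 P (fun w => `|U w|).
  split; first exact: measurableT_comp.
  by apply: eq_L1 LU => w; rewrite real_normK ?num_real.
have <- : E P (fun w => `|U w| ^+ 2) = E P (fun w => U w ^+ 2).
  by apply: eq_E => w; rewrite real_normK ?num_real.
exact: E_sqr_le.
Qed.

Lemma rho_le_sqr U : L2 P U -> rho U ^+ 2 <= E P (fun w => U w ^+ 2).
Proof.
move=> LU; apply: le_trans (E_norm_sqr_le LU).
rewrite ler_pXn2r ?nnegrE ?rho_ge0//; last exact: E_ge0.
exact: rho_le_E (L2_L1 LU).
Qed.

(** Values in [0, 1] differ by at most 1 <= K, so the truncated distance [rho] suffices in place of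
    a first moment. *)
Lemma E_lipschitz (F : R -> R) (K : R) U V : 1 <= K -> measurable_fun setT U -> measurable_fun setT V ->
  (forall x, 0 <= F x <= 1) -> (forall x y, `|F x - F y| <= K * `|x - y|) ->
  `|E P (fun w => F (U w)) - E P (fun w => F (V w))| <= K * rho (fun w => U w - V w).
Proof.
move=> K1 mU mV F01 FK; have mF := lipschitz_measurable FK.
have LF W : measurable_fun setT W -> L1 P (fun w => F (W w)).
  move=> mW; apply: (@L1_bounded _ _ _ _ _ 1); first exact: measurableT_comp.
  by move=> w; have /andP[F0 F1] := F01 (W w); rewrite ger0_norm.
have mB : measurable_fun setT (fun w => U w - V w) by exact: measurable_funB.
rewrite -EB; [|exact: LF|exact: LF].
apply: (le_trans (E_norm (L1B (LF _ mU) (LF _ mV)))).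
rewrite /rho -EZ; last exact: min1_L1.
apply: E_le; [by apply: L1_norm; apply: L1B; exact: LF|by apply: L1Z; exact: min1_L1|] => w.
have /andP[a0 a1] := F01 (U w); have /andP[b0 b1] := F01 (V w).
have h : `|F (U w) - F (V w)| <= 1 by rewrite ler_norml; apply/andP; split; lra.
by rewrite minElt; case: ifP => _; [rewrite mulr1; exact: le_trans K1|exact: FK].
Qed.

End rho.

Lemma uncorrelated_sqr d (T : measurableType d) (R : realType) (P : probability T R)
    (I : eqType) (s : seq I) (xi : I -> T -> R) : uniq s -> (forall i, L2 P (xi i)) ->
  (forall i j, i != j -> E P (fun w => xi i w * xi j w) = 0) ->
  E P (fun w => (\sum_(i <- s) xi i w) ^+ 2) = \sum_(i <- s) E P (fun w => xi i w ^+ 2).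
Proof.
move=> us Lxi orth; elim: s us => [_|i s IH /andP[si us]].
  by rewrite big_nil; under eq_E do rewrite big_nil expr0n; rewrite E0.
have LS : L2 P (fun w => \sum_(j <- s) xi j w) by apply: L2_sum.
rewrite (eq_E _ (g := fun w => xi i w ^+ 2 + 2 * (xi i w * \sum_(j <- s) xi j w) + (\sum_(j <- s) xi j w) ^+ 2)); last first.
  by move=> w; rewrite big_cons; ring.
have L1x : L1 P (fun w => xi i w * \sum_(j <- s) xi j w) by exact: L2_mul.
rewrite ED; [|by apply: L1D; [exact: L2_sqr|exact: L1Z]|exact: L2_sqr].
rewrite ED; [|exact: L2_sqr|exact: L1Z].
rewrite EZ// IH// big_cons.
have -> : E P (fun w => xi i w * \sum_(j <- s) xi j w) = 0; last by rewrite mulr0 addr0.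
under eq_E do rewrite mulr_sumr.
rewrite E_sum => [|j _]; last exact: L2_mul.
rewrite big_seq big1// => j js; apply: orth; apply: contraNneq si => ->.
by rewrite js.
Qed.

(** * The law of large numbers in mean *)

Section lln.
Context d d' (T : measurableType d) (S : measurableType d') (R : realType)
  (P : probability T R) (I : choiceType) (X : I -> T -> S).
Hypothesis mX : forall i, measurable_fun setT (X i).
Hypothesis indX : independent_family P X.
Variables (J : nat -> set I) (eta : nat -> T -> R).
Hypothesis dJ : forall i j, i != j -> J i `&` J j = set0.
Hypothesis meta : forall i, J_measurable X (J i) (eta i).
Hypothesis Leta : L1 P (eta 0%N).
Hypothesis same : forall i (psi : R -> R), measurable_fun setT psi -> L1 P (fun w => psi (eta 0%N w)) ->
  L1 P (fun w => psi (eta i w)) /\ E P (fun w => psi (eta i w)) = E P (fun w => psi (eta 0%N w)).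

Let clip (K x : R) := Num.max (Num.min x K) (- K).

Let mclip K : measurable_fun setT (clip K).
Proof. by apply: measurable_maxr => //; exact: measurable_minr. Qed.

Let clip_le K x : 0 <= K -> `|clip K x| <= K.
Proof. by move=> K0; rewrite ler_norml /clip le_max ge_max ge_min !lexx !orbT /=; lra. Qed.

Let clip_dist K x : 0 <= K -> `|x - clip K x| <= `|x|.
Proof.
move=> K0; rewrite /clip; have [h|h] := leP x K; have [h'|h'] := leP _ (- K); rewrite ?subrr ?normr0//;
  by rewrite ler_norml; case: (ger0P x) => h2; apply/andP; split; lra.
Qed.

(** Only a first moment is available for the diagonal terms to which this is applied. Clipping at
    level m costs at most 2 E|eta - clip eta|; the clipped and centred variables are uncorrelated,
    so their mean has second moment at most (2m)^2/n. *)
Lemma lln : E P (fun w => `|n%:R^-1 * \sum_(i < n) eta i w - E P (eta 0%N)|) @[n --> \oo] --> 0.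
Proof.
have mid : measurable_fun setT (@id R) by [].
have Li i : L1 P (eta i) by have [] := @same i id mid Leta.
pose r m := E P (fun w => `|eta 0%N w - clip m%:R (eta 0%N w)|).
have mr m : measurable_fun setT (fun x : R => `|x - clip m%:R x|).
  by apply: measurableT_comp => //; apply: measurable_funB => //; exact: mclip.
have Lr m : L1 P (fun w => `|eta 0%N w - clip m%:R (eta 0%N w)|).
  apply: (L1_le _ _ (L1_norm Leta)); first exact: (measurableT_comp (mr m) (L1_meas Leta)).
  by move=> w; rewrite normr_id clip_dist.
have r0 : r m @[m --> \oo] --> 0.
  rewrite -(E0 P); apply: (E_dominated _ _ (L1_norm Leta)).
  - by move=> m; exact: L1_meas (Lr m).
  - move=> w; apply: cvg_near_cst; near=> m.
    have : `|eta 0%N w| <= m%:R by near: m; exact: nbhs_infty_ger.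
    rewrite ler_norml => /andP[h1 h2]; rewrite /clip (min_idPl h2) (max_idPl h1).
    by rewrite subrr normr0.
  - by move=> m w; rewrite normr_id clip_dist.
pose xi m i w := clip m%:R (eta i w) - E P (fun w => clip m%:R (eta 0%N w)).
have Lclip m i : L2 P (fun w => clip m%:R (eta i w)).
  apply: (@L2_bounded _ _ _ _ _ m%:R); first exact: (measurableT_comp (mclip m%:R) (L1_meas (Li i))).
  by move=> w; exact: clip_le.
have Lxi m i : L2 P (xi m i) by apply: L2B; [exact: Lclip|exact: L2_cst].
have Exi m i : E P (xi m i) = 0.
  rewrite /xi EB; [|exact: L2_L1|exact: L1_cst].
  by rewrite E_cst; have [_ ->] := @same i _ (mclip m%:R) (L2_L1 (Lclip m 0%N)); rewrite subrr.
have mxi m i : J_measurable X (J i) (xi m i).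
  by apply: measurable_funB => //; exact: (measurableT_comp (mclip m%:R) (@meta i)).
have orth m i j : i != j -> E P (fun w => xi m i w * xi m j w) = 0.
  move=> ij; have [_ ->] := @indep_mul _ _ _ _ _ P _ X (@mX) (@indX) _ _ _ _ (@dJ _ _ ij) (mxi m i) (mxi m j) (L2_L1 (Lxi m i)) (L2_L1 (Lxi m j)).
  by rewrite Exi mul0r.
have xi2 m i : E P (fun w => xi m i w ^+ 2) <= (2 * m%:R) ^+ 2.
  rewrite -[leRHS](E_cst P); apply: E_le; [exact: L2_sqr|exact: L1_cst|] => w.
  have h1 := @clip_le m%:R (eta i w) (ler0n _ _).
  have h2 : `|E P (fun w => clip m%:R (eta 0%N w))| <= m%:R.
    apply: (le_trans (E_norm (L2_L1 (Lclip m 0%N)))); rewrite -[leRHS](E_cst P).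
    by apply: E_le; [exact/L1_norm/L2_L1|exact: L1_cst|move=> w'; exact: clip_le].
  rewrite -(real_normK (num_real (xi m i w))) ler_pXn2r ?nnegrE ?mulr_ge0//.
  by apply: (le_trans (ler_normB _ _)); lra.
pose v m n := E P (fun w => `|n%:R^-1 * \sum_(i < n) xi m i w|).
have Lv m n : L2 P (fun w => n%:R^-1 * \sum_(i < n) xi m i w) by apply: L2Z; apply: L2_sum.
have v0 m : v m n @[n --> \oo] --> 0.
  apply: cvg0_sqr; apply: (@squeeze0 _ _ _ _ _ (@cvg_divn R ((2 * m%:R) ^+ 2))) => n; first exact: sqr_ge0.
  apply: (le_trans (E_norm_sqr_le (Lv m n))).
  rewrite (eq_E _ (g := fun w => n%:R ^- 2 * (\sum_(i < n) xi m i w) ^+ 2)); last by move=> w; rewrite exprMn exprVn.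
  rewrite EZ; last by apply: L2_sqr; apply: L2_sum.
  have -> : E P (fun w => (\sum_(i < n) xi m i w) ^+ 2) = \sum_(i < n) E P (fun w => xi m i w ^+ 2).
    have := @uncorrelated_sqr _ _ _ P _ (iota 0 n) (xi m) (iota_uniq 0 n) (Lxi m) (orth m).
    by rewrite -[X in iota 0 X](subn0 n) -/(index_iota 0 n) big_mkord => <-; apply: eq_E => w; rewrite big_mkord.
  have [->|n0] := eqVneq n 0%N; first by rewrite big_ord0 mulr0 invr0 mulr0.
  apply: (@le_trans _ _ (n%:R ^- 2 * \sum_(i < n) (2 * m%:R) ^+ 2)).
    by apply: ler_wpM2l; [rewrite invr_ge0 exprn_ge0|apply: ler_sum => i _; exact: xi2].
  rewrite sum_cst; have : n%:R != 0 :> R by rewrite pnatr_eq0.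
  by move: (n%:R : R) => N N0; rewrite [leLHS](_ : _ = (2 * m%:R) ^+ 2 / N)//; field.
(* The estimate is for n >= 1; at n = 0 the empirical mean is 0 by convention. *)
rewrite -(cvg_shiftS (fun n => E P (fun w => `|n%:R^-1 * \sum_(i < n) eta i w - E P (eta 0%N)|))).
apply: (@double_limit0 _ _ (fun m => 2 * r m) (fun m n => v m n.+1)) => [n|m n||m].
- exact: E_ge0.
- set N : R := n.+1%:R; have N0 : 0 < N by rewrite ltr0n.
  have Lri i : L1 P (fun w => `|eta i w - clip m%:R (eta i w)|) /\ E P (fun w => `|eta i w - clip m%:R (eta i w)|) = r m.
    exact: (@same i _ (mr m) (Lr m)).
  have LA : L1 P (fun w => N^-1 * \sum_(i < n.+1) `|eta i w - clip m%:R (eta i w)|).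
    by apply: L1Z; apply: L1_sum => i _; have [] := Lri i.
  have Lx : L1 P (fun w => `|N^-1 * \sum_(i < n.+1) xi m i w|) by apply/L1_norm/L2_L1/Lv.
  have Ed : `|E P (fun w => clip m%:R (eta 0%N w)) - E P (eta 0%N)| <= r m.
    rewrite -EB//; last exact: L2_L1.
    apply: (le_trans (E_norm (L1B (L2_L1 (Lclip m 0%N)) Leta))).
    by rewrite (eq_E _ (g := fun w => `|eta 0%N w - clip m%:R (eta 0%N w)|))// => w; rewrite distrC.
  apply: (@le_trans _ _ (E P (fun w => N^-1 * \sum_(i < n.+1) `|eta i w - clip m%:R (eta i w)|
      + `|N^-1 * \sum_(i < n.+1) xi m i w| + r m))).
    apply: E_le.
    + by apply/L1_norm/L1B; [apply: L1Z; exact: L1_sum|exact: L1_cst].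
    + by apply: L1D; [exact: L1D|exact: L1_cst].
    + move=> w; have -> : N^-1 * \sum_(i < n.+1) eta i w - E P (eta 0%N) =
        N^-1 * \sum_(i < n.+1) (eta i w - clip m%:R (eta i w)) + N^-1 * \sum_(i < n.+1) xi m i w
        + (E P (fun w => clip m%:R (eta 0%N w)) - E P (eta 0%N)).
        rewrite -mulrDr -big_split /= /xi.
        have -> : \sum_(i < n.+1) (eta i w - clip m%:R (eta i w) + (clip m%:R (eta i w) - E P (fun w => clip m%:R (eta 0%N w))))
          = \sum_(i < n.+1) eta i w - N * E P (fun w => clip m%:R (eta 0%N w)).
          by rewrite -sum_cst -sumrB; apply: eq_bigr => i _; ring.
        by rewrite mulrBr mulrA mulVf ?gt_eqF// mul1r; ring.
      apply: (le_trans (ler_normD _ _)); apply: lerD => //.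
      apply: (le_trans (ler_normD _ _)); apply: lerD => //.
      have Ni : 0 <= N^-1 by rewrite invr_ge0 ltW.
      by rewrite normrM (ger0_norm Ni); apply: ler_wpM2l => //; exact: ler_norm_sum.
  rewrite ED; [|exact: L1D|exact: L1_cst].
  rewrite ED// E_cst EZ; last by apply: L1_sum => i _; have [] := Lri i.
  rewrite E_sum; last by move=> i _; have [] := Lri i.
  rewrite (eq_bigr (fun=> r m)); last by move=> i _; have [] := Lri i.
  by rewrite sum_cst mulrA mulVf ?gt_eqF// mul1r /v -/N; lra.
- have H : 2 * r m @[m --> \oo] --> (2 * 0 : R) by apply: cvgM; [exact: cvg_cst|].
  by rewrite mulr0 in H.
- by rewrite (cvg_shiftS (v m)).
Unshelve. all: by end_near. Qed.

End lln.

(** * Completeness of L_2 and convergence in distribution *)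

Lemma limn_einf_sup_EFin (R : realType) (v : nat -> R) (l : R) : v n @[n --> \oo] --> l ->
  (limn_einf (fun n => (v n)%:E) = l%:E) * (limn_esup (fun n => (v n)%:E) = l%:E).
Proof. by move=> vl; apply: cvg_limn_einf_sup; apply: cvg_EFin => //; exact: nearW. Qed.

(** The Riesz-Fischer argument, keeping the quantitative bound [e n]: a fast subsequence converges
    almost everywhere because its increments are summable, and Fatou's lemma carries the distance
    bound to the limit. *)
Lemma L2_complete d (T : measurableType d) (R : realType) (P : probability T R)
    (f : nat -> T -> R) (e : nat -> R) : (forall n, L2 P (f n)) ->
  (forall n k, (n <= k)%N -> E P (fun w => (f k w - f n w) ^+ 2) <= e n) ->
  e n @[n --> \oo] --> 0 ->
  exists L : T -> R, measurable_fun setT L /\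
    forall n, L2 P (fun w => L w - f n w) /\ E P (fun w => (L w - f n w) ^+ 2) <= e n.
Proof.
move=> Lf fe e0.
have exN j : exists N : nat, forall n, (N <= n)%N -> e n <= 4^-1 ^+ j.
  have /cvgrPdist_lt /(_ (4^-1 ^+ j)) := e0; case; first by rewrite exprn_gt0.
  move=> N _ H; exists N => n Nn; have := H n Nn; rewrite /= sub0r normrN.
  by move=> h; apply: ltW; apply: le_lt_trans h; exact: ler_norm.
have [N NP] := choice exN.
(* A nondecreasing choice of indices with s j >= N j and s j >= j. Consecutive squared distances are
   then at most 4^-j, so first moments are at most 2^-j. *)
pose s j := (\sum_(i < j.+1) N i + j)%N.
have sN j : (N j <= s j)%N by rewrite /s big_ord_recr /= -addnA (leq_trans _ (leq_addl _ _))// leq_addr.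
have sj j : (j <= s j)%N by rewrite /s leq_addl.
have sS j : (s j <= s j.+1)%N.
  by rewrite /s [X in (_ <= X + _)%N]big_ord_recr /= leq_add// leq_addr.
pose u j := f (s j).
have Lu j : L2 P (u j) by exact: Lf.
have LD j : L2 P (fun w => u j.+1 w - u j w) by exact: L2B.
have uD j : E P (fun w => `|u j.+1 w - u j w|) <= 2^-1 ^+ j.
  have h : E P (fun w => (u j.+1 w - u j w) ^+ 2) <= (2^-1 ^+ j) ^+ 2.
    apply: (le_trans (fe _ _ (sS j))); apply: (le_trans (NP _ _ (sN j))).
    by rewrite exprAC; have -> : 2^-1 ^+ 2 = 4^-1 :> R by field.
  rewrite -(@ler_pXn2r _ 2) ?nnegrE ?E_ge0 ?exprn_ge0//.
  exact: le_trans (E_norm_sqr_le (LD j)) h.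
pose S j w := \sum_(i < j) `|u i.+1 w - u i w|.
have LS j : L1 P (S j) by apply: L1_sum => i _; exact/L1_norm/L2_L1.
have mS j : measurable_fun setT (S j) := L1_meas (LS j).
have ES j : E P (S j) <= 2.
  rewrite E_sum => [|i _]; last exact/L1_norm/L2_L1.
  apply: (@le_trans _ _ (\sum_(i < j) 2^-1 ^+ i)); first by apply: ler_sum => i _.
  have -> : \sum_(i < j) 2^-1 ^+ i = 2 - 2 * 2^-1 ^+ j :> R.
    elim: j => [|j IH]; first by rewrite big_ord0 expr0; ring.
    by rewrite big_ord_recr /= IH exprS; field.
  by rewrite gerBl mulr_ge0// exprn_ge0.
have S0 j w : 0 <= S j w by apply: sumr_ge0.
have mSE j : measurable_fun setT (fun w => (S j w)%:E) by exact/measurable_EFinP.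
have Snd w : {homo (fun j => (S j w)%:E) : n m / (n <= m)%N >-> (n <= m)%E}.
  by apply/nondecreasing_seqP => j; rewrite lee_fin /S big_ord_recr /= lerDl.
pose M w := limn (fun j => (S j w)%:E).
have Mcv w : (S j w)%:E @[j --> \oo] --> M w by exact: ereal_nondecreasing_is_cvgn.
have mM : measurable_fun setT M by apply: emeasurable_fun_cvg mSE _ => w _; exact: Mcv.
have iM : (\int[P]_w M w <= 2%:E)%E.
  rewrite (monotone_convergence _ measurableT mSE) => [|j w _|w _ n m nm]; last 2 first.
  - by rewrite lee_fin.
  - exact: Snd.
  apply: lime_le; last by apply: nearW => j; rewrite (EE (LS j)) lee_fin.
  apply: ereal_nondecreasing_is_cvgn => m n mn; apply: ge0_le_integral => //.
  - by move=> w _; rewrite lee_fin.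
  - by move=> w _; exact: Snd.
have M0 w : (0 <= M w)%E.
  apply: lime_ge; first exact: ereal_nondecreasing_is_cvgn.
  by apply: nearW => j; rewrite lee_fin.
have LM : P.-integrable setT M.
  apply/integrableP; split => //; apply: le_lt_trans (ltry 2).
  rewrite (eq_integral M)// => w _.
  by rewrite gee0_abs// M0.
have cvu : {ae P, forall w, cvgn (u ^~ w)}.
  apply: ae_mono _ (integrable_ae measurableT LM) => w /(_ I) Mfin.
  have Sbd : has_ubound (range (S ^~ w)).
    exists (fine (M w)) => _ [j _ <-]; rewrite -lee_fin fineK//.
    apply: lime_ge; first exact: ereal_nondecreasing_is_cvgn.
    by near=> k; apply: Snd; near: k; exact: nbhs_infty_ge.
  have incS : nondecreasing_seq (S ^~ w).
    by apply/nondecreasing_seqP => j; rewrite /S big_ord_recr /= lerDl.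
  have cS : cvgn [normed series (fun j => u j.+1 w - u j w)].
    have -> : [normed series (fun j => u j.+1 w - u j w)] = S ^~ w.
      by apply/funext => j; rewrite /= /series /= big_mkord.
    exact: nondecreasing_is_cvgn.
  have := normed_cvg cS => /cvg_ex[l ul]; apply/cvg_ex; exists (u 0%N w + l).
  have -> : u ^~ w = (fun j => u 0%N w + series (fun j => u j.+1 w - u j w) j).
    by apply/funext => j; rewrite /series /= telescope_sumr//; ring.
  by apply: cvgD => //; exact: cvg_cst.
(* The upper limit is measurable everywhere and equals the limit wherever that exists. *)
pose L w := fine (limn_esup (fun j => (u j w)%:E)).
have mL : measurable_fun setT L.
  apply: measurableT_comp => //; apply: measurable_fun_limn_esup => j.
  by apply/measurable_EFinP; exact: L2_meas.
have uL : {ae P, forall w, u j w @[j --> \oo] --> L w}.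
  apply: ae_mono _ cvu => w /cvg_ex[l ul].
  suff -> : L w = l by [].
  by rewrite /L (limn_einf_sup_EFin ul).
exists L; split => // n.
have mD : measurable_fun setT (fun w => L w - f n w) by apply: measurable_funB => //; exact: L2_meas.
pose g j w := ((u (j + n)%N w - f n w) ^+ 2)%:E.
have iL : (\int[P]_w ((L w - f n w) ^+ 2)%:E <= (e n)%:E)%E.
  have -> : (\int[P]_w ((L w - f n w) ^+ 2)%:E = \int[P]_w limn_einf (g ^~ w))%E.
    apply: ae_eq_integral => //.
    - by apply/measurable_EFinP; exact: measurable_funX.
    - have -> : (fun w => limn_einf (g ^~ w)) = (fun w => - limn_esup (fun j => - g j w))%E.
        by apply/funext => w; rewrite -limn_einfN; congr limn_einf; apply/funext => j; rewrite /comp oppeK.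
      apply: measurableT_comp => //; apply: measurable_fun_limn_esup => j; apply: measurableT_comp => //.
      apply/measurable_EFinP; apply: measurable_funX.
      by apply: measurable_funB; exact: L2_meas.
    - apply: ae_mono _ uL => w uw _.
      have H : (u (j + n)%N w - f n w) ^+ 2 @[j --> \oo] --> (L w - f n w) ^+ 2.
        have H : u (j + n)%N w - f n w @[j --> \oo] --> L w - f n w.
          by apply: cvgB; [rewrite (cvg_shiftn n (fun j => u j w))|exact: cvg_cst].
        exact: (cvgM H H).
      by rewrite (limn_einf_sup_EFin H).
  apply: le_trans (fatou _ _ _ _) _ => //.
  - move=> j; apply/measurable_EFinP; apply: measurable_funX.
    by apply: measurable_funB; exact: L2_meas.
  - by move=> j w _; rewrite lee_fin sqr_ge0.
  rewrite limn_einf_lim; apply: lime_le; first exact: is_cvg_einfs.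
  apply: nearW => j; apply: (@le_trans _ _ (\int[P]_w g j w)%E).
    by apply: ereal_inf_lbound; exists j => //=.
  rewrite /g EE ?lee_fin; last by apply: L2_sqr; exact: L2B.
  by apply: fe; rewrite (leq_trans _ (sj _))// leq_addl.
have L2d : L2 P (fun w => L w - f n w).
  split => //; apply: L1_ge0 => [|w|]; [exact: measurable_funX|exact: sqr_ge0|].
  exact: le_lt_trans iL (ltry _).
by split => //; rewrite -lee_fin -EE//; exact: L2_sqr.
Unshelve. all: by end_near. Qed.

(** * Ramps as test functions for convergence in distribution *)

Section ramp.
Variable R : realType.
Implicit Types a b x : R.

Definition ramp a b x : R := Num.max 0 (Num.min 1 ((b - x) / (b - a))).

Lemma ramp01 a b x : 0 <= ramp a b x <= 1.
Proof. by rewrite /ramp le_max lexx /= ge_max ler01 ge_min lexx. Qed.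

Lemma ramp_left a b x : a < b -> x <= a -> ramp a b x = 1.
Proof.
move=> ab xa; rewrite /ramp (min_idPl _) ?(max_idPr _)//.
by rewrite ler_pdivlMr ?subr_gt0// mul1r; lra.
Qed.

Lemma ramp_right a b x : a < b -> b <= x -> ramp a b x = 0.
Proof.
move=> ab xb; rewrite /ramp (max_idPl _)// ge_min; apply/orP; right.
by rewrite ler_pdivrMr ?subr_gt0// mul0r; lra.
Qed.

Lemma ramp_lipschitz a b x y : a < b -> `|ramp a b x - ramp a b y| <= (b - a)^-1 * `|x - y|.
Proof.
move=> ab; have k0 : 0 < (b - a)^-1 by rewrite invr_gt0 subr_gt0.
have : `|(b - x) / (b - a) - (b - y) / (b - a)| = (b - a)^-1 * `|x - y|.
  rewrite -mulrBl normrM (ger0_norm (ltW k0)) mulrC distrC; congr (_ * `|_|); ring.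
rewrite /ramp => <-; move: (_ / _) (_ / _) => u v.
have [h1|h1] := leP 1 u; have [h2|h2] := leP 1 v; rewrite ?(max_idPr ler01).
- by rewrite subrr normr0.
- by have [h3|h3] := leP 0 v; rewrite ler_norml; case: (ger0P (v - u)) => h4; apply/andP; split; lra.
- by have [h3|h3] := leP 0 u; rewrite ler_norml; case: (ger0P (v - u)) => h4; apply/andP; split; lra.
- by have [h3|h3] := leP 0 u; have [h5|h5] := leP 0 v; rewrite ler_norml; case: (ger0P (v - u)) => h4; apply/andP; split; lra.
Qed.

End ramp.

(** A ramp descending on [a, b] lies between the indicators of the half-lines up to a and up to b.
    One ramp just right of [x] and one just left of it sandwich the distribution function, and
    continuity at [x] closes the gap. *)
Lemma ramp_cvg_in_distribution d d' (T : measurableType d) (T' : measurableType d') (R : realType)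
    (P : probability T R) (Q : probability T' R) (U : nat -> T -> R) (L : T' -> R) :
  (forall n, measurable_fun setT (U n)) -> measurable_fun setT L ->
  (forall a b : R, a < b -> E P (fun w => ramp a b (U n w)) @[n --> \oo] --> E Q (fun w => ramp a b (L w))) ->
  cvg_in_distribution P Q U L.
Proof.
move=> mU mL UL x cx.
pose cdf d1 (S : measurableType d1) (M : probability S R) (V : S -> R) (y : R) := fine (M (V @^-1` `]-oo, y])).
have mset d1 (S : measurableType d1) (V : S -> R) y : measurable_fun setT V -> measurable (V @^-1` `]-oo, y]).
  by move=> mV; rewrite -[X in measurable X]setTI; apply: mV => //; exact: measurable_itv.
have finE d1 (S : measurableType d1) (M : probability S R) (V : S -> R) y : measurable_fun setT V ->
    M (V @^-1` `]-oo, y]) = (cdf _ _ M V y)%:E.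
  by move=> mV; rewrite /cdf fineK// fin_num_measure//; exact: mset.
have cdfE d1 (S : measurableType d1) (M : probability S R) (V : S -> R) y : measurable_fun setT V ->
    L1 M (\1_(V @^-1` `]-oo, y]) : S -> R) /\ cdf _ _ M V y = E M (\1_(V @^-1` `]-oo, y])).
  move=> mV; split.
    apply: (@L1_bounded _ _ _ _ _ 1); first exact: measurable_indic (mset _ _ _ _ mV).
    by move=> w; rewrite indicE; case: (_ \in _); rewrite ?normr1 ?normr0.
  by rewrite /cdf /E /Rintegral integral_indic ?setIT//; exact: mset.
have Lramp d1 (S : measurableType d1) (M : probability S R) (V : S -> R) a b : a < b -> measurable_fun setT V ->
    L1 M (fun w => ramp a b (V w)).
  move=> ab mV; apply: (@L1_bounded _ _ _ _ _ 1).
    by apply: measurableT_comp mV; apply: lipschitz_measurable => y z; exact: ramp_lipschitz.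
  by move=> w; have /andP[h1 h2] := ramp01 a b (V w); rewrite ger0_norm.
have cdf_le_ramp d1 (S : measurableType d1) (M : probability S R) (V : S -> R) a b : a < b -> measurable_fun setT V ->
    cdf _ _ M V a <= E M (fun w => ramp a b (V w)) <= cdf _ _ M V b.
  move=> ab mV; have [La ->] := cdfE _ _ M V a mV; have [Lb ->] := cdfE _ _ M V b mV.
  apply/andP; split; apply: E_le => //; try exact: Lramp.
    move=> w; rewrite indicE; have [/set_mem/=|_] := boolP (_ \in _); last by have /andP[] := ramp01 a b (V w).
    by rewrite in_itv /= => /(ramp_left ab) ->.
  move=> w; rewrite indicE; have [_|/negP nV] := boolP (_ \in _); first by have /andP[] := ramp01 a b (V w).
  rewrite (ramp_right ab)// leNgt; apply/negP => Vb; apply: nV.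
  by rewrite inE /= in_itv /= ltW.
rewrite (finE _ _ Q L x mL); under eq_cvg do rewrite (finE _ _ P (U _) x (mU _)).
apply: cvg_EFin; first exact: nearW.
have cq : cdf _ _ Q L y @[y --> x] --> cdf _ _ Q L x.
  apply: fine_cvg; rewrite /cdf fineK; last by rewrite fin_num_measure//; exact: mset.
  exact: cx.
apply/cvgrPdist_lt => e e0.
have e20 : 0 < e / 2 by rewrite divr_gt0.
have /cvgrPdist_lt /(_ _ e20) [r /= r0 rq] := cq.
have r20 : 0 < r / 2 by rewrite divr_gt0.
have h1 := rq (x + r / 2); have {}h1 : `|cdf _ _ Q L x - cdf _ _ Q L (x + r / 2)| < e / 2.
  by apply: h1; rewrite /ball_ /= opprD addrA subrr add0r normrN gtr0_norm//; lra.
have h2 := rq (x - r / 2); have {}h2 : `|cdf _ _ Q L x - cdf _ _ Q L (x - r / 2)| < e / 2.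
  by apply: h2; rewrite /ball_ /= opprB addrC subrK gtr0_norm//; lra.
have ab1 : x < x + r / 2 by lra.
have ab2 : x - r / 2 < x by lra.
have /cvgrPdist_lt /(_ _ e20) k1 := UL _ _ ab1; have /cvgrPdist_lt /(_ _ e20) k2 := UL _ _ ab2.
near=> n.
have k3 : `|E Q (fun w => ramp x (x + r / 2) (L w)) - E P (fun w => ramp x (x + r / 2) (U n w))| < e / 2 by near: n.
have k4 : `|E Q (fun w => ramp (x - r / 2) x (L w)) - E P (fun w => ramp (x - r / 2) x (U n w))| < e / 2 by near: n.
have /andP[a1 _] := cdf_le_ramp _ _ P (U n) _ _ ab1 (mU n).
have /andP[_ a2] := cdf_le_ramp _ _ Q L _ _ ab1 mL.
have /andP[_ a3] := cdf_le_ramp _ _ P (U n) _ _ ab2 (mU n).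
have /andP[a4 _] := cdf_le_ramp _ _ Q L _ _ ab2 mL.
move: h1 h2 k3 k4; rewrite !ltr_norml => /andP[? ?] /andP[? ?] /andP[? ?] /andP[? ?].
by apply/andP; split; lra.
Unshelve. all: by end_near. Qed.

(** * The centred chi-square series *)

Definition rect p q : seq (nat * nat) := [seq (i, j) | i <- index_iota 0 p, j <- index_iota 0 q].

Lemma rect_uniq p q : uniq (rect p q).
Proof. by apply: allpairs_uniq; rewrite ?iota_uniq// => -[a b] [c e] _ _ [-> ->]. Qed.

Lemma sum_rect (R : realType) p q (F : nat * nat -> R) :
  \sum_(e <- rect p q) F e = \sum_(i < p) \sum_(j < q) F (i : nat, j : nat).
Proof.
rewrite /rect big_allpairs big_mkord; apply: eq_bigr => i _; by rewrite big_mkord.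
Qed.

Lemma sum_lt_cut (R : realType) n p (u : nat -> R) : (n <= p)%N ->
  \sum_(i < p) (i < n)%N%:R * u i = \sum_(i < n) u i.
Proof.
move=> np; rewrite (big_ord_widen p u np) [RHS]big_mkcond; apply: eq_bigr => i _.
by case: ifP => _; rewrite ?mul1r ?mul0r.
Qed.

Section series.
Context d' (T' : measurableType d') (R : realType) (Q : probability T' R)
  (Z : nat * nat -> T' -> R).
Hypothesis mZ : forall e, measurable_fun setT (Z e).
Hypothesis indZ : independent_family Q Z.
Hypothesis lawZ : forall e (A : set (measurableTypeR R)), measurable A -> Q (Z e @^-1` A) = normal_prob 0 1 A.
Variables (a b : nat -> R).
Hypothesis a_bounded : exists M, forall n, \sum_(i < n) a i ^+ 2 <= M.
Hypothesis b_bounded : exists M, forall n, \sum_(i < n) b i ^+ 2 <= M.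

Definition chi_sum p q w := \sum_(i < p) \sum_(j < q) a i * b j * (Z (i : nat, j : nat) w ^+ 2 - 1).

Let N : probability (measurableTypeR R) R := normal_prob 0 1.
Let psi (x : R) := x ^+ 2 - 1.
Let v := E N (fun x => psi x ^+ 2).

Let psi_L2 : L2 N (psi : measurableTypeR R -> R).
Proof. by apply: L2B; [exact: L2_normal_sqr|exact: L2_cst]. Qed.

Let mpsi : measurable_fun setT psi.
Proof. by case: psi_L2. Qed.

Let LZ e : L2 Q (fun w => psi (Z e w)).
Proof. exact: (@law_L2 _ T' _ (measurableTypeR R) R Q N (Z e) (mZ e) (@lawZ e) psi psi_L2). Qed.

Let EZ0 e : E Q (fun w => psi (Z e w)) = 0.
Proof.
rewrite (@law_E _ T' _ (measurableTypeR R) R Q N (Z e) (mZ e) (@lawZ e) psi mpsi (L2_L1 psi_L2)) /psi EB ?normal_sqr.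
- by rewrite E_cst subrr.
- exact: L2_L1 (L2_normal_sqr R).
- exact: L1_cst.
Qed.

Let EZ2 e : E Q (fun w => psi (Z e w) ^+ 2) = v.
Proof. exact: (@law_E _ T' _ (measurableTypeR R) R Q N (Z e) (mZ e) (@lawZ e) (fun x => psi x ^+ 2) (measurable_funX 2 mpsi) (L2_sqr psi_L2)). Qed.

Let v0 : 0 <= v. Proof. by apply: E_ge0 => x; exact: sqr_ge0. Qed.

Let orth e e' : e != e' -> E Q (fun w => psi (Z e w) * psi (Z e' w)) = 0.
Proof.
move=> ee'; have JJ' : [set e] `&` [set e'] = set0.
  by apply/seteqP; split => // y [/= -> /eqP]; rewrite (negbTE ee').
have m1 : J_measurable Z [set e] (fun w => psi (Z e w)).
  by apply: (measurableT_comp mpsi); exact: (@sub_var _ _ _ _ _ Z [set e]).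
have m2 : J_measurable Z [set e'] (fun w => psi (Z e' w)).
  by apply: (measurableT_comp mpsi); exact: (@sub_var _ _ _ _ _ Z [set e']).
have [_ ->] := @indep_mul _ _ _ _ _ Q _ Z (@mZ) (@indZ) _ _ _ _ JJ' m1 m2 (L2_L1 (LZ e)) (L2_L1 (LZ e')).
by rewrite EZ0 mul0r.
Qed.

Let Ta n := \sum_(i < n) a i ^+ 2.
Let Tb n := \sum_(i < n) b i ^+ 2.

Lemma chi_sum_L2 p q : L2 Q (chi_sum p q).
Proof. by apply: L2_sum => i _; apply: L2_sum => j _; apply: L2Z; exact: LZ. Qed.

(** The variables Z^2 - 1 are centred and orthogonal with common second moment [v], so the squared
    distance is [v] times the sum of (a_i b_j)^2 over the rectangle outside the square. *)
Let chi_sum_dist n p q : (n <= p)%N -> (n <= q)%N ->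
  E Q (fun w => (chi_sum p q w - chi_sum n n w) ^+ 2) = v * (Ta p * Tb q - Ta n * Tb n).
Proof.
move=> np nq.
pose in_n (e : nat * nat) : R := (e.1 < n)%N%:R * (e.2 < n)%N%:R.
pose c (e : nat * nat) := (1 - in_n e) * (a e.1 * b e.2).
have dE w : chi_sum p q w - chi_sum n n w = \sum_(e <- rect p q) c e * psi (Z e w).
  rewrite sum_rect /chi_sum -(sum_lt_cut (fun i => \sum_(j < n) a i * b j * (Z (i, j : nat) w ^+ 2 - 1)) np) -sumrB.
  apply: eq_bigr => i _.
  rewrite -(sum_lt_cut (fun j => a i * b j * (Z (i : nat, j) w ^+ 2 - 1)) nq) mulr_sumr -sumrB.
  by apply: eq_bigr => j _; rewrite /c /in_n /psi /=; ring.
under eq_E do rewrite dE.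
rewrite (uncorrelated_sqr (rect_uniq p q) (xi := fun e w => c e * psi (Z e w))); first last.
- move=> e e' ee'; rewrite (eq_E _ (g := fun w => c e * c e' * (psi (Z e w) * psi (Z e' w)))); last by move=> w; ring.
  by rewrite EZ ?orth ?mulr0//; exact: L2_mul (LZ e) (LZ e').
- by move=> e; exact: L2Z (LZ e).
have cE e : E Q (fun w => (c e * psi (Z e w)) ^+ 2) = v * c e ^+ 2.
  rewrite (eq_E _ (g := fun w => c e ^+ 2 * psi (Z e w) ^+ 2)); last by move=> w; ring.
  by rewrite EZ ?EZ2 1?mulrC//; exact: L2_sqr (LZ e).
rewrite (eq_bigr _ (fun e _ => cE e)) -mulr_sumr; congr (_ * _).
rewrite sum_rect /Ta /Tb.
have sE m m' : (\sum_(i < m) a i ^+ 2) * (\sum_(j < m') b j ^+ 2) = \sum_(i < m) \sum_(j < m') a i ^+ 2 * b j ^+ 2.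
  by rewrite mulr_suml; apply: eq_bigr => i _; rewrite mulr_sumr.
rewrite !sE -(sum_lt_cut (fun i => \sum_(j < n) a i ^+ 2 * b j ^+ 2) np) -sumrB.
apply: eq_bigr => i _; rewrite -(sum_lt_cut (fun j => a i ^+ 2 * b j ^+ 2) nq) mulr_sumr -sumrB.
apply: eq_bigr => j _; rewrite /c /in_n /=.
by case: (i < n)%N; case: (j < n)%N; rewrite /=; ring.
Qed.

(** Square summability of the coefficients is enough because the terms are centred. The last clause
    covers all large rectangles, as [mean_square_sum] demands. *)
Lemma chi_series : exists L : T' -> R, [/\ measurable_fun setT L,
  forall p q, L2 Q (fun w => L w - chi_sum p q w),
  E Q (fun w => (L w - chi_sum n n w) ^+ 2) @[n --> \oo] --> 0 &
  forall eps, 0 < eps -> exists n, forall p q, (n <= p)%N -> (n <= q)%N ->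
    E Q (fun w => (L w - chi_sum p q w) ^+ 2) <= eps].
Proof.
have incr (u : nat -> R) : nondecreasing_seq (fun n => \sum_(i < n) u i ^+ 2).
  by apply/nondecreasing_seqP => n; rewrite big_ord_recr /= lerDl sqr_ge0.
have lim (u : nat -> R) : (exists M, forall n, \sum_(i < n) u i ^+ 2 <= M) ->
    exists l : R, [/\ 0 <= l, \sum_(i < n) u i ^+ 2 @[n --> \oo] --> l & forall n, \sum_(i < n) u i ^+ 2 <= l].
  move=> [M uM]; have bd : has_ubound (range (fun n => \sum_(i < n) u i ^+ 2)) by exists M => _ [n _ <-].
  have ul := nondecreasing_cvgn (incr u) bd; exists (sup (range (fun n => \sum_(i < n) u i ^+ 2))).
  have ub n : \sum_(i < n) u i ^+ 2 <= sup (range (fun n => \sum_(i < n) u i ^+ 2)).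
    by apply: sup_upper_bound; [split => //; exists (\sum_(i < 0) u i ^+ 2), 0%N|exists n].
  split => //; apply: le_trans (ub 0%N); by rewrite big_ord0.
have [la [la0 al ua]] := lim a a_bounded; have [lb [lb0 bl ub]] := lim b b_bounded.
pose e n := v * (la * lb - Ta n * Tb n).
have T0 (u : nat -> R) n : 0 <= \sum_(i < n) u i ^+ 2 by apply: sumr_ge0 => i _; exact: sqr_ge0.
have dist n p q : (n <= p)%N -> (n <= q)%N -> E Q (fun w => (chi_sum p q w - chi_sum n n w) ^+ 2) <= e n.
  move=> np nq; rewrite chi_sum_dist//; apply: ler_wpM2l => //; rewrite lerD2r.
  by apply: ler_pM; [exact: T0|exact: T0|exact: ua|exact: ub].
have e0 : e n @[n --> \oo] --> 0.
  have H : v * (la * lb - Ta n * Tb n) @[n --> \oo] --> (v * (la * lb - la * lb) : R).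
    apply: cvgM; first exact: cvg_cst.
    by apply: cvgB; [exact: cvg_cst|exact: cvgM].
  by rewrite subrr mulr0 in H.
have [|L [mL HL]] := @L2_complete _ _ _ Q (fun n => chi_sum n n) e (fun n => chi_sum_L2 n n) _ e0.
  by move=> n k nk; exact: dist.
have LL p q : L2 Q (fun w => L w - chi_sum p q w).
  have [L0 _] := HL 0%N.
  apply: (@eq_L2 _ _ _ _ (fun w => (L w - chi_sum 0 0 w) + (chi_sum 0 0 w - chi_sum p q w))); first by move=> w; ring.
  by apply: L2D => //; apply: L2B; exact: chi_sum_L2.
exists L; split => //.
- by apply: (@squeeze0 _ _ _ _ _ e0) => n; [by apply: E_ge0 => w; exact: sqr_ge0|have [] := HL n].
- move=> eps eps0; have e40 : 0 < eps / 4 by rewrite divr_gt0.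
  have /cvgrPdist_lt /(_ _ e40) [n _ H] := e0; exists n => p q np nq.
  have {H} := H n (leqnn n); rewrite /= sub0r normrN => H.
  have en := le_lt_trans (ler_norm _) H.
  rewrite (eq_E _ (g := fun w => ((L w - chi_sum n n w) + (chi_sum n n w - chi_sum p q w)) ^+ 2)); last by move=> w; congr (_ ^+ 2); ring.
  apply: (le_trans (E_sqrD (LL n n) (L2B (chi_sum_L2 n n) (chi_sum_L2 p q)))).
  have [_ h1] := HL n.
  rewrite (eq_E _ (f := fun w => (chi_sum n n w - chi_sum p q w) ^+ 2) (g := fun w => (chi_sum p q w - chi_sum n n w) ^+ 2)); last first.
    by move=> w; rewrite -sqrrN opprB.
  by have := dist n p q np nq; lra.
Qed.

End series.

(** * The limit of the degenerate U-statistic *)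

Lemma cvg0_norm (R : realType) (u : nat -> R) : u n @[n --> \oo] --> 0 -> `|u n| @[n --> \oo] --> 0.
Proof.
move=> /cvgrPdist_lt H; apply/cvgrPdist_lt => e /H; apply: filterS => n.
by rewrite !sub0r !normrN normr_id.
Qed.

Lemma weighted_le (R : realType) (x y p q r : R) : x <= 2 * p -> y <= 2 * q -> q <= r ->
  2 * x + 2 * y <= 4 * p + 4 * r.
Proof. lra. Qed.

Section sample.
Context d (T : measurableType d) (R : realType) (P : probability T R)
  (W : bool * nat -> T -> R) (mu : bool -> probability (measurableTypeR R) R).
Hypothesis mW : forall a, measurable_fun setT (W a).
Hypothesis indW : independent_family P W.
Hypothesis lawW : forall a (A : set (measurableTypeR R)), measurable A -> P (W a @^-1` A) = mu a.1 A.

Lemma pair_L1 (f h : R -> R) i : measurable_fun setT f -> measurable_fun setT h ->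
  L1 (mu false) f -> L1 (mu true) h ->
  L1 P (fun w => f (W (false, i) w) * h (W (true, i) w)) /\
  E P (fun w => f (W (false, i) w) * h (W (true, i) w)) = E (mu false) f * E (mu true) h.
Proof.
move=> mf mh Lf Lh.
have jf : J_measurable W (side false) (fun w => f (W (false, i) w)).
  by apply: (measurableT_comp mf); exact: (@sub_var _ _ _ _ _ W (side false)).
have jh : J_measurable W (side true) (fun w => h (W (true, i) w)).
  by apply: (measurableT_comp mh); exact: (@sub_var _ _ _ _ _ W (side true)).
have L1' := W_L1 (@mW) (@lawW) (a := (false, i)) mf Lf.
have L2' := W_L1 (@mW) (@lawW) (a := (true, i)) mh Lh.
have [H ->] := sides_mul (@mW) (@indW) jf jh L1' L2'.
by rewrite (W_E (@mW) (@lawW) (a := (false, i)) mf Lf) (W_E (@mW) (@lawW) (a := (true, i)) mh Lh).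
Qed.

Definition row (i : nat) : set (bool * nat) := [set a | a.2 = i].

Lemma row_disjoint i j : i != j -> row i `&` row j = set0.
Proof. by move=> /eqP ij; apply/seteqP; split => // -[b k]; rewrite /row /= => -[-> /ij]. Qed.

Lemma row_measurable (F : R * R -> R) i : measurable_fun setT F ->
  J_measurable W (row i) (fun w => F (W (false, i) w, W (true, i) w)).
Proof.
move=> mF; apply: (measurableT_comp mF).
by apply: measurable_fun_pair; exact: (@sub_var _ _ _ _ _ W (row i)).
Qed.

Lemma row_same (F : R * R -> R) i : measurable_fun setT F ->
  L1 P (fun w => F (W (false, 0%N) w, W (true, 0%N) w)) ->
  L1 P (fun w => F (W (false, i) w, W (true, i) w)) /\
  E P (fun w => F (W (false, i) w, W (true, i) w)) = E P (fun w => F (W (false, 0%N) w, W (true, 0%N) w)).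
Proof. by move=> mF LF; exact: (@E_pair _ _ _ _ _ _ (@mW) (@indW) (@lawW) (false, i) (true, i) (false, 0%N) (true, 0%N)). Qed.

Lemma lln_pair (F : R * R -> R) : measurable_fun setT F ->
  L1 P (fun w => F (W (false, 0%N) w, W (true, 0%N) w)) ->
  E P (fun w => `|n%:R^-1 * \sum_(i < n) F (W (false, i : nat) w, W (true, i : nat) w)
    - E P (fun w => F (W (false, 0%N) w, W (true, 0%N) w))|) @[n --> \oo] --> 0.
Proof.
move=> mF LF.
apply: (@lln _ _ _ _ _ P _ W (@mW) (@indW) row (fun i w => F (W (false, i) w, W (true, i) w)) row_disjoint _ LF).
- by move=> i; exact: row_measurable.
- move=> i psi mpsi Lpsi; apply: (row_same (F := psi \o F)) => //.
  exact: measurableT_comp.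
Qed.

(** * The truncated U-statistic as a quadratic form *)

Section spectral.
Variables (K : bool -> set nat) (lambda : bool -> nat -> R) (g : bool -> nat -> R -> R).
Hypothesis k_ex : forall b, kernel_exists (mu b).
Hypothesis k_L2 : forall b, kernel_square_integrable (mu b).
Hypothesis k_spec : forall b, spectral_decomposition (mu b) (K b) (lambda b) (g b).
Let k b := kernel (mu b).
Let lam b := eigval (K b) (lambda b).
Let gam b := eigfun (K b) (g b).
Let t b m := trunc (K b) (lambda b) (g b) m.
Let kD b : degenerate P W mu b (k b) := kernel_degenerate (@mW) (@indW) (@lawW) (k_ex b) (k_L2 b) (k_spec b).
Let tD b m : degenerate P W mu b (t b m) := trunc_degenerate (@mW) (@indW) (@lawW) (k_spec b) m.
Let kt b m : R -> R -> R := fun x y => k b x y - t b m x y.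
Let ktD b m : degenerate P W mu b (kt b m) := degenerateB (kD b) (tD b m).
Let gamL2 b j : L2 (mu b) (gam b j) := eigfun_L2 (k_spec b) j.
Let mgam b j : measurable_fun setT (gam b j) := eigfun_measurable (k_spec b) j.
Let lam0 b j : 0 <= lam b j := eigval_ge0 (k_spec b) j.

Lemma knormD b k1 k2 : degenerate P W mu b k1 -> degenerate P W mu b k2 ->
  knorm P W b (fun x y => k1 x y - k2 x y) <= 2 * knorm P W b k1 + 2 * knorm P W b k2.
Proof.
move=> D1 D2; have L1' := gram_L2 (@mW) (@indW) (@lawW) D1 (i := 0%N) (j := 1%N) isT.
have L2' := gram_L2 (@mW) (@indW) (@lawW) D2 (i := 0%N) (j := 1%N) isT.
have := E_sqrD L1' (L2N L2'); rewrite /knorm.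
rewrite (eq_E _ (f := fun w => (- gram W b k2 0 1 w) ^+ 2) (g := fun w => gram W b k2 0 1 w ^+ 2)) // => w.
by rewrite sqrrN.
Qed.

(** Parseval's identity for products of eigenfunctions at two independent points. *)
Lemma knorm_trunc b m : knorm P W b (t b m) = \sum_(j < m) lam b j ^+ 2.
Proof.
pose xi j w := lam b j * (gam b j (W (b, 0%N) w) * gam b j (W (b, 1%N) w)).
have pm j j' : L1 P (fun w => (gam b j (W (b, 0%N) w) * gam b j' (W (b, 0%N) w)) * (gam b j (W (b, 1%N) w) * gam b j' (W (b, 1%N) w))) /\
   E P (fun w => (gam b j (W (b, 0%N) w) * gam b j' (W (b, 0%N) w)) * (gam b j (W (b, 1%N) w) * gam b j' (W (b, 1%N) w))) = ((j == j') && valid_index (K b) j)%:R.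
  have m2 : measurable_fun setT (fun x => gam b j x * gam b j' x) by exact: measurable_funM.
  have Lm : L1 (mu b) (fun x => gam b j x * gam b j' x) by exact: L2_mul.
  have [H ->] := pair_mul (@mW) (@indW) (@lawW) m2 m2 Lm Lm.
  split => //; rewrite (eigfun_orthonormal (k_spec b)).
  by case: (_ && _); rewrite ?mulr1 ?mulr0.
have xiL2 j : L2 P (xi j).
  exact: L2Z (eigfun_pair_L2 (@mW) (@indW) (@lawW) (k_spec b) j j).
rewrite /knorm (eq_E _ (g := fun w => (\sum_(j <- index_iota 0 m) xi j w) ^+ 2)); last first.
  by move=> w; rewrite big_mkord /gram /t /trunc; congr (_ ^+ 2); apply: eq_bigr => j _; rewrite /xi mulrA.
rewrite (uncorrelated_sqr (iota_uniq _ _) xiL2) ?big_mkord.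
  apply: eq_bigr => j _.
  rewrite (eq_E _ (g := fun w => lam b j ^+ 2 * ((gam b j (W (b, 0%N) w) * gam b j (W (b, 0%N) w)) * (gam b j (W (b, 1%N) w) * gam b j (W (b, 1%N) w))))); last first.
    by move=> w; rewrite /xi; move: (lam b j) (gam _ _ _) (gam _ _ _) => p u v; ring.
  have [H EH] := pm j j; rewrite EZ// EH eqxx /=.
  have [vj|vj] := boolP (valid_index _ _); first by rewrite mulr1.
  by rewrite /lam (eigval_invalid (k_spec b) vj) expr0n /= mul0r.
move=> i j ij.
rewrite (eq_E _ (g := fun w => lam b i * lam b j * ((gam b i (W (b, 0%N) w) * gam b j (W (b, 0%N) w)) * (gam b i (W (b, 1%N) w) * gam b j (W (b, 1%N) w))))); last first.
  by move=> w; rewrite /xi; move: (lam b i) (lam b j) (gam _ _ _) (gam _ _ _) (gam _ _ _) (gam _ _ _) => p q u v y z; ring.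
by have [H EH] := pm i j; rewrite EZ// EH (negbTE ij) mulr0.
Qed.

Lemma eigval_sqr_bounded b : exists M, forall n, \sum_(i < n) lam b i ^+ 2 <= M.
Proof.
exists (2 * knorm P W b (k b) + 2) => n.
have /cvgrPdist_lt /(_ 1 ltr01) [N _ H] := trunc_cvg (@mW) (@indW) (@lawW) (k_ex b) (k_L2 b) (k_spec b).
have := H (maxn n N) (leq_maxr _ _); rewrite /= sub0r normrN => {}H.
have {}H := le_lt_trans (ler_norm _) H.
have incr : nondecreasing_seq (fun n => \sum_(i < n) lam b i ^+ 2).
  by apply/nondecreasing_seqP => j; rewrite big_ord_recr /= lerDl sqr_ge0.
apply: (le_trans (incr _ _ (leq_maxl n N))); rewrite -knorm_trunc.
have := knormD (kD b) (ktD b (maxn n N)).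
have -> : (fun x y => k b x y - kt b (maxn n N) x y) = t b (maxn n N).
  by apply/funext => x; apply/funext => y; rewrite /kt subKr.
move=> h; apply: (le_trans h); rewrite /kt /k /t; lra.
Qed.

Definition ustat (k1 k2 : R -> R -> R) n w :=
  n%:R^-1 * \sum_(i < n) \sum_(j < n | (j : nat) != i) gram W false k1 i j w * gram W true k2 i j w.

Lemma ustat_L2 k1 k2 n : degenerate P W mu false k1 -> degenerate P W mu true k2 -> L2 P (ustat k1 k2 n).
Proof.
move=> D1 D2; apply: L2Z; apply: L2_sum => i _; apply: L2_sum => j ji.
by apply: (gram_prod_L2 (@mW) (@indW) (@lawW) D1 D2); rewrite eq_sym.
Qed.

Lemma ustat_norm k1 k2 n : degenerate P W mu false k1 -> degenerate P W mu true k2 ->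
  E P (fun w => ustat k1 k2 n w ^+ 2) <= 2 * (knorm P W false k1 * knorm P W true k2).
Proof.
move=> D1 D2; have NN : 0 <= knorm P W false k1 * knorm P W true k2 by rewrite mulr_ge0 ?knorm_ge0.
pose S w := \sum_(i < n) \sum_(j < n | (j : nat) != i) gram W false k1 i j w * gram W true k2 i j w.
have LS : L2 P S.
  apply: L2_sum => i _; apply: L2_sum => j ji.
  by apply: (gram_prod_L2 (@mW) (@indW) (@lawW) D1 D2); rewrite eq_sym.
rewrite (eq_E _ (g := fun w => n%:R ^- 2 * S w ^+ 2)); last by move=> w; rewrite /ustat exprMn exprVn.
rewrite EZ; last exact: L2_sqr.
have := ustat_sqr (@mW) (@indW) (@lawW) D1 D2 n; rewrite -/S => h.
apply: (@le_trans _ _ (n%:R ^- 2 * (knorm P W false k1 * knorm P W true k2 * (2 * n%:R ^+ 2)))).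
  by apply: ler_wpM2l => //; rewrite invr_ge0 exprn_ge0.
have [->|n0] := eqVneq n 0%N; first by rewrite expr0n /= mulr0 !mulr0 mulr_ge0.
have nR : n%:R ^+ 2 != 0 :> R by rewrite expf_neq0// pnatr_eq0.
by rewrite mulrCA [_ * (2 * _)]mulrCA mulVf// mulr1 mulrC.
Qed.

(** A bound for the squared mean effect of truncation that does not involve n. *)
Let alpha m := 4 * (knorm P W false (kt false m) * knorm P W true (k true)) +
  4 * ((2 * knorm P W false (k false) + 2 * knorm P W false (kt false m)) * knorm P W true (kt true m)).

Let alpha_cvg : alpha m @[m --> \oo] --> 0.
Proof.
have c1 := trunc_cvg (@mW) (@indW) (@lawW) (k_ex false) (k_L2 false) (k_spec false).
have c2 := trunc_cvg (@mW) (@indW) (@lawW) (k_ex true) (k_L2 true) (k_spec true).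
have H : alpha m @[m --> \oo] --> (4 * (0 * knorm P W true (k true)) + 4 * ((2 * knorm P W false (k false) + 2 * 0) * 0) : R).
  apply: cvgD.
    by apply: cvgM; [exact: cvg_cst|apply: cvgM => //; exact: cvg_cst].
  apply: cvgM; [exact: cvg_cst|apply: cvgM => //].
  apply: cvgD; first exact: cvg_cst.
  by apply: cvgM => //; exact: cvg_cst.
by rewrite mul0r !mulr0 addr0 in H.
Qed.

Let ustat_approx m n : E P (fun w => (ustat (k false) (k true) n w - ustat (t false m) (t true m) n w) ^+ 2) <= alpha m.
Proof.
(* The splitting k1 k2 - t1 t2 = (k1 - t1) k2 + t1 (k2 - t2), with the norm of t1 bounded through t1
   = k1 - (k1 - t1). *)
rewrite (eq_E _ (g := fun w => (ustat (kt false m) (k true) n w + ustat (t false m) (kt true m) n w) ^+ 2)); last first.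
  move=> w; congr (_ ^+ 2); rewrite /ustat -mulrBr -mulrDr; congr (_ * _).
  rewrite -sumrB -big_split /=; apply: eq_bigr => i _.
  rewrite -sumrB -big_split /=; apply: eq_bigr => j _.
  rewrite /gram /kt; move: (k false _ _) (k true _ _) (t false _ _ _) (t true _ _ _) => u v y z; ring.
apply: (le_trans (E_sqrD (ustat_L2 n (ktD false m) (kD true)) (ustat_L2 n (tD false m) (ktD true m)))).
have h1 := ustat_norm n (ktD false m) (kD true).
have h2 := ustat_norm n (tD false m) (ktD true m).
have h3 := knormD (kD false) (ktD false m).
have tE : (fun x y => k false x y - kt false m x y) = t false m.
  by apply/funext => x; apply/funext => y; rewrite /kt subKr.
rewrite tE in h3.
have h4 := ler_wpM2r (knorm_ge0 P W true (kt true m)) h3.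
rewrite /alpha.
exact: weighted_le h1 h2 h4.
Qed.

Let c (e : nat * nat) := lam false e.1 * lam true e.2.
Let G (e : nat * nat) i w := gam false e.1 (W (false, i) w) * gam true e.2 (W (true, i) w).

Let c0 e : 0 <= c e. Proof. by rewrite mulr_ge0. Qed.

Let mGF e : measurable_fun setT (fun x : R * R => gam false e.1 x.1 * gam true e.2 x.2).
Proof. by apply: measurable_funM; [exact: (measurableT_comp (mgam _ _))|exact: (measurableT_comp (mgam _ _))]. Qed.

(** Independence of X and Y makes the products of eigenfunctions orthonormal; those with an invalid
    index are 0. *)
Let G_mul e e' i : L1 P (fun w => G e i w * G e' i w) /\
  E P (fun w => G e i w * G e' i w) = ((e == e') && (valid_index (K false) e.1 && valid_index (K true) e.2))%:R.
Proof.
have m2 b j j' : measurable_fun setT (fun x => gam b j x * gam b j' x) by exact: measurable_funM.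
have L b j j' : L1 (mu b) (fun x => gam b j x * gam b j' x) by exact: L2_mul.
have [H EH] := pair_L1 i (m2 false e.1 e'.1) (m2 true e.2 e'.2) (L false e.1 e'.1) (L true e.2 e'.2).
split; first by apply: eq_L1 H => w; rewrite /G mulrACA.
rewrite (eq_E _ (g := fun w => gam false e.1 (W (false, i) w) * gam false e'.1 (W (false, i) w) *
     (gam true e.2 (W (true, i) w) * gam true e'.2 (W (true, i) w)))); last by move=> w; rewrite /G mulrACA.
rewrite EH (eigfun_orthonormal (k_spec false)) (eigfun_orthonormal (k_spec true)).
rewrite -natrM mulnb; congr (_ : bool)%:R; rewrite andbACA; congr (_ && _).
Qed.

Let G_L2 e i : L2 P (G e i).
Proof.
split; last by have [H _] := G_mul e e i; apply: eq_L1 H => w; rewrite expr2.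
by apply: measurable_funM; [exact: (measurableT_comp (mgam _ _) (mW _))|exact: (measurableT_comp (mgam _ _) (mW _))].
Qed.

Let G_mean e i : E P (G e i) = 0.
Proof.
have [_ ->] := pair_L1 i (mgam false e.1) (mgam true e.2) (L2_L1 (gamL2 _ _)) (L2_L1 (gamL2 _ _)).
by rewrite (eigfun_mean (k_spec false)) mul0r.
Qed.

Let S n e w := (Num.sqrt n%:R)^-1 * \sum_(i < n) G e i w.

Let S_clt s (u : nat * nat -> R) : uniq s -> (forall e, c e = 0 -> u e = 0) ->
  E P (fun w => cos (\sum_(e <- s) u e * S n e w)) @[n --> \oo] -->
  expR (- ((\sum_(e <- s) u e ^+ 2) / 2)).
Proof.
move=> us u0.
pose F (x : R * R) := \sum_(e <- s) u e * (gam false e.1 x.1 * gam true e.2 x.2).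
have mF : measurable_fun setT F by apply: measurable_sum => e; apply: measurable_funM.
pose eta i w := \sum_(e <- s) u e * G e i w.
have etaE i w : eta i w = F (W (false, i) w, W (true, i) w) by [].
have Leta i : L2 P (eta i) by apply: L2_sum => e _; exact: L2Z.
have Lb (f : R -> R) : measurable_fun setT f -> (forall x, `|f x| <= 1) -> forall i r,
    E P (fun w => f (r * eta i w)) = E P (fun w => f (r * eta 0%N w)).
  move=> mf f1 i r.
  have mrF : measurable_fun setT (fun x => f (r * F x)) by apply: (measurableT_comp mf); exact: measurable_funM.
  have [] := row_same i mrF => //.
  apply: (@L1_bounded _ _ _ _ _ 1) => // .
  by apply: (measurableT_comp mf); apply: measurable_funM => //; exact: L2_meas (Leta 0%N).
have H : E P (fun w => cos ((Num.sqrt n%:R)^-1 * \sum_(i < n) eta i w)) @[n --> \oo] -->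
    expR (- ((\sum_(e <- s) u e ^+ 2) / 2)).
  apply: (@cos_clt _ _ _ _ _ P _ W (@mW) (@indW) row eta _ _ _ Leta).
  - by move=> i n ltin; apply: row_disjoint; rewrite gtn_eqF.
  - by move=> i; exact: (@row_measurable F i mF).
  - rewrite E_sum => [|e _]; last exact/L1Z/L2_L1.
    by apply: big1 => e _; rewrite EZ ?G_mean ?mulr0//; exact: L2_L1.
  - rewrite (uncorrelated_sqr us (xi := fun e w => u e * G e 0%N w)).
    + apply: eq_bigr => e _.
      rewrite (eq_E _ (g := fun w => u e ^+ 2 * (G e 0%N w * G e 0%N w))); last by move=> w; ring.
      have [H EH] := G_mul e e 0%N; rewrite EZ// EH eqxx /=.
      have [|/nandP ve] := boolP (_ && _); first by rewrite mulr1.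
      (* At an invalid index [G e] is 0 and contributes no variance; its coefficient [c e] is 0 too,
         hence so is [u e]. *)
      rewrite mulr0 u0 ?expr0n//= /c; case: ve => ve; first by rewrite /lam (eigval_invalid (k_spec false) ve) mul0r.
      by rewrite /lam (eigval_invalid (k_spec true) ve) mulr0.
    + by move=> e; exact: L2Z.
    + move=> e e' ee'; rewrite (eq_E _ (g := fun w => u e * u e' * (G e 0%N w * G e' 0%N w))); last by move=> w; ring.
      by have [H EH] := G_mul e e' 0%N; rewrite EZ// EH (negbTE ee') mulr0.
  - by apply: Lb; [apply: continuous_measurable_fun; exact: continuous_cos|exact: cos_max].
  - by apply: Lb; [apply: continuous_measurable_fun; exact: continuous_sin|exact: sin_max].
apply: cvg_trans H; apply: near_eq_cvg; apply: nearW => n; apply: eq_E => w; congr cos.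
rewrite /S /eta exchange_big /= mulr_sumr; apply: eq_bigr => e _; rewrite -mulr_sumr; ring.
Qed.

Let D e n w := n%:R^-1 * \sum_(i < n) G e i w ^+ 2.

Let D_cvg e : c e * E P (fun w => `|D e n w - E P (fun w => G e 0%N w ^+ 2)|) @[n --> \oo] --> 0.
Proof.
have mF : measurable_fun setT (fun x : R * R => (gam false e.1 x.1 * gam true e.2 x.2) ^+ 2) by exact: measurable_funX.
have H := lln_pair mF (L2_sqr (G_L2 e 0%N)).
have H2 : c e * E P (fun w => `|D e n w - E P (fun w => G e 0%N w ^+ 2)|) @[n --> \oo] --> c e * 0.
  by apply: cvgM; [exact: cvg_cst|exact: H].
by rewrite mulr0 in H2.
Qed.

Let cG e : c e * E P (fun w => G e 0%N w ^+ 2) = c e.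
Proof.
rewrite (eq_E _ (g := fun w => G e 0%N w * G e 0%N w)); last by move=> w; rewrite expr2.
have [_ ->] := G_mul e e 0%N; rewrite eqxx /=.
have [|/nandP ve] := boolP (_ && _); first by rewrite mulr1.
rewrite mulr0 /c; case: ve => ve; first by rewrite /lam (eigval_invalid (k_spec false) ve) mul0r.
by rewrite /lam (eigval_invalid (k_spec true) ve) mulr0.
Qed.

(** Adding the diagonal i = j completes the squares; the diagonal is then removed as the average
    [D], to which the law of large numbers applies. *)
Let ustat_truncE m n w : ustat (t false m) (t true m) n w =
  \sum_(e <- rect m m) c e * S n e w ^+ 2 - \sum_(e <- rect m m) c e * D e n w.
Proof.
have prodE i j : gram W false (t false m) i j w * gram W true (t true m) i j w =
    \sum_(e <- rect m m) c e * (G e i w * G e j w).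
  rewrite sum_rect /gram /t /trunc mulr_suml; apply: eq_bigr => p _; rewrite mulr_sumr; apply: eq_bigr => q _.
  rewrite /c /G /= -/(lam false p) -/(lam true q) -/(gam false p) -/(gam true q).
  by move: (lam _ _) (lam _ _) (gam _ _ _) (gam _ _ _) (gam _ _ _) (gam _ _ _) => ? ? ? ? ? ?; ring.
have -> : ustat (t false m) (t true m) n w =
    \sum_(e <- rect m m) n%:R^-1 * \sum_(i < n) \sum_(j < n | (j : nat) != i) c e * (G e i w * G e j w).
  rewrite /ustat -mulr_sumr exchange_big /=; congr (_ * _); apply: eq_bigr => i _.
  by rewrite exchange_big /=; apply: eq_bigr => j _; exact: prodE.
rewrite -sumrB; apply: eq_bigr => e _.
have -> : \sum_(i < n) \sum_(j < n | (j : nat) != i) c e * (G e i w * G e j w) =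
    c e * ((\sum_(i < n) G e i w) ^+ 2 - \sum_(i < n) G e i w ^+ 2).
  rewrite mulrBr expr2 mulr_suml !mulr_sumr -sumrB; apply: eq_bigr => i _.
  rewrite -mulr_sumr -mulrBr; congr (_ * _).
  by rewrite (sum_neq (fun j => G e i w * G e j w)) -mulr_sumr expr2.
rewrite /S /D exprMn exprVn sqr_sqrtr//; ring.
Qed.

Section limit.
Context d' (T' : measurableType d') (Q : probability T' R) (Z : nat * nat -> T' -> R).
Hypothesis mZ : forall e, measurable_fun setT (Z e).
Hypothesis indZ : independent_family Q Z.
Hypothesis lawZ : forall e (A : set (measurableTypeR R)), measurable A -> Q (Z e @^-1` A) = normal_prob 0 1 A.
Variable L : T' -> R.
Hypothesis mL : measurable_fun setT L.
Hypothesis L_L2 : forall p q, L2 Q (fun w => L w - chi_sum Z (lam false) (lam true) p q w).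
Hypothesis L_cvg : E Q (fun w => (L w - chi_sum Z (lam false) (lam true) n n w) ^+ 2) @[n --> \oo] --> 0.

Lemma ustat_ramp_cvg (a b : R) : a < b ->
  E P (fun w => ramp a b (ustat (k false) (k true) n w)) @[n --> \oo] --> E Q (fun w => ramp a b (L w)).
Proof.
move=> ab; apply/subr_cvg0; apply: norm_cvg0.
pose F := ramp a b; pose C := Num.max 1 (b - a)^-1.
have C1 : 1 <= C by rewrite le_max lexx.
have FC x y : `|F x - F y| <= C * `|x - y|.
  by apply: (le_trans (ramp_lipschitz x y ab)); rewrite ler_wpM2r// le_max lexx orbT.
have F01 x : 0 <= F x <= 1 by exact: ramp01.
pose dm m := \sum_(e <- rect m m) c e.
pose Qn m n w := \sum_(e <- rect m m) c e * S n e w ^+ 2.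
pose Qm m w := \sum_(e <- rect m m) c e * Z e w ^+ 2.
have dm0 m : 0 <= dm m by apply: sumr_ge0.
have mS n e : measurable_fun setT (S n e).
  by apply: measurable_funM => //; apply: measurable_sum => i; exact: L2_meas (G_L2 e i).
have mQn m n : measurable_fun setT (Qn m n).
  by apply: measurable_sum => e; apply: measurable_funM => //; exact: measurable_funX.
have mD e n : measurable_fun setT (D e n).
  by apply: measurable_funM => //; apply: measurable_sum => i; apply: measurable_funX; exact: L2_meas (G_L2 e i).
have mU n : measurable_fun setT (ustat (k false) (k true) n) := L2_meas (ustat_L2 n (kD false) (kD true)).
have mUm m n : measurable_fun setT (ustat (t false m) (t true m) n) := L2_meas (ustat_L2 n (tD false m) (tD true m)).
have Qc m : E P (fun w => F (Qn m n w - dm m)) @[n --> \oo] --> E Q (fun w => F (Qm m w - dm m)).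
  have K0 : 0 <= (b - a)^-1 by rewrite invr_ge0 subr_ge0 ltW.
  (* The centring constant [dm m] is moved into the test function, which keeps its Lipschitz
     constant and vanishes beyond b + [dm m]; the maximum with 0 keeps this threshold
     nonnegative. *)
  apply: (quadratic_cvg (@mZ) (@indZ) (@lawZ) (rect_uniq m m) c0 mS _ (F := fun x => F (x - dm m)) (b := Num.max 0 (b + dm m)) K0).
  - by move=> u u0; exact: (S_clt (rect_uniq m m) u0).
  - by rewrite le_max lexx.
  - move=> x y; apply: (le_trans (ramp_lipschitz _ _ ab)).
    by rewrite opprB addrA subrK.
  - move=> x; rewrite ge_max => /andP[_ h]; apply: ramp_right => //; lra.
have chiE m w : chi_sum Z (lam false) (lam true) m m w = Qm m w - dm m.
  rewrite /Qm /dm !sum_rect -sumrB; apply: eq_bigr => i _; rewrite -sumrB; apply: eq_bigr => j _.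
  by rewrite /c /=; ring.
have alpha0 m : 0 <= alpha m.
  by apply: le_trans (ustat_approx m 0%N); apply: E_ge0 => w; exact: sqr_ge0.
(* Uniform in n: truncation of the kernels and of the limiting series. For fixed m: replacement of
   [D] by its mean, and convergence of the quadratic form. *)
apply: (@double_limit0 _ _ (fun m => C * Num.sqrt (alpha m) + C * rho Q (fun w => L w - chi_sum Z (lam false) (lam true) m m w))
   (fun m n => C * (\sum_(e <- rect m m) c e * E P (fun w => `|D e n w - E P (fun w => G e 0%N w ^+ 2)|))
      + `|E P (fun w => F (Qn m n w - dm m)) - E Q (fun w => F (Qm m w - dm m))|)) => [n|m n||m].
- exact: normr_ge0.
- have mB : measurable_fun setT (fun w => Qn m n w - dm m) by exact: measurable_funB.
  have h1 := E_lipschitz P C1 (mU n) (mUm m n) F01 FC.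
  have h2 := E_lipschitz P C1 (mUm m n) mB F01 FC.
  have mchi : measurable_fun setT (chi_sum Z (lam false) (lam true) m m) := L2_meas (chi_sum_L2 (@mZ) (@lawZ) _ _ m m).
  have h3 := E_lipschitz Q C1 mL mchi F01 FC.
  have r1 : rho P (fun w => ustat (k false) (k true) n w - ustat (t false m) (t true m) n w) <= Num.sqrt (alpha m).
    rewrite -(@ler_pXn2r _ 2) ?nnegrE ?rho_ge0 ?sqrtr_ge0// sqr_sqrtr//.
    apply: le_trans (ustat_approx m n); apply: rho_le_sqr.
    by apply: L2B; [exact: ustat_L2 (kD false) (kD true)|exact: ustat_L2 (tD false m) (tD true m)].
  have LD e : L1 P (fun w => `|D e n w - E P (fun w => G e 0%N w ^+ 2)|).
    by apply/L1_norm/L1B; [apply: L1Z; apply: L1_sum => i _; exact: L2_sqr|exact: L1_cst].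
  have r2 : rho P (fun w => ustat (t false m) (t true m) n w - (Qn m n w - dm m)) <=
      \sum_(e <- rect m m) c e * E P (fun w => `|D e n w - E P (fun w => G e 0%N w ^+ 2)|).
    have eqd w : ustat (t false m) (t true m) n w - (Qn m n w - dm m) =
       - \sum_(e <- rect m m) c e * (D e n w - E P (fun w => G e 0%N w ^+ 2)).
      rewrite ustat_truncE -/(Qn m n w) /dm.
      have -> : \sum_(e <- rect m m) c e * (D e n w - E P (fun w => G e 0%N w ^+ 2)) =
          \sum_(e <- rect m m) c e * D e n w - \sum_(e <- rect m m) c e.
        by rewrite -sumrB; apply: eq_bigr => e _; rewrite mulrBr cG.
      ring.
    have L1d : L1 P (fun w => ustat (t false m) (t true m) n w - (Qn m n w - dm m)).
      apply: (@eq_L1 _ _ _ _ (fun w => - \sum_(e <- rect m m) c e * (D e n w - E P (fun w => G e 0%N w ^+ 2)))).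
        by move=> w; rewrite eqd.
      apply: L1N; apply: L1_sum => e _; apply: L1Z; apply: L1B; last exact: L1_cst.
      by apply: L1Z; apply: L1_sum => i _; exact: L2_sqr.
    apply: (le_trans (rho_le_E L1d)).
    have -> : \sum_(e <- rect m m) c e * E P (fun w => `|D e n w - E P (fun w => G e 0%N w ^+ 2)|) =
        E P (fun w => \sum_(e <- rect m m) c e * `|D e n w - E P (fun w => G e 0%N w ^+ 2)|).
      by rewrite E_sum => [|e _]; [apply: eq_bigr => e _; rewrite EZ|exact: L1Z].
    apply: E_le; [exact: L1_norm|by apply: L1_sum => e _; exact: L1Z|] => w.
    rewrite eqd normrN; apply: (le_trans (ler_norm_sum _ _ _)); apply: ler_sum => e _.
    by rewrite normrM (ger0_norm (c0 e)).
  have -> : E Q (fun w => F (Qm m w - dm m)) = E Q (fun w => F (chi_sum Z (lam false) (lam true) m m w)).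
    by apply: eq_E => w; rewrite chiE.
  have C0 : 0 <= C by lra.
  have {}h1 := le_trans h1 (ler_wpM2l C0 r1).
  have {}h2 := le_trans h2 (ler_wpM2l C0 r2).
  move: h1 h2 h3; rewrite -/F.
  move: (E P _) (E P _) (E P _) (E Q _) (E Q _) (C * _) (C * _) (C * _) => x1 x2 x3 x4 x5 y1 y2 y3.
  rewrite !ler_norml => /andP[? ?] /andP[? ?] /andP[? ?].
  have := ler_norm (x1 - x4); have := ler_norm (- (x1 - x4)); rewrite normrN => ? ?.
  by apply/andP; split; lra.
- have s0 : Num.sqrt (alpha m) @[m --> \oo] --> 0.
    by apply: cvg0_sqr; under eq_cvg do rewrite sqr_sqrtr//.
  have r0 : rho Q (fun w => L w - chi_sum Z (lam false) (lam true) m m w) @[m --> \oo] --> 0.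
    apply: cvg0_sqr; apply: (@squeeze0 _ _ _ _ _ L_cvg) => m; first exact: sqr_ge0.
    exact: rho_le_sqr.
  have H : C * Num.sqrt (alpha m) + C * rho Q (fun w => L w - chi_sum Z (lam false) (lam true) m m w) @[m --> \oo] --> (C * 0 + C * 0 : R).
    by apply: cvgD; apply: cvgM => //; exact: cvg_cst.
  by rewrite mulr0 addr0 in H.
- have H1 : \sum_(e <- rect m m) c e * E P (fun w => `|D e n w - E P (fun w => G e 0%N w ^+ 2)|) @[n --> \oo] --> \sum_(e <- rect m m) (0 : R).
    by apply: cvg_bigsum => e; exact: D_cvg.
  rewrite big1// in H1.
  have H2 : `|E P (fun w => F (Qn m n w - dm m)) - E Q (fun w => F (Qm m w - dm m))| @[n --> \oo] --> (0 : R).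
    have H3 : E P (fun w => F (Qn m n w - dm m)) - E Q (fun w => F (Qm m w - dm m)) @[n --> \oo] --> (0 : R).
      by apply/subr_cvg0; exact: Qc.
    exact: cvg0_norm H3.
  have H : C * (\sum_(e <- rect m m) c e * E P (fun w => `|D e n w - E P (fun w => G e 0%N w ^+ 2)|))
      + `|E P (fun w => F (Qn m n w - dm m)) - E Q (fun w => F (Qm m w - dm m))| @[n --> \oo] --> (C * 0 + 0 : R).
    by apply: cvgD => //; apply: cvgM => //; exact: cvg_cst.
  by rewrite mulr0 addr0 in H.
Qed.

End limit.
End spectral.
End sample.

(** * The estimators and the U-statistic *)

Lemma scaled_sum_le (R : realType) (s t a b c e x y u v : R) : 0 <= s -> 0 <= t ->
  2 * s * `|a| + 16 * s * `|b| + 20 * t * (`|c| * `|e|) + 8 * t * (x + y) + 2 * (s * u) + 2 * (s * v) <=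
  (2 * `|s * a| + 16 * `|s * b| + 20 * `|t * (c * e)| + 8 * (t * x + t * y)) + 2 * (s * u) + 2 * (s * v).
Proof.
move=> s0 t0; rewrite !normrM (ger0_norm s0) (ger0_norm t0).
by rewrite le_eqVlt; apply/orP; left; apply/eqP; ring.
Qed.

Lemma le_norm_sum (R : realType) (x v p q : R) : x <= v + 2 * p + 2 * q ->
  0 <= v -> 0 <= p -> 0 <= q -> x <= `|v + (p + p) + (q + q)|.
Proof. by move=> h v0 p0 q0; rewrite ger0_norm; lra. Qed.

Lemma sum_chain_le (R : realType) (x y v e p q pp qq : R) : x <= y + qq -> y <= v + pp ->
  pp <= p + p -> qq <= q + q -> v <= e -> x <= e + 2 * p + 2 * q.
Proof. by move=> *; lra. Qed.

Lemma scaled_sum4_le (R : realType) (s t a x y z u : R) : 0 <= s ->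
  2 * s * (`|a| + x + y + z) + t * u <= 2 * (`|s * a| + s * x + s * y + s * z) + t * u.
Proof.
move=> s0; rewrite normrM (ger0_norm s0).
by rewrite le_eqVlt; apply/orP; left; apply/eqP; ring.
Qed.

Lemma cubic_cvg (R : realType) (a b C D : R) : 0 <= a -> 0 <= b -> 0 <= C -> 0 <= D ->
  n%:R ^- 3 * ((n%:R * a + Num.sqrt (C * (2 * n%:R ^+ 2))) * (n%:R * b + Num.sqrt (D * (2 * n%:R ^+ 2)))) @[n --> \oo] --> 0.
Proof.
move=> a0 b0 C0 D0; pose c := (a + Num.sqrt (C * 2)) * (b + Num.sqrt (D * 2)).
have sq (e : R) n : 0 <= e -> Num.sqrt (e * (2 * n%:R ^+ 2)) = n%:R * Num.sqrt (e * 2) :> R.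
  by move=> e0; rewrite mulrA sqrtrM ?mulr_ge0// sqrtr_sqr ger0_norm// mulrC.
apply: (@squeeze0 _ _ _ _ _ (cvg_divn c)) => n.
  by rewrite mulr_ge0 ?invr_ge0 ?exprn_ge0// mulr_ge0// addr_ge0 ?sqrtr_ge0// mulr_ge0.
rewrite !sq//.
have [->|n0] := posnP n; first by rewrite !mul0r addr0 mul0r !mulr0 invr0 mulr0.
have nR : n%:R != 0 :> R by rewrite pnatr_eq0 -lt0n.
rewrite /c; move: (Num.sqrt _) (Num.sqrt _) (n%:R) nR => s u m m0.
by rewrite le_eqVlt; apply/orP; left; apply/eqP; field.
Qed.

Section ramp_perturb.
Context d (T : measurableType d) (R : realType) (P : probability T R).

Lemma ramp_perturb (U V : nat -> T -> R) (a b l : R) : a < b ->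
  (forall n, measurable_fun setT (U n)) -> (forall n, measurable_fun setT (V n)) ->
  rho P (fun w => V n w - U n w) @[n --> \oo] --> 0 ->
  E P (fun w => ramp a b (U n w)) @[n --> \oo] --> l ->
  E P (fun w => ramp a b (V n w)) @[n --> \oo] --> l.
Proof.
move=> ab mU mV r0 Ul; pose C := Num.max 1 (b - a)^-1.
have C1 : 1 <= C by rewrite le_max lexx.
have FC x y : `|ramp a b x - ramp a b y| <= C * `|x - y|.
  by apply: (le_trans (ramp_lipschitz x y ab)); rewrite ler_wpM2r// le_max lexx orbT.
have H : E P (fun w => ramp a b (V n w)) - E P (fun w => ramp a b (U n w)) @[n --> \oo] --> (0 : R).
  have Cr : C * rho P (fun w => V n w - U n w) @[n --> \oo] --> (C * 0 : R) by apply: cvgM => //; exact: cvg_cst.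
  rewrite mulr0 in Cr; apply: (cvg0_le _ Cr) => n.
  exact: (E_lipschitz P C1 (mV n) (mU n) (fun x => ramp01 a b x) FC).
have H2 : (E P (fun w => ramp a b (V n w)) - E P (fun w => ramp a b (U n w))) + E P (fun w => ramp a b (U n w)) @[n --> \oo] --> (0 + l : R).
  exact: cvgD.
rewrite add0r in H2; apply: cvg_trans H2; apply: near_eq_cvg; apply: nearW => n; ring.
Qed.

(** The scaled second moment is at most C n^(r - 2s) <= C/n. *)
Lemma scaled_cvg0 (f : nat -> T -> R) (C : R) r s : (forall n, L2 P (f n)) -> 0 <= C ->
  (forall n, (0 < n)%N -> E P (fun w => f n w ^+ 2) <= C * n%:R ^+ r) -> (0 < s)%N -> (r < 2 * s)%N ->
  E P (fun w => `|n%:R ^- s * f n w|) @[n --> \oo] --> 0.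
Proof.
move=> Lf C0 fC s0 rs; apply: cvg0_sqr; apply: (@squeeze0 _ _ _ _ _ (cvg_divn C)) => n; first exact: sqr_ge0.
apply: (le_trans (E_norm_sqr_le (L2Z _ (Lf n)))).
have [->|n0] := posnP n.
  rewrite invr0 mulr0 (eq_E _ (g := fun=> 0)) ?E0// => w.
  by rewrite [0 ^+ s]expr0n (gtn_eqF s0) /= invr0 mul0r expr0n.
rewrite (eq_E _ (g := fun w => n%:R ^- s ^+ 2 * f n w ^+ 2)); last by move=> w; rewrite exprMn.
rewrite EZ; last exact: L2_sqr.
have nR : 0 < n%:R :> R by rewrite ltr0n.
have n1 : 1 <= n%:R :> R by rewrite ler1n.
apply: (@le_trans _ _ (n%:R ^- s ^+ 2 * (C * n%:R ^+ r))).
  by apply: ler_wpM2l; [rewrite exprn_ge0// invr_ge0 exprn_ge0|exact: fC].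
rewrite mulrCA; apply: ler_wpM2l => //.
have -> : n%:R ^- s ^+ 2 = n%:R ^- (2 * s) :> R by rewrite exprVn -exprM mulnC.
rewrite mulrC ler_pdivrMr ?exprn_gt0// mulrC ler_pdivlMr// -exprSr.
by rewrite ler_weXn2l.
Qed.

End ramp_perturb.

Section sample.
Context d (T : measurableType d) (R : realType) (P : probability T R)
  (W : bool * nat -> T -> R) (mu : bool -> probability (measurableTypeR R) R).
Hypothesis mW : forall a, measurable_fun setT (W a).
Hypothesis indW : independent_family P W.
Hypothesis lawW : forall a (A : set (measurableTypeR R)), measurable A -> P (W a @^-1` A) = mu a.1 A.
Variables (K : bool -> set nat) (lambda : bool -> nat -> R) (g : bool -> nat -> R -> R).
Hypothesis k_ex : forall b, kernel_exists (mu b).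
Hypothesis k_L2 : forall b, kernel_square_integrable (mu b).
Hypothesis k_spec : forall b, spectral_decomposition (mu b) (K b) (lambda b) (g b).
Let k b := kernel (mu b).
Let kD b : degenerate P W mu b (k b).
Proof. exact: (kernel_degenerate (@mW) (@indW) (@lawW) (k_ex b) (k_L2 b) (k_spec b)). Qed.
Let A := gram W false (k false).
Let B := gram W true (k true).
Let oA n i w := off A n i w.
Let oB n i w := off B n i w.
Let N1 := knorm P W false (k false).
Let N2 := knorm P W true (k true).
Let N10 : 0 <= N1.
Proof. exact: (knorm_ge0 _ _ _ _). Qed.
Let N20 : 0 <= N2.
Proof. exact: (knorm_ge0 _ _ _ _). Qed.
Let NN0 : 0 <= N1 * N2. Proof. exact: mulr_ge0 N10 N20. Qed.
Let U := ustat W (k false) (k true).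

Let oA_L2 n i : L2 P (oA n i).
Proof. exact: (off_L2 (@mW) (@indW) (@lawW) (kD false) n i). Qed.
Let oB_L2 n i : L2 P (oB n i).
Proof. exact: (off_L2 (@mW) (@indW) (@lawW) (kD true) n i). Qed.
Let oA_J n i : J_measurable W (side false) (oA n i).
Proof. exact: (off_measurable (kD false) n i). Qed.
Let oB_J n i : J_measurable W (side true) (oB n i).
Proof. exact: (off_measurable (kD true) n i). Qed.

Definition tilde_stat n w := n%:R * kappa_tilde (fun i => W (false, i) w) (fun i => W (true, i) w) n.
Definition hat_stat n w := n%:R * kappa_hat (fun i => W (false, i) w) (fun i => W (true, i) w) n.

Let mdist b n i : measurable_fun setT (fun w => mean_dist (fun i => W (b, i) w) n i).
Proof.
apply: measurable_funM => //; apply: measurable_sum => j; apply: measurableT_comp => //.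
exact: measurable_funB.
Qed.

Let mgrand b n : measurable_fun setT (fun w => grand_mean_dist (fun i => W (b, i) w) n).
Proof.
apply: measurable_funM => //; apply: measurable_sum => i; apply: measurable_sum => j; apply: measurableT_comp => //.
exact: measurable_funB.
Qed.

Let mh_tilde b n i j : measurable_fun setT (fun w => h_tilde (fun i => W (b, i) w) n i j).
Proof.
apply: measurable_funM => //; apply: measurable_funD; last exact: measurable_funM.
apply: measurable_funB; last exact: measurable_funM.
apply: measurable_funB; last exact: measurable_funM.
by apply: measurableT_comp => //; exact: measurable_funB.
Qed.

Let mh_hat b n i j : measurable_fun setT (fun w => h_hat (fun i => W (b, i) w) n i j).
Proof.
apply: measurable_funM => //; apply: measurable_funD => //.
apply: measurable_funB => //; apply: measurable_funB => //.
by apply: measurableT_comp => //; exact: measurable_funB.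
Qed.

Lemma tilde_stat_measurable n : measurable_fun setT (tilde_stat n).
Proof.
apply: measurable_funM => //; apply: measurable_funM => //.
apply: measurable_sum => i; apply: measurable_sum_seq => j _ _; exact: measurable_funM.
Qed.

Lemma hat_stat_measurable n : measurable_fun setT (hat_stat n).
Proof.
apply: measurable_funM => //; apply: measurable_funM => //.
by apply: measurable_sum => i; apply: measurable_sum => j; exact: measurable_funM.
Qed.

Let U_measurable n : measurable_fun setT (U n).
Proof. exact: (L2_meas (ustat_L2 (@mW) (@indW) (@lawW) n (kD false) (kD true))). Qed.

Let S0 n w := \sum_(i < n) \sum_(j < n | (j : nat) != i) A i j w * B i j w.
Let Q0 n w := \sum_(i < n) oA n i w * oB n i w.
Let ta n w := \sum_(i < n) oA n i w.
Let tb n w := \sum_(i < n) oB n i w.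

Let S0_L2 n : L2 P (S0 n).
Proof.
apply: L2_sum => i _; apply: L2_sum => j ji.
by apply: (gram_prod_L2 (@mW) (@indW) (@lawW) (kD false) (kD true)); rewrite eq_sym.
Qed.

Let Q0_L2 n : L2 P (Q0 n).
Proof. by apply: L2_sum => i _; exact: (off_prod_L2 (@mW) (@indW) (@lawW) (kD false) (kD true)). Qed.

Let ta_L2 n : L2 P (ta n). Proof. by apply: L2_sum => i _. Qed.
Let tb_L2 n : L2 P (tb n). Proof. by apply: L2_sum => i _. Qed.

Let ta_J n : J_measurable W (side false) (ta n).
Proof. by apply: measurable_sum => i; exact: oA_J. Qed.
Let tb_J n : J_measurable W (side true) (tb n).
Proof. by apply: measurable_sum => i; exact: oB_J. Qed.

Let S0_cvg : E P (fun w => `|n%:R ^- 2 * S0 n w|) @[n --> \oo] --> 0.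
Proof.
have C0 : 0 <= 2 * (N1 * N2) := mulr_ge0 (ler0n R 2) NN0.
apply: (@scaled_cvg0 _ _ _ P S0 (2 * (N1 * N2)) 2 2 S0_L2 C0 _ isT isT) => n _.
 apply: (le_trans (ustat_sqr (@mW) (@indW) (@lawW) (kD false) (kD true) n)).
by rewrite -/N1 -/N2; move: (_ ^+ 2) => x; rewrite mulrCA mulrA.
Qed.

Let Q0_cvg : E P (fun w => `|n%:R ^- 2 * Q0 n w|) @[n --> \oo] --> 0.
Proof.
have C0 : 0 <= 4 * (N1 * N2) := mulr_ge0 (ler0n R 4) NN0.
apply: (@scaled_cvg0 _ _ _ P Q0 (4 * (N1 * N2)) 3 2 Q0_L2 C0 _ isT isT) => n n0.
 apply: (le_trans (off_prod_sqr (@mW) (@indW) (@lawW) (kD false) (kD true) n)).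
have n1 : 1 <= n%:R :> R by rewrite ler1n.
have h : 2 * n%:R ^+ 3 + 2 * n%:R ^+ 2 <= 4 * n%:R ^+ 3 :> R.
  have : n%:R ^+ 2 <= n%:R ^+ 3 :> R by rewrite ler_weXn2l.
  lra.
have -> : 4 * (N1 * N2) * n%:R ^+ 3 = N1 * N2 * (4 * n%:R ^+ 3) by move: (N1 * N2) (n%:R ^+ 3) => x y; ring.
exact: (ler_wpM2l NN0 h).
Qed.

Let tab_L2 n : L2 P (fun w => ta n w * tb n w).
Proof. exact: (@sides_L2 _ _ _ P W (@mW) (@indW) (ta n) (tb n) (ta_J n) (tb_J n) (ta_L2 n) (tb_L2 n)). Qed.

Let ta_sqr n : E P (fun w => ta n w ^+ 2) <= N1 * (2 * n%:R ^+ 2).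
Proof. exact: (off_tot_sqr (@mW) (@indW) (@lawW) (kD false) n). Qed.
Let tb_sqr n : E P (fun w => tb n w ^+ 2) <= N2 * (2 * n%:R ^+ 2).
Proof. exact: (off_tot_sqr (@mW) (@indW) (@lawW) (kD true) n). Qed.

Let tab_cvg : E P (fun w => `|n%:R ^- 3 * (ta n w * tb n w)|) @[n --> \oo] --> 0.
Proof.
have C0 : 0 <= 4 * (N1 * N2) := mulr_ge0 (ler0n R 4) NN0.
apply: (@scaled_cvg0 _ _ _ P (fun n w => ta n w * tb n w) (4 * (N1 * N2)) 4 3 tab_L2 C0 _ isT isT) => n n0.
 rewrite (eq_E _ (g := fun w => ta n w ^+ 2 * tb n w ^+ 2)); last by move=> w; rewrite exprMn.
have [_ ->] := @sides_mul _ _ _ P W (@mW) (@indW) (fun w => ta n w ^+ 2) (fun w => tb n w ^+ 2) (measurable_funX 2 (ta_J n)) (measurable_funX 2 (tb_J n)) (L2_sqr (ta_L2 n)) (L2_sqr (tb_L2 n)).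
have -> : 4 * (N1 * N2) * n%:R ^+ 4 = (N1 * (2 * n%:R ^+ 2)) * (N2 * (2 * n%:R ^+ 2)) by ring.
by apply: ler_pM => //; apply: E_ge0 => w; exact: sqr_ge0.
Qed.

Let sq_cvg (f : nat -> nat -> T -> R) (C : R) : 0 <= C ->
  (forall n, E P (fun w => \sum_(i < n) f n i w ^+ 2) <= C * (n%:R * (n%:R + 1))) ->
  n%:R ^- 3 * E P (fun w => \sum_(i < n) f n i w ^+ 2) @[n --> \oo] --> 0.
Proof.
move=> C0 fC; apply: (@squeeze0 _ _ _ _ _ (cvg_divn (2 * C))) => n.
  by rewrite mulr_ge0 ?invr_ge0 ?exprn_ge0// E_ge0// => w; apply: sumr_ge0 => i _; exact: sqr_ge0.
have [->|n0] := posnP n; first by rewrite expr0n /= invr0 mul0r mulr0.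
have nR : 0 < n%:R :> R by rewrite ltr0n.
have n1 : 1 <= n%:R :> R by rewrite ler1n.
apply: (@le_trans _ _ (n%:R ^- 3 * (C * (n%:R * (n%:R + 1))))).
  by apply: ler_wpM2l; [rewrite invr_ge0 exprn_ge0|exact: fC].
rewrite mulrCA -mulrA [2 * _]mulrC -mulrA; apply: ler_wpM2l => //.
rewrite [leLHS]mulrC ler_pdivrMr ?exprn_gt0// [leRHS]mulrC.
have -> : n%:R ^+ 3 * (n%:R^-1 * 2) = 2 * n%:R ^+ 2 :> R by field; rewrite gt_eqF.
nra.
Qed.

Let formula b : exists (a : R -> R) (c : R), (forall x y, `|a x - a y| <= 2^-1 * `|x - y|) /\
   forall i j w, gram W b (k b) i j w = - 2^-1 * `|W (b, i) w - W (b, j) w| + a (W (b, i) w) + a (W (b, j) w) + c.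
Proof.
have [a [c [aL kE _]]] := kernel_formula (@mW) (@indW) (@lawW) (k_ex b).
by exists a, c; split => // i j w; rewrite /gram /k kE.
Qed.

Let spread b z n w := n%:R ^- 2 * \sum_(i < n) (W (b, i : nat) w - z) ^+ 2.

Let mspread b z n : measurable_fun setT (spread b z n).
Proof.
apply: measurable_funM => //; apply: measurable_sum => i; apply: measurable_funX; exact: measurable_funB.
Qed.

Let spread_cvg b : exists z, rho P (spread b z n) @[n --> \oo] --> 0.
Proof.
have [z Lz] := ae_exists (kernel_section_L2 (@mW) (@indW) (@lawW) (k_ex b) (k_L2 b)).
exists z; have H := truncated_sqr_cvg (@mW) (@indW) (@lawW) (k_ex b) (k_L2 b) Lz.
apply: cvg_trans H; apply: near_eq_cvg; apply: nearW => n; apply: eq_E => w.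
rewrite ger0_norm// mulr_ge0 ?invr_ge0 ?exprn_ge0//; apply: sumr_ge0 => i _; exact: sqr_ge0.
Qed.

(** The part [V] of the error tends to 0 in mean by the moment bounds; the two spreads n^-2 sum_i
    (X_i - z)^2 need not be integrable and are controlled only through [rho]. *)
Lemma tilde_stat_ustat : rho P (fun w => tilde_stat n w - U n w) @[n --> \oo] --> 0.
Proof.
have [a [c [aL aE]]] := formula false; have [b [c' [bL bE]]] := formula true.
have [z z0] := spread_cvg false; have [w0 w00] := spread_cvg true.
pose V n w := 2 * `|n%:R ^- 2 * S0 n w| + 16 * `|n%:R ^- 2 * Q0 n w| + 20 * `|n%:R ^- 3 * (ta n w * tb n w)|
  + 8 * (n%:R ^- 3 * (\sum_(i < n) oA n i w ^+ 2) + n%:R ^- 3 * (\sum_(i < n) oB n i w ^+ 2)).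
pose EV n := 2 * E P (fun w => `|n%:R ^- 2 * S0 n w|) + 16 * E P (fun w => `|n%:R ^- 2 * Q0 n w|)
  + 20 * E P (fun w => `|n%:R ^- 3 * (ta n w * tb n w)|)
  + 8 * (n%:R ^- 3 * E P (fun w => \sum_(i < n) oA n i w ^+ 2) + n%:R ^- 3 * E P (fun w => \sum_(i < n) oB n i w ^+ 2)).
have l1 n : L1 P (fun w => `|n%:R ^- 2 * S0 n w|) by apply/L1_norm/L1Z/L2_L1.
have l2 n : L1 P (fun w => `|n%:R ^- 2 * Q0 n w|) by apply/L1_norm/L1Z/L2_L1.
have l3 n : L1 P (fun w => `|n%:R ^- 3 * (ta n w * tb n w)|) by apply/L1_norm/L1Z/L2_L1/tab_L2.
have l4 n : L1 P (fun w => \sum_(i < n) oA n i w ^+ 2) by apply: L1_sum => i _; exact: L2_sqr.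
have l5 n : L1 P (fun w => \sum_(i < n) oB n i w ^+ 2) by apply: L1_sum => i _; exact: L2_sqr.
have VE n : L1 P (V n) /\ E P (V n) = EV n.
  have k1 := L1Z 2 (l1 n); have k2 := L1Z 16 (l2 n); have k3 := L1Z 20 (l3 n).
  have k4 := L1Z (n%:R ^- 3) (l4 n); have k5 := L1Z (n%:R ^- 3) (l5 n).
  have k6 := L1Z 8 (L1D k4 k5); have k7 := L1D k1 k2; have k8 := L1D k7 k3.
  split; first exact: L1D.
  by rewrite (ED k8 k6) (ED k7 k3) (ED k1 k2) (EZ _ (l1 n)) (EZ _ (l2 n)) (EZ _ (l3 n)) (EZ _ (L1D k4 k5)) (ED k4 k5) (EZ _ (l4 n)) (EZ _ (l5 n)).
have EV0 : EV n @[n --> \oo] --> 0.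
  have H : EV n @[n --> \oo] --> (2 * 0 + 16 * 0 + 20 * 0 + 8 * (0 + 0) : R).
    apply: cvgD.
      apply: cvgD; last by apply: cvgM; [exact: cvg_cst|exact: tab_cvg].
      by apply: cvgD; (apply: cvgM; first exact: cvg_cst); [exact: S0_cvg|exact: Q0_cvg].
    apply: cvgM; first exact: cvg_cst.
    apply: cvgD; [apply: (@sq_cvg (fun n i => oA n i) N1 N10)|apply: (@sq_cvg (fun n i => oB n i) N2 N20)] => n.
      exact: (off_sum_sqr (@mW) (@indW) (@lawW) (kD false) n).
    exact: (off_sum_sqr (@mW) (@indW) (@lawW) (kD true) n).
  by rewrite !(mulr0, addr0) in H.
have bound0 : EV n + 2 * rho P (spread false z n) + 2 * rho P (spread true w0 n) @[n --> \oo] --> 0.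
  have H : EV n + 2 * rho P (spread false z n) + 2 * rho P (spread true w0 n) @[n --> \oo] --> (0 + 2 * 0 + 2 * 0 : R).
    by apply: cvgD; [apply: cvgD => //|]; apply: cvgM => //; exact: cvg_cst.
  by rewrite !(mulr0, addr0) in H.
(* The error bound is available for n >= 2. *)
rewrite -(cvg_shiftn 2 (fun n => rho P (fun w => tilde_stat n w - U n w))).
rewrite -(cvg_shiftn 2 (fun n => EV n + 2 * rho P (spread false z n) + 2 * rho P (spread true w0 n))) in bound0.
apply: (@squeeze0 _ _ _ _ _ bound0) => m; first exact: rho_ge0.
rewrite addn2; set n := m.+2.
have mdiff : measurable_fun setT (fun w => tilde_stat n w - U n w).
  by apply: measurable_funB; [exact: tilde_stat_measurable|exact: U_measurable].
have [LV EVn] := VE n; have mV := L1_meas LV.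
have mfx := mspread false z n; have mfy := mspread true w0 n.
have V0 w : 0 <= V n w.
  have i3 : 0 <= n%:R ^- 3 :> R by rewrite invr_ge0 exprn_ge0.
  rewrite /V !addr_ge0// mulr_ge0// addr_ge0// mulr_ge0// sumr_ge0// => i _; exact: sqr_ge0.
have sp0 b' z' w : 0 <= spread b' z' n w.
  by rewrite mulr_ge0 ?invr_ge0 ?exprn_ge0// sumr_ge0// => i _; exact: sqr_ge0.
have pointwise w : `|tilde_stat n w - U n w| <= V n w + 2 * spread false z n w + 2 * spread true w0 n w.
  have H : forall A' B' : nat -> nat -> R,
      A' = (fun i j => - 2^-1 * `|W (false, i) w - W (false, j) w| + a (W (false, i) w) + a (W (false, j) w) + c) ->
      B' = (fun i j => - 2^-1 * `|W (true, i) w - W (true, j) w| + b (W (true, i) w) + b (W (true, j) w) + c') ->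
      `|n%:R * kappa_tilde (fun i => W (false, i) w) (fun i => W (true, i) w) n - n%:R^-1 * (\sum_(i < n) \sum_(j < n | (j : nat) != i) A' i j * B' i j)| <=
  2 * (n%:R ^+ 2)^-1 * `|\sum_(i < n) \sum_(j < n | (j : nat) != i) A' i j * B' i j|
  + 16 * (n%:R ^+ 2)^-1 * `|\sum_(i < n) offs A' n i * offs B' n i|
  + 20 * (n%:R ^+ 3)^-1 * (`|\sum_(i < n) offs A' n i| * `|\sum_(i < n) offs B' n i|)
  + 8 * (n%:R ^+ 3)^-1 * (\sum_(i < n) offs A' n i ^+ 2 + \sum_(i < n) offs B' n i ^+ 2)
  + 2 * ((n%:R ^+ 2)^-1 * (\sum_(i < n) (W (false, i : nat) w - z) ^+ 2))
  + 2 * ((n%:R ^+ 2)^-1 * (\sum_(i < n) (W (true, i : nat) w - w0) ^+ 2)).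
    move=> A' B' -> ->; apply: (@kappa_tilde_error R m.+1 isT (fun i => W (false, i) w) (fun i => W (true, i) w)
       (fun i => a (W (false, i) w)) (fun i => b (W (true, i) w)) c c' (a z) (b w0) z w0).
      by move=> i; exact: aL.
    by move=> i; exact: bL.
  have {}H := H (fun i j => A i j w) (fun i j => B i j w).
  apply: le_trans (H _ _) _.
  - by apply/funext => i; apply/funext => j; exact: aE.
  - by apply/funext => i; apply/funext => j; exact: bE.
  have i2 : 0 <= n%:R ^- 2 :> R by rewrite invr_ge0 exprn_ge0.
  have i3 : 0 <= n%:R ^- 3 :> R by rewrite invr_ge0 exprn_ge0.
  exact: (@scaled_sum_le R (n%:R ^- 2) (n%:R ^- 3) (S0 n w) (Q0 n w) (ta n w) (tb n w) _ _ _ _ i2 i3).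
(* Doubled terms are written as sums because [rho] is subadditive but not homogeneous. *)
apply: (@le_trans _ _ (rho P (fun w => (V n w + (spread false z n w + spread false z n w)) + (spread true w0 n w + spread true w0 n w)))).
  apply: rho_le => // [|w].
    exact: (measurable_funD (measurable_funD mV (measurable_funD mfx mfx)) (measurable_funD mfy mfy)).
  exact: le_norm_sum (pointwise w) (V0 w) (sp0 false z w) (sp0 true w0 w).
have r1 := rhoD P (measurable_funD mV (measurable_funD mfx mfx)) (measurable_funD mfy mfy).
have r2 := rhoD P mV (measurable_funD mfx mfx).
have r3 := rhoD P mfx mfx; have r4 := rhoD P mfy mfy.
have r5 := rho_le_E LV.
have r6 : E P (fun w => `|V n w|) = EV n by rewrite -EVn; apply: eq_E => w; rewrite ger0_norm.
rewrite r6 in r5; exact: sum_chain_le r1 r2 r3 r4 r5.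
Qed.

(** * The biased statistic under the trace condition *)

Section trace.
Hypothesis k_tr : forall b, kernel_trace_class (mu b).
Let dk b (z : R) := k b z z.
Let tr b := E (mu b) (fun z => `|dk b z|).

Let dk_L1 b : L1 (mu b) (dk b).
Proof. exact: (kernel_diag_L1 (@mW) (@indW) (@lawW) (k_ex b) (k_tr b)). Qed.

Let mdk b : measurable_fun setT (dk b).
Proof. exact: L1_meas (dk_L1 b). Qed.

Let mndk b : measurable_fun setT (fun z => `|dk b z|).
Proof. exact: (measurableT_comp (@normr_measurable R setT) (mdk b)). Qed.

Let aA i w := `|A i i w|.
Let aB i w := `|B i i w|.

Let aA_L1 i : L1 P (aA i) /\ E P (aA i) = tr false.
Proof.
have L := L1_norm (dk_L1 false).
by split; [exact: (W_L1 (@mW) (@lawW) (a := (false, i)) (mndk false) L)|exact: (W_E (@mW) (@lawW) (a := (false, i)) (mndk false) L)].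
Qed.

Let aB_L1 i : L1 P (aB i) /\ E P (aB i) = tr true.
Proof.
have L := L1_norm (dk_L1 true).
by split; [exact: (W_L1 (@mW) (@lawW) (a := (true, i)) (mndk true) L)|exact: (W_E (@mW) (@lawW) (a := (true, i)) (mndk true) L)].
Qed.

Let J_norm b (f : T -> R) : J_measurable W (side b) f -> J_measurable W (side b) (fun w => `|f w|).
Proof. by move=> mf; exact: (measurableT_comp (@normr_measurable R setT) mf). Qed.

Let aA_J i : J_measurable W (side false) (aA i).
Proof. by apply: J_norm; apply: (gram_measurable (kD false)). Qed.

Let aB_J i : J_measurable W (side true) (aB i).
Proof. by apply: J_norm; apply: (gram_measurable (kD true)). Qed.

Let tr0 b : 0 <= tr b. Proof. by apply: E_ge0 => z; exact: normr_ge0. Qed.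

Let le_sqrt (f : T -> R) (C : R) : L2 P f -> E P (fun w => f w ^+ 2) <= C -> E P (fun w => `|f w|) <= Num.sqrt C.
Proof.
move=> Lf fC; have C0 : 0 <= C by apply: le_trans fC; apply: E_ge0 => w; exact: sqr_ge0.
have e0 : 0 <= E P (fun w => `|f w|) by apply: E_ge0 => w; exact: normr_ge0.
rewrite -(@ler_pXn2r _ 2) ?nnegrE ?sqrtr_ge0// sqr_sqrtr//.
exact: le_trans (E_norm_sqr_le Lf) fC.
Qed.

Let sqr_off_le b n (i : 'I_n) : E P (fun w => off (gram W b (k b)) n i w ^+ 2) <= knorm P W b (k b) * (n%:R + 1).
Proof.
have /andP[_] := off_cov (@mW) (@indW) (@lawW) (kD b) (ltn_ord i) (ltn_ord i).
by rewrite eqxx mul1r.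
Qed.

Let e1 n := Num.sqrt (N1 * (n%:R + 1)).
Let e2 n := Num.sqrt (N2 * (n%:R + 1)).

(** For the products of a diagonal entry with an off-diagonal row sum: n terms of size n^(1/2),
    divided by n^2. *)
Let sqrt_cvg (C D : R) : 0 <= C -> 0 <= D -> n%:R ^- 2 * (n%:R * (C * Num.sqrt (D * (n%:R + 1)))) @[n --> \oo] --> 0.
Proof.
move=> C0 D0; apply: cvg0_sqr; apply: (@squeeze0 _ _ _ _ _ (cvg_divn (2 * (C ^+ 2 * D)))) => n; first exact: sqr_ge0.
have [->|n0] := posnP n; first by rewrite mul0r mulr0 expr0n /= invr0 mulr0.
have nR : 0 < n%:R :> R by rewrite ltr0n.
have n1 : 1 <= n%:R :> R by rewrite ler1n.
have Dn : 0 <= D * (n%:R + 1) by rewrite mulr_ge0// addr_ge0.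
rewrite !exprMn sqr_sqrtr//.
have -> : n%:R ^- 2 ^+ 2 * (n%:R ^+ 2 * (C ^+ 2 * (D * (n%:R + 1)))) = C ^+ 2 * D * ((n%:R + 1) / n%:R ^+ 2).
  by field; rewrite gt_eqF.
have -> : 2 * (C ^+ 2 * D) / n%:R = C ^+ 2 * D * (2 / n%:R) by field; rewrite gt_eqF.
apply: ler_wpM2l; first by rewrite mulr_ge0// sqr_ge0.
rewrite ler_pdivrMr ?exprn_gt0//.
have -> : 2 / n%:R * n%:R ^+ 2 = 2 * n%:R :> R by field; rewrite gt_eqF.
lra.
Qed.

Let HV n w := 2 * (`|n%:R ^- 2 * Q0 n w| + n%:R ^- 2 * (\sum_(i < n) aA i w * `|oB n i w|)
   + n%:R ^- 2 * (\sum_(i < n) `|oA n i w| * aB i w) + n%:R ^- 2 * (\sum_(i < n) aA i w * aB i w))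
   + n%:R ^- 3 * ((\sum_(i < n) aA i w + `|ta n w|) * (\sum_(i < n) aB i w + `|tb n w|)).

Let EHV n := 2 * (E P (fun w => `|n%:R ^- 2 * Q0 n w|) + n%:R ^- 2 * (n%:R * (tr false * e2 n))
   + n%:R ^- 2 * (n%:R * (tr true * e1 n)) + n%:R ^- 2 * (n%:R * (tr false * tr true)))
   + n%:R ^- 3 * ((n%:R * tr false + Num.sqrt (N1 * (2 * n%:R ^+ 2))) * (n%:R * tr true + Num.sqrt (N2 * (2 * n%:R ^+ 2)))).

(** Every product pairs a factor from side [false] with one from side [true], so independence
    replaces Cauchy-Schwarz and first moments of the diagonal entries suffice. *)
Let HV_le n : L1 P (HV n) /\ E P (HV n) <= EHV n.
Proof.
have absB i : L1 P (fun w => `|oB n i w|) by exact: L1_norm (L2_L1 (oB_L2 n i)).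
have absA i : L1 P (fun w => `|oA n i w|) by exact: L1_norm (L2_L1 (oA_L2 n i)).
have p1 i := @sides_mul _ _ _ P W (@mW) (@indW) (aA i) (fun w => `|oB n i w|) (aA_J i) (J_norm (oB_J n i)) (aA_L1 i).1 (absB i).
have p2 i := @sides_mul _ _ _ P W (@mW) (@indW) (fun w => `|oA n i w|) (aB i) (J_norm (oA_J n i)) (aB_J i) (absA i) (aB_L1 i).1.
have p3 i := @sides_mul _ _ _ P W (@mW) (@indW) (aA i) (aB i) (aA_J i) (aB_J i) (aA_L1 i).1 (aB_L1 i).1.
pose SA w := \sum_(i < n) aA i w + `|ta n w|.
pose SB w := \sum_(i < n) aB i w + `|tb n w|.
have jA : J_measurable W (side false) SA.
  by apply: measurable_funD; [apply: measurable_sum => i; exact: aA_J|exact: J_norm (ta_J n)].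
have jB : J_measurable W (side true) SB.
  by apply: measurable_funD; [apply: measurable_sum => i; exact: aB_J|exact: J_norm (tb_J n)].
have lA0 : L1 P (fun w => \sum_(i < n) aA i w) by apply: L1_sum => i _; exact: (aA_L1 i).1.
have lB0 : L1 P (fun w => \sum_(i < n) aB i w) by apply: L1_sum => i _; exact: (aB_L1 i).1.
have lta : L1 P (fun w => `|ta n w|) by exact: L1_norm (L2_L1 (ta_L2 n)).
have ltb : L1 P (fun w => `|tb n w|) by exact: L1_norm (L2_L1 (tb_L2 n)).
have lA : L1 P SA by exact: L1D lA0 lta.
have lB : L1 P SB by exact: L1D lB0 ltb.
have p4 := @sides_mul _ _ _ P W (@mW) (@indW) SA SB jA jB lA lB.
have q0 : L1 P (fun w => `|n%:R ^- 2 * Q0 n w|) by exact: L1_norm (L1Z _ (L2_L1 (Q0_L2 n))).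
have s1 : L1 P (fun w => \sum_(i < n) aA i w * `|oB n i w|) by apply: L1_sum => i _; exact: (p1 i).1.
have s2 : L1 P (fun w => \sum_(i < n) `|oA n i w| * aB i w) by apply: L1_sum => i _; exact: (p2 i).1.
have s3 : L1 P (fun w => \sum_(i < n) aA i w * aB i w) by apply: L1_sum => i _; exact: (p3 i).1.
have z1 := L1Z (n%:R ^- 2) s1; have z2 := L1Z (n%:R ^- 2) s2; have z3 := L1Z (n%:R ^- 2) s3.
have z4 := L1Z (n%:R ^- 3) p4.1.
have y1 := L1D q0 z1; have y2 := L1D y1 z2; have y3 := L1D y2 z3; have y4 := L1Z 2 y3.
split; first exact: L1D y4 z4.
have i2 : 0 <= n%:R ^- 2 :> R by rewrite invr_ge0 exprn_ge0.
have i3 : 0 <= n%:R ^- 3 :> R by rewrite invr_ge0 exprn_ge0.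
have E1 : E P (fun w => \sum_(i < n) aA i w * `|oB n i w|) <= n%:R * (tr false * e2 n).
  rewrite E_sum => [|i _]; last exact: (p1 i).1.
  rewrite -sum_cst; apply: ler_sum => i _.
  rewrite (p1 i).2 (aA_L1 i).2; apply: ler_wpM2l; first exact: tr0.
  exact: le_sqrt (oB_L2 n i) (sqr_off_le true i).
have E2 : E P (fun w => \sum_(i < n) `|oA n i w| * aB i w) <= n%:R * (tr true * e1 n).
  rewrite E_sum => [|i _]; last exact: (p2 i).1.
  rewrite -sum_cst; apply: ler_sum => i _.
  rewrite (p2 i).2 (aB_L1 i).2 mulrC; apply: ler_wpM2l; first exact: tr0.
  exact: le_sqrt (oA_L2 n i) (sqr_off_le false i).
have E3 : E P (fun w => \sum_(i < n) aA i w * aB i w) <= n%:R * (tr false * tr true).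
  rewrite E_sum => [|i _]; last exact: (p3 i).1.
  rewrite -sum_cst; apply: ler_sum => i _.
  by rewrite (p3 i).2 (aA_L1 i).2 (aB_L1 i).2.
have EA : E P SA <= n%:R * tr false + Num.sqrt (N1 * (2 * n%:R ^+ 2)).
  rewrite (ED lA0 lta); apply: lerD; last exact: le_sqrt (ta_L2 n) (ta_sqr n).
  rewrite E_sum => [|i _]; last exact: (aA_L1 i).1.
  rewrite -sum_cst; apply: ler_sum => i _.
  by rewrite (aA_L1 i).2.
have EB' : E P SB <= n%:R * tr true + Num.sqrt (N2 * (2 * n%:R ^+ 2)).
  rewrite (ED lB0 ltb); apply: lerD; last exact: le_sqrt (tb_L2 n) (tb_sqr n).
  rewrite E_sum => [|i _]; last exact: (aB_L1 i).1.
  rewrite -sum_cst; apply: ler_sum => i _.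
  by rewrite (aB_L1 i).2.
have SA0 : 0 <= E P SA.
  by apply: E_ge0 => w; apply: addr_ge0; [apply: sumr_ge0 => i _; exact: normr_ge0|exact: normr_ge0].
have SB0 : 0 <= E P SB.
  by apply: E_ge0 => w; apply: addr_ge0; [apply: sumr_ge0 => i _; exact: normr_ge0|exact: normr_ge0].
rewrite (ED y4 z4) (EZ _ y3) (ED y2 z3) (ED y1 z2) (ED q0 z1) (EZ _ s1) (EZ _ s2) (EZ _ s3) (EZ _ p4.1) p4.2.
have h4 := ler_wpM2l i3 (ler_pM SA0 SB0 EA EB').
exact: lerD (ler_wpM2l (ler0n R 2) (lerD (lerD (lerD (lexx _) (ler_wpM2l i2 E1)) (ler_wpM2l i2 E2)) (ler_wpM2l i2 E3))) h4.
Qed.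

Let EHV_cvg : EHV n @[n --> \oo] --> 0.
Proof.
have c3 : n%:R ^- 2 * (n%:R * (tr false * tr true)) @[n --> \oo] --> 0.
  apply: (@squeeze0 _ _ _ _ _ (cvg_divn (tr false * tr true))) => n.
    by rewrite mulr_ge0 ?invr_ge0 ?exprn_ge0// mulr_ge0// mulr_ge0.
  have [->|n0] := posnP n; first by rewrite mul0r mulr0 invr0 mulr0.
  have nR : n%:R != 0 :> R by rewrite pnatr_eq0 -lt0n.
  by rewrite le_eqVlt; apply/orP; left; apply/eqP; field.
have c4 := cubic_cvg (tr0 false) (tr0 true) N10 N20.
have H : EHV n @[n --> \oo] --> (2 * (0 + 0 + 0 + 0) + 0 : R).
  apply: cvgD => //; apply: cvgM; first exact: cvg_cst.
  apply: cvgD => //; apply: cvgD; last exact: sqrt_cvg (tr0 true) N10.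
  by apply: cvgD; [exact: Q0_cvg|exact: sqrt_cvg (tr0 false) N20].
by rewrite !(mulr0, addr0) in H.
Qed.

Let DV n w := n%:R^-1 * \sum_(i < n) A i i w * B i i w.
Let t2 := E (mu false) (dk false) * E (mu true) (dk true).

Let DV_L1 n : L1 P (DV n) /\ E P (fun w => `|DV n w - t2|) @[n --> \oo] --> 0.
Proof.
have [L0 E0'] := pair_L1 (@mW) (@indW) (@lawW) 0 (mdk false) (mdk true) (dk_L1 false) (dk_L1 true).
split.
  apply: L1Z; apply: L1_sum => i _.
  exact: (pair_L1 (@mW) (@indW) (@lawW) i (mdk false) (mdk true) (dk_L1 false) (dk_L1 true)).1.
have mF : measurable_fun setT (fun x : R * R => dk false x.1 * dk true x.2).
  by apply: measurable_funM; [exact: (measurableT_comp (mdk _))|exact: (measurableT_comp (mdk _))].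
have H := lln_pair (@mW) (@indW) (@lawW) mF L0.
by rewrite E0' in H.
Qed.

(** The diagonal average tends to the product of the traces by the law of large numbers; all other
    differences from U_n are bounded by [HV]. *)
Lemma hat_stat_ustat : rho P (fun w => hat_stat n w - (U n w + t2)) @[n --> \oo] --> 0.
Proof.
have [a [c [aL aE]]] := formula false; have [b [c' [bL bE]]] := formula true.
pose bd n := EHV n + E P (fun w => `|DV n w - t2|).
have bd0 : bd n @[n --> \oo] --> 0.
  have H : bd n @[n --> \oo] --> (0 + 0 : R) by apply: cvgD; [exact: EHV_cvg|exact: (DV_L1 0%N).2].
  by rewrite addr0 in H.
rewrite -(cvg_shiftn 2 (fun n => rho P (fun w => hat_stat n w - (U n w + t2)))).
rewrite -(cvg_shiftn 2 bd) in bd0.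
apply: (@squeeze0 _ _ _ _ _ bd0) => m; first exact: rho_ge0.
rewrite addn2; set n := m.+2.
have [LH EH] := HV_le n; have mH := L1_meas LH.
have LD : L1 P (fun w => DV n w - t2) by exact: L1B (DV_L1 n).1 (L1_cst _ _).
have mD := L1_meas LD.
have pointwise w : `|hat_stat n w - U n w - DV n w| <= HV n w.
  have H : forall A' B' : nat -> nat -> R,
      A' = (fun i j => - 2^-1 * `|W (false, i) w - W (false, j) w| + a (W (false, i) w) + a (W (false, j) w) + c) ->
      B' = (fun i j => - 2^-1 * `|W (true, i) w - W (true, j) w| + b (W (true, i) w) + b (W (true, j) w) + c') ->
  `|n%:R * kappa_hat (fun i => W (false, i) w) (fun i => W (true, i) w) n - n%:R^-1 * (\sum_(i < n) \sum_(j < n | (j : nat) != i) A' i j * B' i j)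
     - n%:R^-1 * \sum_(i < n) A' i i * B' i i| <=
  2 * (n%:R ^+ 2)^-1 * (`|\sum_(i < n) offs A' n i * offs B' n i| + \sum_(i < n) `|A' i i| * `|offs B' n i|
     + \sum_(i < n) `|offs A' n i| * `|B' i i| + \sum_(i < n) `|A' i i| * `|B' i i|)
  + (n%:R ^+ 3)^-1 * ((\sum_(i < n) `|A' i i| + `|\sum_(i < n) offs A' n i|) *
      (\sum_(i < n) `|B' i i| + `|\sum_(i < n) offs B' n i|)).
    move=> A' B' -> ->; exact: (@kappa_hat_error R m.+1 (fun i => W (false, i) w) (fun i => W (true, i) w)
       (fun i => a (W (false, i) w)) (fun i => b (W (true, i) w)) c c').
  have {}H := H (fun i j => A i j w) (fun i j => B i j w).
  apply: le_trans (H _ _) _.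
  - by apply/funext => i; apply/funext => j; exact: aE.
  - by apply/funext => i; apply/funext => j; exact: bE.
  have i2 : 0 <= n%:R ^- 2 :> R by rewrite invr_ge0 exprn_ge0.
  exact: (@scaled_sum4_le R (n%:R ^- 2) (n%:R ^- 3) (Q0 n w) _ _ _ _ i2).
have mhat : measurable_fun setT (fun w => hat_stat n w - (U n w + t2)).
  by apply: measurable_funB; [exact: hat_stat_measurable|apply: measurable_funD => //; exact: U_measurable].
apply: (@le_trans _ _ (rho P (fun w => HV n w + `|DV n w - t2|))).
  have mnD := L1_meas (L1_norm LD).
  apply: rho_le => // [|w]; first exact: (measurable_funD mH mnD).
  have -> : hat_stat n w - (U n w + t2) = (hat_stat n w - U n w - DV n w) + (DV n w - t2).
    by move: (hat_stat n w) (U n w) (DV n w) (t2) => x1 x2 x3 x4; ring.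
  apply: (le_trans (ler_normD _ _)); apply: le_trans (ler_norm _).
  by apply: lerD; [exact: pointwise|exact: lexx].
apply: (le_trans (rho_le_E (L1D LH (L1_norm LD)))).
have HV0 w : 0 <= HV n w by exact: le_trans (normr_ge0 _) (pointwise w).
rewrite (eq_E _ (g := fun w => HV n w + `|DV n w - t2|)); last first.
  by move=> w; rewrite ger0_norm// addr_ge0.
by rewrite (ED LH (L1_norm LD)); apply: lerD; [exact: EH|exact: lexx].
Qed.

End trace.
End sample.

(** * The sample as one independent family *)

Lemma measurable_RV d (T : measurableType d) (R : realType) (Q : probability T R) (L : T -> R) :
  measurable_fun setT L -> exists V : {RV Q >-> measurableTypeR R}, forall w, V w = L w.
Proof.
move=> mL; have mL' : (L : T -> measurableTypeR R) \in mfun by rewrite inE.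
by exists (mfun_Sub mL').
Qed.

Section ms.
Context d (T : measurableType d) (R : realType) (Q : probability T R).

Lemma mean_square_cvg (f : nat -> nat -> T -> R) : (forall p q, L2 Q (f p q)) ->
  (forall eps, 0 < eps -> exists n, forall p q, (n <= p)%N -> (n <= q)%N -> E Q (fun w => f p q w ^+ 2) <= eps) ->
  (\int[Q]_w ((f p.1 p.2 w) ^+ 2)%:E)%E @[p --> filter_prod \oo \oo] --> 0%E.
Proof.
move=> Lf fe.
have -> : (fun p : nat * nat => \int[Q]_w ((f p.1 p.2 w) ^+ 2)%:E)%E = (fun p => (E Q (fun w => f p.1 p.2 w ^+ 2))%:E).
  by apply/funext => p; rewrite (EE (L2_sqr (Lf _ _))).
apply: cvg_EFin; first exact: nearW.
apply/cvgrPdist_lt => e e0; have [n H] := fe (e / 2) (divr_gt0 e0 (ltr0Sn R 1)).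
exists ([set p | (n <= p)%N], [set q | (n <= q)%N]); first by split; exact: nbhs_infty_ge.
move=> [p q] /= [np nq]; rewrite sub0r normrN ger0_norm; last by apply: E_ge0 => w; exact: sqr_ge0.
by apply: le_lt_trans (H p q np nq) _; lra.
Qed.

End ms.

Section sample_family.
Context d0 d (T0 : measurableType d0) (T : measurableType d) (R : realType)
  (P0 : probability T0 R) (P : probability T R)
  (X Y : {RV P0 >-> measurableTypeR R}) (Xs Ys : nat -> {RV P >-> measurableTypeR R}).
Hypothesis XY_copies : forall i : nat, same_law P P0
  (fun w => (Xs i w, Ys i w) : measurableTypeR R * measurableTypeR R)
  (fun w => (X w, Y w) : measurableTypeR R * measurableTypeR R).
Hypothesis XY_indep : independent_family P
  (fun (i : nat) (w : T) => (Xs i w, Ys i w) : measurableTypeR R * measurableTypeR R).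
Hypothesis X_indep_Y : independent_pair P0 X Y.

Definition coord (a : bool * nat) (w : T) : R := if a.1 then Ys a.2 w else Xs a.2 w.
Definition coord_law (b : bool) : probability (measurableTypeR R) R :=
  if b then (distribution P0 Y : probability (measurableTypeR R) R)
  else (distribution P0 X : probability (measurableTypeR R) R).

Lemma coord_measurable a : measurable_fun setT (coord a).
Proof.
case: a => [[] i]; rewrite /coord; [exact: (@measurable_funPT _ _ _ _ (Ys i))|exact: (@measurable_funPT _ _ _ _ (Xs i))].
Qed.

Let pair_law (A B : set (measurableTypeR R)) i : measurable A -> measurable B ->
  P ((fun w => (Xs i w, Ys i w)) @^-1` (A `*` B)) = (P0 (X @^-1` A) * P0 (Y @^-1` B))%E.
Proof.
move=> mA mB; rewrite -X_indep_Y//; exact: (XY_copies i (measurableX mA mB)).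
Qed.

Lemma coordE a (A : set (measurableTypeR R)) : measurable A -> P (coord a @^-1` A) = coord_law a.1 A.
Proof.
move=> mA; have PT (V : {RV P0 >-> measurableTypeR R}) : P0 (V @^-1` setT) = 1%E by rewrite preimage_setT probability_setT.
case: a => [[] i]; rewrite /coord /coord_law /=.
  have := @pair_law setT A i measurableT mA; rewrite PT mul1e => H; rewrite /distribution /pushforward -H; congr (P _).
  by apply/seteqP; split => w //= [].
have := @pair_law A setT i mA measurableT; rewrite PT mule1 => H; rewrite /distribution /pushforward -H; congr (P _).
by apply/seteqP; split => w //= [].
Qed.

(** The indices are grouped by rows. Independence of the pairs splits the probability over rows, and
    independence of X and Y splits each row. *)
Lemma coord_indep : independent_family P coord.
Proof.
move=> J A uJ mA.
pose A' a : set (measurableTypeR R) := if a \in J then A a else setT.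
have mA' a : measurable (A' a) by rewrite /A'; case: ifP => _; [exact: mA|exact: measurableT].
pose B i : set (measurableTypeR R * measurableTypeR R) := A' (false, i) `*` A' (true, i).
have mB i : measurable (B i) by exact: measurableX.
pose J' := undup (map snd J).
have -> : \bigcap_(a in [set` J]) (coord a @^-1` A a) =
    \bigcap_(i in [set` J']) ((fun w => (Xs i w, Ys i w)) @^-1` B i).
  apply/seteqP; split => w /= H.
    move=> i _; split; rewrite /= /A'; case: ifP => // aJ; exact: (H _ aJ).
  move=> [b i] /= aJ; have iJ : i \in J' by rewrite mem_undup; apply/mapP; exists (b, i).
  have [] := H i iJ; rewrite /= /A' /coord /=; case: b aJ => aJ; rewrite aJ//.
rewrite XY_indep ?undup_uniq//.
have p1 a : a \notin J -> P (coord a @^-1` A' a) = 1%E.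
  by rewrite /A' => /negbTE ->; rewrite preimage_setT probability_setT.
have pE i : P ((fun w => (Xs i w, Ys i w)) @^-1` B i) =
    (\prod_(b <- [:: false; true]) P (coord (b, i) @^-1` A' (b, i)))%E.
  rewrite /B pair_law// big_cons big_seq1; congr (_ * _)%E; by rewrite coordE.
rewrite (eq_bigr _ (fun i _ => pE i)).
rewrite exchange_big -(big_allpairs (F := fun a => P (coord a @^-1` A' a))).
pose S := [seq (b, i) | b <- [:: false; true], i <- J'].
rewrite -/S.
(* Completing the rows added entries outside [J]; their sets are the whole space, with probability
   1. *)
rewrite (bigID (mem J)) /= [X in (_ * X)%E]big1 => [|a]; last exact: p1.
rewrite mule1 -big_filter.
have memS a : (a \in S) = (a.2 \in J').
  case: a => b i; apply/allpairsP/idP => /= [[[b' i'] /= [_ iJ [_ ->]]]//|iJ].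
  by exists (b, i); split => //=; case: b.
have SJ : perm_eq [seq a <- S | a \in J] J.
  apply: uniq_perm => //.
    by apply/filter_uniq/allpairs_uniq => //; [exact: undup_uniq|move=> [? ?] [? ?] _ _ [-> ->]].
  move=> a; rewrite mem_filter memS; case aJ: (a \in J) => //=.
  by rewrite mem_undup; apply/mapP; exists a.
rewrite (perm_big _ SJ) /=; apply: eq_big_seq => a aJ.
by rewrite /A' aJ.
Qed.

End sample_family.

(** * The limit laws *)

Lemma sum_eigval (R : realType) (K K' : set nat) (a b : nat -> R) p q (F : nat -> nat -> R) :
  \sum_(i < p | (i : nat) \in K) \sum_(j < q | (j : nat) \in K') a i * b j * F i j =
  \sum_(i < p) \sum_(j < q) eigval K a i * eigval K' b j * F i j.
Proof.
rewrite big_mkcond; apply: eq_bigr => i _; rewrite /eigval; case: ifP => iK.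
  by rewrite big_mkcond; apply: eq_bigr => j _; case: ifP => jK; rewrite ?(mulr0, mul0r).
by rewrite big1// => j _; rewrite !mul0r.
Qed.

Lemma ramp_shift (R : realType) (a b t x : R) : ramp a b (x + t) = ramp (a - t) (b - t) x.
Proof. by rewrite /ramp; congr (Num.max 0 (Num.min 1 (_ / _))); ring. Qed.

(** Reduces rectangular partial sums to square ones: by monotonicity, the product of partial traces
    over a larger rectangle is closer to its limit. *)
Lemma prod_gap (R : realType) (s s' t t' u u' : R) : 0 <= s -> 0 <= s' -> s <= t -> s' <= t' -> t <= u -> t' <= u' ->
  (u * u' - t * t') ^+ 2 <= (u * u' - s * s') ^+ 2.
Proof.
move=> s0 s'0 st st' tu tu'.
have h1 : s * s' <= t * t' by exact: ler_pM.
have h2 : t * t' <= u * u' by apply: ler_pM => //; [exact: le_trans st|exact: le_trans st'].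
by rewrite ler_pXn2r ?nnegrE// ?subr_ge0//; [rewrite lerB|exact: le_trans h1 h2].
Qed.

Section limit_laws.
Context d (T : measurableType d) (R : realType) (P : probability T R)
  (W : bool * nat -> T -> R) (mu : bool -> probability (measurableTypeR R) R).
Hypothesis mW : forall a, measurable_fun setT (W a).
Hypothesis indW : independent_family P W.
Hypothesis lawW : forall a (A : set (measurableTypeR R)), measurable A -> P (W a @^-1` A) = mu a.1 A.
Context (K : bool -> set nat) (lambda : bool -> nat -> R) (g : bool -> nat -> R -> R).
Hypothesis k_ex : forall b, kernel_exists (mu b).
Hypothesis k_L2 : forall b, kernel_square_integrable (mu b).
Hypothesis k_spec : forall b, spectral_decomposition (mu b) (K b) (lambda b) (g b).
Context d' (T' : measurableType d') (Q : probability T' R) (Z : nat * nat -> T' -> R).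
Hypothesis mZ : forall e, measurable_fun setT (Z e).
Hypothesis indZ : independent_family Q Z.
Hypothesis lawZ : forall e (A : set (measurableTypeR R)), measurable A -> Q (Z e @^-1` A) = normal_prob 0 1 A.
Let k b := kernel (mu b).
Let lam b := eigval (K b) (lambda b).
Let chi := chi_sum Z (lam false) (lam true).
Let U := ustat W (k false) (k true).

Let mU n : measurable_fun setT (U n).
Proof.
have kD b := kernel_degenerate (@mW) (@indW) (@lawW) (k_ex b) (k_L2 b) (k_spec b).
exact: L2_meas (ustat_L2 (@mW) (@indW) (@lawW) n (kD false) (kD true)).
Qed.

Lemma ustat_limit : exists L : T' -> R, [/\ measurable_fun setT L,
  forall p q, L2 Q (fun w => L w - chi p q w),
  forall eps, 0 < eps -> exists n, forall p q, (n <= p)%N -> (n <= q)%N ->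
    E Q (fun w => (L w - chi p q w) ^+ 2) <= eps &
  forall a b, a < b -> E P (fun w => ramp a b (U n w)) @[n --> \oo] --> E Q (fun w => ramp a b (L w))].
Proof.
have bd b := eigval_sqr_bounded (@mW) (@indW) (@lawW) k_ex k_L2 k_spec b.
have [L [mL LL Lc Le]] := chi_series (@mZ) (@indZ) (@lawZ) (bd false) (bd true).
exists L; split => // a b ab.
exact: (ustat_ramp_cvg (@mW) (@indW) (@lawW) k_ex k_L2 k_spec (@mZ) (@indZ) (@lawZ) mL LL Lc ab).
Qed.

Lemma tilde_stat_limit : exists L : {RV Q >-> measurableTypeR R},
  mean_square_sum Q (K false) (K true)
    (fun i j w => lambda false i * lambda true j * (Z (i, j) w ^+ 2 - 1)) L /\
  cvg_in_distribution P Q (tilde_stat W) L.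
Proof.
have [L0 [mL LL Le Lr]] := ustat_limit; have [L LE] := measurable_RV Q mL.
have {LE} LE : (L : T' -> R) = L0 by apply/funext => w; exact: LE.
exists L; rewrite LE; split.
  apply: cvg_trans (mean_square_cvg LL Le); apply: near_eq_cvg; apply: nearW => p /=.
  by apply: eq_integral => w _; rewrite (sum_eigval _ _ _ _ _ _ (fun i j => Z (i, j) w ^+ 2 - 1)).
apply: ramp_cvg_in_distribution => // [|a b ab]; first exact: tilde_stat_measurable.
apply: (ramp_perturb ab mU (tilde_stat_measurable (@mW))); last exact: Lr.
exact: (tilde_stat_ustat (@mW) (@indW) (@lawW) k_ex k_L2 k_spec).
Qed.

Section trace_class.
Hypothesis k_tr : forall b, kernel_trace_class (mu b).
Let tr b := E (mu b) (fun z => k b z z).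
Let s b n := \sum_(j < n) lam b j.

Let lam0 b j : 0 <= lam b j.
Proof. exact: eigval_ge0 (k_spec b) j. Qed.

Let s0 b n : 0 <= s b n.
Proof. exact: sumr_ge0. Qed.

Let s_mono b m n : (m <= n)%N -> s b m <= s b n.
Proof.
apply: (@homo_leq _ (s b) <=%R) => [i|i j l|i].
- exact: lexx.
- exact: le_trans.
by rewrite /s big_ord_recr /= lerDl.
Qed.

Let s_cvg b : s b n @[n --> \oo] --> tr b.
Proof. exact: (trace_formula (@mW) (@indW) (@lawW) (k_ex b) (k_L2 b) (k_spec b) (k_tr b)). Qed.

Let s_le b n : s b n <= tr b.
Proof.
rewrite -(cvg_lim _ (s_cvg (b := b)))//; apply: nondecreasing_cvgn_le => [m l|]; first exact: s_mono.
by apply/cvg_ex; exists (tr b); exact: s_cvg.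
Qed.

Let chi_sqr p q w : \sum_(i < p) \sum_(j < q) lam false i * lam true j * Z (i : nat, j : nat) w ^+ 2 =
  chi p q w + s false p * s true q.
Proof.
rewrite /chi /chi_sum /s mulr_suml -big_split; apply: eq_bigr => i _ /=.
by rewrite mulr_sumr -big_split; apply: eq_bigr => j _ /=; ring.
Qed.

Lemma hat_stat_limit : exists L : {RV Q >-> measurableTypeR R},
  mean_square_sum Q (K false) (K true)
    (fun i j w => lambda false i * lambda true j * Z (i, j) w ^+ 2) L /\
  cvg_in_distribution P Q (hat_stat W) L.
Proof.
have [L0 [mL LL Le Lr]] := ustat_limit; pose t2 := tr false * tr true.
have mL2 : measurable_fun setT (fun w => L0 w + t2) by exact: measurable_funD.
have [L LE] := measurable_RV Q mL2.
have {LE} LE : (L : T' -> R) = (fun w => L0 w + t2) by apply/funext => w; exact: LE.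
exists L; rewrite LE; split; last first.
  apply: ramp_cvg_in_distribution => // [|a b ab]; first exact: hat_stat_measurable.
  apply: (@ramp_perturb _ _ _ _ (fun n w => U n w + t2) _ _ _ _ ab _ (hat_stat_measurable (@mW))).
  - by move=> n; apply: measurable_funD.
  - exact: (hat_stat_ustat (@mW) (@indW) (@lawW) k_ex k_L2 k_spec k_tr).
  have ab' : a - t2 < b - t2 by rewrite ltrD2r.
  have -> : E Q (fun w => ramp a b (L0 w + t2)) = E Q (fun w => ramp (a - t2) (b - t2) (L0 w)).
    by apply: eq_E => w; exact: ramp_shift.
  apply: cvg_trans (Lr _ _ ab'); apply: near_eq_cvg; apply: nearW => n.
  by apply: eq_E => w; rewrite ramp_shift.
(* A partial sum of lambda_i mu_j Z_ij^2 is the centred one plus the product of two partial traces,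
   so the error is a centred tail plus a deterministic gap that vanishes by the trace formula. *)
pose f p q w := (L0 w - chi p q w) + (t2 - s false p * s true q).
have Lf p q : L2 Q (f p q) by apply: L2D; [exact: LL|exact: L2_cst].
suff fe eps : 0 < eps -> exists n, forall p q, (n <= p)%N -> (n <= q)%N -> E Q (fun w => f p q w ^+ 2) <= eps.
  apply: cvg_trans (mean_square_cvg Lf fe); apply: near_eq_cvg; apply: nearW => p /=.
  apply: eq_integral => w _; rewrite (sum_eigval _ _ _ _ _ _ (fun i j => Z (i, j) w ^+ 2)) chi_sqr /f; congr (_ ^+ 2)%:E; ring.
move=> e0; have e4 : 0 < eps / 4 by rewrite divr_gt0.
have [n1 H1] := Le _ e4.
have st : (t2 - s false n * s true n) ^+ 2 @[n --> \oo] --> (0 : R).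
  have H : (t2 - s false n * s true n) ^+ 2 @[n --> \oo] --> ((t2 - tr false * tr true) * (t2 - tr false * tr true) : R).
    by apply: cvgM; apply: cvgB; [exact: cvg_cst|exact: cvgM|exact: cvg_cst|exact: cvgM].
  by rewrite subrr mul0r in H.
have /cvgrPdist_lt /(_ _ e4) [n2 _ H2] := st.
exists (maxn n1 n2) => p q; rewrite !geq_max => /andP[p1 p2] /andP[q1 q2].
have H3 := H2 n2 (leqnn n2); rewrite /= sub0r normrN ger0_norm ?sqr_ge0// in H3.
have H4 := prod_gap (s0 false n2) (s0 true n2) (s_mono false p2) (s_mono true q2) (s_le false p) (s_le true q).
have H5 := H1 p q p1 q1.
have H6 := E_sqrD (LL p q) (L2_cst Q (t2 - s false p * s true q)).
rewrite E_cst in H6.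
move: H3 H4 H5 H6; rewrite -/t2 /f; move: (E _ _) (E _ _) (_ ^+ 2) (_ ^+ 2) => *; lra.
Qed.

End trace_class.
End limit_laws.

Theorem theorem4 (R : realType) (d0 d d' : measure_display)
    (T0 : measurableType d0) (P0 : probability T0 R)
    (T : measurableType d) (P : probability T R)
    (T' : measurableType d') (Q : probability T' R)
    (X Y : {RV P0 >-> measurableTypeR R})
    (Xs Ys : nat -> {RV P >-> measurableTypeR R})
    (Z : nat -> nat -> {RV Q >-> measurableTypeR R})
    (K1 K2 : set nat) (lambda mu : nat -> R) (g1 g2 : nat -> R -> R)
    (XY_copies : forall i : nat, same_law P P0
       (fun w => (Xs i w, Ys i w) : measurableTypeR R * measurableTypeR R)
       (fun w => (X w, Y w) : measurableTypeR R * measurableTypeR R))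
    (XY_indep : independent_family P
       (fun (i : nat) (w : T) =>
          (Xs i w, Ys i w) : measurableTypeR R * measurableTypeR R))
    (h1_exists : kernel_exists (distribution P0 X))
    (h2_exists : kernel_exists (distribution P0 Y))
    (h1_L2 : kernel_square_integrable (distribution P0 X))
    (h2_L2 : kernel_square_integrable (distribution P0 Y))
    (h1_spec : spectral_decomposition (distribution P0 X) K1 lambda g1)
    (h2_spec : spectral_decomposition (distribution P0 Y) K2 mu g2)
    (X_indep_Y : independent_pair P0 X Y)
    (Z_indep : independent_family Q
       (fun (ij : nat * nat) (w : T') => Z ij.1 ij.2 w : measurableTypeR R))
    (Z_normal : forall (i j : nat) (A : set (measurableTypeR R)),
       measurable A -> distribution Q (Z i j) A = normal_prob 0 1 A) :
  (exists L : {RV Q >-> measurableTypeR R},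
     mean_square_sum Q K1 K2
       (fun i j w => lambda i * mu j * (Z i j w ^+ 2 - 1)) L /\
     cvg_in_distribution P Q
       (fun n w => n%:R * kappa_tilde (fun i => Xs i w) (fun i => Ys i w) n) L)
  /\
  (kernel_trace_class (distribution P0 X) ->
   kernel_trace_class (distribution P0 Y) ->
   exists L : {RV Q >-> measurableTypeR R},
     mean_square_sum Q K1 K2
       (fun i j w => lambda i * mu j * Z i j w ^+ 2) L /\
     cvg_in_distribution P Q
       (fun n w => n%:R * kappa_hat (fun i => Xs i w) (fun i => Ys i w) n) L).
Proof.
pose K b := if b then K2 else K1; pose l b := if b then mu else lambda; pose g b := if b then g2 else g1.
pose W := coord Xs Ys; pose m := coord_law X Y.
have mW a : measurable_fun setT (W a) by exact: coord_measurable.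
have indW : independent_family P W by exact: coord_indep XY_copies XY_indep X_indep_Y.
have lawW a (A : set (measurableTypeR R)) : measurable A -> P (W a @^-1` A) = m a.1 A.
  exact: (coordE XY_copies X_indep_Y).
have k_ex b : kernel_exists (m b) by case: b.
have k_L2 b : kernel_square_integrable (m b) by case: b.
have k_spec b : spectral_decomposition (m b) (K b) (l b) (g b) by case: b.
pose Z' (e : nat * nat) (w : T') : R := Z e.1 e.2 w.
have mZ e : measurable_fun setT (Z' e) by exact: (@measurable_funPT _ _ _ _ (Z e.1 e.2)).
have lawZ e (A : set (measurableTypeR R)) : measurable A -> Q (Z' e @^-1` A) = normal_prob 0 1 A.
  exact: Z_normal.
split; first exact: (tilde_stat_limit mW indW lawW k_ex k_L2 k_spec mZ Z_indep lawZ).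
move=> tr1 tr2; have k_tr b : kernel_trace_class (m b) by case: b.
exact: (hat_stat_limit mW indW lawW k_ex k_L2 k_spec mZ Z_indep lawZ k_tr).
Qed.
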